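(* Let $N\ge 1$ be an integer, $\alpha\in(0,N)$, and let $p,q$ satisfy $\frac{N+\alpha}{N}<p,\,q<2_*^\alpha$ and $p\neq q$. Let $A(x)\equiv A>0$ and $B(x)\equiv B>0$ be positive constants. Then there exists a positive ground state solution $(u,v)\in H$ (that is, a ground state solution with $u>0$ and $v>0$) of the system $$\begin{cases}-\Delta u+A(x)u=\frac{2p}{p+q}\bigl(I_\alpha\ast|v|^q\bigr)|u|^{p-2}u,\\ -\Delta v+B(x)v=\frac{2q}{p+q}\bigl(I_\alpha\ast|u|^p\bigr)|v|^{q-2}v,\\ u(x)\to0\ \text{ and }\ v(x)\to 0\ \text{ as } |x|\to\infty\end{cases}$$ in $\mathbb R^N$, such that $\mathcal I(u,v)=c_0$.
   Context: Functions are real valued on $\mathbb R^N$. $2_*^\alpha:=\frac{N+\alpha}{N-2}$ if $N\ge3$ and $2_*^\alpha:=\infty$ if $N=1,2$. The Riesz potential $I_\alpha:\mathbb R^N\setminus\{0\}\to\mathbb R$ is $I_\alpha(x)=\frac{A_\alpha}{|x|^{N-\alpha}}$ with $A_\alpha=\frac{\Gamma(\frac{N-\alpha}{2})}{2^\alpha\pi^{N/2}\Gamma(\frac{\alpha}{2})}$, and $\ast$ is convolution on $\mathbb R^N$. $H:=H^1(\mathbb R^N)\times H^1(\mathbb R^N)$. The action functional on $H$ is $$\mathcal I(u,v)=\frac12\int_{\mathbb R^N}\bigl(|\nabla u|^2+A(x)|u|^2+|\nabla v|^2+B(x)|v|^2\bigr)-\frac{2}{p+q}\int_{\mathbb R^N}(I_\alpha\ast|u|^p)|v|^q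 ,$$ which is well defined and continuously differentiable; solutions in $H$ of the differential equations of the system are understood in the weak sense, i.e. as critical points of $\mathcal I$. Put $\mathcal P(u,v):=\langle\mathcal I'(u,v),(u,v)\rangle$, $\mathcal N_0:=\{(u,v)\in H\setminus\{(0,0)\}\mid \mathcal P(u,v)=0\}$ and $c_0:=\inf_{(u,v)\in\mathcal N_0}\mathcal I(u,v)$. A nontrivial solution $(u,v)\in H$ of the system is called a ground state solution if $\mathcal I(u,v)=c_0$. *)

(* Defs.v *)
From HB Require Import structures.
From mathcomp Require Import all_boot all_order all_algebra.
From mathcomp Require Import all_classical all_reals all_analysis.

Set Implicit Arguments.
Unset Strict Implicit.
Unset Printing Implicit Defensive.

Import Order.TTheory GRing.Theory Num.Theory.
Import numFieldNormedType.Exports.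

Local Open Scope classical_set_scope.
Local Open Scope ring_scope.

(* The space R^N is 'rV[R]_N.  Its sigma-algebra is the one generated by the
   coordinates, i.e. the Borel sigma-algebra when T is R. *)

Definition measure_rV_display : measure_display -> measure_display.
Proof. exact. Qed.

Section measurable_rV.
Context {d} {T : sigmaRingType d} (n : nat).

Let coord (i : 'I_n) (x : 'rV[T]_n) : T := x ord0 i.

Let rV_set0 : g_sigma_preimage coord set0.
Proof. exact: sigma_algebra0. Qed.

Let rV_setC X : g_sigma_preimage coord X -> g_sigma_preimage coord (~` X).
Proof. exact: sigma_algebraC. Qed.

Let rV_bigcup (F : _^nat) : (forall i, g_sigma_preimage coord (F i)) ->
  g_sigma_preimage coord (\bigcup_i (F i)).
Proof. exact: sigma_algebra_bigcup. Qed.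

HB.instance Definition _ := @isMeasurable.Build (measure_rV_display d)
  'rV[T]_n (g_sigma_preimage coord) rV_set0 rV_setC rV_bigcup.

End measurable_rV.

Lemma measurable_fun_rV d d' (X : measurableType d) (T : measurableType d')
    (n : nat) (f : X -> 'rV[T]_n) :
  (forall i, measurable_fun setT (fun x => f x ord0 i)) ->
  measurable_fun setT f.
Proof.
move=> mf _ Y mY; rewrite setTI.
have : (image_set_system setT f measurable) Y.
  apply: mY; split; first exact/sigma_algebra_image/sigma_algebra_measurable.
  move=> Z.
  rewrite -bigcup_seq => -[i _ [W mW <-]]; rewrite /image_set_system/=.
  by rewrite setTI; have := mf i measurableT W mW; rewrite !setTI.
by rewrite /image_set_system/= setTI.
Qed.

Lemma measurable_coord d (T : measurableType d) (n : nat) (i : 'I_n) :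
  measurable_fun setT (fun x : 'rV[T]_n => x ord0 i).
Proof.
move=> _ Y mY; rewrite setTI; apply: sub_sigma_algebra => /=.
rewrite -bigcup_seq/=; exists i => /=; first by rewrite mem_index_enum.
by exists Y => //; rewrite setTI.
Qed.

Section lebesgue_rV.
Context {R : realType}.

Definition rV_cons (n : nat) (p : R * 'rV[R]_n) : 'rV[R]_n.+1 :=
  row_mx (const_mx p.1 : 'rV[R]_1) p.2.

Lemma rV_cons0 n (p : R * 'rV[R]_n) : rV_cons p ord0 ord0 = p.1.
Proof.
rewrite /rV_cons mxE; case: splitP => [j _|j /= ji]; first by rewrite mxE.
by move: ji; rewrite add1n.
Qed.

Lemma rV_consS n (p : R * 'rV[R]_n) (i : 'I_n) :
  rV_cons p ord0 (lift ord0 i) = p.2 ord0 i.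
Proof.
rewrite /rV_cons mxE; case: splitP => [[[|//] ?] //|j /= ji].
by congr (p.2 _ _); apply/val_inj; move: ji; rewrite /= /bump/= => -[].
Qed.

Lemma measurable_rV_cons n : measurable_fun setT (@rV_cons n).
Proof.
apply: measurable_fun_rV => i.
case: (unliftP ord0 i) => [j ->|->].
  under eq_fun do rewrite rV_consS.
  apply: (measurableT_comp (measurable_coord j)); exact: measurable_snd.
under eq_fun do rewrite rV_cons0.
exact: measurable_fst.
Qed.

Section step.
Context (n : nat) (m : {sigma_finite_measure set 'rV[R]_n -> \bar R}).

Definition lebesgue_cons : set 'rV[R]_n.+1 -> \bar R :=
  pushforward (lebesgue_measure \x m)%E (@rV_cons n).

Let lebesgue_cons0 : lebesgue_cons set0 = 0%E.
Proof. by rewrite /lebesgue_cons /pushforward preimage_set0 measure0. Qed.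

Let lebesgue_cons_ge0 A : (0 <= lebesgue_cons A)%E.
Proof. exact: (measure_ge0 (lebesgue_measure \x m)%E). Qed.

Let lebesgue_cons_sigma_additive : semi_sigma_additive lebesgue_cons.
Proof.
move=> F mF tF mUF; rewrite /lebesgue_cons /pushforward preimage_bigcup.
apply: (@measure_semi_sigma_additive _ _ _ (lebesgue_measure \x m)%E).
- by move=> k; rewrite -[X in measurable X]setTI; exact: measurable_rV_cons.
- apply/trivIsetP => /= i j _ _ ij; rewrite -preimage_setI.
  by move/trivIsetP : tF => /(_ _ _ _ _ ij) ->//; rewrite preimage_set0.
- by rewrite -preimage_bigcup -[X in measurable X]setTI;
    exact: measurable_rV_cons.
Qed.

HB.instance Definition _ := isMeasure.Build _ _ _ lebesgue_cons
  lebesgue_cons0 lebesgue_cons_ge0 lebesgue_cons_sigma_additive.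

Definition rV_uncons (x : 'rV[R]_n.+1) : R * 'rV[R]_n :=
  (x ord0 ord0, \row_i x ord0 (lift ord0 i)).

Lemma rV_consK : cancel (@rV_cons n) rV_uncons.
Proof.
move=> [a v]; rewrite /rV_uncons rV_cons0; congr pair.
by apply/rowP => i; rewrite mxE rV_consS.
Qed.

Lemma measurable_rV_uncons : measurable_fun setT rV_uncons.
Proof.
apply/measurable_fun_pairP; split; first exact: measurable_coord.
apply: measurable_fun_rV => i.
have -> : (fun x => (snd \o rV_uncons) x ord0 i)
        = (fun x => x ord0 (lift ord0 i)).
  by apply/funext => x; rewrite /= mxE.
exact: measurable_coord.
Qed.

Let lebesgue_cons_sigma_finite : sigma_finite setT lebesgue_cons.
Proof.
have /sigma_finiteP[F [TF ndF Foo]] := sigma_finiteT (@lebesgue_measure R).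
have /sigma_finiteP[G [TG ndG Goo]] := sigma_finiteT m.
exists (fun k => rV_uncons @^-1` (F k `*` G k)).
  rewrite -preimage_bigcup (_ : \bigcup_k _ = setT) ?preimage_setT//.
  apply/seteqP; split => // -[x y] _.
  have [i _ Fi] : (\bigcup_i F i) x by rewrite -TF.
  have [j _ Gj] : (\bigcup_i G i) y by rewrite -TG.
  exists (maxn i j) => //; split => /=.
    by move: x Fi; exact/subsetPset/ndF/leq_maxl.
  by move: y Gj; exact/subsetPset/ndG/leq_maxr.
move=> k; have [mF Fk] := Foo k; have [mG Gk] := Goo k; split.
  rewrite -[X in measurable X]setTI.
  by apply: measurable_rV_uncons => //; exact: measurableX.
rewrite /lebesgue_cons /pushforward -comp_preimage.
rewrite (_ : rV_uncons \o _ = id); last exact/funext/rV_consK.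
by rewrite preimage_id product_measure1E// lte_mul_pinfty// ge0_fin_numE.
Qed.

HB.instance Definition _ := Measure_isSigmaFinite.Build _ _ _ lebesgue_cons
  lebesgue_cons_sigma_finite.

End step.

Fixpoint lebesgue_rV (n : nat) :
    {sigma_finite_measure set 'rV[R]_n -> \bar R} :=
  if n is k.+1 then lebesgue_cons (lebesgue_rV k) else dirac (0 : 'rV[R]_0).

Lemma lebesgue_rV_box (n : nat) (X : 'I_n -> set R) :
  (forall i, measurable (X i)) ->
  lebesgue_rV n [set x | forall i, X i (x ord0 i)] =
  (\prod_(i < n) lebesgue_measure (X i))%E.
Proof.
elim: n X => [X _|n IH X mX].
  by rewrite big_ord0 /= diracE mem_set// => -[].
rewrite big_ord_recl -(IH (fun i => X (lift ord0 i)))//.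
rewrite -product_measure1E//; last first.
  rewrite [X in measurable X](_ : _ = \bigcap_(i in [set: 'I_n])
     ((fun x : 'rV[R]_n => x ord0 i) @^-1` X (lift ord0 i))).
    apply: fin_bigcap_measurable => // i _.
    by rewrite -[X in measurable X]setTI; exact: measurable_coord.
  by apply/seteqP; split => x /= h i; [move=> _|]; exact: h.
  exact: mX.
rewrite /= /lebesgue_cons /pushforward.
apply: (congr1 (product_measure1 lebesgue_measure (lebesgue_rV n))
  (_ : _ = X ord0 `*` [set x : 'rV[R]_n | forall i, X (lift ord0 i) (x ord0 i)])).
apply/seteqP; split => p /=.
  move=> h; split; first by have := h ord0; rewrite rV_cons0.
  by move=> i; have := h (lift ord0 i); rewrite rV_consS.
move=> [h0 h] i; case: (unliftP ord0 i) => [j ->|->]; last by rewrite rV_cons0.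
by rewrite rV_consS; exact: h.
Qed.

End lebesgue_rV.

Section sobolev.
Context {R : realType} {N : nat}.
Local Notation E := 'rV[R]_N.
Local Notation leb := (@lebesgue_rV R N).
Implicit Types u v g phi : E -> R.

(* The library norm on 'rV[R]_N is the sup norm. *)
Definition enorm (x : E) : R := Num.sqrt (\sum_i x ord0 i ^+ 2).

Definition partial (i : 'I_N) phi : E -> R := 'D_(delta_mx ord0 i) phi.

Definition iter_partial (s : seq 'I_N) phi : E -> R := foldr partial phi s.

Definition smooth phi : Prop := forall s : seq 'I_N,
  continuous (iter_partial s phi) /\
  forall i x, derivable (iter_partial s phi) x (delta_mx ord0 i).

Definition test_function phi : Prop :=
  smooth phi /\ compact (closure [set x | phi x != 0]).

Definition weak_partial (i : 'I_N) u g : Prop := forall phi, test_function phi ->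
  \int[leb]_x (u x * partial i phi x) = - \int[leb]_x (g x * phi x).

(* H^1(R^N); an element is given by any of its Borel representatives, every
   Lebesgue class having one. *)
Definition H1 : set (E -> R) := [set u | u \in Lfun leb 2%:E /\
  forall i, exists2 g, g \in Lfun leb 2%:E & weak_partial i u g].

(* The gradient is determined up to a null set when u is in H^1. *)
Definition grad u (x : E) : 'rV[R]_N :=
  \row_i (xget (cst 0) [set g | g \in Lfun leb 2%:E /\ weak_partial i u g]) x.

Definition Hspace : set ((E -> R) * (E -> R)) := [set w | H1 w.1 /\ H1 w.2].

Definition Hzero (w : (E -> R) * (E -> R)) : Prop :=
  {ae leb, forall x, w.1 x = 0} /\ {ae leb, forall x, w.2 x = 0}.

Definition Hnorm (w : (E -> R) * (E -> R)) : R :=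
  Num.sqrt (\int[leb]_x (enorm (grad w.1 x) ^+ 2 + `|w.1 x| ^+ 2 +
                         enorm (grad w.2 x) ^+ 2 + `|w.2 x| ^+ 2)).

(* L is the Frechet derivative at w of the functional J on H.  Boundedness
   forces L to depend only on almost-everywhere classes. *)
Definition is_frechet_derivative (J : (E -> R) * (E -> R) -> R)
    (w : (E -> R) * (E -> R)) (L : (E -> R) * (E -> R) -> R) : Prop :=
  [/\ forall (a : R) h k, Hspace h -> Hspace k -> L (a *: h + k) = a * L h + L k,
      exists C : R, forall h, Hspace h -> `|L h| <= C * Hnorm h
    & forall e : R, 0 < e -> exists2 d : R, 0 < d & forall h, Hspace h -> Hnorm h < d ->
        `|J (w + h) - J w - L h| <= e * Hnorm h].

Definition vanishes_at_infinity u : Prop :=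
  forall e : R, 0 < e -> exists M : R, forall x, M < enorm x -> `|u x| < e.

End sobolev.

(* Euler's integral. *)
Definition Gamma {R : realType} (s : R) : R :=
  \int[lebesgue_measure]_(t in `]0, +oo[) (t `^ (s - 1) * expR (- t)).

Section choquard.
Context {R : realType} (N : nat).
Local Notation E := 'rV[R]_N.
Local Notation leb := (@lebesgue_rV R N).

Definition critical_exponent (alpha : R) : \bar R :=
  if (N <= 2)%N then +oo%E else ((N%:R + alpha) / (N%:R - 2))%:E.

Definition riesz_const (alpha : R) : R :=
  Gamma ((N%:R - alpha) / 2) /
  (2 `^ alpha * pi `^ (N%:R / 2) * Gamma (alpha / 2)).

(* The value at 0, where the kernel is not defined, is irrelevant. *)
Definition riesz (alpha : R) (x : E) : R :=
  riesz_const alpha / enorm x `^ (N%:R - alpha).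

Definition convolution (f g : E -> R) (x : E) : \bar R :=
  \int[leb]_y (f (x - y) * g y)%:E.

Section system.
Context (alpha p q : R) (A B : E -> R).

Definition action (w : (E -> R) * (E -> R)) : R :=
  let: (u, v) := w in
  2^-1 * \int[leb]_x (enorm (grad u x) ^+ 2 + A x * `|u x| ^+ 2 +
                      enorm (grad v x) ^+ 2 + B x * `|v x| ^+ 2)
  - 2 / (p + q) *
    fine (\int[leb]_x (convolution (riesz alpha) (fun y => `|u y| `^ p)%R x *
                       (`|v x| `^ q)%R%:E)%E).

(* N_0: nonzero w in H with <action'(w), w> = 0. *)
Definition nehari : set ((E -> R) * (E -> R)) :=
  [set w | [/\ Hspace w, ~ Hzero w &
     exists2 L, is_frechet_derivative action w L & L w = 0]].

Definition ground_level : \bar R := ereal_inf [set (action w)%:E | w in nehari].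

(* Weak solutions in H of
     - Delta u + A u = 2p/(p+q) (I_alpha * |v|^q) |u|^(p-2) u,
     - Delta v + B v = 2q/(p+q) (I_alpha * |u|^p) |v|^(q-2) v,
   with u and v tending to 0 at infinity: the differential equations are
   understood in the weak sense, i.e. w is a critical point of the action. *)
Definition solution (w : (E -> R) * (E -> R)) : Prop :=
  [/\ Hspace w, is_frechet_derivative action w (cst 0),
      vanishes_at_infinity w.1 & vanishes_at_infinity w.2].

Definition ground_state (w : (E -> R) * (E -> R)) : Prop :=
  [/\ solution w, ~ Hzero w & (action w)%:E = ground_level].

End system.
End choquard.

(* Main.v *)
(* By homogeneity, minimising the action on N_0 amounts to maximising the coupling
   D(u,v), the integral of (I_alpha * |u|^p) |v|^q, on the unit ball of the energy
   norm.  Energies are handled through averages of |u(x+z) - u(x)|^2 over small z: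
   polarization in a hyperplane decreases them, increases D and brings mass closer
   to the origin.  Hence maximisers of D minus a small second moment are invariant
   under all polarizations.  Such functions are monotone along octants, which gives
   uniform decay, compactness, and in the limit a polarization-invariant maximiser.

   A multiple w of it satisfies J(w+h) >= J(w) - o(h), by D <= S |.|^(p+q), and
   J(w+h) + J(w-h) - 2 J(w) <= C |h|^2, because t^p and t^q are convex and the
   kernel is positive; so w is critical.  Every element of N_0 satisfies
   |w|^2 = 2 D(w), whence the level of w is c_0.  Nonnegative variations make the
   components supersolutions of - Delta u + A u = 0; comparison with compactly
   supported radial barriers shows that they are positive almost everywhere. *)
Require Import Defs.
From HB Require Import structures.
From mathcomp Require Import all_boot all_order all_algebra fingroup perm.
From mathcomp Require Import all_classical all_reals all_analysis.
From mathcomp Require Import measurable_realfun ring lra.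
Set Implicit Arguments.
Unset Strict Implicit.
Unset Printing Implicit Defensive.
Import Order.TTheory GRing.Theory Num.Theory.
Import numFieldNormedType.Exports.
Local Open Scope classical_set_scope.
Local Open Scope ring_scope.

(** * Integrals of nonnegative functions *)

(** The problem is translation invariant, so a maximising sequence may drift to infinity. The second
    moment pins it, but its coefficient must tend to zero and the estimates drawn from it
    degenerate; invariance under polarization survives, being an inequality between values at mirror
    points that passes to almost-everywhere limits. Only the hyperplanes x_k = t and x_i - x_j = t
    with t nonzero are used: their reflections are signed permutations up to translation, and they
    already force decay. Averaged differences reduce polarization to a four-point inequality, lower
    semicontinuity to Fatou's lemma, and both the Sobolev embedding and local compactness to
    measuring balls and grid cells. The Riesz kernel is split at |x| = 1, each part with its own
    exponent near 2N/(N+alpha): at that exponent itself the matching power of the kernel is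
    integrable neither at 0 nor at infinity. Maximality is first known only against pairs of finite
    second moment; cutoffs and Fatou's lemma remove this restriction. Positivity and decay are
    demanded at every point, so the maximiser is finally modified on a null set. *)

Section generic_measure.
Context {d} {T : measurableType d} {R : realType} (mu : {measure set T -> \bar R}).
Implicit Types f g : T -> R.

Lemma mfD f g : measurable_fun setT f -> measurable_fun setT g ->
  measurable_fun setT (fun x => f x + g x).
Proof. by move=> mf mg; exact: measurable_funD. Qed.

Lemma mfB f g : measurable_fun setT f -> measurable_fun setT g ->
  measurable_fun setT (fun x => f x - g x).
Proof. by move=> mf mg; exact: measurable_funB. Qed.

Lemma mfM f g : measurable_fun setT f -> measurable_fun setT g ->
  measurable_fun setT (fun x => f x * g x).
Proof. by move=> mf mg; exact: measurable_funM. Qed.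

Lemma mfN f : measurable_fun setT f -> measurable_fun setT (fun x => - f x).
Proof. by move=> mf; exact: measurable_funN. Qed.

Lemma mfX n f : measurable_fun setT f -> measurable_fun setT (fun x => f x ^+ n).
Proof. by move=> mf; exact: measurable_funX. Qed.

Lemma mfnorm f : measurable_fun setT f -> measurable_fun setT (fun x => `|f x|).
Proof. by move=> mf; exact: measurableT_comp. Qed.

Lemma mfpowR a f : measurable_fun setT f -> measurable_fun setT (fun x => f x `^ a).
Proof. by move=> mf; apply: (measurableT_comp (measurable_powR _)). Qed.

Lemma mfmax f g : measurable_fun setT f -> measurable_fun setT g ->
  measurable_fun setT (fun x => Num.max (f x) (g x)).
Proof. by move=> mf mg; exact: measurable_maxr. Qed.

Lemma mfmin f g : measurable_fun setT f -> measurable_fun setT g ->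
  measurable_fun setT (fun x => Num.min (f x) (g x)).
Proof. by move=> mf mg; exact: measurable_minr. Qed.

Lemma mfb (b : T -> bool) : measurable_fun setT b ->
  measurable_fun setT (fun x => (b x)%:R : R).
Proof.
move=> mb; pose h (c : bool) : R := c%:R.
by apply: (@measurableT_comp _ _ _ _ _ _ h).
Qed.

Lemma mfneg (b : T -> bool) : measurable_fun setT b ->
  measurable_fun setT (fun x => ~~ b x).
Proof. by move=> mb; apply: (@measurableT_comp _ _ _ _ _ _ negb). Qed.

Lemma mfand (b c : T -> bool) : measurable_fun setT b -> measurable_fun setT c ->
  measurable_fun setT (fun x => b x && c x).
Proof. by move=> mb mc; exact: measurable_and. Qed.

Lemma mflt f g : measurable_fun setT f -> measurable_fun setT g ->
  measurable_fun setT (fun x => (f x < g x)%R).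
Proof. by move=> mf mg; exact: measurable_fun_ltr. Qed.

Lemma mfle f g : measurable_fun setT f -> measurable_fun setT g ->
  measurable_fun setT (fun x => (f x <= g x)%R).
Proof. by move=> mf mg; exact: measurable_fun_ler. Qed.

Lemma mfsum (I : Type) (s : seq I) (F : I -> T -> R) :
  (forall i, measurable_fun setT (F i)) ->
  measurable_fun setT (fun x => \sum_(i <- s) F i x).
Proof.
move=> mF; elim: s => [|i s IH].
  by under eq_fun do rewrite big_nil; exact: measurable_cst.
under eq_fun do rewrite big_cons; exact: mfD.
Qed.

Lemma mfif (b : T -> bool) f g : measurable_fun setT b -> measurable_fun setT f ->
  measurable_fun setT g -> measurable_fun setT (fun x => if b x then f x else g x).
Proof.
move=> mb mf mg.
rewrite (_ : (fun x => _) = (fun x => (b x)%:R * f x + (1 - (b x)%:R) * g x)).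
  apply: mfD; apply: mfM => //; first exact: mfb.
  by apply: mfB; [exact: measurable_cst|exact: mfb].
by apply/funext => x; case: (b x); rewrite /= ?(mul1r, mul0r, subrr, subr0, addr0, add0r).
Qed.

Lemma measurable_bool_set (b : T -> bool) : measurable_fun setT b ->
  measurable [set x | b x].
Proof.
move=> mb; have := mb measurableT [set true] I; rewrite setTI.
by congr (measurable _).
Qed.

Definition nnint (f : T -> R) : \bar R := \int[mu]_x (f x)%:E.

Lemma nnint_ge0 f : (forall x, 0 <= f x) -> (0 <= nnint f)%E.
Proof. by move=> f0; apply: integral_ge0 => x _; rewrite lee_fin. Qed.

Lemma nnint_le f g : measurable_fun setT f -> measurable_fun setT g ->
  (forall x, 0 <= f x) -> (forall x, f x <= g x) -> (nnint f <= nnint g)%E.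
Proof.
move=> mf mg f0 fg; apply: ge0_le_integral => //.
- by move=> x _; rewrite lee_fin.
- exact/measurable_EFinP.
- exact/measurable_EFinP.
- by move=> x _; rewrite lee_fin.
Qed.

Lemma nnint_ae_le f g : measurable_fun setT f -> measurable_fun setT g ->
  (forall x, 0 <= f x) -> (forall x, 0 <= g x) ->
  {ae mu, forall x, f x <= g x} -> (nnint f <= nnint g)%E.
Proof.
move=> mf mg f0 g0 fg; apply: ae_ge0_le_integral => //.
- by move=> x _; rewrite lee_fin.
- exact/measurable_EFinP.
- by move=> x _; rewrite lee_fin.
- exact/measurable_EFinP.
- by apply: filterS fg => x h _; rewrite lee_fin.
Qed.

Lemma eq_nnint f g : (forall x, f x = g x) -> nnint f = nnint g.
Proof. by move=> fg; rewrite /nnint; apply: eq_integral => x _; rewrite fg. Qed.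

Lemma nnint_ae_eq f g : measurable_fun setT f -> measurable_fun setT g ->
  {ae mu, forall x, f x = g x} -> nnint f = nnint g.
Proof.
move=> mf mg fg; apply: ae_eq_integral => //.
- exact/measurable_EFinP.
- exact/measurable_EFinP.
- by apply: filterS fg => x h _; rewrite h.
Qed.

Lemma nnintD f g : measurable_fun setT f -> measurable_fun setT g ->
  (forall x, 0 <= f x) -> (forall x, 0 <= g x) ->
  nnint (fun x => f x + g x) = (nnint f + nnint g)%E.
Proof.
move=> mf mg f0 g0; rewrite /nnint.
under eq_integral do rewrite EFinD.
rewrite ge0_integralD//.
- by move=> x _; rewrite lee_fin.
- exact/measurable_EFinP.
- by move=> x _; rewrite lee_fin.
- exact/measurable_EFinP.
Qed.

Lemma nnintZ k f : measurable_fun setT f -> (forall x, 0 <= f x) -> 0 <= k ->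
  nnint (fun x => k * f x) = (k%:E * nnint f)%E.
Proof.
move=> mf f0 k0; rewrite /nnint.
under eq_integral do rewrite EFinM.
rewrite ge0_integralZl_EFin//.
- by move=> x _; rewrite lee_fin.
- exact/measurable_EFinP.
Qed.

Lemma nnint_sum (I : Type) (s : seq I) (F : I -> T -> R) :
  (forall i, measurable_fun setT (F i)) -> (forall i x, 0 <= F i x) ->
  nnint (fun x => \sum_(i <- s) F i x) = (\sum_(i <- s) nnint (F i))%E.
Proof.
move=> mF F0; elim: s => [|i s IH].
  by rewrite big_nil /nnint; under eq_integral do rewrite big_nil; exact: integral0.
rewrite big_cons -IH -nnintD//; first by apply: eq_nnint => x; rewrite big_cons.
- exact: mfsum.
- by move=> x; apply: sumr_ge0.
Qed.

Lemma nnint_eq0 f : measurable_fun setT f -> (forall x, 0 <= f x) ->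
  nnint f = 0%E -> {ae mu, forall x, f x = 0}.
Proof.
move=> mf f0 h.
have mEf : measurable_fun setT (EFin \o f) by exact/measurable_EFinP.
have [+ _] := ae_eq_integral_abs mu measurableT mEf.
move=> /(_ _)/wrap[].
  by rewrite -[RHS]h; apply: eq_integral => x _; rewrite /= ger0_norm.
by apply: filterS => x /(_ I) [].
Qed.

Lemma ae_nnint0 f : measurable_fun setT f ->
  {ae mu, forall x, f x = 0} -> nnint f = 0%E.
Proof.
move=> mf h; rewrite (@nnint_ae_eq f (cst 0))//.
by rewrite /nnint/= integral0.
Qed.

Lemma nnint_indic (b : T -> bool) : measurable_fun setT b ->
  nnint (fun x => (b x)%:R) = mu [set x | b x].
Proof.
move=> mb; rewrite /nnint -[in RHS](setIT [set x | b x]) -integral_indic//; last first.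
  exact: measurable_bool_set.
apply: eq_integral => x _; rewrite indicE; congr ((_%:R)%:E).
case: (boolP (b x)) => bx; first by rewrite mem_set.
by rewrite memNset//=; exact/negP.
Qed.

End generic_measure.
Arguments nnint {d T R} mu f%_R.

(** * Invariance of Lebesgue measure *)

Section rV_measurable.
Context {R : realType}.

Section rVn.
Variable n : nat.
Local Notation E := 'rV[R]_n.
Local Notation leb := (@lebesgue_rV R n).

Definition box (X : 'I_n -> set R) : set E := [set x | forall i, X i (x ord0 i)].

Lemma measurable_box X : (forall i, measurable (X i)) -> measurable (box X).
Proof.
move=> mX.
rewrite (_ : box X = \bigcap_(i in [set: 'I_n])
    ((fun x : 'rV[R]_n => x ord0 i) @^-1` X i)).
  apply: fin_bigcap_measurable => // i _.
  by rewrite -[X in measurable X]setTI; exact: measurable_coord.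
by apply/seteqP; split => x /= h i; [move=> _|]; exact: h.
Qed.

Definition boxes : set (set E) :=
  [set box X | X in [set X | forall i, measurable (X i)]].

Lemma boxesI : setI_closed boxes.
Proof.
move=> _ _ [X mX <-] [Y mY <-]; exists (fun i => X i `&` Y i).
  by move=> i; apply: measurableI; [exact: mX|exact: mY].
apply/seteqP; split => x /=.
  by move=> h; split => i; have [] := h i.
by move=> [h1 h2] i; split; [exact: h1|exact: h2].
Qed.

Lemma measurable_boxesE : @measurable _ E = <<s boxes >>.
Proof.
apply/seteqP; split.
  apply: smallest_sub; first exact: smallest_sigma_algebra.
  move=> Z; rewrite -bigcup_seq => -[i _ [W mW <-]]; apply: sub_sigma_algebra.
  exists (fun j => if j == i then W else setT).
    by move=> j /=; case: ifP.
  rewrite setTI; apply/seteqP; split => x /=; first by move/(_ i); rewrite eqxx.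
  by move=> Wx j; case: eqP => [->|].
apply: smallest_sub; first exact: sigma_algebra_measurable.
by move=> _ [X mX <-]; exact: measurable_box.
Qed.

Definition cube (r : R) : set E := [set x | forall i, `|x ord0 i| <= r].

Lemma cubeE r : cube r = box (fun _ => `[- r, r]%classic).
Proof.
by apply/seteqP; split => x h i; have := h i; rewrite /= in_itv/= ler_norml.
Qed.

Lemma leb_box X : (forall i, measurable (X i)) ->
  leb (box X) = (\prod_(i < n) lebesgue_measure (X i))%E.
Proof. exact: lebesgue_rV_box. Qed.

Lemma leb_cube r : 0 <= r -> leb (cube r) = ((2 * r) ^+ n)%:E.
Proof.
move=> r0; rewrite cubeE leb_box//.
under eq_bigr do rewrite lebesgue_measure_itv/=.
rewrite (eq_bigr (fun=> (2 * r)%:E)); last first.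
  move=> i _; rewrite lte_fin; case: ltP => h; first by rewrite opprK mulr_natl mulr2n.
  by congr EFin; lra.
by rewrite prodEFin prodr_const card_ord.
Qed.

Lemma measurable_cube r : measurable (cube r).
Proof. by rewrite cubeE; exact: measurable_box. Qed.

Lemma cube_cover : \bigcup_k cube k%:R = [set: E].
Proof.
apply/seteqP; split => // x _.
have /=[k hk] : exists k : nat, \sum_i `|x ord0 i| < k%:R.
  by exists (Num.bound (\sum_i `|x ord0 i|)); rewrite archi_boundP// sumr_ge0.
exists k => // i; apply: ltW; apply: le_lt_trans hk.
by rewrite (bigD1 i)//= lerDl sumr_ge0.
Qed.

(** Boxes are stable under intersection and generate the sigma-algebra, and cubes of finite measure
    exhaust the space, so agreement on boxes suffices. *)
Lemma leb_unique (m : {measure set E -> \bar R}) :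
  (forall X, (forall i, measurable (X i)) ->
    m (box X) = (\prod_(i < n) lebesgue_measure (X i))%E) ->
  forall A, measurable A -> leb A = m A.
Proof.
move=> h A mA.
apply: (@measure_unique _ _ _ boxes (fun k => cube k%:R) measurable_boxesE boxesI) => //.
- by move=> k; rewrite cubeE; exists (fun _ => `[- k%:R, k%:R]%classic).
- exact: cube_cover.
- by move=> _ [X mX <-]; rewrite h//; exact: leb_box.
- by move=> k; rewrite [ltLHS]leb_cube// ltry.
Qed.

Lemma mE_add d (T : measurableType d) (f g : T -> E) : measurable_fun setT f ->
  measurable_fun setT g -> measurable_fun setT (fun x => f x + g x).
Proof.
move=> mf mg; apply: measurable_fun_rV => i; under eq_fun do rewrite mxE.
by apply: mfD; exact: (measurableT_comp (measurable_coord i)).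
Qed.

Lemma mE_opp d (T : measurableType d) (f : T -> E) : measurable_fun setT f ->
  measurable_fun setT (fun x => - f x).
Proof.
move=> mf; apply: measurable_fun_rV => i; under eq_fun do rewrite mxE.
by apply: mfN; exact: (measurableT_comp (measurable_coord i)).
Qed.

Lemma mE_scale d (T : measurableType d) (k : T -> R) (f : T -> E) : measurable_fun setT k ->
  measurable_fun setT f ->
  measurable_fun setT (fun x => k x *: f x).
Proof.
move=> mk mf; apply: measurable_fun_rV => i; under eq_fun do rewrite mxE.
by apply: mfM => //; exact: (measurableT_comp (measurable_coord i)).
Qed.

(** An open set is a countable union of rational balls of the library norm, and these are boxes. *)
Lemma open_measurable_rV (U : set E) : open U -> measurable U.
Proof.
move=> oU.
pose c (k : 'rV[rat]_n * rat) : set E := 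
    box (fun i => ball (ratr (k.1 ord0 i) : R) (ratr k.2)).
  have cE y (q : rat) : 0 < (ratr q : R) -> c (y, q) = ball (map_mx ratr y : E) (ratr q).
    move=> q0; apply/seteqP; split => x /=.
      by move=> h; split=> // j i; rewrite !ord1 mxE; exact: h.
    by move=> [_ h] i; have := h ord0 i; rewrite mxE.
rewrite (_ : U = \bigcup_k (if `[< c k `<=` U >] then c k else set0)); last first.
  apply/seteqP; split => x; last by move=> [k _]; case: asboolP => // h /h.
  move=> Ux; have /nbhs_ballP[e /= e0 he] : nbhs x U by apply: open_nbhs_nbhs; split.
  have e20 : 0 < e / 2 by rewrite divr_gt0.
  have [q hq] := rat_in_itvoo e20.
  have q0 : 0 < (ratr q : R) by move: hq; rewrite in_itv/= => /andP[].
  have hy i : exists z : rat, `|ratr z - x ord0 i| < ratr q.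
    have xq : x ord0 i - ratr q < x ord0 i + ratr q by lra.
    have [z hz] := rat_in_itvoo xq.
    by exists z; move: hz; rewrite in_itv/= ltr_distl.
  pose y : 'rV[rat]_n := \row_i projT1 (cid (hy i)).
  have bxy : ball (map_mx ratr y : E) (ratr q) x.
    split=> // i j; rewrite !ord1 !mxE /ball/=; case: cid => z /= .
    by [].
  exists (y, q) => //=; rewrite cE//; case: asboolP => //; case.
  move=> z hz; apply: he.
  move: hq; rewrite in_itv/= => /andP[_ hq].
  have : ball x (ratr q + ratr q) z by apply: (ball_triangle _ hz); exact: ball_sym.
  by apply: le_ball; lra.
apply: countable_bigcupT_measurable => // k; case: ifP => // _.
by apply: measurable_box => i; exact: measurable_ball.
Qed.

Lemma continuous_measurable_rV (f : E -> R) : continuous f -> measurable_fun setT f.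
Proof.
move=> /continuousP cf; apply: (measurability _ (RGenOpens.measurableE R)).
move=> _ [_ [a [b ->] <-]]; rewrite setTI; apply: open_measurable_rV.
by apply: cf; exact: interval_open.
Qed.

End rVn.
End rV_measurable.

(** * Invariance under translations and signed permutations of coordinates *)

Section lebesgue_invariance.
Context {R : realType}.

Lemma mmulR (s c : R) : measurable_fun setT (fun x : R => s * x + c).
Proof.
by apply: mfD; [apply: mfM; [exact: measurable_cst|exact: measurable_id]|exact: measurable_cst].
Qed.

Lemma lebesgue_measure_isometry (s c : R) (A : set R) : s ^+ 2 = 1 -> measurable A ->
  lebesgue_measure ((fun x : R => s * x + c) @^-1` A) = lebesgue_measure A.
Proof.
move=> s1 mA; have mf := mmulR s c.
pose f (x : measurableTypeR R) : measurableTypeR R := s * x + c.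
apply/esym; change (lebesgue_measure A = pushforward lebesgue_measure f A).
apply: lebesgue_measure_unique => //= _ [[a b]] _ <-.
rewrite /pushforward /=.
have [sN|sN] : s = 1 \/ s = -1.
  by move/eqP: s1; rewrite sqrf_eq1 => /orP[] /eqP; [left|right].
  rewrite (_ : f @^-1` _ = `]a - c, b - c]%classic); last first.
    by apply/seteqP; split => x /=; rewrite /f sN mul1r !in_itv/= => /andP[h1 h2]; apply/andP; split; lra.
  rewrite !lebesgue_measure_itv/= !lte_fin ltrBlDr subrK.
  by case: ifP => // _; rewrite -!EFinD; congr EFin; lra.
(* A reflection turns the interval closed on the right into one closed on the left, of the same
   length. *)
rewrite (_ : f @^-1` _ = `[c - b, c - a[%classic); last first.
  by apply/seteqP; split => x /=; rewrite /f sN !in_itv/= => /andP[h1 h2]; apply/andP; split; lra.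
rewrite !lebesgue_measure_itv/= !lte_fin ltrD2l ltrN2.
by case: ifP => // _; rewrite -!EFinD; congr EFin; lra.
Qed.

Section aff.
Variable n : nat.
Local Notation E := 'rV[R]_n.
Local Notation leb := (@lebesgue_rV R n).

Implicit Types (s c x : E) (pi : {perm 'I_n}).

(** With entries of [s] equal to 1 or -1, this covers all isometries needed: translations, point
    reflections, reflections in coordinate hyperplanes and shifted exchanges of two coordinates. *)
Definition signed_perm (pi : 'S_n) (s c : E) (x : E) : E :=
  \row_i (s ord0 i * x ord0 (pi i) + c ord0 i).

Lemma measurable_signed_perm pi s c : measurable_fun setT (signed_perm pi s c).
Proof.
apply: measurable_fun_rV => i; under eq_fun do rewrite mxE.
apply: mfD; last exact: measurable_cst.
by apply: mfM; [exact: measurable_cst|exact: measurable_coord].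
Qed.

Lemma leb_signed_perm pi s c (A : set E) : (forall i, s ord0 i ^+ 2 = 1) ->
  measurable A -> leb (signed_perm pi s c @^-1` A) = leb A.
Proof.
move=> s1 mA; apply/esym.
have mf := measurable_signed_perm pi s c.
apply: (@leb_unique R n (pushforward leb (signed_perm pi s c))) => // X mX.
pose Y i : set R := (fun x : R => s ord0 ((pi^-1)%g i) * x + c ord0 ((pi^-1)%g i)) @^-1` X ((pi^-1)%g i).
have mY i : measurable (Y i).
  rewrite /Y -[X in measurable X]setTI; exact: mmulR.
transitivity (leb (box Y)).
  apply: (congr1 (leb : set E -> \bar R)).
  apply/seteqP; split => x /= h i.
    by have := h ((pi^-1)%g i); rewrite mxE permKV.
  by have := h (pi i); rewrite /Y /= permK mxE.
rewrite leb_box// (reindex_inj (@perm_inj _ pi))/=.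
apply: eq_bigr => i _; rewrite /Y permK.
exact: lebesgue_measure_isometry.
Qed.

End aff.
End lebesgue_invariance.

(** Measurability directed by the head symbol; a function known to be measurable from the context is
    composed with whatever stands in its argument. *)
Ltac meas1 :=
  match goal with
  | |- measurable_fun _ ?f => assumption
  | |- measurable_fun _ (fun _ => ?c) => exact: measurable_cst
  | |- measurable_fun _ (fun x => x) => exact: measurable_id
  | |- measurable_fun _ (fun x => x.1) => exact: measurable_fst
  | |- measurable_fun _ (fun x => x.2) => exact: measurable_snd
  | |- measurable_fun _ (fun x => (@EFin _ _)) => apply/measurable_EFinP
  | |- measurable_fun _ (fun x => GRing.exp _ _) => apply: mfX
  | |- measurable_fun _ (fun x => GRing.mul _ _) => apply: mfM
  | |- measurable_fun _ (fun x => GRing.add _ (GRing.opp _)) => first [apply: mfB | apply: mE_add]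
  | |- measurable_fun _ (fun x => GRing.add _ _) => first [apply: mfD | apply: mE_add]
  | |- measurable_fun _ (fun x => GRing.opp _) => first [apply: mfN | apply: mE_opp]
  | |- measurable_fun _ (fun x => GRing.scale _ _) => apply: mE_scale
  | |- measurable_fun _ (fun x => Num.norm _) => apply: mfnorm
  | |- measurable_fun _ (fun x => powR _ _) => apply: mfpowR
  | |- measurable_fun _ (fun x => Order.max _ _) => apply: mfmax
  | |- measurable_fun _ (fun x => Order.min _ _) => apply: mfmin
  | |- measurable_fun _ (fun x => (nat_of_bool _)%:R) => apply: mfb
  | |- measurable_fun _ (fun x => Order.lt _ _) => apply: mflt
  | |- measurable_fun _ (fun x => Order.le _ _) => apply: mfle
  | |- measurable_fun _ (fun x => bigop.body _ _ _) => apply: mfsum => ?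
  | |- measurable_fun _ (fun x => if _ then _ else _) => apply: mfif
  | |- measurable_fun _ (fun x => fun_of_matrix (@?g x) ?a ?b) =>
      apply: (@measurableT_comp _ _ _ _ _ _ (fun z => fun_of_matrix z a b) _ g);
        [exact: measurable_coord|]
  | H : measurable_fun _ ?u |- measurable_fun _ (fun x => ?u (@?g x)) =>
      apply: (@measurableT_comp _ _ _ _ _ _ u _ g); [exact: H|]
  | H : forall i, measurable_fun _ (?u i) |- measurable_fun _ (fun x => ?u ?j (@?g x)) =>
      apply: (@measurableT_comp _ _ _ _ _ _ (u j) _ g); [exact: H|]
  | H : forall i, measurable_fun _ (?u i) |- measurable_fun _ (?u _) => exact: H
  | |- _ => progress cbv beta
  end.
Ltac meas := repeat meas1.

(** * The Euclidean norm *)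

Section enorm.
Context {R : realType} {N : nat}.
Local Notation E := 'rV[R]_N.
Implicit Types x y : E.

Definition sqn x : R := \sum_i x ord0 i ^+ 2.

Lemma sqn_ge0 x : 0 <= sqn x.
Proof. by apply: sumr_ge0 => i _; exact: sqr_ge0. Qed.

Lemma enormE x : enorm x = Num.sqrt (sqn x). Proof. by []. Qed.

Lemma enorm_ge0 x : 0 <= enorm x. Proof. exact: sqrtr_ge0. Qed.

Lemma enorm_sqr x : enorm x ^+ 2 = sqn x.
Proof. by rewrite enormE sqr_sqrtr// sqn_ge0. Qed.

Lemma ler_enorm x y : (enorm x <= enorm y) = (sqn x <= sqn y).
Proof. by rewrite -!enorm_sqr ler_pXn2r// nnegrE enorm_ge0. Qed.

Lemma coord_le_enorm x i : `|x ord0 i| <= enorm x.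
Proof.
rewrite -ler_sqr ?nnegrE ?enorm_ge0// enorm_sqr /sqn (bigD1 i)//= real_normK ?num_real//.
by rewrite lerDl sumr_ge0// => j _; exact: sqr_ge0.
Qed.

Lemma enorm_le_sum x : enorm x <= \sum_i `|x ord0 i|.
Proof.
rewrite -ler_sqr ?nnegrE ?enorm_ge0 ?sumr_ge0// enorm_sqr /sqn.
suff [] : \sum_i x ord0 i ^+ 2 <= (\sum_i `|x ord0 i|) ^+ 2 /\ 0 <= \sum_i `|x ord0 i| by [].
elim/big_ind2 : _ => [|a b c d [h1 h1'] [h2 h2']|i _].
- by rewrite expr0n lexx.
- split; last exact: addr_ge0.
  apply: (le_trans (lerD h1 h2)).
  by rewrite sqrrD -addrA lerD2l lerDr mulrn_wge0// mulr_ge0.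
- by rewrite real_normK ?num_real.
Qed.

Lemma enormN x : enorm (- x) = enorm x.
Proof. by rewrite !enormE; congr Num.sqrt; apply: eq_bigr => i _; rewrite mxE sqrrN. Qed.

Lemma sqnN x : sqn (- x) = sqn x.
Proof. by rewrite -!enorm_sqr enormN. Qed.

Lemma measurable_sqn : measurable_fun setT (sqn : E -> R).
Proof. rewrite /sqn; by meas. Qed.

Lemma measurable_enorm : measurable_fun setT (enorm : E -> R).
Proof.
rewrite (_ : enorm = fun x => sqn x `^ 2^-1).
  by have h := measurable_sqn; meas.
by apply/funext => x; rewrite enormE -powR12_sqrt// sqn_ge0.
Qed.

End enorm.

(** * Measure-preserving maps, double integrals and null sets *)

Section measure_preserving.
Context {R : realType} {N : nat}.
Local Notation E := 'rV[R]_N.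
Local Notation leb := (@lebesgue_rV R N).
Implicit Types (f g u v : E -> R) (T : E -> E).

Definition mpres T := measurable_fun setT T /\
  forall A, measurable A -> leb (T @^-1` A) = leb A.

Lemma mpres_signed_perm (pi : {perm 'I_N}) (s c : E) :
  (forall i, s ord0 i ^+ 2 = 1) -> mpres (signed_perm pi s c).
Proof.
move=> s1; split; first exact: measurable_signed_perm.
by move=> A mA; exact: leb_signed_perm.
Qed.

Lemma mpres_add c : mpres (fun x => x + c).
Proof.
rewrite (_ : (fun x => x + c) = signed_perm 1%g (const_mx 1) c).
  by apply: mpres_signed_perm => i; rewrite mxE expr1n.
by apply/funext => x; apply/rowP => i; rewrite !mxE perm1 mul1r.
Qed.

Lemma mpres_sub c : mpres (fun x => x - c).
Proof. exact: mpres_add. Qed.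

Lemma mpres_subl c : mpres (fun x => c - x).
Proof.
rewrite (_ : (fun x => c - x) = signed_perm 1%g (const_mx (-1)) c).
  by apply: mpres_signed_perm => i; rewrite mxE sqrrN expr1n.
by apply/funext => x; apply/rowP => i; rewrite !mxE perm1 mulN1r addrC.
Qed.

Lemma mpres_measurable T f : mpres T -> measurable_fun setT f ->
  measurable_fun setT (fun x => f (T x)).
Proof. by move=> [mT _] mf; exact: (measurableT_comp mf). Qed.

Lemma mpres_eint T (f : E -> \bar R) : mpres T -> measurable_fun setT f ->
  (forall x, 0 <= f x)%E -> (\int[leb]_x f (T x) = \int[leb]_x f x)%E.
Proof.
move=> [mT hT] mf f0.
transitivity (\int[pushforward leb T]_x (f x))%E.
  by rewrite ge0_integral_pushforward.
by apply: eq_measure_integral => A mA _; exact: hT.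
Qed.

Lemma mpres_nnint T f : mpres T -> measurable_fun setT f -> (forall x, 0 <= f x) ->
  nnint leb (fun x => f (T x)) = nnint leb f.
Proof.
move=> hT mf f0; rewrite /nnint (@mpres_eint T (EFin \o f))//.
exact/measurable_EFinP.
Qed.

(** Positive and negative parts are transported separately, so the identity also covers integrands
    for which the real integral takes its default value. *)
Lemma mpres_int T f : mpres T -> measurable_fun setT f ->
  (\int[leb]_x (f (T x)) = \int[leb]_x (f x))%R.
Proof.
move=> hT mf; have mfT := mpres_measurable hT mf; congr fine.
rewrite integralE [in RHS]integralE; congr (_ - _)%E.
- have mp : measurable_fun setT (funepos (EFin \o f)).
    by apply: measurable_funepos; exact/measurable_EFinP.
  have h := mpres_eint hT mp (fun x => funepos_ge0 _ x).
  by rewrite -h; apply: eq_integral => x _; rewrite !funeposE.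
- have mn : measurable_fun setT (funeneg (EFin \o f)).
    by apply: measurable_funeneg; exact/measurable_EFinP.
  have h := mpres_eint hT mn (fun x => funeneg_ge0 _ x).
  by rewrite -h; apply: eq_integral => x _; rewrite !funenegE.
Qed.

Lemma mpres_ae T (P : E -> Prop) : mpres T -> {ae leb, forall x, P x} ->
  {ae leb, forall x, P (T x)}.
Proof.
move=> [mT hT] [A [mA A0 sA]]; exists (T @^-1` A); split.
- by rewrite -[X in measurable X]setTI; exact: mT.
- by rewrite [LHS]hT.
- by move=> x /= h; apply: sA.
Qed.

Lemma leb_set1 (x : E) : (0 < N)%N -> leb [set x] = 0%E.
Proof.
move=> N0; rewrite (_ : [set x] = box (fun i => [set x ord0 i])).
  rewrite leb_box// (bigD1 (Ordinal N0))//= lebesgue_measure_set1 mul0e//.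
by apply/seteqP; split => y /=; [move=> -> i|move=> h; apply/rowP].
Qed.

Lemma ae_neq (x : E) : (0 < N)%N -> {ae leb, forall y, y <> x}.
Proof.
move=> N0; exists [set x]; split => //; last 2 first.
- exact: leb_set1.
- by move=> y /= /contrapT.
by rewrite (_ : [set x] = box (fun i => [set x ord0 i]));
  [exact: measurable_box|apply/seteqP; split => y /=; [move=> -> i|move=> h; apply/rowP]].
Qed.

Definition dint (F : E -> E -> R) : \bar R :=
  nnint (leb \x leb)%E (fun z => F z.1 z.2).

Definition measurable2 (F : E -> E -> R) :=
  measurable_fun setT (fun z : E * E => F z.1 z.2).

Lemma measurable2_swap F : measurable2 F -> measurable2 (fun x y => F y x).
Proof.
move=> mF; apply: (@measurableT_comp _ _ _ _ _ _ (fun z : E * E => F z.1 z.2) _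
  (fun z : E * E => (z.2, z.1))) => //.
by apply/measurable_fun_pairP; split; [exact: measurable_snd|exact: measurable_fst].
Qed.

Lemma measurable2_inner F x : measurable2 F -> measurable_fun setT (F x).
Proof.
move=> mF; apply: (@measurableT_comp _ _ _ _ _ _ (fun z : E * E => F z.1 z.2) _
  (fun y : E => (x, y))) => //.
by apply/measurable_fun_pairP; split; [exact: measurable_cst|exact: measurable_id].
Qed.

Lemma measurable_nnint_inner F : measurable2 F -> (forall x y, 0 <= F x y) ->
  measurable_fun setT (fun x => nnint leb (F x)).
Proof.
move=> mF F0.
apply: (@measurable_fun_fubini_tonelli_F _ _ _ _ _ leb (fun z : E * E => (F z.1 z.2)%:E)).
  exact/measurable_EFinP.
by move=> z; rewrite lee_fin.
Qed.

Lemma dintE F : measurable2 F -> (forall x y, 0 <= F x y) ->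
  dint F = (\int[leb]_x nnint leb (F x))%E.
Proof.
move=> mF F0.
apply: (@fubini_tonelli1 _ _ _ _ _ leb leb (fun z : E * E => (F z.1 z.2)%:E)).
  exact/measurable_EFinP.
by move=> z; rewrite lee_fin.
Qed.

Lemma dint_swap F : measurable2 F -> (forall x y, 0 <= F x y) ->
  dint F = dint (fun x y => F y x).
Proof.
move=> mF F0; rewrite (dintE (measurable2_swap mF))// /dint /nnint.
apply: (@fubini_tonelli2 _ _ _ _ _ leb leb (fun z : E * E => (F z.1 z.2)%:E)).
  exact/measurable_EFinP.
by move=> z; rewrite lee_fin.
Qed.

Lemma eq_dint_inner F G : measurable2 F -> (forall x y, 0 <= F x y) ->
  measurable2 G -> (forall x y, 0 <= G x y) ->
  (forall x, nnint leb (F x) = nnint leb (G x)) -> dint F = dint G.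
Proof.
by move=> mF F0 mG G0 h; rewrite (dintE mF F0) (dintE mG G0); apply: eq_integral => x _; exact: h.
Qed.

Lemma dint_mpres2 F T : mpres T -> measurable2 F -> (forall x y, 0 <= F x y) ->
  dint (fun x y => F x (T y)) = dint F.
Proof.
move=> hT mF F0; apply: eq_dint_inner => //.
  case: hT => mT _.
  apply: (@measurableT_comp _ _ _ _ _ _ (fun z : E * E => F z.1 z.2) _
    (fun z : E * E => (z.1, T z.2))) => //.
  apply/measurable_fun_pairP; split; first exact: measurable_fst.
  exact: (@measurableT_comp _ _ _ _ _ _ T _ (fun z : E * E => z.2) mT measurable_snd).
by move=> x; rewrite mpres_nnint//; exact: (measurable2_inner x mF).
Qed.

Lemma dint_mpres1 F T : mpres T -> measurable2 F -> (forall x y, 0 <= F x y) ->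
  dint (fun x y => F (T x) y) = dint F.
Proof.
move=> hT mF F0.
have h := dint_mpres2 hT (measurable2_swap mF) (fun x y => F0 y x).
rewrite (dint_swap mF F0) -h dint_swap//.
case: hT => mT _.
apply: (@measurableT_comp _ _ _ _ _ _ (fun z : E * E => F z.1 z.2) _
    (fun z : E * E => (T z.1, z.2))) => //.
apply/measurable_fun_pairP; split; last exact: measurable_snd.
exact: (@measurableT_comp _ _ _ _ _ _ T _ (fun z : E * E => z.1) mT measurable_fst).
Qed.

(** By Tonelli the double integral of the indicator of the exceptional set is 0. The property is
    boolean so that this indicator is a measurable function. *)
Lemma ae_ae_prod (b : E -> E -> bool) : measurable_fun setT (fun z : E * E => b z.1 z.2) ->
  (forall x, {ae leb, forall y, b x y}) -> {ae (leb \x leb)%E, forall z, b z.1 z.2}.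
Proof.
move=> mb h; pose F x y : R := (~~ b x y)%:R.
have mF : measurable2 F by rewrite /measurable2 /F; apply: mfb; exact: mfneg.
have : dint F = 0%E.
  rewrite dintE// integral0_eq// => x _; apply: ae_nnint0; first exact: (measurable2_inner x mF).
  by apply: filterS (h x) => y; rewrite /F => ->.
move/nnint_eq0 => /(_ mF) /(_ (fun _ => ler0n _ _)).
by apply: filterS => -[x y]; rewrite /F/=; case: (b x y) => // /eqP; rewrite oner_eq0.
Qed.

(** The exceptional set is null in the product; integrating its indicator in the other order shows
    that almost all opposite sections are null. *)
Lemma ae_swap (b : E -> E -> bool) : measurable_fun setT (fun z : E * E => b z.1 z.2) ->
  (forall x, {ae leb, forall y, b x y}) -> {ae leb, forall y, {ae leb, forall x, b x y}}.
Proof.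
move=> mb h; pose F x y : R := (~~ b x y)%:R.
have mF : measurable2 F by rewrite /measurable2 /F; apply: mfb; exact: mfneg.
have mF' := measurable2_swap mF.
have F0 : dint F = 0%E.
  by apply: ae_nnint0 => //; apply: filterS (ae_ae_prod mb h) => -[x y] /=; rewrite /F => ->.
rewrite dint_swap// dintE// in F0.
have mI : measurable_fun setT (fun y => nnint leb (F^~ y)) by exact: measurable_nnint_inner.
have [+ _] := ae_eq_integral_abs leb measurableT mI.
move=> /(_ _)/wrap[].
  by rewrite -[RHS]F0; apply: eq_integral => x _; rewrite gee0_abs// nnint_ge0.
apply: filterS => x /(_ I) /nnint_eq0 => /(_ (measurable2_inner _ mF')) /(_ (fun _ => ler0n _ _)).
by apply: filterS => y; rewrite /F/=; case: (b y x) => // /eqP; rewrite oner_eq0.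
Qed.

End measure_preserving.

(** * Square-integrable functions *)

Section L2.
Context {d} {T : measurableType d} {R : realType} (mu : {measure set T -> \bar R}).
Implicit Types f g u v w : T -> R.

Lemma le_limn_einf (w : (\bar R)^nat) (C : \bar R) (n0 : nat) :
  (forall n, (n0 <= n)%N -> (w n <= C)%E) -> (limn_einf w <= C)%E.
Proof.
move=> h; rewrite limn_einf_lim; apply: lime_le; first exact: is_cvg_einfs.
exists n0 => // n /= nn; apply: ge_ereal_inf; exists (w n); first by exists n => /=.
exact: h.
Qed.

Lemma nnint_fatou (h : nat -> T -> R) f (C : \bar R) (n0 : nat) :
  (forall n, measurable_fun setT (h n)) -> measurable_fun setT f ->
  (forall n x, 0 <= h n x) -> (forall x, 0 <= f x) ->
  {ae mu, forall x, h n x @[n --> \oo] --> f x} ->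
  (forall n, (n0 <= n)%N -> (nnint mu (h n) <= C)%E) -> (nnint mu f <= C)%E.
Proof.
move=> mh mf h0 f0 hf hC.
have mEh n : measurable_fun setT (EFin \o h n) by exact/measurable_EFinP.
have fat := @fatou _ _ _ mu setT measurableT (fun n => EFin \o h n) mEh
  (fun n x _ => eq_ind_r is_true (h0 n x) (lee_fin _ _)).
apply: le_trans (le_limn_einf hC); apply: le_trans fat.
apply: ae_ge0_le_integral => //.
- by move=> x _; rewrite lee_fin.
- exact/measurable_EFinP.
- move=> x _; rewrite limn_einf_lim; apply: lime_ge; first exact: is_cvg_einfs.
  near=> n; by apply/ereal_infP => _ [m _ <-]; rewrite lee_fin.
- pose g x := limn_esup (fun n => (- (h n x)%:E)%E).
  have mg : measurable_fun setT g.
    apply: measurable_fun_limn_esup => n.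
    by apply: (@measurableT_comp _ _ _ _ _ _ (fun y : \bar R => (- y)%E));
      [exact: oppe_measurable|exact: (mEh n)].
  by apply: (@measurableT_comp _ _ _ _ _ _ (fun y : \bar R => (- y)%E) _ g);
    [exact: oppe_measurable|exact: mg].
- apply: filterS hf => x hx _.
  have hx' : (h n x)%:E @[n --> \oo] --> (f x)%:E by apply: cvg_EFin => //; exact: nearW.
  by have [-> _] := cvg_limn_einf_sup hx'.
Unshelve. all: by end_near. Qed.

(** Stated for functions rather than classes, with a nonnegative integral; [LfunP2] relates it to
    the space in which H^1 is defined. *)
Definition L2 u := measurable_fun setT u /\ (nnint mu (fun x => (u x ^+ 2)%R) < +oo)%E.

Definition ip u v : R := \int[mu]_x (u x * v x).
Definition n2 u : R := ip u u.

Definition intb f := mu.-integrable setT (EFin \o f).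

Lemma intbP f : measurable_fun setT f -> (nnint mu (fun x => (`|f x|%R)%R) < +oo)%E -> intb f.
Proof.
move=> mf h; apply/integrableP; split; first exact/measurable_EFinP.
by under eq_integral do rewrite /=.
Qed.

Lemma intb_measurable f : intb f -> measurable_fun setT f.
Proof. by move=> /integrableP[/measurable_EFinP]. Qed.

Lemma intb_abs_lty f : intb f -> (nnint mu (fun x => (`|f x|%R)%R) < +oo)%E.
Proof. by move=> /integrableP[]. Qed.

Lemma intb_le f g : measurable_fun setT f -> intb g -> (forall x, `|f x| <= g x) -> intb f.
Proof.
move=> mf ig h; apply: intbP => //; apply: le_lt_trans (intb_abs_lty ig).
have mg := intb_measurable ig.
apply: nnint_le => //; [by meas|by meas|].
by move=> x; rewrite (le_trans (h x))// ler_norm.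
Qed.

Lemma intbD f g : intb f -> intb g -> intb (fun x => f x + g x).
Proof. by move=> hf hg; have := integrableD measurableT hf hg. Qed.

Lemma intbB f g : intb f -> intb g -> intb (fun x => f x - g x).
Proof. by move=> hf hg; have := integrableB measurableT hf hg. Qed.

Lemma intbZ k f : intb f -> intb (fun x => k * f x).
Proof. by move=> hf; have := integrableZl measurableT k hf. Qed.

Lemma intb_sum (I : Type) (s : seq I) (F : I -> T -> R) : (forall i, intb (F i)) ->
  intb (fun x => \sum_(i <- s) F i x).
Proof.
move=> h; elim: s => [|i s IH].
  by under eq_fun do rewrite big_nil; exact: integrable0.
by under eq_fun do rewrite big_cons; exact: intbD.
Qed.

Lemma RintD f g : intb f -> intb g ->
  \int[mu]_x (f x + g x) = \int[mu]_x f x + \int[mu]_x g x.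
Proof. by move=> hf hg; rewrite RintegralD. Qed.

Lemma RintB f g : intb f -> intb g ->
  \int[mu]_x (f x - g x) = \int[mu]_x f x - \int[mu]_x g x.
Proof. by move=> hf hg; rewrite RintegralB. Qed.

Lemma RintZ k f : intb f -> \int[mu]_x (k * f x) = k * \int[mu]_x f x.
Proof. by move=> hf; rewrite RintegralZl. Qed.

Lemma Rint_sum (I : Type) (s : seq I) (F : I -> T -> R) : (forall i, intb (F i)) ->
  \int[mu]_x (\sum_(i <- s) F i x) = \sum_(i <- s) \int[mu]_x F i x.
Proof.
move=> h; elim: s => [|i s IH].
  rewrite big_nil; under eq_Rintegral do rewrite big_nil.
  by rewrite /Rintegral/= integral0.
rewrite big_cons -IH -RintD//; last exact: intb_sum.
by apply: eq_Rintegral => x _; rewrite big_cons.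
Qed.

Lemma Rint_le f g : intb f -> intb g -> (forall x, f x <= g x) ->
  \int[mu]_x f x <= \int[mu]_x g x.
Proof. by move=> hf hg h; apply: le_Rintegral. Qed.

Lemma nnint_Rint f : intb f -> (forall x, 0 <= f x) -> nnint mu f = (\int[mu]_x f x)%:E.
Proof.
by move=> hf f0; rewrite /Rintegral fineK//; exact: integrable_fin_num.
Qed.

Lemma intb_nn f : measurable_fun setT f -> (forall x, 0 <= f x) -> (nnint mu f < +oo)%E -> intb f.
Proof.
move=> mf f0 h; apply: intbP => //; rewrite (_ : (fun x => `|f x|) = f)//.
by apply/funext => x; rewrite ger0_norm.
Qed.

Lemma Rint_ae_eq f g : measurable_fun setT f -> measurable_fun setT g ->
  {ae mu, forall x, f x = g x} -> \int[mu]_x f x = \int[mu]_x g x.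
Proof. by move=> mf mg h; congr fine; exact: nnint_ae_eq. Qed.

Lemma intbM u v : L2 u -> L2 v -> intb (fun x => u x * v x).
Proof.
move=> [mu_ hu] [mv hv]; apply: intbP; first by meas.
have m1 : measurable_fun setT (fun x => u x ^+ 2) by meas.
have m2 : measurable_fun setT (fun x => v x ^+ 2) by meas.
apply: (@le_lt_trans _ _ (nnint mu (fun x => (u x ^+ 2 + v x ^+ 2)%R))).
  apply: nnint_le => //; [by meas|by meas|] => x.
  rewrite normrM -[u x ^+ 2]real_normK ?num_real// -[v x ^+ 2]real_normK ?num_real//.
  have := sqr_ge0 (`|u x| - `|v x|); have := normr_ge0 (u x); have := normr_ge0 (v x).
  nra.
rewrite nnintD//; [exact: lte_add_pinfty|by move=> x; exact: sqr_ge0|by move=> x; exact: sqr_ge0].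
Qed.

Lemma L2P u : L2 u <-> measurable_fun setT u /\ intb (fun x => u x ^+ 2).
Proof.
split=> -[mu_ h]; split => //.
  apply: intb_nn => //; [by meas|by move=> x; exact: sqr_ge0].
by have := intb_abs_lty h; congr (_ < _)%E; apply: eq_nnint => x; rewrite ger0_norm ?sqr_ge0.
Qed.

Lemma n2E u : L2 u -> nnint mu (fun x => (u x ^+ 2)%R) = (n2 u)%:E.
Proof.
move=> /L2P[mu_ h]; rewrite nnint_Rint//; last by move=> x; exact: sqr_ge0.
Qed.

Lemma n2_ge0 u : 0 <= n2 u.
Proof. by apply: Rintegral_ge0 => x _; rewrite -expr2 sqr_ge0. Qed.

Lemma ipC u v : ip u v = ip v u.
Proof. by apply: eq_Rintegral => x _; rewrite mulrC. Qed.

Lemma L20 : L2 (cst 0).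
Proof.
split; first exact: measurable_cst.
by rewrite /nnint integral0_eq ?ltry// => x _; rewrite expr0n.
Qed.

Lemma L2D u v : L2 u -> L2 v -> L2 (fun x => u x + v x).
Proof.
move=> Hu Hv; have [mu_ _] := Hu; have [mv _] := Hv.
apply/L2P; split; first by meas.
rewrite (_ : (fun x => _) = fun x => u x * u x + (v x * v x + 2 * (u x * v x))).
  by apply: intbD; [exact: intbM|apply: intbD; [exact: intbM|apply: intbZ; exact: intbM]].
by apply/funext => x; ring.
Qed.

Lemma L2Z k u : L2 u -> L2 (fun x => k * u x).
Proof.
move=> /L2P[mu_ h]; apply/L2P; split; first by meas.
by under eq_fun do rewrite exprMn; exact: intbZ.
Qed.

Lemma L2N u : L2 u -> L2 (fun x => - u x).
Proof. by move=> h; under eq_fun do rewrite -mulN1r; exact: L2Z. Qed.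

Lemma L2B u v : L2 u -> L2 v -> L2 (fun x => u x - v x).
Proof. by move=> hu hv; apply: L2D => //; exact: L2N. Qed.

Lemma L2_sum (I : Type) (s : seq I) (F : I -> T -> R) : (forall i, L2 (F i)) ->
  L2 (fun x => \sum_(i <- s) F i x).
Proof.
move=> h; elim: s => [|i s IH].
  by under eq_fun do rewrite big_nil; exact: L20.
by under eq_fun do rewrite big_cons; exact: L2D.
Qed.

Lemma L2_le u v : measurable_fun setT u -> L2 v -> (forall x, `|u x| <= `|v x|) -> L2 u.
Proof.
move=> mu_ [mv hv] h; split => //; apply: le_lt_trans hv.
apply: nnint_le; [by meas|by meas|by move=> x; exact: sqr_ge0|].
move=> x; rewrite -[u x ^+ 2]real_normK ?num_real// -[v x ^+ 2]real_normK ?num_real//.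
by rewrite ler_pXn2r// nnegrE.
Qed.

Lemma ipDl u v w : L2 u -> L2 v -> L2 w ->
  ip (fun x => u x + v x) w = ip u w + ip v w.
Proof.
move=> hu hv hw; rewrite /ip -RintD; [|exact: intbM|exact: intbM].
by apply: eq_Rintegral => x _; rewrite mulrDl.
Qed.

Lemma ipZl k u w : L2 u -> L2 w -> ip (fun x => k * u x) w = k * ip u w.
Proof.
move=> hu hw; rewrite /ip -RintZ; last exact: intbM.
by apply: eq_Rintegral => x _; rewrite mulrA.
Qed.

Lemma ipBl u v w : L2 u -> L2 v -> L2 w ->
  ip (fun x => u x - v x) w = ip u w - ip v w.
Proof.
move=> hu hv hw; rewrite /ip -RintB; [|exact: intbM|exact: intbM].
by apply: eq_Rintegral => x _; rewrite mulrBl.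
Qed.

Lemma ip_suml (I : Type) (s : seq I) (F : I -> T -> R) w : (forall i, L2 (F i)) -> L2 w ->
  ip (fun x => \sum_(i <- s) F i x) w = \sum_(i <- s) ip (F i) w.
Proof.
move=> h hw; rewrite /ip -Rint_sum; last by move=> i; exact: intbM.
by apply: eq_Rintegral => x _; rewrite mulr_suml.
Qed.

Lemma n2D u v : L2 u -> L2 v -> n2 (fun x => u x + v x) = n2 u + n2 v + 2 * ip u v.
Proof.
move=> hu hv; have huv := L2D hu hv; rewrite /n2 ipDl// ipC ipDl// [X in _ + X]ipC ipDl//.
by rewrite [ip v u]ipC; ring.
Qed.

Lemma n2Z k u : L2 u -> n2 (fun x => k * u x) = k ^+ 2 * n2 u.
Proof. by move=> hu; have := L2Z k hu => ?; rewrite /n2 ipZl// ipC ipZl//; ring. Qed.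

Lemma n2N u : n2 (fun x => - u x) = n2 u.
Proof. by apply: eq_Rintegral => x _; rewrite mulrNN. Qed.

Lemma n2B u v : L2 u -> L2 v -> n2 (fun x => u x - v x) = n2 u + n2 v - 2 * ip u v.
Proof.
move=> hu hv; rewrite (n2D hu (L2N hv)) n2N.
have -> : ip u (fun x => - v x) = - ip u v; last by rewrite mulrN.
rewrite ipC (_ : (fun x => - v x) = fun x => -1 * v x); last by apply/funext => x; rewrite mulN1r.
by rewrite ipZl// mulN1r ipC.
Qed.

Lemma n2_le u v : L2 u -> L2 v -> (forall x, `|u x| <= `|v x|) -> n2 u <= n2 v.
Proof.
move=> hu hv h; apply: Rint_le; [exact: intbM|exact: intbM|] => x.
rewrite -!expr2 -[u x ^+ 2]real_normK ?num_real// -[v x ^+ 2]real_normK ?num_real//.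
by rewrite ler_pXn2r// nnegrE.
Qed.

Lemma ip_young (l : R) u v : 0 < l -> L2 u -> L2 v -> 2 * ip u v <= l * n2 u + l^-1 * n2 v.
Proof.
move=> l0 hu hv.
have h := n2_ge0 (fun x => l * u x - v x).
rewrite (n2B (L2Z l hu) hv) (n2Z _ hu) (ipZl _ hu hv) in h.
rewrite -(ler_pM2l l0).
have -> : l * (l * n2 u + l^-1 * n2 v) = l ^+ 2 * n2 u + n2 v.
  by rewrite mulrDr !mulrA -expr2 divff ?gt_eqF// mul1r.
lra.
Qed.

Lemma cauchy_schwarz u v : L2 u -> L2 v -> ip u v ^+ 2 <= n2 u * n2 v.
Proof.
move=> hu hv.
have key l : 0 <= l ^+ 2 * n2 u + n2 v - 2 * (l * ip u v).
  by rewrite -(n2Z _ hu) -(ipZl _ hu hv) -(n2B (L2Z l hu) hv) n2_ge0.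
have [nu0|nu0] := eqVneq (n2 u) 0.
  (* When [n2 u] vanishes the quadratic in [l] is affine; this value of [l] would make it equal to
     -1 unless [ip u v] is 0. *)
  rewrite nu0 mul0r; have := key ((n2 v + 1) / (2 * ip u v)).
  have [->|ip0] := eqVneq (ip u v) 0; first by rewrite expr0n.
  rewrite nu0 mulr0 add0r (_ : 2 * ((n2 v + 1) / (2 * ip u v) * ip u v) = n2 v + 1); last by field.
  lra.
have nup : 0 < n2 u by rewrite lt_neqAle eq_sym nu0 n2_ge0.
(* The vertex of the parabola. *)
have := key (ip u v / n2 u).
rewrite -(ler_pM2r nup) mul0r (_ : ((ip u v / n2 u) ^+ 2 * n2 u + n2 v - 2 * (ip u v / n2 u * ip u v)) * n2 u = n2 u * n2 v - ip u v ^+ 2); last by field.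
lra.
Qed.

Lemma ip_bound u v : L2 u -> L2 v -> `|ip u v| <= Num.sqrt (n2 u) * Num.sqrt (n2 v).
Proof.
move=> hu hv; rewrite -sqrtrM ?n2_ge0// -sqrtr_sqr.
by rewrite ler_wsqrtr// cauchy_schwarz.
Qed.

Lemma n2D_le u v : L2 u -> L2 v -> n2 (fun x => u x + v x) <= 2 * n2 u + 2 * n2 v.
Proof.
move=> hu hv; rewrite n2D//; have := n2_ge0 (fun x => u x - v x); rewrite n2B//; lra.
Qed.

Lemma n2_eq0 u : L2 u -> n2 u = 0 -> {ae mu, forall x, u x = 0}.
Proof.
move=> hu h; have [m_ _] := hu; have e := n2E hu; rewrite h in e.
have m2 : measurable_fun setT (fun x => u x ^+ 2) by meas.
have := nnint_eq0 m2 (fun x => sqr_ge0 _) e.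
by apply: filterS => x /eqP; rewrite sqrf_eq0 => /eqP.
Qed.

Lemma L2_ae u v : measurable_fun setT v -> L2 u -> {ae mu, forall x, u x = v x} -> L2 v.
Proof.
move=> mv [mu_ h] uv; split => //; rewrite -(nnint_ae_eq _ _ (_ : {ae mu, forall x, u x ^+ 2 = v x ^+ 2}))//; [by meas|by meas|].
by apply: filterS uv => x ->.
Qed.

Lemma LfunP2 u : (u \in Lfun mu 2%:E) <-> L2 u.
Proof.
split=> [h|[mu_ h]].
  have := Lfun2_integrable_sqr h => hi; apply/L2P; split => //.
  exact: (set_mem (sub_Lfun_mfun h)).
apply/andP; split; apply: mem_set => //=.
rewrite /finite_norm unlock; apply: poweR_lty.
rewrite (eq_integral (fun x => (u x ^+ 2)%:E))//.
by move=> x _; rewrite /= powR_mulrn// real_normK ?num_real.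
Qed.

Lemma dct (f : nat -> T -> R) g h : (forall n, measurable_fun setT (f n)) ->
  measurable_fun setT g -> {ae mu, forall x, f n x @[n --> \oo] --> g x} ->
  intb h -> (forall n x, `|f n x| <= h x) ->
  intb g /\ (\int[mu]_x f n x)%R @[n --> \oo] --> (\int[mu]_x g x)%R.
Proof.
move=> mf mg cv ih dom.
have mEf n : measurable_fun setT (EFin \o f n) by exact/measurable_EFinP.
have mEg : measurable_fun setT (EFin \o g) by exact/measurable_EFinP.
have [||ig _ cvi] := @dominated_convergence _ _ _ mu setT measurableT (fun n => EFin \o f n)
  (EFin \o g) (EFin \o h) mEf mEg _ ih _.
- by apply: filterS cv => x hx _; apply: cvg_EFin => //; exact: nearW.
- by apply: nearW => x n _; rewrite /= lee_fin.
split => //; apply: fine_cvg; rewrite fineK//; exact: integrable_fin_num.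
Qed.

Lemma intb_ae_fin (F : T -> \bar R) : measurable_fun setT F -> (forall x, 0 <= F x)%E ->
  (\int[mu]_x F x < +oo)%E -> {ae mu, forall x, (F x < +oo)%E}.
Proof.
move=> mF F0 h.
have iF : mu.-integrable setT F.
  by apply/integrableP; split => //; under eq_integral do rewrite gee0_abs//.
by apply: filterS (integrable_ae measurableT iF) => x /(_ I); rewrite ge0_fin_numE.
Qed.

(** Completeness of L^2 with explicit rate, giving pointwise limits along the whole sequence. The
    growing regions [B] allow purely local Cauchy bounds: constant [true] gives the global theorem,
    cubes the local one. *)
Lemma riesz_fischer (B : nat -> T -> bool) (v : nat -> T -> R) :
  (forall n, measurable_fun setT (B n)) -> (forall n, measurable_fun setT (v n)) ->
  (forall n m x, (n <= m)%N -> B n x -> B m x) -> (forall x, exists n, B n x) ->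
  (forall n m, (n <= m)%N ->
    (nnint mu (fun x => ((B n x)%:R * (v n x - v m x) ^+ 2)%R) <= (16^-1 ^+ n)%:E)%E) ->
  exists u : T -> R, [/\ measurable_fun setT u,
    {ae mu, forall x, v n x @[n --> \oo] --> u x} &
    forall n, (nnint mu (fun x => ((B n x)%:R * (v n x - u x) ^+ 2)%R) <= (16^-1 ^+ n)%:E)%E].
Proof.
move=> mB mv ndB covB hv.
(* Of the rate 16^-n the factor 4^n is spent on pointwise control: the integrals still sum
   geometrically, and finiteness of the sum at [x] bounds the increments by a multiple of 2^-n. *)
pose F n x : R := 4 ^+ n * ((B n x)%:R * (v n x - v n.+1 x) ^+ 2).
have F0 n x : 0 <= F n x.
  by apply: mulr_ge0; [exact: exprn_ge0|apply: mulr_ge0 => //; exact: sqr_ge0].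
have mF n : measurable_fun setT (F n) by rewrite /F; meas; exact: mB.
have mS : measurable_fun setT (fun x => \sum_(0 <= n <oo) (F n x)%:E)%E.
  apply: ge0_emeasurable_sum => n *; first by rewrite lee_fin.
  exact/measurable_EFinP.
have S0 x : (0 <= \sum_(0 <= n <oo) (F n x)%:E)%E.
  by apply: nneseries_ge0 => n _ _; rewrite lee_fin.
have Sfin : (\int[mu]_x \sum_(0 <= n <oo) (F n x)%:E < +oo)%E.
  rewrite integral_nneseries//; last 2 first.
    by move=> n; exact/measurable_EFinP.
    by move=> n x _; rewrite lee_fin.
  apply: (@le_lt_trans _ _ (\sum_(0 <= n <oo) (geometric 1 (4^-1) n)%:E)%E).
    apply: lee_nneseries => [n _ _|n _]; first by apply: nnint_ge0.
    rewrite [leLHS](_ : _ = nnint mu (F n))//.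
    rewrite /F nnintZ; [|by meas; exact: mB|by move=> x; rewrite mulr_ge0// sqr_ge0|by rewrite exprn_ge0].
    apply: (@le_trans _ _ ((4 ^+ n)%:E * (16^-1 ^+ n)%:E)%E).
      by apply: lee_wpmul2l; [rewrite lee_fin exprn_ge0|exact: hv].
    rewrite -EFinM lee_fin -exprMn /geometric/= mul1r.
    by rewrite (_ : 4 * 16^-1 = 4^-1)//; field.
  have hg : (limn (series (geometric 1 (4^-1 : R))))%:E = (\sum_(0 <= n <oo) (geometric 1 (4^-1) n)%:E)%E.
    rewrite -EFin_lim; last by apply: is_cvg_geometric_series; rewrite ger0_norm; lra.
    apply: (congr1 (fun F : nat -> \bar R => limn F)); apply/funext => n.
    by rewrite /series/= -sumEFin.
  by rewrite -hg ltry.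
have aecvg : {ae mu, forall x, cvgn (fun n => v n x)}.
  apply: filterS (intb_ae_fin mS S0 Sfin) => x hx.
  have [n0 Bn0] := covB x.
  pose C := fine (\sum_(0 <= n <oo) (F n x)%:E)%E.
  have FC n : F n x <= C.
    rewrite -lee_fin /C fineK ?ge0_fin_numE//.
    apply: le_trans (nneseries_lim_ge n.+1 _); last by move=> *; rewrite lee_fin.
    by rewrite big_nat_recr//= leeDr// sume_ge0// => i _; rewrite lee_fin.
  have C0 : 0 <= C by exact: le_trans (F0 0%N x) (FC 0%N).
  pose D n := v (n.+1 + n0)%N x - v (n + n0)%N x.
  have hD n : `|D n| <= geometric (Num.sqrt C) (2^-1) n.
    have := FC (n + n0)%N; rewrite /F (ndB _ _ _ (leq_addl n n0) Bn0) mul1r => h.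
    have h4 : (4 : R) ^+ n * D n ^+ 2 <= C.
      apply: le_trans h; rewrite /D -addSn -sqrrN opprB; apply: ler_wpM2r; first exact: sqr_ge0.
      by rewrite exprD ler_peMr ?exprn_ge0// exprn_ege1//; lra.
    rewrite /geometric/= -(ler_pM2l (_ : 0 < 2 ^+ n)) ?exprn_gt0//.
    rewrite mulrCA -exprMn divff// expr1n mulr1.
    rewrite -ler_sqr ?nnegrE ?mulr_ge0 ?exprn_ge0 ?sqrtr_ge0//.
    rewrite sqr_sqrtr// exprMn real_normK ?num_real// -exprM mulnC exprM.
    by rewrite (_ : 2 ^+ 2 = 4)//; ring.
  have cD : cvgn (series D).
    apply: normed_cvg; apply: (@series_le_cvg _ _ (geometric (Num.sqrt C) (2^-1))) => [n|n|n|].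
    - exact: normr_ge0.
    - exact: le_trans (normr_ge0 _) (hD n).
    - exact: hD.
    - by apply: is_cvg_geometric_series; rewrite ger0_norm; lra.
  have : cvgn (fun n => v (n + n0)%N x).
    have -> : (fun n => v (n + n0)%N x) = (fun n => v n0 x + series D n).
      by apply/funext => n; rewrite (eq_sum_telescope (fun n => v (n + n0)%N x) n).
    by apply: is_cvgD => //; exact: is_cvg_cst.
  by move=> /cvg_ex[l hl]; apply/cvg_ex; exists l; rewrite -(cvg_shiftn n0).
(* The upper limit is measurable everywhere and agrees with the limit wherever the latter exists. *)
pose u x := fine (limn_esup (fun n => (v n x)%:E)).
have mu_ : measurable_fun setT u.
  apply: (@measurableT_comp _ _ _ _ _ _ fine) => //.
  by apply: measurable_fun_limn_esup => n; exact/measurable_EFinP.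
have aeu : {ae mu, forall x, v n x @[n --> \oo] --> u x}.
  apply: filterS aecvg => x /cvg_ex[l hl].
  have hl' : (v n x)%:E @[n --> \oo] --> l%:E by apply: cvg_EFin => //; exact: nearW.
  have [_ e] := cvg_limn_einf_sup hl'.
  by rewrite /u e.
exists u; split => // n.
apply: (@nnint_fatou (fun m x => (B n x)%:R * (v n x - v m x) ^+ 2) _ _ n) => //.
- by move=> m; meas; exact: mB.
- by meas; exact: mB.
- by move=> m x; rewrite mulr_ge0// sqr_ge0.
- by move=> x; rewrite mulr_ge0// sqr_ge0.
- apply: filterS aeu => x hx.
  have hd : (v n x - v m x) @[m --> \oo] --> v n x - u x by apply: cvgB => //; exact: cvg_cst.
  by rewrite expr2; under eq_fun do rewrite expr2; apply: cvgM; [exact: cvg_cst|exact: cvgM].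
- by move=> m nm; exact: hv.
Qed.

End L2.

Lemma fine_le_lty {R : realType} (x : \bar R) (c : R) : (x <= c%:E)%E -> (x < +oo)%E.
Proof. by move=> h; apply: le_lt_trans h (ltry _). Qed.

(** * Riesz representation by minimisation of a quadratic functional *)

Section riesz_minimisation.
Context {R : realType} {V : lmodType R} (S : set V) (b : V -> V -> R) (l : V -> R) (K : R).
Hypotheses (S0 : S 0) (SD : forall (a : R) x y, S x -> S y -> S (a *: x + y)).
Hypotheses (bC : forall x y, S x -> S y -> b x y = b y x)
  (bl : forall (a : R) x y z, S x -> S y -> S z -> b (a *: x + y) z = a * b x z + b y z)
  (b0 : forall x, S x -> 0 <= b x x)
  (ll : forall (a : R) x y, S x -> S y -> l (a *: x + y) = a * l x + l y)
  (lK : forall x, S x -> 2 * l x <= K + b x x).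

Let J x := b x x - 2 * l x.

Let JD (a : R) x y : S x -> S y ->
  J (a *: x + y) = a ^+ 2 * b x x + 2 * a * (b y x - l x) + J y.
Proof.
move=> Sx Sy; have Sxy := SD a Sx Sy; rewrite /J ll// bl// (bC Sx Sxy) (bC Sy Sxy) !bl//.
by rewrite (bC Sx Sy); ring.
Qed.

(* Minimising sequences of [J] are Cauchy by the parallelogram identity. *)
Lemma riesz_minimising_sequence : exists x : nat -> V, [/\ forall n, S (x n),
  forall n m, (n <= m)%N -> b (x n - x m) (x n - x m) <= 16^-1 ^+ n &
  forall n y, S y -> (b (x n) y - l y) ^+ 2 <= 16^-1 ^+ n * (b y y + 1)].
Proof.
have JK x : S x -> - K <= J x.
  by move=> Sx; rewrite /J lerNl opprB lerBlDr; exact: lK.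
pose A : set R := [set J x | x in S].
have hA : has_inf A.
  by split; [exists (J 0); exists 0|exists (- K) => _ [x Sx <-]; exact: JK].
(* With this tolerance the parallelogram identity leaves exactly 16^-n, the rate required by
   [riesz_fischer]. *)
have ex n : exists x, S x /\ J x < inf A + 16^-1 ^+ n / 4.
  have e0 : 0 < (16^-1 : R) ^+ n / 4 by rewrite divr_gt0// exprn_gt0// invr_gt0.
  by have [_ [x Sx <-] h] := inf_adherent e0 hA; exists x.
have [x hx] := choice ex.
have Jinf y : S y -> inf A <= J y by move=> Sy; apply: (inf_lbound hA.2); exists y.
have e1 n m : (n <= m)%N -> (16^-1 : R) ^+ m <= 16^-1 ^+ n.
  by move=> nm; rewrite ler_wiXn2l//; lra.
have Sm x1 : S x1 -> S (- x1) by move=> h; have := SD (-1) h S0; rewrite addr0 scaleN1r.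
exists x; split => [n|n m nm|n y Sy]; first by have [] := hx n.
  have [Sn hn] := hx n; have [Sm' hm] := hx m.
  have SB : S (x n - x m) by have := SD 1 Sn (Sm _ Sm'); rewrite scale1r.
  (* The competitor is the midpoint of [x n] and [x m]; together with the coefficient -1, which
     recovers [J (x m)], it yields the parallelogram identity. *)
  have h : inf A <= J ((- 2^-1) *: (x n - x m) + x n) by apply: Jinf; exact: SD.
  have hJm : J ((-1) *: (x n - x m) + x n) = J (x m).
    by rewrite scaleN1r opprB subrK.
  rewrite JD// in h; rewrite JD// in hJm.
  have := e1 _ _ nm; lra.
have [Sn hn] := hx n.
set e : R := 16^-1 ^+ n in hn *; set de := b (x n) y - l y; set B := b y y.
have B0 : 0 <= B by exact: b0.
(* The best step in direction [y] is [de / B]; the denominator [B + 1] avoids the degenerate case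
   [B = 0]. *)
have h : inf A <= J ((- (de / (B + 1))) *: y + x n) by apply: Jinf; exact: SD.
rewrite JD// -/B -/de in h.
have B1 : 0 < B + 1 by lra.
have e0 : 0 < e by rewrite exprn_gt0.
have eq1 : (- (de / (B + 1))) ^+ 2 * B + 2 * - (de / (B + 1)) * de =
   - (de ^+ 2 * (B + 2) / (B + 1) ^+ 2).
  by field; rewrite gt_eqF.
have h2 : de ^+ 2 * (B + 2) / (B + 1) ^+ 2 <= e by lra.
rewrite ler_pdivrMr ?exprn_gt0// in h2.
have : de ^+ 2 * (B + 1) <= e * (B + 1) ^+ 2.
  by apply: le_trans h2; apply: ler_wpM2l; [exact: sqr_ge0|lra].
by rewrite expr2 mulrA ler_pM2r.
Qed.

End riesz_minimisation.

(** * Test functions *)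

Section directional.
Context {R : realType} {N : nat}.
Local Notation E := 'rV[R]_N.
Local Notation leb := (@lebesgue_rV R N).
Implicit Types (f g phi u : E -> R) (x z : E).

Definition unit_vec (i : 'I_N) : E := delta_mx ord0 i.

(** The difference quotient along a line is literally the directional one, so one-variable calculus
    applies to directional derivatives. *)
Lemma line_quotient f x (v : E) (t : R) :
  (fun h : R => h^-1 *: (((fun s : R => f (x + s *: v)) \o shift t) (h *: (1 : R)) - f (x + t *: v))) =
  (fun h : R => h^-1 *: ((f \o shift (x + t *: v)) (h *: v) - f (x + t *: v))).
Proof.
apply/funext => h /=; congr (_ *: (f _ - _)).
by rewrite /GRing.scale/= mulr1 -/(GRing.scale _ _) scalerDl addrCA.
Qed.

Lemma derivable_line f x v (t : R) : derivable f (x + t *: v) v ->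
  derivable (fun s : R => f (x + s *: v)) t 1.
Proof. by rewrite /derivable line_quotient. Qed.

Lemma derive_line f x v (t : R) :
  'D_1 (fun s : R => f (x + s *: v)) t = 'D_v f (x + t *: v).
Proof. by rewrite /derive line_quotient. Qed.

Lemma is_derive_of_line f x v (d : R) :
  is_derive (0 : R) 1 (fun s : R => f (x + s *: v)) d -> is_derive x v f d.
Proof.
move=> [h1 h2]; move: h1 h2; rewrite /derivable /derive line_quotient scale0r addr0 => h1 h2.
by split.
Qed.

Lemma mvt_dir f i x (t : R) : (forall y, derivable f y (unit_vec i)) ->
  exists2 c : R, `|c| <= `|t| & f (x + t *: unit_vec i) - f x = t * partial i f (x + c *: unit_vec i).
Proof.
move=> df; pose g (s : R) := f (x + s *: unit_vec i).
have dg (s : R) : is_derive s 1 g (partial i f (x + s *: unit_vec i)).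
  by split; [exact: derivable_line|exact: derive_line].
have cg (a b : R) : {within `[a, b], continuous g}.
  by apply: derivable_within_continuous => s _; have [] := dg s.
have g0 : g 0 = f x by rewrite /g scale0r addr0.
have [t0|t0] := leP 0 t.
  have [c hc h] := MVT_segment t0 (fun s _ => dg s) (cg 0 t).
  exists c; last by rewrite -g0 mulrC -[in RHS](subr0 t) -h.
  by move: hc; rewrite in_itv/= => /andP[h1 h2]; rewrite !ger0_norm.
have [c hc h] := MVT_segment (ltW t0) (fun s _ => dg s) (cg t 0).
exists c.
  by move: hc; rewrite in_itv/= => /andP[h1 h2]; rewrite !ler0_norm ?lerN2// ltW.
by rewrite -g0 -[LHS]opprB h sub0r mulrN opprK mulrC.
Qed.

End directional.

Section test_functions.
Context {R : realType} {N : nat}.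
Local Notation E := 'rV[R]_N.
Local Notation leb := (@lebesgue_rV R N).
Implicit Types (f g phi u : E -> R) (x z : E).

Lemma smooth_partial i phi : smooth phi -> smooth (partial i phi).
Proof.
by move=> h s; have := h (rcons s i); rewrite /iter_partial foldr_rcons.
Qed.

Lemma partial_support i phi x : partial i phi x != 0 -> closure [set y | phi y != 0] x.
Proof.
move=> h; apply: contrapT => nc; move/negP: h; apply.
have : \near x, phi x = (cst 0 : E -> R) x.
  have oC : open (~` closure [set y | phi y != 0]).
    by apply: closed_openC; exact: closed_closure.
  have : nbhs x (~` closure [set y | phi y != 0]) by apply: open_nbhs_nbhs; split.
  by apply: filterS => y /= hy; apply/eqP; apply: contra_notT hy => hy; exact: subset_closure.
by move=> /near_eq_derive h0; rewrite /partial h0 derive_cst.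
Qed.

Lemma test_partial i phi : test_function phi -> test_function (partial i phi).
Proof.
move=> [sm cp]; split; first exact: smooth_partial.
apply: subclosed_compact cp _; first exact: closed_closure.
rewrite closureE => x h; apply: h; split; first exact: closed_closure.
by move=> y; exact: partial_support.
Qed.

Lemma continuous_test phi : test_function phi -> continuous phi.
Proof. by move=> [sm _]; have [] := sm [::]. Qed.

Lemma measurable_test phi : test_function phi -> measurable_fun setT phi.
Proof. by move=> h; apply: continuous_measurable_rV; exact: continuous_test. Qed.

Lemma derivable_test i phi x : test_function phi -> derivable phi x (unit_vec i).
Proof. by move=> [sm _]; have [_] := sm [::]; apply. Qed.

Lemma coord_le_norm x i : `|x ord0 i| <= `|x|.
Proof. by rewrite [leRHS]/Num.norm/= mx_normrE; apply/bigmax_geP; right => /=; exists (ord0, i). Qed.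

Lemma compact_support_cube (A : set E) : compact A -> exists2 M : R, 0 < M & A `<=` cube M.
Proof.
move=> /compact_bounded [M [_ hM]]; exists (Num.max M 0 + 1).
  by rewrite ltr_pwDr// le_max lexx orbT.
move=> x Ax i; apply: le_trans (coord_le_norm _ _) _; apply: hM => //.
by rewrite ltr_pwDr// le_max lexx.
Qed.

Lemma test_csupport phi : test_function phi ->
  exists2 M : R, 0 < M & forall x, closure [set y | phi y != 0] x -> cube M x.
Proof. by move=> [_ /compact_support_cube]. Qed.

Lemma test_support phi : test_function phi ->
  exists2 M : R, 0 < M & forall x, phi x != 0 -> cube M x.
Proof.
move=> [_ /compact_support_cube[M M0 h]]; exists M => // x px.
by apply: h; exact: subset_closure.
Qed.

Lemma test_bounded phi : test_function phi -> exists2 C : R, 0 <= C & forall x, `|phi x| <= C.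
Proof.
move=> tp; have cp := continuous_test tp; have [_ cs] := tp.
have : compact (phi @` closure [set x | phi x != 0]).
  by apply: continuous_compact => //; exact: continuous_subspaceT.
move=> /compact_bounded [M [_ hM]]; exists (Num.max M 0 + 1).
  by rewrite addr_ge0// le_max lexx orbT.
move=> x; have [->|px] := eqVneq (phi x) 0.
  by rewrite normr0 addr_ge0// le_max lexx orbT.
apply: (hM (Num.max M 0 + 1)); first by rewrite ltr_pwDr// le_max lexx.
by exists x => //; apply: subset_closure.
Qed.

Lemma test_C2_bound phi : test_function phi -> exists C : R, [/\ 0 <= C,
  forall i x, `|partial i phi x| <= C &
  forall i j x, `|partial i (partial j phi) x| <= C].
Proof.
move=> tp.
have h1 i : {C : R | 0 <= C /\ forall x, `|partial i phi x| <= C}.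
  by apply: cid; have [C ? ?] := test_bounded (test_partial i tp); exists C.
have h2 i j : {C : R | 0 <= C /\ forall x, `|partial i (partial j phi) x| <= C}.
  by apply: cid; have [C ? ?] := test_bounded (test_partial i (test_partial j tp)); exists C.
pose c1 i := sval (h1 i); pose c2 i j := sval (h2 i j).
have c10 i : 0 <= c1 i by have [] := svalP (h1 i).
have c20 i j : 0 <= c2 i j by have [] := svalP (h2 i j).
have s1 : 0 <= \sum_i c1 i by apply: sumr_ge0.
have s2 i : 0 <= \sum_j c2 i j by apply: sumr_ge0.
have s3 : 0 <= \sum_i \sum_j c2 i j by apply: sumr_ge0.
exists (\sum_i c1 i + \sum_i \sum_j c2 i j); split; first exact: addr_ge0.
  move=> i x; have [_ /(_ x) h] := svalP (h1 i); apply: le_trans h _.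
  by rewrite ler_wpDr// (bigD1 i)//= -[leLHS]/(c1 i) lerDl sumr_ge0.
move=> i j x; have [_ /(_ x) h] := svalP (h2 i j); apply: le_trans h _.
rewrite ler_wpDl// (bigD1 i)//= -[leLHS]/(c2 i j) ler_wpDr ?sumr_ge0//.
by rewrite (bigD1 j)//= lerDl sumr_ge0.
Qed.

Definition l1norm z : R := \sum_i `|z ord0 i|.

Lemma l1norm_ge0 z : 0 <= l1norm z. Proof. exact: sumr_ge0. Qed.

Lemma rV_sum_unit z : z = \sum_(i < N) z ord0 i *: unit_vec i.
Proof.
apply/rowP => j; rewrite summxE (bigD1 j)//= !mxE !eqxx mulr1 big1 ?addr0// => i ij.
by rewrite !mxE eqxx/= eq_sym (negbTE ij) mulr0.
Qed.

(** Smoothness is given through iterated partial derivatives, so the point is moved one coordinate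
    at a time and each move is a mean value theorem along an axis. *)
Lemma test_taylor_seq phi C (s : seq 'I_N) x z : test_function phi -> 0 <= C ->
  (forall i j x, `|partial i (partial j phi) x| <= C) ->
  `|phi (x + \sum_(i <- s) z ord0 i *: unit_vec i) - phi x
    - \sum_(i <- s) z ord0 i * partial i phi x| <= C * (\sum_(i <- s) `|z ord0 i|) ^+ 2.
Proof.
move=> tp C0 hC; elim: s x => [|i s IH] x.
  by rewrite !big_nil addr0 !subrr normr0 expr0n mulr0.
rewrite !big_cons addrA.
set x' := x + z ord0 i *: unit_vec i; set Z := \sum_(j <- s) _ *: _; set sg := \sum_(j <- s) `|_|.
have sg0 : 0 <= sg by apply: sumr_ge0.
have [c hc h] := mvt_dir x (z ord0 i) (fun y => @derivable_test i phi y tp).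
have h2 : `|partial i phi (x + c *: unit_vec i) - partial i phi x| <= C * `|z ord0 i|.
  have [c' _ ->] := mvt_dir x c (fun y => @derivable_test i _ y (test_partial i tp)).
  by rewrite normrM mulrC ler_pM.
have h3 : `|\sum_(j <- s) z ord0 j * (partial j phi x' - partial j phi x)| <= C * `|z ord0 i| * sg.
  apply: le_trans (ler_norm_sum _ _ _) _; rewrite mulr_sumr; apply: ler_sum => j _.
  have [c' _ ->] := mvt_dir x (z ord0 i) (fun y => @derivable_test i _ y (test_partial j tp)).
  by rewrite normrM mulrC ler_wpM2r// normrM mulrC ler_wpM2r.
(* The error splits into that of the remaining path from [x'], that of the first move, and the
   change of the remaining partial derivatives between [x] and [x']. *)
have -> : phi (x' + Z) - phi x - (z ord0 i * partial i phi x + \sum_(j <- s) z ord0 j * partial j phi x) =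
  (phi (x' + Z) - phi x' - \sum_(j <- s) z ord0 j * partial j phi x') +
  (z ord0 i * (partial i phi (x + c *: unit_vec i) - partial i phi x) +
   \sum_(j <- s) z ord0 j * (partial j phi x' - partial j phi x)).
  rewrite mulrBr -h; under [X in _ = _ + (_ + X)]eq_bigr do rewrite mulrBr.
  by rewrite sumrB -/x'; ring.
apply: le_trans (ler_normD _ _) _.
apply: le_trans (lerD (IH x') (ler_normD _ _)) _.
rewrite normrM; have := ler_wpM2l (normr_ge0 (z ord0 i)) h2; have := normr_ge0 (z ord0 i).
rewrite -/sg; set a := `|z ord0 i|; move=> a0 ha; move: h3 ha; rewrite -/a.
set X1 := `|_ - _|; set X2 := `|_| => h3 ha.
have := mulr_ge0 C0 (mulr_ge0 a0 sg0); nra.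
Qed.

Lemma cube_sub_nbhd (M : R) x z : l1norm z <= 1 -> cube M (x + z) -> cube (M + 1) x.
Proof.
move=> z1 h i; have := h i; rewrite mxE => hi.
have : `|z ord0 i| <= 1.
  by apply: le_trans z1; rewrite /l1norm (bigD1 i)//= lerDl sumr_ge0.
have : `|x ord0 i| <= `|x ord0 i + z ord0 i| + `|z ord0 i|.
  by rewrite -{1}(addrK (z ord0 i) (x ord0 i)); exact: ler_normB.
lra.
Qed.

Definition incube (M : R) x : bool := `[< cube M x >].

Lemma incubeP M x : reflect (cube M x) (incube M x). Proof. exact: asboolP. Qed.

Lemma measurable_incube M : measurable_fun setT (incube M).
Proof.
apply: (measurable_fun_bool true) => //.
rewrite setTI (_ : _ @^-1` _ = cube M); first exact: measurable_cube.
by apply/seteqP; split => x /= /incubeP.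
Qed.

Lemma nnint_incube M : 0 <= M -> nnint leb (fun x => (incube M x)%:R) = ((2 * M) ^+ N)%:E.
Proof.
move=> M0; rewrite nnint_indic; last exact: measurable_incube.
rewrite -(@leb_cube R N)//; apply: (congr1 (leb : set E -> \bar R)).
by apply/seteqP; split => x /incubeP.
Qed.

Lemma intb_incube M : intb leb (fun x => (incube M x)%:R : R).
Proof.
apply: intb_nn => //; first by apply: mfb; exact: measurable_incube.
apply: (@le_lt_trans _ _ (nnint leb (fun x => ((incube (Num.max M 0) x)%:R)%R))).
  apply: nnint_le => //; [apply: mfb; exact: measurable_incube|apply: mfb; exact: measurable_incube|].
  move=> x; case: (incubeP M x) => // h; rewrite (_ : incube _ x)//.
  by apply/incubeP => i; apply: le_trans (h i) _; rewrite le_max lexx.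
by rewrite nnint_incube ?ltry// le_max lexx orbT.
Qed.

(** The indicator makes the remainder square integrable; the cube containing the support is enlarged
    by 1 because shifts of length up to 1 are allowed. *)
Lemma test_taylor phi : test_function phi -> exists C M : R, [/\ 0 <= C, 0 < M &
  forall x z, l1norm z <= 1 ->
    `|phi (x + z) - phi x - \sum_i z ord0 i * partial i phi x|
      <= C * l1norm z ^+ 2 * (incube M x)%:R].
Proof.
move=> tp; have [C [C0 _ h2]] := test_C2_bound tp.
have [M M0 hM'] := test_csupport tp.
have hM y : phi y != 0 -> cube M y by move=> py; apply: hM'; exact: subset_closure.
exists C, (M + 1); split => //; first by lra.
move=> x z z1; case: incubeP => hx.
  rewrite mulr1 {1}(rV_sum_unit z); exact: test_taylor_seq.
have nc : ~ cube M x by move=> h; apply: hx => i; have := h i; lra.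
have -> : phi (x + z) = 0.
  by apply/eqP; apply: contra_notT hx => /hM h; exact: (cube_sub_nbhd z1).
have -> : phi x = 0 by apply/eqP; apply: contra_notT nc => /hM.
rewrite big1 ?subrr ?normr0 ?mulr0// => i _.
have -> : partial i phi x = 0; last by rewrite mulr0.
by apply/eqP; apply: contra_notT nc => /partial_support /hM'.
Qed.

End test_functions.

(** * The flat functions t^(-k) exp(-1/t) *)

Section bump.
Context {R : realType}.

(* [t ^ (-k) * exp (- 1 / t)], extended by 0 to [t <= 0]; the derivatives of
   these functions are combinations of functions of the same family. *)
Definition bump (k : nat) (t : R) : R :=
  if 0 < t then t^-1 ^+ k * expR (- t^-1) else 0.

Lemma exprn_le_expR (k : nat) (s : R) : 0 <= s -> s ^+ k * expR (- s) <= (k`!)%:R.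
Proof.
move=> s0; rewrite expRN -ler_pdivlMr ?invr_gt0 ?expR_gt0// invrK.
case: k => [|k]; first by rewrite expr0 mul1r -expR0 ler_expR.
have f0 : (0 : R) < (k.+1)`!%:R by rewrite ltr0n fact_gt0.
have := expR_ge1Dxn k s0; set X := _ / _ => h.
have : X <= expR s by lra.
by rewrite /X ler_pdivrMr// mulrC.
Qed.

Lemma bump_ge0 k t : 0 <= bump k t.
Proof.
rewrite /bump; case: ltP => // t0.
by rewrite mulr_ge0 ?expR_ge0// exprn_ge0// invr_ge0 ltW.
Qed.

(** The exponential beats every power of 1/t; order 2 is what makes the derivative at 0 vanish. *)
Lemma bump_le_sqr k t : bump k t <= (k.+2)`!%:R * t ^+ 2.
Proof.
rewrite /bump; case: ltP => [t0|_]; last by rewrite mulr_ge0 ?sqr_ge0.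
have s0 : 0 <= t^-1 by rewrite invr_ge0 ltW.
apply: le_trans (ler_wpM2r (sqr_ge0 t) (exprn_le_expR k.+2 s0)).
rewrite le_eqVlt -[k.+2]addn2 exprD; apply/orP; left; apply/eqP.
by set A := t^-1 ^+ k; set B := expR _; field; rewrite gt_eqF.
Qed.

(** For positive t this is the chain rule through 1/t. At 0 [bump_le_sqr] sends the difference
    quotient to 0, in agreement with the formula. *)
Lemma is_derive_bump k (t : R) :
  is_derive t 1 (bump k) (bump k.+2 t - k%:R * bump k.+1 t).
Proof.
have [t0|t0|t0] := ltgtP t 0.
- have E0 : \near t, (cst 0 : R -> R) t = bump k t.
    by near=> s; rewrite /bump ltNge ltW//=; near: s; exact: lt_nbhsl.
  have d0 : derivable (cst 0 : R -> R) t 1 by exact: derivable_cst.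
  split; first exact: near_eq_derivable d0.
  by rewrite -(near_eq_derive _ E0) derive_cst /bump ltNge (ltW t0)/= mulr0 subrr.
- have E0 : \near t, ((fun s : R => s ^+ k * expR (- s)) \o (fun x : R => x^-1)) t = bump k t.
    by near=> s; rewrite /bump /= ifT//; near: s; exact: lt_nbhsr.
  have tn0 : t != 0 by rewrite gt_eqF.
  have d1 : is_derive t 1 (fun x : R => x^-1) (- t ^- 2).
    have := @is_deriveV R id t 1 1 tn0 (is_derive_id _ _).
    by rewrite /GRing.scale/= mulr1.
  have d2 : is_derive (t^-1) 1 (fun s : R => s ^+ k * expR (- s))
      (k%:R * t^-1 ^+ k.-1 * expR (- t^-1) - t^-1 ^+ k * expR (- t^-1)).
    have dX : is_derive t^-1 1 (fun s : R => s ^+ k) (k%:R * t^-1 ^+ k.-1).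
      split; first exact: exprn_derivable.
      by rewrite exp_derive /GRing.scale/= mulr1.
    have dE : is_derive t^-1 1 (fun s : R => expR (- s)) (- expR (- t^-1)).
      have h1 : is_derive t^-1 1 (fun s : R => - s) (- 1) by exact: is_deriveN.
      by have := is_derive1_comp (is_derive_expR (- t^-1)) h1; rewrite mulrN1.
    have := is_deriveM dX dE; rewrite /GRing.scale/=; set a := (X in is_derive _ _ _ X) => h.
    rewrite (_ : _ - _ = a)//; rewrite /a; ring.
  have [h1 h2] := is_derive1_comp d2 d1.
  split; first exact: near_eq_derivable h1.
  rewrite -(near_eq_derive _ E0) h2 /bump t0 -exprVn.
  set a := t^-1; set b := expR _; clear; case: k => [|k]; rewrite ?mul0r /= !exprS; ring.
- rewrite t0; have b00 j : bump j 0 = 0 by rewrite /bump ltxx.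
  rewrite !b00 mulr0 subrr.
  have key : (fun h : R => h^-1 *: ((bump k \o shift 0) (h *: (1 : R)) - bump k 0)) @ 0^' --> (0 : R).
    apply/cvgrPdist_lt => e e0; have C0 : (0 : R) < (k.+2)`!%:R by rewrite ltr0n fact_gt0.
    near=> h; rewrite /= b00 subr0 sub0r normrN addr0.
    have hn0 : h != 0 by near: h; exact: nbhs_dnbhs_neq.
    have hd : `|h| < e / (k.+2)`!%:R by near: h; apply: dnbhs0_lt; rewrite divr_gt0.
    rewrite /GRing.scale/= mulr1 normrM normfV ger0_norm ?bump_ge0// mulrC.
    rewrite ltr_pdivrMr ?normr_gt0//; apply: le_lt_trans (bump_le_sqr k h) _.
    rewrite -[h ^+ 2]real_normK ?num_real// expr2 mulrA ltr_pM2r ?normr_gt0//.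
    by rewrite mulrC -ltr_pdivlMr.
  split; first by apply/cvg_ex; exists 0.
  exact: cvg_lim key.
Unshelve. all: by end_near. Qed.

Lemma bump_continuous k : continuous (bump k).
Proof.
move=> t; apply: differentiable_continuous; apply/derivable1_diffP.
by have [] := is_derive_bump k t.
Qed.

End bump.

(** * A class of smooth functions closed under differentiation *)

Section elementary_smooth.
Context {R : realType} {N : nat}.
Local Notation E := 'rV[R]_N.
Local Notation leb := (@lebesgue_rV R N).
Implicit Types (f g phi u : E -> R) (x z : E).

(* Stable under partial derivatives, and rich enough for plateau functions and
   radial barriers. *)
Inductive esm : (E -> R) -> Prop :=
| esm_cst c : esm (fun=> c)
| esm_add f g : esm f -> esm g -> esm (fun x => f x + g x)
| esm_mul f g : esm f -> esm g -> esm (fun x => f x * g x)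
| esm_inv f : esm f -> (forall x, 0 < f x) -> esm (fun x => (f x)^-1)
| esm_coord i : esm (fun x => x ord0 i)
| esm_bump k f : esm f -> esm (fun x => bump k (f x)).

Lemma is_derive_comp_dir (g : R -> R) f i x (df dg : R) :
  is_derive x (unit_vec i) f df -> is_derive (f x) 1 g dg ->
  is_derive x (unit_vec i) (fun x => g (f x)) (dg * df).
Proof.
move=> [f1 f2] hg; apply: is_derive_of_line.
have h : is_derive (0 : R) 1 (fun s : R => f (x + s *: unit_vec i)) df.
  have e : x + (0 : R) *: unit_vec i = x by rewrite scale0r addr0.
  split; first by apply: derivable_line; rewrite e.
  by rewrite derive_line e.
have hg' : is_derive (f (x + (0 : R) *: unit_vec i)) 1 g dg by rewrite scale0r addr0.
exact: (is_derive1_comp hg' h).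
Qed.

Lemma is_derive_coord (i j : 'I_N) x :
  is_derive x (unit_vec j) (fun x => x ord0 i) ((i == j)%:R : R).
Proof.
apply: is_derive_of_line.
rewrite (_ : (fun s : R => _) = (fun s : R => s * (i == j)%:R + x ord0 i)); last first.
  by apply/funext => s; rewrite !mxE eqxx/= addrC.
have h : is_derive (0 : R) 1 (fun s : R => s * (i == j)%:R) ((i == j)%:R : R).
  have [_|_] := eqVneq i j.
    by under eq_fun do rewrite mulr1; exact: is_derive_id.
  by under eq_fun do rewrite mulr0; exact: is_derive_cst.
by have := is_deriveD h (is_derive_cst (x ord0 i) (0 : R) 1); rewrite addr0.
Qed.

Lemma esm_affine i (a b : R) : esm (fun x => a * x ord0 i + b).
Proof. by apply: esm_add; [apply: esm_mul; [exact: esm_cst|exact: esm_coord]|exact: esm_cst]. Qed.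

Lemma esm_sub f g : esm f -> esm g -> esm (fun x => f x - g x).
Proof.
move=> hf hg; rewrite (_ : (fun x => _) = (fun x => f x + (-1) * g x)).
  by apply: esm_add => //; apply: esm_mul => //; exact: esm_cst.
by apply/funext => x; rewrite mulN1r.
Qed.

Lemma esm_continuous f : esm f -> continuous f.
Proof.
elim=> [c|{}f g _ hf _ hg|{}f g _ hf _ hg|{}f _ hf f0|i|k {}f _ hf].
- exact: cst_continuous.
- by move=> x; exact: (cvgD (hf x) (hg x)).
- by move=> x; exact: (cvgM (hf x) (hg x)).
- move=> x; have fx : f x != 0 by rewrite gt_eqF// f0.
  exact: (cvgV fx (hf x)).
- exact: coord_continuous.
- by move=> x; apply: (@continuous_comp _ _ _ f (bump k)); [exact: hf|exact: bump_continuous].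
Qed.

Lemma esm_derive f i : esm f -> exists2 f', esm f' & forall x, is_derive x (unit_vec i) f (f' x).
Proof.
elim=> [c|{}f g hf [f' hf' df] hg [g' hg' dg]|{}f g hf [f' hf' df] hg [g' hg' dg]
       |{}f hf [f' hf' df] f0|j|k {}f hf [f' hf' df]].
- by exists (fun=> 0); [exact: esm_cst|move=> x; exact: is_derive_cst].
- exists (fun x => f' x + g' x); first exact: esm_add.
  by move=> x; exact: is_deriveD.
- exists (fun x => f x * g' x + g x * f' x).
    by apply: esm_add; exact: esm_mul.
  by move=> x; exact: is_deriveM.
- exists (fun x => (- 1 * ((f x)^-1 * (f x)^-1)) * f' x).
    apply: esm_mul => //; apply: esm_mul; first exact: esm_cst.
    by apply: esm_mul; exact: esm_inv.
  move=> x; have fn0 : f x != 0 by rewrite gt_eqF.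
  have [d1 d2] := df x; split; first exact: derivableV.
  rewrite deriveV// d2 /GRing.scale/= -exprVn expr2; ring.
- by exists (fun=> (j == i)%:R); [exact: esm_cst|move=> x; exact: is_derive_coord].
- exists (fun x => (bump k.+2 (f x) - k%:R * bump k.+1 (f x)) * f' x).
    apply: esm_mul => //; apply: esm_sub; first exact: esm_bump.
    by apply: esm_mul; [exact: esm_cst|exact: esm_bump].
  by move=> x; apply: is_derive_comp_dir => //; exact: is_derive_bump.
Qed.

Lemma esm_partial f i : esm f -> esm (partial i f).
Proof.
move=> /(esm_derive i) [f' hf' df]; rewrite (_ : partial i f = f')//.
by apply/funext => x; have [_ h] := df x; rewrite -h.
Qed.

Lemma esm_smooth f : esm f -> smooth f.
Proof.
move=> hf s; suff hs : esm (iter_partial s f).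
  split; first exact: esm_continuous.
  by move=> i x; have [f' _ /(_ x)[]] := esm_derive i hs.
by elim: s => //= i s; exact: esm_partial.
Qed.

Lemma compact_cube (M : R) : compact (cube M : set E).
Proof.
rewrite cubeE; have := @rV_compact R N (fun _ => `[- M, M]%classic).
by apply => i; exact: segment_compact.
Qed.

Lemma esm_test f M : esm f -> (forall x, f x != 0 -> cube M x) -> test_function f.
Proof.
move=> hf h; split; first exact: esm_smooth.
have cM := @compact_cube M.
apply: subclosed_compact cM _; first exact: closed_closure.
rewrite closureE => x hx; apply: hx; split; first exact: compact_closed (@compact_cube M).
by move=> y; exact: h.
Qed.

(** The usual smooth step b(s) / (b(s) + b(1 - s)) with s = a x_i + b, where b(s) is exp(-1/s): it
    is 0 for s <= 0 and 1 for s >= 1. The two bumps never vanish together. *)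
Definition step (i : 'I_N) (a b : R) x : R :=
  bump 0 (a * x ord0 i + b) *
  (bump 0 (a * x ord0 i + b) + bump 0 (- a * x ord0 i + (1 - b)))^-1.

Lemma step_den i a b x :
  0 < bump 0 (a * x ord0 i + b) + bump 0 (- a * x ord0 i + (1 - b)).
Proof.
have p t : 0 < t -> 0 < bump 0 t by move=> t0; rewrite /bump t0 mulr_gt0 ?expR_gt0 ?exprn_gt0 ?invr_gt0.
have [h|h] := ltP 0 (a * x ord0 i + b).
  by rewrite ltr_pwDl ?bump_ge0//; exact: p.
by rewrite ltr_wpDl ?bump_ge0//; apply: p; rewrite mulNr; lra.
Qed.

Lemma esm_step i a b : esm (step i a b).
Proof.
apply: esm_mul; first by apply: esm_bump; exact: esm_affine.
apply: esm_inv; last by move=> x; exact: step_den.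
by apply: esm_add; apply: esm_bump; exact: esm_affine.
Qed.

Lemma step_ge0 i a b x : 0 <= step i a b x.
Proof. by rewrite mulr_ge0 ?bump_ge0// invr_ge0 ltW// step_den. Qed.

Lemma step_le1 i a b x : step i a b x <= 1.
Proof. by rewrite /step ler_pdivrMr ?step_den// mul1r lerDl bump_ge0. Qed.

Lemma step_eq0 i a b x : a * x ord0 i + b <= 0 -> step i a b x = 0.
Proof. by move=> h; rewrite /step {1}/bump ltNge h mul0r. Qed.

Lemma step_eq1 i a b x : 1 <= a * x ord0 i + b -> step i a b x = 1.
Proof.
move=> h; rewrite /step; have -> : bump 0 (- a * x ord0 i + (1 - b)) = 0.
  by rewrite /bump ltNge mulNr (_ : _ <= 0)//; lra.
have := step_den i a b x; have -> : bump 0 (- a * x ord0 i + (1 - b)) = 0.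
  by rewrite /bump ltNge mulNr (_ : _ <= 0)//; lra.
by rewrite addr0 => h0; rewrite divff// gt_eqF.
Qed.

Lemma esm_prod (I : Type) (s : seq I) (F : I -> E -> R) : (forall i, esm (F i)) ->
  esm (fun x => \prod_(i <- s) F i x).
Proof.
move=> hF; elim: s => [|i s IH].
  by under eq_fun do rewrite big_nil; exact: esm_cst.
by under eq_fun do rewrite big_cons; exact: esm_mul.
Qed.

(** In each coordinate a step rises over [a_i, a_i + 1/m] and another falls over [b_i - 1/m, b_i],
    so [m] is the steepness at the faces of the box. *)
Definition plateau (m : R) (a b : 'I_N -> R) x : R :=
  \prod_i (step i m (- (m * a i)) x * step i (- m) (m * b i) x).

Lemma esm_plateau m a b : esm (plateau m a b).
Proof. by apply: esm_prod => i; apply: esm_mul; exact: esm_step. Qed.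

Lemma plateau_ge0 m a b x : 0 <= plateau m a b x.
Proof. by apply: prodr_ge0 => i _; rewrite mulr_ge0 ?step_ge0. Qed.

Lemma plateau_le1 m a b x : plateau m a b x <= 1.
Proof.
rewrite /plateau; apply: prodr_ile1 => i _; rewrite mulr_ge0 ?step_ge0//=.
by rewrite mulr_ile1 ?step_ge0 ?step_le1.
Qed.

Lemma plateau_neq0 m a b x : 0 < m -> plateau m a b x != 0 -> forall i, a i < x ord0 i < b i.
Proof.
move=> m0 h i; apply: contraNT h => h; rewrite /plateau (bigD1 i)//=.
rewrite negb_and -!leNgt in h; case/orP: h => h.
  by rewrite step_eq0 ?mul0r// -mulrBr pmulr_rle0// subr_le0.
by rewrite [step i (- m) _ x]step_eq0 ?mulr0 ?mul0r// mulNr addrC -mulrBr pmulr_rle0// subr_le0.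
Qed.

Lemma plateau_eq1 m a b x : (forall i, 1 <= m * (x ord0 i - a i) /\ 1 <= m * (b i - x ord0 i)) ->
  plateau m a b x = 1.
Proof.
move=> h; rewrite /plateau big1// => i _; have [h1 h2] := h i.
rewrite !step_eq1 ?mulr1//; first by rewrite mulNr addrC -mulrBr.
by rewrite -mulrBr.
Qed.

Lemma test_plateau m a b : 0 < m -> test_function (plateau m a b).
Proof.
move=> m0; pose M := \sum_i (`|a i| + `|b i|).
apply: (@esm_test _ M); first exact: esm_plateau.
move=> x /(plateau_neq0 m0) h i; have /andP[h1 h2] := h i.
apply: (@le_trans _ _ (`|a i| + `|b i|)).
  rewrite ler_norml; have := ler_norm (b i); have := ler_norm (- a i); rewrite normrN.
  have := normr_ge0 (a i); have := normr_ge0 (b i); lra.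
by rewrite /M (bigD1 i)//= lerDl sumr_ge0// => j _; rewrite addr_ge0.
Qed.

Definition inbox (a b : 'I_N -> R) x : bool := [forall i, a i < x ord0 i < b i].

Lemma plateau_cvg a b x : plateau n.+1%:R a b x @[n --> \oo] --> ((inbox a b x)%:R : R).
Proof.
have [/forallP h|/forallP h] := boolP (inbox a b x); last first.
  rewrite (_ : (fun n => _) = cst 0); first exact: cvg_cst.
  apply/funext => n /=; apply/eqP; apply/negPn/negP => hp; apply: h => i.
  exact: (plateau_neq0 _ hp).
(* A bound for the inverse distances from [x] to all faces; once n exceeds it, [x] lies on the flat
   part. *)
pose d : R := \sum_i ((x ord0 i - a i)^-1 + (b i - x ord0 i)^-1).
have p i : 0 < x ord0 i - a i /\ 0 < b i - x ord0 i.
  by have /andP[] := h i; rewrite !subr_gt0.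
have inv0 i : 0 <= (x ord0 i - a i)^-1 /\ 0 <= (b i - x ord0 i)^-1.
  by have [? ?] := p i; rewrite !invr_ge0 !ltW.
apply: cvg_near_cst; near=> n; apply: plateau_eq1 => i.
have hn : d <= n%:R by near: n; exact: nbhs_infty_ger.
have hn1 : d <= n.+1%:R by apply: le_trans hn _; rewrite ler_nat.
have hd : (x ord0 i - a i)^-1 + (b i - x ord0 i)^-1 <= d.
  rewrite /d (bigD1 i)//= lerDl sumr_ge0// => j _; have [? ?] := inv0 j; exact: addr_ge0.
have [p1 p2] := p i; have [i1 i2] := inv0 i.
by split; rewrite -ler_pdivrMr// div1r; lra.
Unshelve. all: by end_near. Qed.

End elementary_smooth.

Lemma le_of_geometric {R : realType} (x c r : R) : 0 <= r < 1 ->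
  (forall n : nat, x <= c * r ^+ n) -> x <= 0.
Proof.
move=> /andP[r0 r1] h; have cv : (geometric c r) @ \oo --> (0 : R).
  by apply: cvg_geometric; rewrite ger0_norm.
by apply: (cvgr_to_ge cv); apply: nearW => n; exact: h.
Qed.

(** * The fundamental lemma of the calculus of variations *)

Section fundamental_lemma.
Context {R : realType} {N : nat}.
Local Notation E := 'rV[R]_N.
Local Notation leb := (@lebesgue_rV R N).
Implicit Types (f g phi psi u v : E -> R) (x z : E).

Lemma L2_incube M : L2 leb (fun x => (incube M x)%:R : R).
Proof.
apply/L2P; split; first by apply: mfb; exact: measurable_incube.
rewrite (_ : (fun x => _) = (fun x => (incube M x)%:R : R)); first exact: intb_incube.
by apply/funext => x; case: (incube M x); rewrite ?expr1n ?expr0n.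
Qed.

Lemma test_L2 phi : test_function phi -> L2 leb phi.
Proof.
move=> tp; have [C C0 hC] := test_bounded tp; have [M M0 hM] := test_support tp.
apply: (@L2_le _ _ _ _ _ (fun x => C * (incube M x)%:R)).
- exact: measurable_test.
- by apply: L2Z; exact: L2_incube.
- move=> x; rewrite normrM (ger0_norm C0) ger0_norm//.
  have [->|px] := eqVneq (phi x) 0; first by rewrite normr0 mulr_ge0.
  by rewrite (_ : incube M x) ?mulr1//; apply/incubeP; exact: hM.
Qed.

Lemma inboxP a b x : reflect (box (fun i => `]a i, b i[%classic) x) (inbox a b x).
Proof.
apply: (iffP forallP) => h i; have := h i; first by rewrite /= in_itv.
by rewrite /= in_itv.
Qed.

Lemma measurable_inbox (a b : 'I_N -> R) : measurable_fun setT (inbox a b).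
Proof.
apply: (measurable_fun_bool true) => //.
rewrite setTI (_ : _ @^-1` _ = box (fun i => `]a i, b i[%classic)).
  exact: measurable_box.
by apply/seteqP; split => x /= /inboxP.
Qed.

Definition oboxes : set (set E) :=
  [set box (fun i => `]ab.1 i, ab.2 i[%classic) | ab in [set: ('I_N -> R) * ('I_N -> R)]].

Lemma oboxesI : setI_closed oboxes.
Proof.
move=> _ _ [[a b] _ <-] [[c e] _ <-].
exists (fun i => Num.max (a i) (c i), fun i => Num.min (b i) (e i)) => //=.
apply/seteqP; split => x /= h.
  by split => i; have := h i; rewrite /= !in_itv/= gt_max lt_min => /andP[/andP[? ?] /andP[? ?]]; apply/andP.
move=> i; have [/(_ i) + /(_ i)] := h; rewrite /= !in_itv/= gt_max lt_min.
by move=> /andP[-> ->] /andP[-> ->].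
Qed.

Lemma measurable_oboxesE : @measurable _ E = <<s oboxes >>.
Proof.
apply/seteqP; split; last first.
  apply: smallest_sub; first exact: sigma_algebra_measurable.
  by move=> _ [ab _ <-]; exact: measurable_box.
apply: smallest_sub; first exact: smallest_sigma_algebra.
move=> Z; rewrite -bigcup_seq => -[i _ [W mW <-]]; rewrite setTI.
have mi : measurable_fun [set: g_sigma_algebraType oboxes] (fun x : E => x ord0 i).
  apply: (measurability _ (RGenOpens.measurableE R)).
  move=> _ [_ [l [u ->] <-]]; rewrite setTI.
  (* A condition on one coordinate is a union of open boxes whose other sides grow. *)
  rewrite (_ : _ @^-1` _ = \bigcup_(n in [set: nat]) box (fun j => `](if j == i then l else - n%:R), (if j == i then u else n%:R)[%classic)).
    apply: bigcup_measurable => n _; apply: sub_sigma_algebra.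
    by exists (fun j => if j == i then l else - n%:R, fun j => if j == i then u else n%:R).
  apply/seteqP; split => x /=; last by move=> [n _ /(_ i)]; rewrite eqxx.
  move=> hx; have [k _ hk] : (\bigcup_k cube k%:R) x by rewrite cube_cover.
  exists k.+1 => // j; have [->|ij] := eqVneq j i => //=.
  have := hk j; rewrite ler_norml in_itv/= => /andP[h1 h2].
  have : (k%:R : R) < k.+1%:R by rewrite ltr_nat.
  by move=> h; apply/andP; split; lra.
have := mi measurableT W mW; rewrite setTI.
exact.
Qed.

Lemma int_plateau_lim u a b : L2 leb u ->
  (forall phi, test_function phi -> ip leb u phi = 0) ->
  \int[leb]_x (u x * (inbox a b x)%:R) = 0.
Proof.
move=> hu h0; have [mu_ _] := hu.
pose M := \sum_i (`|a i| + `|b i|).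
have t n : test_function (plateau n.+1%:R a b) by apply: test_plateau; rewrite ltr0n.
pose f n x := u x * plateau n.+1%:R a b x.
have mf n : measurable_fun setT (f n).
  by have := measurable_test (t n) => ?; rewrite /f; meas.
have mI := measurable_inbox a b.
have cv x : f n x @[n --> \oo] --> u x * (inbox a b x)%:R.
  by apply: cvgM; [exact: cvg_cst|exact: plateau_cvg].
have ig : leb.-integrable setT (fun x => (`|u x| * (incube M x)%:R)%:E).
  apply: intbM; last exact: L2_incube.
  by apply: (L2_le _ hu) => [|x]; [meas|rewrite normr_id].
have hdom n x : `|f n x| <= `|u x| * (incube M x)%:R.
  rewrite normrM ler_wpM2l// ger0_norm ?plateau_ge0//.
  have [-> //|px] := eqVneq (plateau n.+1%:R a b x) 0.
  rewrite (_ : incube M x) ?plateau_le1//; apply/incubeP => i.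
  have /andP[h1 h2] := @plateau_neq0 R N n.+1%:R a b x (ltr0Sn _ _) px i.
  apply: (@le_trans _ _ (`|a i| + `|b i|)).
    rewrite ler_norml; have := ler_norm (b i); have := ler_norm (- a i); rewrite normrN.
    have := normr_ge0 (a i); have := normr_ge0 (b i); lra.
  by rewrite /M (bigD1 i)//= lerDl sumr_ge0// => j _; rewrite addr_ge0.
have mg : measurable_fun setT (fun x => u x * (inbox a b x)%:R) by meas.
have [_] := dct mf mg (aeW _ cv) ig hdom.
rewrite (_ : (fun n => _) = cst 0); last by apply/funext => n; exact: h0.
by move=> h; exact: (cvg_unique (@Rhausdorff R) h (cvg_cst 0)).
Qed.

(** Testing with plateaus shows that [u] has integral 0 over every open box; Dynkin's theorem
    extends this to all measurable subsets of a cube, on which [u] is integrable. *)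
Lemma fundamental_lemma u : L2 leb u ->
  (forall phi, test_function phi -> ip leb u phi = 0) -> {ae leb, forall x, u x = 0}.
Proof.
move=> hu h0; have [mu_ _] := hu.
have hbox a b := int_plateau_lim a b hu h0.
pose Q (r : R) : set E := box (fun i => `]- r, r[%classic).
have mQ r : measurable (Q r) by exact: measurable_box.
have patchQ a b : ((EFin \o u) \_ (box (fun i => `]a i, b i[%classic)))%E =
    (fun x => (u x * (inbox a b x)%:R)%:E).
  apply/funext => x; rewrite patchE; case: inboxP => [h|h]; first by rewrite mem_set//= mulr1.
  by rewrite memNset// mulr0.
have iI a b : intb leb (fun x => u x * (inbox a b x)%:R).
  apply: intbM => //; apply: (L2_le _ (L2_incube (\sum_i (`|a i| + `|b i|)))).
    by apply: mfb; exact: measurable_inbox.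
  move=> x; case: inboxP => [h|_]; last by rewrite normr0.
  rewrite (_ : incube _ x)//; apply/incubeP => i; have := h i.
  rewrite /= in_itv/= => /andP[h1 h2].
  apply: (@le_trans _ _ (`|a i| + `|b i|)).
    rewrite ler_norml; have := ler_norm (b i); have := ler_norm (- a i); rewrite normrN.
    have := normr_ge0 (a i); have := normr_ge0 (b i); lra.
  by rewrite (bigD1 i)//= lerDl sumr_ge0// => j _; rewrite addr_ge0.
have iQ r : leb.-integrable (Q r) (EFin \o u).
  by rewrite integrable_mkcond// patchQ; exact: iI.
have QI a b : (\int[leb]_(x in box (fun i => `]a i, b i[%classic)) (u x)%:E = 0)%E.
  rewrite integral_mkcond [X in integral _ _ X]patchQ.
  have := hbox a b; rewrite /Rintegral => e.
  by rewrite -(fineK (integrable_fin_num measurableT (iI a b))) /= e.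
(* Everything is intersected with a bounded cube, so that complements and disjoint unions can be
   handled by additivity of a finite integral. *)
have key r A : measurable A -> (\int[leb]_(x in A `&` Q r) (u x)%:E = 0)%E.
  move=> mA; rewrite measurable_oboxesE in mA.
  have iA B : measurable B -> leb.-integrable (B `&` Q r) (EFin \o u).
    by move=> mB; apply: (integrableS (mQ r)) => //; exact: measurableI.
  apply: (@dynkin_induction _ E oboxes
    (fun A => \int[leb]_(x in A `&` Q r) (u x)%:E = 0)%E measurable_oboxesE oboxesI) mA => //.
  - by rewrite setTI; exact: QI.
  - move=> _ [[a b] _ <-] /=.
    have [[c e] _ <-] : oboxes (box (fun i => `]a i, b i[%classic) `&` Q r).
      by apply: oboxesI; [exists (a, b)|exists (fun=> - r, fun=> r)].
    exact: QI.
  - move=> S mS hS.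
    have h : (\int[leb]_(x in (S `&` Q r) `|` (~` S `&` Q r)) (u x)%:E =
      \int[leb]_(x in S `&` Q r) (u x)%:E + \int[leb]_(x in ~` S `&` Q r) (u x)%:E)%E.
      apply: integral_setU => //.
      - exact: measurableI.
      - by apply: measurableI => //; exact: measurableC.
      - apply/measurable_EFinP; exact: measurable_funTS.
      - by apply/disj_setPS => x [[Sx _] []].
    rewrite -setIUl setUv setTI in h; rewrite [LHS]QI hS add0e in h.
    by rewrite -h.
  - move=> F mF tF hF; rewrite setI_bigcupl integral_bigcup//.
    + by apply: eseries0 => n _ _; exact: hF.
    + move=> i j _ _ [x [[Fi _] [Fj _]]]; apply: tF => //; exists x; split; [exact: Fi|exact: Fj].
    + by move=> k; exact: measurableI.
    + by rewrite -setI_bigcupl; apply: iA; exact: bigcup_measurable.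
have aeQ r : {ae leb, forall x, Q r x -> u x = 0}.
  have := @integral_ae_eq _ _ _ leb (Q r) (mQ r) (cst 0%E) (EFin \o u) (iQ r).
  move=> /(_ (measurable_cst _)) /(_ _)/wrap[].
    move=> A AQ mA; rewrite integral0 -(key r A mA); congr (integral _ _ _).
    by apply/seteqP; split => [x h|x []//]; split => //; exact: AQ.
  by apply: filterS => x h /h [].
have := @ae_foralln _ _ _ leb (fun n x => Q n%:R x -> u x = 0) (fun n => aeQ n%:R).
apply: filterS => x h; have [n _ hn] : (\bigcup_k cube k%:R) x by rewrite cube_cover.
apply: (h n.+1) => i; have := hn i; rewrite /= in_itv/= ler_norml => /andP[h1 h2].
have : (n%:R : R) < n.+1%:R by rewrite ltr_nat.
by move=> h'; apply/andP; split; lra.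
Qed.

End fundamental_lemma.

(** * Linear combinations and translates of test functions *)

Section test_closure.
Context {R : realType} {N : nat}.
Local Notation E := 'rV[R]_N.
Local Notation leb := (@lebesgue_rV R N).
Implicit Types (f g phi psi u v : E -> R) (x z : E).

Lemma cube_test phi M : smooth phi -> (forall x, phi x != 0 -> cube M x) -> test_function phi.
Proof.
move=> sm h; split => //.
have cM := @compact_cube R N M.
apply: subclosed_compact cM _; first exact: closed_closure.
rewrite closureE => x hx; apply: hx; split; last by move=> y; exact: h.
exact: compact_closed (@compact_cube R N M).
Qed.

Lemma iter_partial_lin a phi psi s : smooth phi -> smooth psi ->
  iter_partial s (fun x => a * phi x + psi x) =
  (fun x => a * iter_partial s phi x + iter_partial s psi x).
Proof.
move=> sp sq; elim: s => //= i s ->; apply/funext => x.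
have [_ /(_ i x) d1] := sp s; have [_ /(_ i x) d2] := sq s.
have d1' : is_derive x (delta_mx ord0 i) (fun x => a * iter_partial s phi x) (a * partial i (iter_partial s phi) x).
  have h1 : is_derive x (delta_mx ord0 i) (iter_partial s phi) (partial i (iter_partial s phi) x) by [].
  by have := is_deriveZ a h1.
have d2' : is_derive x (delta_mx ord0 i) (iter_partial s psi) (partial i (iter_partial s psi) x) by [].
by have [_] := is_deriveD d1' d2'.
Qed.

Lemma smooth_lin a phi psi : smooth phi -> smooth psi -> smooth (fun x => a * phi x + psi x).
Proof.
move=> sp sq s; rewrite iter_partial_lin//.
have [c1 d1] := sp s; have [c2 d2] := sq s; split.
  move=> x; exact: (cvgD (cvgM (cvg_cst a) (c1 x)) (c2 x)).
move=> i x.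
have h1 : is_derive x (delta_mx ord0 i) (iter_partial s phi) (partial i (iter_partial s phi) x) by [].
have d1' := is_deriveZ a h1.
have d2' : is_derive x (delta_mx ord0 i) (iter_partial s psi) (partial i (iter_partial s psi) x) by [].
by have [] := is_deriveD d1' d2'.
Qed.

Lemma test_lin a phi psi : test_function phi -> test_function psi ->
  test_function (fun x => a * phi x + psi x).
Proof.
move=> tp tq; have [M1 M10 h1] := test_support tp; have [M2 M20 h2] := test_support tq.
apply: (@cube_test _ (Num.max M1 M2)); first by apply: smooth_lin; [case: tp|case: tq].
move=> x; have [->|px _] := eqVneq (phi x) 0.
  by rewrite mulr0 add0r => /h2 h i; rewrite le_max h orbT.
by move=> i; rewrite le_max (h1 _ px).
Qed.

Lemma test0 : test_function (cst 0 : E -> R).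
Proof.
apply: (@esm_test _ _ _ 1); first exact: esm_cst.
by move=> x; rewrite eqxx.
Qed.

Lemma shift_quotient f c x (v : E) :
  (fun h : R => h^-1 *: (((fun y => f (y + c)) \o shift x) (h *: v) - f (x + c))) =
  (fun h : R => h^-1 *: ((f \o shift (x + c)) (h *: v) - f (x + c))).
Proof. by apply/funext => h /=; rewrite addrA. Qed.

Lemma partial_shift i phi c : partial i (fun y => phi (y + c)) = (fun x => partial i phi (x + c)).
Proof. by apply/funext => x; rewrite /partial /derive shift_quotient. Qed.

Lemma iter_partial_shift s phi c :
  iter_partial s (fun y => phi (y + c)) = (fun x => iter_partial s phi (x + c)).
Proof. by elim: s => //= i s ->; exact: partial_shift. Qed.

Lemma test_shift phi c : test_function phi -> test_function (fun x => phi (x + c)).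
Proof.
move=> tp; have [M M0 hM] := test_support tp; have [sp _] := tp.
apply: (@cube_test _ (M + l1norm c)).
  move=> s; rewrite iter_partial_shift; have [c1 d1] := sp s; split.
    move=> x; apply: (@continuous_comp _ _ _ (fun x : E => x + c) (iter_partial s phi)); last exact: c1.
    exact: (cvgD cvg_id (cvg_cst c)).
  by move=> i x; have := d1 i (x + c); rewrite /derivable shift_quotient.
move=> x /hM h i; have := h i; rewrite mxE => hi.
have hc : `|c ord0 i| <= l1norm c by rewrite /l1norm (bigD1 i)//= lerDl sumr_ge0.
have : `|x ord0 i| <= `|x ord0 i + c ord0 i| + `|c ord0 i|.
  by rewrite -{1}(addrK (c ord0 i) (x ord0 i)); exact: ler_normB.
lra.
Qed.

Lemma measurable_shift u z : measurable_fun setT u -> measurable_fun setT (fun x => u (x + z)).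
Proof. by move=> mu_; exact: (mpres_measurable (mpres_add z)). Qed.

Lemma L2_mpres T u : mpres T -> L2 leb u -> L2 leb (fun x => u (T x)).
Proof.
move=> hT [mu_ h]; split; first exact: mpres_measurable.
have m2 : measurable_fun setT (fun x => u x ^+ 2) by meas.
by rewrite (mpres_nnint hT m2)// => x; exact: sqr_ge0.
Qed.

Lemma L2_shift u z : L2 leb u -> L2 leb (fun x => u (x + z)).
Proof. exact: (L2_mpres (mpres_add z)). Qed.

Lemma n2_shift u z : L2 leb u -> n2 leb (fun x => u (x + z)) = n2 leb u.
Proof.
move=> [mu_ _]; rewrite /n2 /ip.
have m2 : measurable_fun setT (fun x => u x * u x) by meas.
exact: (mpres_int (mpres_add z) m2).
Qed.

Lemma ip_shift u v z : L2 leb u -> L2 leb v ->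
  ip leb (fun x => u (x + z)) v = ip leb u (fun x => v (x - z)).
Proof.
move=> [mu_ _] [mv _]; rewrite /ip.
have mv' : measurable_fun setT (fun x => v (x - z)) by exact: measurable_shift.
have m2 : measurable_fun setT (fun x => u x * v (x - z)) by meas.
have := mpres_int (mpres_add z) m2 => <-.
by apply: eq_Rintegral => x _; rewrite addrK.
Qed.

End test_closure.

(** * Riesz representation tested on smooth functions *)

Section riesz_test.
Context {R : realType} {N : nat} {K : nat}.
Local Notation E := 'rV[R]_N.
Local Notation leb := (@lebesgue_rV R N).
Local Notation V := ('I_K -> E -> R).

(** A functional on tuples of test functions whose squared norm is at most [c], encoded without
    square roots as [2 * l F <= c + |F|^2], is represented by L^2 functions. Minimisation takes
    place in the incomplete space of test functions and only the limit leaves it. *)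
Lemma riesz_test (l : V -> R) (c : R) :
  (forall (a : R) (F G : V), (forall i, test_function (F i)) -> (forall i, test_function (G i)) ->
    l (fun i x => a * F i x + G i x) = a * l F + l G) ->
  (forall F : V, (forall i, test_function (F i)) -> 2 * l F <= c + \sum_i n2 leb (F i)) ->
  exists g : V, [/\ forall i, L2 leb (g i), \sum_i n2 leb (g i) <= c &
    forall F : V, (forall i, test_function (F i)) -> \sum_i ip leb (g i) (F i) = l F].
Proof.
move=> ll lc; pose S : set V := [set F | forall i, test_function (F i)].
pose b (F G : V) := \sum_i ip leb (F i) (G i).
have linE (a : R) (F G : V) : a *: F + G = (fun i x => a * F i x + G i x) by [].
have SL F i : S F -> L2 leb (F i) by move=> SF; apply: test_L2; exact: SF.
have S0 : S 0 by move=> i; exact: test0.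
have SD (a : R) x y : S x -> S y -> S (a *: x + y).
  by move=> Sx Sy i; apply: test_lin; [exact: Sx|exact: Sy].
have bl (a : R) x y z : S x -> S y -> S z -> b (a *: x + y) z = a * b x z + b y z.
  move=> Sx Sy Sz; rewrite /b mulr_sumr -big_split; apply: eq_bigr => i _ /=.
  by rewrite -ipZl ?ipDl//; try exact: SL; apply: L2Z; exact: SL.
have [|||||X [SX Xc Xl]] := @riesz_minimising_sequence R V S b l c S0 SD.
- by move=> x y Sx Sy; apply: eq_bigr => i _; exact: ipC.
- exact: bl.
- by move=> x Sx; apply: sumr_ge0 => i _; exact: n2_ge0.
- by move=> a x y Sx Sy; exact: ll.
- by move=> x Sx; exact: lc.
have hX i n m : (n <= m)%N -> (nnint leb (fun x => (true%:R * (X n i x - X m i x) ^+ 2)%R) <= (16^-1 ^+ n)%:E)%E.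
  move=> nm.
  have hL : L2 leb (fun x => X n i x - X m i x) by apply: L2B; exact: SL.
  rewrite (eq_nnint _ (fun x => mul1r _)) n2E// lee_fin.
  apply: le_trans (Xc _ _ nm); rewrite /b (bigD1 i)//= lerDl.
  by apply: sumr_ge0 => j _; exact: n2_ge0.
have hg i : exists g : E -> R, [/\ measurable_fun setT g,
    {ae leb, forall x, X n i x @[n --> \oo] --> g x} &
    forall n, (nnint leb (fun x => (true%:R * (X n i x - g x) ^+ 2)%R) <= (16^-1 ^+ n)%:E)%E].
  apply: (@riesz_fischer _ _ _ leb (fun _ _ => true) (fun n => X n i)) => //.
  - by move=> n; have [] := SL _ i (SX n).
  - by move=> n m nm; exact: hX.
have [g gP] := choice hg.
have Ld n i : L2 leb (fun x => X n i x - g i x).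
  have [mg _ /(_ n) h] := gP i; have [mX _] := SL _ i (SX n).
  split; first by meas.
  apply: le_lt_trans (fine_le_lty h); apply: nnint_le; [by meas|by meas|by move=> x; exact: sqr_ge0|].
  by move=> x; rewrite mul1r.
have nd n i : n2 leb (fun x => X n i x - g i x) <= 16^-1 ^+ n.
  rewrite -lee_fin -n2E//; have [_ _ /(_ n)] := gP i; apply: le_trans.
  by rewrite (eq_nnint _ (fun x => mul1r _)).
have Lg i : L2 leb (g i).
  rewrite (_ : g i = fun x => X 0%N i x - (X 0%N i x - g i x)); first by apply: L2B => //; exact: SL.
  by apply/funext => x; rewrite opprB addrCA subrr addr0.
have gl F : S F -> \sum_i ip leb (g i) (F i) = l F.
  move=> SF; have e0 : `|\sum_i ip leb (g i) (F i) - l F| <= 0.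
    apply: (@le_of_geometric _ _ (K%:R + b F F + (b F F + 1)) 4^-1); first by apply/andP; split; lra.
    move=> n; have hn := Xl n F SF.
    have h1 : `|\sum_i ip leb (X n i) (F i) - \sum_i ip leb (g i) (F i)| <= (K%:R + b F F) * 4^-1 ^+ n.
      rewrite -sumrB; apply: le_trans (ler_norm_sum _ _ _) _.
      apply: (@le_trans _ _ (\sum_(i < K) 4^-1 ^+ n * (1 + n2 leb (F i)))); last first.
        by rewrite -mulr_sumr big_split/= sumr_const card_ord mulrC.
      apply: ler_sum => i _; rewrite -ipBl//; try exact: SL.
      have r0 : (0 : R) < 4^-1 ^+ n by rewrite exprn_gt0// invr_gt0.
      have LF := SL F i SF.
      (* Young's inequality with weight 4^n turns the squared error 16^-n into a bound of order 4^-n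
         on the pairing. *)
      have hy := ip_young (l := (4^-1 ^+ n)^-1) _ (Ld n i) LF.
      have hz := ip_young (l := (4^-1 ^+ n)^-1) _ (Ld n i) (L2N LF).
      rewrite invr_gt0 invrK in hy hz; have := hy r0; have := hz r0.
      rewrite n2N [ip leb _ (fun x => - F i x)]ipC (_ : (fun x => - F i x) = fun x => -1 * F i x); last by apply/funext => x; rewrite mulN1r.
      rewrite ipZl// [ip leb (F i) _]ipC.
      have := nd n i; set D := n2 _ _; set P := ip _ _ _; set Q := n2 _ _.
      have -> : (16^-1 : R) ^+ n = 4^-1 ^+ n * 4^-1 ^+ n by rewrite -exprMn; congr (_ ^+ _); field.
      set r := 4^-1 ^+ n in r0 *; move=> hD; have : r^-1 * D <= r.
        by rewrite -(ler_pM2l r0) mulrA divff ?gt_eqF// mul1r.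
      have Q0 : 0 <= Q by exact: n2_ge0.
      have := mulr_ge0 (ltW r0) Q0.
      by rewrite ler_norml mulN1r; move=> *; apply/andP; split; nra.
    have h2 : `|b (X n) F - l F| <= (b F F + 1) * 4^-1 ^+ n.
      have bF0 : 0 <= b F F by apply: sumr_ge0 => i _; exact: n2_ge0.
      have r0 : (0 : R) < 4^-1 ^+ n by rewrite exprn_gt0// invr_gt0.
      have cr : 0 <= (b F F + 1) * 4^-1 ^+ n by apply: mulr_ge0; [lra|exact: ltW].
      rewrite -ler_sqr ?nnegrE//.
      rewrite real_normK ?num_real//; apply: le_trans hn _.
      have -> : (16^-1 : R) ^+ n = 4^-1 ^+ n * 4^-1 ^+ n by rewrite -exprMn; congr (_ ^+ _); field.
      rewrite exprMn mulrC -expr2 ler_wpM2r ?sqr_ge0// expr2 ler_peMr//; lra.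
    rewrite mulrDl; apply: le_trans (lerD h1 h2).
    rewrite -/(b (X n) F) (distrC (b (X n) F)); apply: le_trans (ler_normD _ _).
    by rewrite subrKA.
  by apply/eqP; rewrite -subr_eq0 -normr_le0.
exists g; split => //.
rewrite -subr_le0; apply: (@le_of_geometric _ _ K%:R 16^-1); first by apply/andP; split; lra.
(* The norm bound comes from the hypothesis at the minimising tuple itself, through |g|^2 = 2 (g, X)
   - |X|^2 + |X - g|^2. *)
move=> n; have h := lc _ (SX n); rewrite -gl// in h.
have : \sum_i n2 leb (fun x => X n i x - g i x) <= K%:R * 16^-1 ^+ n.
  apply: (@le_trans _ _ (\sum_(i < K) (16^-1 : R) ^+ n)); first exact: ler_sum.
  by rewrite sumr_const card_ord mulr_natl.
have -> : \sum_i n2 leb (fun x => X n i x - g i x) =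
   \sum_i n2 leb (X n i) + \sum_i n2 leb (g i) - 2 * \sum_i ip leb (g i) (X n i).
  rewrite mulr_sumr -big_split -sumrB; apply: eq_bigr => i _ /=.
  by rewrite n2B//; [rewrite [ip leb (g i) _]ipC|exact: SL].
lra.
Qed.

End riesz_test.

(** * Weak gradients *)

Section weak_gradient.
Context {R : realType} {N : nat}.
Local Notation E := 'rV[R]_N.
Local Notation leb := (@lebesgue_rV R N).
Implicit Types (f phi psi u v : E -> R) (x z : E) (g : 'I_N -> E -> R) (e : R).

Definition wgrad u g := forall i, L2 leb (g i) /\ weak_partial i u (g i).

Lemma weak_partial_ip i u f : weak_partial i u f <->
  forall phi, test_function phi -> ip leb u (partial i phi) = - ip leb f phi.
Proof. by []. Qed.

Lemma H1P u : H1 u <-> L2 leb u /\ exists g, wgrad u g.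
Proof.
split=> [[/LfunP2 hu h]|[hu [g hg]]].
  split => //; have [g hg] : {g : 'I_N -> E -> R | forall i, L2 leb (g i) /\ weak_partial i u (g i)}.
    apply: cid; have ex i : exists f, L2 leb f /\ weak_partial i u f.
      by have [f /LfunP2 hf hw] := h i; exists f.
    by have [g hg] := choice ex; exists g.
  by exists g.
split; first exact/LfunP2.
by move=> i; have [h1 h2] := hg i; exists (g i) => //; exact/LfunP2.
Qed.

Lemma weak_unique i u f1 f2 : L2 leb f1 -> L2 leb f2 -> weak_partial i u f1 ->
  weak_partial i u f2 -> {ae leb, forall x, f1 x = f2 x}.
Proof.
move=> h1 h2 /weak_partial_ip w1 /weak_partial_ip w2.
have : {ae leb, forall x, f1 x - f2 x = 0}.
  apply: fundamental_lemma; first exact: L2B.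
  move=> phi tp; rewrite ipBl//; last exact: test_L2.
  by have := w1 _ tp; rewrite w2// => /oppr_inj ->; rewrite subrr.
by apply: filterS => x /eqP; rewrite subr_eq0 => /eqP.
Qed.

Definition gradc u i x : R := grad u x ord0 i.

Lemma gradP u : H1 u -> wgrad u (gradc u).
Proof.
move=> /H1P[hu [g hg]] i.
have : gradc u i = xget (cst 0) [set f | f \in Lfun leb 2%:E /\ weak_partial i u f].
  by apply/funext => x; rewrite /gradc /grad mxE.
move=> ->; have [h1 h2] := hg i.
have := @xgetPex _ (cst 0) [set f | f \in Lfun leb 2%:E /\ weak_partial i u f].
move=> /(_ _)/wrap[]; first by exists (g i); split => //; exact/LfunP2.
by move=> [/LfunP2].
Qed.

Definition dirichlet u : R := \sum_i n2 leb (gradc u i).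

Lemma n2_ae f1 f2 : measurable_fun setT f1 -> measurable_fun setT f2 ->
  {ae leb, forall x, f1 x = f2 x} -> n2 leb f1 = n2 leb f2.
Proof.
move=> m1 m2 h; apply: Rint_ae_eq; [by meas|by meas|].
by apply: filterS h => x ->.
Qed.

Lemma wgrad_gradc u g : H1 u -> wgrad u g -> forall i, {ae leb, forall x, gradc u i x = g i x}.
Proof.
move=> hu hg i; have [h1 h2] := hg i; have [h3 h4] := gradP hu i.
exact: (weak_unique h3 h1 h4 h2).
Qed.

Lemma dirichletE u g : H1 u -> wgrad u g -> dirichlet u = \sum_i n2 leb (g i).
Proof.
move=> hu hg; apply: eq_bigr => i _; apply: n2_ae; last exact: wgrad_gradc.
- by have [[]] := gradP hu i.
- by have [[]] := hg i.
Qed.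

Lemma dirichlet_ge0 u : 0 <= dirichlet u.
Proof. by apply: sumr_ge0 => i _; exact: n2_ge0. Qed.

Lemma sum_telescope (F : nat -> R) (c : R) n : (forall k, (k < n)%N -> F k.+1 - F k <= c) ->
  F n - F 0%N <= n%:R * c.
Proof.
elim: n => [|n IH] h; first by rewrite subrr mul0r.
have h1 := IH (fun k kn => h k (ltnW kn)); have h2 := h n (ltnSn n).
by rewrite -natr1 mulrDl mul1r; lra.
Qed.

Lemma le_of_inv_bound (a c : R) (n0 : nat) :
  (forall n, (n0 <= n)%N -> a <= c / n.+1%:R) -> a <= 0.
Proof.
move=> h; rewrite leNgt; apply/negP => a0.
pose n := maxn n0 (Num.bound (`|c| / a)).
have := h n (leq_maxl _ _); rewrite ler_pdivlMr ?ltr0n//.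
have hb : `|c| / a < n.+1%:R.
  apply: (lt_le_trans (archi_boundP _)); first by rewrite divr_ge0// ltW.
  by rewrite ler_nat ltnW// ltnS leq_maxr.
rewrite ltr_pdivrMr// in hb; have := ler_norm c; rewrite mulrC; lra.
Qed.

Lemma l1normZ (a : R) z : l1norm (a *: z) = `|a| * l1norm z.
Proof. by rewrite /l1norm mulr_sumr; apply: eq_bigr => i _; rewrite mxE normrM. Qed.

Lemma l1normN z : l1norm (- z) = l1norm z.
Proof. by apply: eq_bigr => i _; rewrite mxE normrN. Qed.

Definition dirg g z x : R := \sum_i z ord0 i * g i x.

Lemma L2_dirg g z : (forall i, L2 leb (g i)) -> L2 leb (dirg g z).
Proof. by move=> hg; apply: L2_sum => i; exact: L2Z. Qed.

Lemma n2_dirg g z : (forall i, L2 leb (g i)) ->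
  n2 leb (dirg g z) = \sum_i \sum_j ip leb (g i) (g j) * (z ord0 i * z ord0 j).
Proof.
move=> hg; have hd := L2_dirg z hg; rewrite /n2 {1}/dirg ip_suml//; last by move=> i; exact: L2Z.
apply: eq_bigr => i _; rewrite ipZl// ipC {1}/dirg ip_suml//; last by move=> j; exact: L2Z.
by rewrite mulr_sumr; apply: eq_bigr => j _; rewrite ipZl// ipC; ring.
Qed.

Lemma ip_dirg g z phi : (forall i, L2 leb (g i)) -> L2 leb phi ->
  ip leb (dirg g z) phi = \sum_i z ord0 i * ip leb (g i) phi.
Proof.
move=> hg hp; rewrite /dirg ip_suml//; last by move=> i; exact: L2Z.
by apply: eq_bigr => i _; rewrite ipZl.
Qed.

(** The Taylor remainder has L^2 norm of order |z|^2; Young's inequality with weight |z|^2 makes the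
    error depend on [u] only through [n2 u], hence uniformly over its translates. *)
Lemma test_expansion phi : test_function phi -> exists2 C : R, 0 <= C &
  forall u z, L2 leb u -> 0 < l1norm z <= 1 ->
  `|ip leb u (fun x => phi (x + z) - phi x) - \sum_i z ord0 i * ip leb u (partial i phi)|
    <= C * (n2 leb u + 1) * l1norm z ^+ 2.
Proof.
move=> tp; have [C [M [C0 M0 hT]]] := test_taylor tp.
pose I2 := n2 leb (fun x => (incube M x)%:R : R).
have I20 : 0 <= I2 by exact: n2_ge0.
exists (1 + C ^+ 2 * I2); first by rewrite addr_ge0// mulr_ge0// sqr_ge0.
move=> u z hu /andP[z0 z1].
pose r x := phi (x + z) - phi x - \sum_i z ord0 i * partial i phi x.
have Lp : L2 leb phi by exact: test_L2.
have Ld i : L2 leb (partial i phi) by apply: test_L2; exact: test_partial.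
have Lz : L2 leb (fun x => phi (x + z) - phi x) by apply: L2B => //; exact: L2_shift.
have Ls : L2 leb (fun x => \sum_i z ord0 i * partial i phi x) by exact: (L2_dirg z Ld).
have Lr : L2 leb r by exact: L2B.
have -> : ip leb u (fun x => phi (x + z) - phi x) - \sum_i z ord0 i * ip leb u (partial i phi) = ip leb u r.
  rewrite [RHS]ipC ipBl// [ip leb _ u]ipC; congr (_ - _).
  rewrite [RHS](_ : _ = ip leb (dirg (fun i => partial i phi) z) u)// ip_dirg//.
  by apply: eq_bigr => i _; rewrite ipC.
set a := l1norm z in z0 z1 *.
have a20 : 0 < a ^+ 2 by rewrite exprn_gt0.
have nr : n2 leb r <= (C * a ^+ 2) ^+ 2 * I2.
  rewrite -n2Z; last exact: L2_incube.
  apply: n2_le => //; first by apply: L2Z; exact: L2_incube.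
  by move=> x; rewrite [leRHS]ger0_norm ?hT// !mulr_ge0// ltW.
have y1 := ip_young (l := a ^+ 2) a20 hu Lr.
have y2 := ip_young (l := a ^+ 2) a20 hu (L2N Lr).
rewrite n2N [ip leb u (fun x => - r x)]ipC (_ : (fun x => - r x) = fun x => -1 * r x) in y2; last by apply/funext => x; rewrite mulN1r.
rewrite ipZl// [ip leb r u]ipC mulN1r in y2.
have hb : (a ^+ 2)^-1 * n2 leb r <= C ^+ 2 * I2 * a ^+ 2.
  rewrite -(ler_pM2l a20) mulrA divff ?gt_eqF// mul1r; apply: le_trans nr _.
  by rewrite le_eqVlt; apply/orP; left; apply/eqP; ring.
have nu0 := n2_ge0 leb u.
have h1 : 0 <= a ^+ 2 * n2 leb u by rewrite mulr_ge0// ltW.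
have ci0 : 0 <= C ^+ 2 * I2 by apply: mulr_ge0 => //; exact: sqr_ge0.
have h2 : 0 <= C ^+ 2 * I2 * a ^+ 2 by apply: mulr_ge0 => //; exact: ltW.
have h3 : 0 <= C ^+ 2 * I2 * n2 leb u * a ^+ 2.
  by apply: mulr_ge0; [exact: mulr_ge0|exact: ltW].
have -> : (1 + C ^+ 2 * I2) * (n2 leb u + 1) * a ^+ 2 =
  a ^+ 2 * n2 leb u + a ^+ 2 + C ^+ 2 * I2 * n2 leb u * a ^+ 2 + C ^+ 2 * I2 * a ^+ 2 by ring.
by rewrite ler_norml; apply/andP; split; lra.
Qed.

(** Along the segment from 0 to [z] the pairing of the translate of [u] with [phi] has derivative
    equal to the pairing of the directional derivative with a translate of [phi]. This is bounded
    uniformly by Young's inequality, and a subdivision replaces integration of the derivative. *)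
Lemma ip_translate_le u g z phi : L2 leb u -> wgrad u g -> test_function phi ->
  ip leb (fun x => u (x + z) - u x) phi <= (n2 leb (dirg g z) + n2 leb phi) / 2.
Proof.
move=> hu hg tp; have Lg i : L2 leb (g i) by have [] := hg i.
have Lp := test_L2 tp.
set ka := (X in _ <= X).
have ka0 : 0 <= ka by rewrite /ka divr_ge0// addr_ge0// n2_ge0.
have [l0|zn0] := eqVneq (l1norm z) 0.
  have z0 : z = 0.
    apply/rowP => i; rewrite mxE; apply/eqP; rewrite -normr_le0 -l0 /l1norm (bigD1 i)//= lerDl.
    exact: sumr_ge0.
  rewrite (_ : ip _ _ _ = 0)// /ip /Rintegral integral0_eq// => x _.
  by rewrite z0 addr0 subrr mul0r.
have lz0 : 0 < l1norm z by rewrite lt_neqAle eq_sym zn0 l1norm_ge0.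
have [C C0 hC] := test_expansion tp.
pose us (s : R) x := u (x + s *: z).
have Lus s : L2 leb (us s) by exact: L2_shift.
pose F s := ip leb (us s) phi.
(* One subdivision step: first order term at most [h * ka], error quadratic in [h]. *)
have stepF s h : 0 < h -> h * l1norm z <= 1 ->
   F (s + h) - F s <= h * ka + C * (n2 leb u + 1) * (h * l1norm z) ^+ 2.
  move=> h0 hz1.
  have e1 : F (s + h) = ip leb (us s) (fun x => phi (x + (- (h *: z)))).
    rewrite /F -ip_shift//; congr (ip _ _ _); apply/funext => x.
    by rewrite /us -addrA -scalerDl [h + s]addrC.
  have e2 : F (s + h) - F s = ip leb (us s) (fun x => phi (x + (- (h *: z))) - phi x).
    rewrite e1 /F ipC [ip leb (us s) phi]ipC -ipBl//; first by rewrite ipC.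
    exact: L2_shift.
  rewrite e2.
  have := hC (us s) (- (h *: z)) (Lus s); rewrite l1normN l1normZ (ger0_norm (ltW h0)).
  rewrite n2_shift// => /(_ _)/wrap[]; first by rewrite hz1 mulr_gt0.
  have -> : \sum_i (- (h *: z)) ord0 i * ip leb (us s) (partial i phi) =
     h * ip leb (dirg g z) (fun x => phi (x - s *: z)).
    rewrite ip_dirg//; last by apply: L2_shift.
    rewrite mulr_sumr; apply: eq_bigr => i _.
    have ts : test_function (fun x => phi (x - s *: z)) by exact: test_shift.
    have [_ /weak_partial_ip w] := hg i; have := w _ ts; rewrite partial_shift => hw.
    rewrite !mxE ip_shift//; last by apply: test_L2; exact: test_partial.
    by rewrite hw; ring.
  rewrite ler_norml => /andP[_].
  have hy := ip_young ltr01 (L2_dirg z Lg) (L2_shift (- (s *: z)) Lp).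
  rewrite n2_shift// invr1 !mul1r in hy.
  have : h * (2 * ip leb (dirg g z) (fun x => phi (x - s *: z))) <= h * (n2 leb (dirg g z) + n2 leb phi).
    by rewrite ler_pM2l.
  rewrite /ka; lra.
have e0 : ip leb (fun x => u (x + z) - u x) phi = F 1 - F 0.
  rewrite ipBl//; last exact: L2_shift.
  have u1 : us 1 = (fun x => u (x + z)) by apply/funext => x; rewrite /us scale1r.
  have u0 : us 0 = u by apply/funext => x; rewrite /us scale0r addr0.
  by rewrite /F u1 u0.
rewrite -subr_le0 e0.
(* With n + 1 equal steps the quadratic errors add up to O(1/(n+1)); the threshold on n makes every
   step of length at most 1. *)
apply: (@le_of_inv_bound _ (C * (n2 leb u + 1) * l1norm z ^+ 2) (Num.bound (l1norm z))) => n hn.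
have n0 : (0 : R) < n.+1%:R by rewrite ltr0n.
pose h : R := n.+1%:R^-1.
have h0 : 0 < h by rewrite invr_gt0.
have hz1 : h * l1norm z <= 1.
  rewrite mulrC ler_pdivrMr// mul1r; apply: (le_trans (ltW (archi_boundP (l1norm_ge0 z)))).
  by rewrite ler_nat (leq_trans hn).
have := @sum_telescope (fun k => F (k%:R * h)) (h * ka + C * (n2 leb u + 1) * (h * l1norm z) ^+ 2) n.+1 _.
move=> /(_ _)/wrap[].
  by move=> k _; rewrite -natr1 mulrDl mul1r; exact: stepF.
rewrite /= mul0r /h divff ?gt_eqF// mulrDr mulrA divff ?gt_eqF// mul1r.
have -> : n.+1%:R * (C * (n2 leb u + 1) * (n.+1%:R^-1 * l1norm z) ^+ 2) =
  C * (n2 leb u + 1) * l1norm z ^+ 2 / n.+1%:R.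
  by field; rewrite gt_eqF.
move=> hh; rewrite lerBlDl; exact: hh.
Qed.

(* By duality against test functions. *)
Lemma n2_translate_le u g z : L2 leb u -> wgrad u g ->
  n2 leb (fun x => u (x + z) - u x) <= n2 leb (dirg g z).
Proof.
move=> hu hg; have Lg i : L2 leb (g i) by have [] := hg i.
have Lw : L2 leb (fun x => u (x + z) - u x) by apply: L2B => //; exact: L2_shift.
have [||h [Lh nh hh]] := @riesz_test R N 1 (fun F => ip leb (fun x => u (x + z) - u x) (F ord0)) (n2 leb (dirg g z)).
- move=> a F G tF tG; have LF := test_L2 (tF ord0); have LG := test_L2 (tG ord0).
  by rewrite ipC ipDl//; [rewrite ipZl// ipC [ip leb (G ord0) _]ipC|exact: L2Z].
- move=> F tF; rewrite big_ord1; have := @ip_translate_le u g z _ hu hg (tF ord0); lra.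
rewrite big_ord1 in nh; apply: le_trans nh; rewrite le_eqVlt; apply/orP; left; apply/eqP.
have : {ae leb, forall x, u (x + z) - u x - h ord0 x = 0}.
  apply: fundamental_lemma; first exact: L2B.
  move=> phi tp; rewrite ipBl//; last exact: test_L2.
  by have := hh (fun=> phi) (fun=> tp); rewrite big_ord1 => ->; rewrite subrr.
move=> hae; apply: n2_ae; [by have [] := Lw|by have [] := Lh ord0|].
by apply: filterS hae => x /eqP; rewrite subr_eq0 => /eqP.
Qed.

End weak_gradient.

(** * Nonlocal approximation of the Dirichlet energy *)

Section nonlocal_energy.
Context {R : realType} {N : nat}.
Local Notation E := 'rV[R]_N.
Local Notation leb := (@lebesgue_rV R N).
Implicit Types (f phi psi u v : E -> R) (x z : E) (g : 'I_N -> E -> R) (e : R).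

Definition ball_ind e z : R := (enorm z < e)%R%:R.

Lemma ball_ind_ge0 e z : 0 <= ball_ind e z. Proof. exact: ler0n. Qed.

Lemma measurable_ball_ind e : measurable_fun setT (ball_ind e).
Proof. by have h := @measurable_enorm R N; rewrite /ball_ind; meas. Qed.

Lemma ball_ind_signed_perm e (pi : {perm 'I_N}) (s : E) z : (forall i, s ord0 i ^+ 2 = 1) ->
  ball_ind e (signed_perm pi s 0 z) = ball_ind e z.
Proof.
move=> s1; rewrite /ball_ind !enormE (_ : sqn (signed_perm pi s 0 z) = sqn z)//.
rewrite /sqn [RHS](reindex_inj (@perm_inj _ pi))/=; apply: eq_bigr => i _.
by rewrite !mxE addr0 exprMn s1 mul1r.
Qed.

Definition ball_moment e (i j : 'I_N) : R := \int[leb]_z (ball_ind e z * (z ord0 i * z ord0 j)).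

Lemma intb_ball_moment e i j : intb leb (fun z => ball_ind e z * (z ord0 i * z ord0 j)).
Proof.
have hb := measurable_ball_ind e.
apply: (@intb_le _ _ _ _ _ (fun z => e ^+ 2 * (incube e z)%:R)); first by meas.
  by apply: intbZ; exact: intb_incube.
move=> z; rewrite /ball_ind; case: ltP => h; last by rewrite mul0r normr0 mulr_ge0// sqr_ge0.
have hc i' : `|z ord0 i'| <= e by apply: ltW; apply: le_lt_trans h; exact: coord_le_enorm.
rewrite (_ : incube e z) ?mul1r ?mulr1 ?normrM ?expr2; last by apply/incubeP => i'; exact: hc.
by rewrite ler_pM.
Qed.

Lemma ball_moment_off e i j : i != j -> ball_moment e i j = 0.
Proof.
move=> ij; pose s : E := \row_k (if k == i then -1 else 1).
have s1 k : s ord0 k ^+ 2 = 1 by rewrite mxE; case: ifP => _; rewrite ?sqrrN expr1n.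
have hb := measurable_ball_ind e.
have mf : measurable_fun setT (fun z : E => ball_ind e z * (z ord0 i * z ord0 j)) by meas.
have := mpres_int (mpres_signed_perm 1%g 0 s1) mf.
rewrite (_ : (fun x => _) = (fun z => (-1) * (ball_ind e z * (z ord0 i * z ord0 j)))); last first.
  apply/funext => z; rewrite ball_ind_signed_perm// !mxE !perm1 eqxx eq_sym (negbTE ij); ring.
rewrite RintZ; last exact: intb_ball_moment.
rewrite -/(ball_moment e i j); lra.
Qed.

Lemma ball_moment_diag e i j : ball_moment e i i = ball_moment e j j.
Proof.
have s1 (k : 'I_N) : (const_mx 1 : E) ord0 k ^+ 2 = 1 by rewrite mxE expr1n.
have hb := measurable_ball_ind e.
have mf : measurable_fun setT (fun z : E => ball_ind e z * (z ord0 i * z ord0 i)) by meas.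
rewrite /ball_moment -(mpres_int (mpres_signed_perm (tperm i j) 0 s1) mf).
apply: eq_Rintegral => z _; rewrite ball_ind_signed_perm// !mxE tpermL; ring.
Qed.

(** The common value of the integrals of z_i^2 over the ball, written as an average so that no
    coordinate has to be singled out. *)
Definition moment e : R := N%:R^-1 * \sum_i ball_moment e i i.

Lemma ball_momentE e i : ball_moment e i i = moment e.
Proof.
rewrite /moment (eq_bigr (fun=> ball_moment e i i)); last by move=> j _; exact: ball_moment_diag.
rewrite sumr_const card_ord -[ball_moment e i i *+ _]mulr_natl mulrA mulVf ?mul1r// pnatr_eq0 -lt0n.
exact: leq_ltn_trans (ltn_ord i).
Qed.

Lemma intb_quad e (c : 'I_N -> 'I_N -> R) :
  intb leb (fun z => ball_ind e z * \sum_i \sum_j c i j * (z ord0 i * z ord0 j)).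
Proof.
under eq_fun do rewrite mulr_sumr.
apply: intb_sum => i; under eq_fun do rewrite mulr_sumr.
apply: intb_sum => j; under eq_fun do rewrite mulrCA.
by apply: intbZ; exact: intb_ball_moment.
Qed.

(** Sign changes kill the off-diagonal moments and exchanges of coordinates equate the diagonal
    ones, so averaging a quadratic form extracts its trace. This is how squared directional
    differences produce the Dirichlet energy. *)
Lemma Rint_quad e (c : 'I_N -> 'I_N -> R) :
  \int[leb]_z (ball_ind e z * \sum_i \sum_j c i j * (z ord0 i * z ord0 j)) = moment e * \sum_i c i i.
Proof.
under eq_Rintegral do rewrite mulr_sumr.
have ib i j : intb leb (fun z => ball_ind e z * (c i j * (z ord0 i * z ord0 j))).
  by under eq_fun do rewrite mulrCA; apply: intbZ; exact: intb_ball_moment.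
rewrite Rint_sum; last first.
  by move=> i; under eq_fun do rewrite mulr_sumr; exact: intb_sum.
rewrite mulr_sumr; apply: eq_bigr => i _.
under eq_Rintegral do rewrite mulr_sumr.
rewrite Rint_sum// (bigD1 i)//= big1 ?addr0 => [|j ji].
  under eq_Rintegral do rewrite mulrCA.
  by rewrite RintZ ?(intb_ball_moment _ _ _)// -/(ball_moment e i i) ball_momentE mulrC.
under eq_Rintegral do rewrite mulrCA.
by rewrite RintZ ?(intb_ball_moment _ _ _)// -/(ball_moment e i j) ball_moment_off ?mulr0// eq_sym.
Qed.

Lemma nnint_inbox (a b : 'I_N -> R) : (forall i, a i <= b i) ->
  nnint leb (fun x => (inbox a b x)%:R) = (\prod_i (b i - a i))%:E.
Proof.
move=> ab; rewrite nnint_indic; last exact: measurable_inbox.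
transitivity (leb (box (fun i => `]a i, b i[%classic))).
  by apply: (congr1 (leb : set E -> \bar R)); apply/seteqP; split => x /inboxP.
rewrite leb_box// -prodEFin; apply: eq_bigr => i _.
rewrite lebesgue_measure_itv/= lte_fin; case: ltP => h; first by rewrite EFinB.
by congr EFin; have := ab i; lra.
Qed.

Lemma moment_gt0 e : (0 < N)%N -> 0 < e -> 0 < moment e.
Proof.
move=> N0 e0; pose i0 := Ordinal N0; rewrite -(ball_momentE e i0).
(* The box with all coordinates between d/2 and d lies in the ball of radius e, and z_i^2 is at
   least (d/2)^2 on it. *)
pose d : R := e / (2 * N%:R).
have N0' : (0 : R) < N%:R by rewrite ltr0n.
have d0 : 0 < d by rewrite divr_gt0// mulr_gt0.
pose b := inbox (fun _ : 'I_N => d / 2) (fun _ => d).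
have mb : measurable_fun setT b by exact: measurable_inbox.
have hb := measurable_ball_ind e.
have mf : measurable_fun setT (fun z : E => ball_ind e z * (z ord0 i0 * z ord0 i0)) by meas.
have f0 z : 0 <= ball_ind e z * (z ord0 i0 * z ord0 i0) by rewrite mulr_ge0 ?ball_ind_ge0// -expr2 sqr_ge0.
have hbz z : b z -> (d / 2) ^+ 2 <= ball_ind e z * (z ord0 i0 * z ord0 i0).
  move=> /forallP h.
  have -> : ball_ind e z = 1.
    rewrite /ball_ind (_ : enorm z < e)//; apply: le_lt_trans (enorm_le_sum _) _.
    apply: (@le_lt_trans _ _ (\sum_(i < N) d)).
      apply: ler_sum => i _; have /andP[h1 h2] := h i; rewrite ger0_norm ?ltW//; lra.
    rewrite sumr_const card_ord -[d *+ _]mulr_natl (_ : N%:R * d = e / 2); first lra.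
    by rewrite /d; field; rewrite gt_eqF.
  by rewrite mul1r -expr2 ler_sqr ?nnegrE; have /andP[h1 h2] := h i0; lra.
have i1 : nnint leb (fun z => (d / 2) ^+ 2 * (b z)%:R) = ((d / 2) ^+ 2 * \prod_(i < N) (d - d / 2))%:E.
  rewrite nnintZ ?sqr_ge0//; last exact: mfb.
  by rewrite nnint_inbox ?EFinM// => i; lra.
have i2 : ((d / 2) ^+ 2 * \prod_(i < N) (d - d / 2) <= ball_moment e i0 i0).
  rewrite -lee_fin -i1 /ball_moment -nnint_Rint//; last exact: intb_ball_moment.
  apply: nnint_le => //.
  - by apply: mfM; [exact: measurable_cst|exact: mfb].
  - by move=> z; rewrite mulr_ge0// sqr_ge0.
  - by move=> z; have := hbz z; case: (b z) => [/(_ isT)|_]; rewrite ?mulr1 ?mulr0.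
apply: lt_le_trans i2; rewrite prodr_const card_ord.
have d2 : 0 < d - d / 2 by lra.
by rewrite mulr_gt0// exprn_gt0// divr_gt0.
Qed.

(* At most [moment e] times the Dirichlet energy, and bounded by a multiple of
   [moment e] for all [e] only on H^1; unlike the gradient it behaves well under
   polarization and almost-everywhere limits. *)
Definition eps_energy e u : \bar R := dint (fun z x => (ball_ind e z * (u (x + z) - u x) ^+ 2)%R).

Lemma measurable2_eps_energy e u : measurable_fun setT u ->
  measurable2 (fun z x => ball_ind e z * (u (x + z) - u x) ^+ 2).
Proof. by move=> mu_; have hb := measurable_ball_ind e; rewrite /measurable2; meas. Qed.

Lemma eps_energy_fun_ge0 e u z x : 0 <= ball_ind e z * (u (x + z) - u x) ^+ 2.
Proof. by rewrite mulr_ge0 ?ball_ind_ge0// sqr_ge0. Qed.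

Definition transl_gap u z : R := n2 leb (fun x => u (x + z) - u x).

Lemma L2_gap u z : L2 leb u -> L2 leb (fun x => u (x + z) - u x).
Proof. by move=> hu; apply: L2B => //; exact: L2_shift. Qed.

Lemma measurable_gap u : L2 leb u -> measurable_fun setT (transl_gap u).
Proof.
move=> hu; have [mu_ _] := hu.
rewrite (_ : transl_gap u = fun z => fine (nnint leb (fun x => (u (x + z) - u x) ^+ 2))).
  apply: (@measurableT_comp _ _ _ _ _ _ fine) => //.
  apply: (@measurable_nnint_inner _ _ (fun z x => (u (x + z) - u x) ^+ 2)).
    by rewrite /measurable2; meas.
  by move=> z x; exact: sqr_ge0.
by apply/funext => z; rewrite n2E//; exact: L2_gap.
Qed.

Lemma eps_energyE e u : L2 leb u -> eps_energy e u = nnint leb (fun z => ball_ind e z * transl_gap u z).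
Proof.
move=> hu; have [mu_ _] := hu; rewrite /eps_energy dintE; last 2 first.
- exact: measurable2_eps_energy.
- by move=> z x; exact: eps_energy_fun_ge0.
apply: eq_integral => z _; rewrite nnintZ ?ball_ind_ge0//; last 2 first.
- by have mz := measurable_shift z mu_; meas.
- by move=> x; exact: sqr_ge0.
by rewrite n2E ?EFinM//; exact: L2_gap.
Qed.

Lemma eps_energy_le_wgrad e u g : L2 leb u -> wgrad u g ->
  (eps_energy e u <= (moment e * \sum_i n2 leb (g i))%:E)%E.
Proof.
move=> hu hg; have Lg i : L2 leb (g i) by have [] := hg i.
rewrite eps_energyE//.
have e1 z : ball_ind e z * n2 leb (dirg g z) =
    ball_ind e z * \sum_i \sum_j ip leb (g i) (g j) * (z ord0 i * z ord0 j).
  by rewrite n2_dirg.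
have ih : intb leb (fun z => ball_ind e z * n2 leb (dirg g z)).
  by under eq_fun do rewrite e1; exact: intb_quad.
apply: (@le_trans _ _ (nnint leb (fun z => (ball_ind e z * n2 leb (dirg g z))%R))).
  apply: nnint_le.
  - by have hb := measurable_ball_ind e; have hm := measurable_gap hu; meas.
  - exact: intb_measurable ih.
  - by move=> z; rewrite mulr_ge0 ?ball_ind_ge0 ?n2_ge0.
  - by move=> z; rewrite ler_wpM2l ?ball_ind_ge0//; exact: n2_translate_le.
rewrite nnint_Rint//; last by move=> z; rewrite mulr_ge0 ?ball_ind_ge0 ?n2_ge0.
by under eq_Rintegral do rewrite e1; rewrite Rint_quad.
Qed.

Lemma l1norm_sqr_le z : l1norm z ^+ 2 <= N%:R * sqn z.
Proof.
rewrite /l1norm expr2 mulr_suml; under eq_bigr do rewrite mulr_sumr.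
apply: (@le_trans _ _ (\sum_i \sum_j (z ord0 i ^+ 2 / 2 + z ord0 j ^+ 2 / 2))).
  apply: ler_sum => i _; apply: ler_sum => j _.
  rewrite -[z ord0 i ^+ 2]real_normK ?num_real// -[z ord0 j ^+ 2]real_normK ?num_real//.
  have := sqr_ge0 (`|z ord0 i| - `|z ord0 j|); nra.
have dsum (a : 'I_N -> R) : \sum_i \sum_j (a i + a j) = N%:R * \sum_i a i + N%:R * \sum_i a i.
  under eq_bigr => i _ do rewrite big_split/= sumr_const card_ord -[a i *+ N]mulr_natl.
  by rewrite big_split/= -mulr_sumr sumr_const card_ord -[(\sum_i a i) *+ N]mulr_natl.
rewrite (dsum (fun i => z ord0 i ^+ 2 / 2)) -mulr_suml -/(sqn z); lra.
Qed.

(** For w = u(. + z) - u and psi = sum of z_i F_i one has |w|^2 >= 2 (w, psi) - |psi|^2. Moving the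
    translation onto F_i and expanding gives a quadratic form in z; the cubic remainder is at most a
    multiple of e |z|^2, absorbed in the diagonal. *)
Lemma gap_lower_bound u (F : 'I_N -> E -> R) : L2 leb u -> (forall i, test_function (F i)) ->
  exists2 k : R, 0 <= k & forall e z, 0 < e -> e * N%:R <= 1 -> enorm z < e ->
    \sum_i \sum_j (- 2 * ip leb u (partial j (F i)) - ip leb (F i) (F j)
        - (i == j)%:R * (k * e)) * (z ord0 i * z ord0 j) <= transl_gap u z.
Proof.
move=> hu tF; have LF i := test_L2 (tF i).
have hC i : {C : R | 0 <= C /\ forall u z, L2 leb u -> 0 < l1norm z <= 1 ->
  `|ip leb u (fun x => F i (x + z) - F i x) - \sum_j z ord0 j * ip leb u (partial j (F i))|
    <= C * (n2 leb u + 1) * l1norm z ^+ 2}.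
  by apply: cid; have [C C0 h] := test_expansion (tF i); exists C.
pose C := \sum_i sval (hC i).
have C0 : 0 <= C by apply: sumr_ge0 => i _; have [] := svalP (hC i).
have nu0 := n2_ge0 leb u.
exists (2 * N%:R * C * (n2 leb u + 1)).
  by rewrite !mulr_ge0// addr_ge0.
move=> e z e0 eN ze.
have [l0|zn0] := eqVneq (l1norm z) 0.
  rewrite big1 => [|i _]; first exact: n2_ge0.
  have z0 : z ord0 i = 0.
    apply/eqP; rewrite -normr_le0 -l0 /l1norm (bigD1 i)//= lerDl; exact: sumr_ge0.
  by rewrite big1// => j _; rewrite z0 mul0r mulr0.
have lz0 : 0 < l1norm z by rewrite lt_neqAle eq_sym zn0 l1norm_ge0.
have ze' i : `|z ord0 i| <= e by apply: ltW; apply: le_lt_trans ze; exact: coord_le_enorm.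
have lz1 : l1norm z <= 1.
  apply: le_trans eN; apply: (@le_trans _ _ (\sum_(i < N) e)); first exact: ler_sum.
  by rewrite sumr_const card_ord mulr_natr.
pose w x := u (x + z) - u x.
have Lw : L2 leb w by exact: L2_gap.
pose er i := ip leb u (fun x => F i (x - z) - F i x) - \sum_j (- z) ord0 j * ip leb u (partial j (F i)).
have her i : `|er i| <= sval (hC i) * (n2 leb u + 1) * l1norm z ^+ 2.
  by have [_ h] := svalP (hC i); have := h u (- z) hu; rewrite l1normN => h'; apply: h'; rewrite lz0 lz1.
have ew i : ip leb w (F i) = - \sum_j z ord0 j * ip leb u (partial j (F i)) + er i.
  have Ls : L2 leb (fun x => F i (x - z)) by exact: L2_shift.
  have e1 : ip leb u (fun x => F i (x - z) - F i x) = ip leb u (fun x => F i (x - z)) - ip leb u (F i).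
    by rewrite ipC ipBl// [ip leb _ u]ipC [ip leb (F i) u]ipC.
  rewrite /w ipBl//; last exact: L2_shift.
  rewrite ip_shift// /er e1.
  have -> : \sum_j (- z) ord0 j * ip leb u (partial j (F i)) = - \sum_j z ord0 j * ip leb u (partial j (F i)).
    by rewrite -sumrN; apply: eq_bigr => j _; rewrite mxE mulNr.
  lra.
have hy := ip_young ltr01 Lw (L2_dirg z LF).
rewrite invr1 !mul1r -/(transl_gap u z) n2_dirg// ipC ip_dirg// in hy.
have hS : \sum_i z ord0 i * ip leb (F i) w =
   - (\sum_i \sum_j ip leb u (partial j (F i)) * (z ord0 i * z ord0 j)) + \sum_i z ord0 i * er i.
  rewrite -sumrN -big_split; apply: eq_bigr => i _ /=.
  rewrite ipC ew mulrDr mulrN mulr_sumr; congr (- _ + _); apply: eq_bigr => j _; ring.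
rewrite hS in hy.
have herr : - (\sum_i z ord0 i * er i) <= N%:R * C * (n2 leb u + 1) * e * sqn z.
  rewrite -sumrN; apply: (@le_trans _ _ (\sum_i e * (sval (hC i) * (n2 leb u + 1) * l1norm z ^+ 2))).
    apply: ler_sum => i _; apply: le_trans (ler_norm _) _.
    by rewrite normrN normrM; apply: ler_pM.
  rewrite -mulr_sumr -!mulr_suml -/C.
  apply: (@le_trans _ _ (e * (C * (n2 leb u + 1) * (N%:R * sqn z)))).
    rewrite ler_wpM2l ?(ltW e0)// ler_wpM2l ?l1norm_sqr_le// mulr_ge0// addr_ge0//.
  by rewrite le_eqVlt; apply/orP; left; apply/eqP; ring.
have -> : \sum_i \sum_j (- 2 * ip leb u (partial j (F i)) - ip leb (F i) (F j)
        - (i == j)%:R * (2 * N%:R * C * (n2 leb u + 1) * e)) * (z ord0 i * z ord0 j) =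
   - 2 * (\sum_i \sum_j ip leb u (partial j (F i)) * (z ord0 i * z ord0 j)) -
   \sum_i \sum_j ip leb (F i) (F j) * (z ord0 i * z ord0 j) -
   2 * N%:R * C * (n2 leb u + 1) * e * sqn z.
  move: (2 * N%:R * C * (n2 leb u + 1) * e) => K.
  rewrite /sqn !mulr_sumr -!sumrB; apply: eq_bigr => i _.
  rewrite mulr_sumr -sumrB.
  have -> : K * z ord0 i ^+ 2 = \sum_j (i == j)%:R * K * (z ord0 i * z ord0 j).
    rewrite (bigD1 i)//= eqxx mul1r big1 ?addr0 ?expr2// => j ji.
    by rewrite eq_sym (negbTE ji) !mul0r.
  rewrite -sumrB; apply: eq_bigr => j _; ring.
lra.
Qed.

(** Averaging the quadratic lower bound over the ball and letting e tend to 0 along the given scales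
    yields 2 l(F) <= M + |F|^2 for l(F) = - (u, div F). The representing tuple is the weak gradient
    and inherits the bound [M]. *)
Theorem wgrad_of_eps_energy u (M : R) : (0 < N)%N -> L2 leb u ->
  (forall d : R, 0 < d -> exists2 e, 0 < e < d & (eps_energy e u <= (moment e * M)%:E)%E) ->
  exists2 g, wgrad u g & \sum_i n2 leb (g i) <= M.
Proof.
move=> N0 hu hE; have [mu_ _] := hu.
have N0' : (0 : R) < N%:R by rewrite ltr0n.
pose l (F : 'I_N -> E -> R) := - \sum_i ip leb u (partial i (F i)).
have [||g [Lg ng gl]] := @riesz_test R N N l M.
- move=> a F G tF tG; rewrite /l mulrN -opprD mulr_sumr -big_split; congr (- _).
  apply: eq_bigr => i _ /=.
  have -> : partial i (fun x => a * F i x + G i x) = (fun x => a * partial i (F i) x + partial i (G i) x).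
    by apply: (@iter_partial_lin _ _ a (F i) (G i) [:: i]); [have [] := tF i|have [] := tG i].
  have h1 := test_L2 (test_partial i (tF i)); have h2 := test_L2 (test_partial i (tG i)).
  by rewrite ipC ipDl//; [rewrite ipZl// [ip leb _ u]ipC [X in _ + X = _]ipC|exact: L2Z].
- move=> F tF; have [k k0 hk] := gap_lower_bound hu tF.
  rewrite -subr_le0; set X := 2 * l F - _.
  apply: (@le_of_inv_bound _ _ (N%:R * k) N) => n hn.
  have d0 : 0 < (n.+1%:R^-1 : R) by rewrite invr_gt0 ltr0n.
  have [e /andP[e0 ed] he] := hE _ d0.
  have eN : e * N%:R <= 1.
    apply: (@le_trans _ _ (n.+1%:R^-1 * N%:R)); first by rewrite ler_wpM2r// ltW.
    by rewrite mulrC ler_pdivrMr ?ltr0n// mul1r ler_nat (leq_trans hn).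
  rewrite eps_energyE// in he.
  have hb := measurable_ball_ind e; have hg := measurable_gap hu.
  have mg : measurable_fun setT (fun z => ball_ind e z * transl_gap u z) by meas.
  have g0 z : 0 <= ball_ind e z * transl_gap u z by rewrite mulr_ge0 ?ball_ind_ge0 ?n2_ge0.
  have ig : intb leb (fun z => ball_ind e z * transl_gap u z).
    by apply: intb_nn => //; exact: fine_le_lty he.
  rewrite nnint_Rint// lee_fin in he.
  have := Rint_le (intb_quad e (fun i j => - 2 * ip leb u (partial j (F i)) - ip leb (F i) (F j)
        - (i == j)%:R * (k * e))) ig.
  rewrite Rint_quad => /(_ _)/wrap[].
    move=> z; rewrite /ball_ind; case: ltP => hz; last by rewrite !mul0r.
    by rewrite !mul1r; exact: hk.
  move=> h; have := le_trans h he; rewrite ler_pM2l ?moment_gt0//.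
  have -> : \sum_i (- 2 * ip leb u (partial i (F i)) - ip leb (F i) (F i) - (i == i)%:R * (k * e)) =
     2 * l F - \sum_i n2 leb (F i) - N%:R * (k * e).
    rewrite !sumrB /l -mulr_sumr mulrN -mulNr; congr (_ - _).
    under eq_bigr do rewrite eqxx mul1r.
    by rewrite sumr_const card_ord -[(k * e) *+ N]mulr_natl.
  move: (l F) (\sum_i n2 leb (F i)) @X => lF sF X h'.
  have h3 : 2 * lF - (M + sF) <= N%:R * (k * e) by lra.
  apply: (le_trans h3).
  by rewrite mulrA; apply: ler_wpM2l; [rewrite mulr_ge0// ltW|exact: ltW].
exists g => // i; split => //; apply/weak_partial_ip => phi tp.
(* A tuple concentrated in one slot isolates the i-th derivative. *)
pose F j : E -> R := if j == i then phi else cst 0.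
have tF j : test_function (F j) by rewrite /F; case: ifP => // _; exact: test0.
have := gl F tF; rewrite /l (bigD1 i)//= [X in - X](bigD1 i)//= /F eqxx.
rewrite big1 ?addr0 => [|j ji]; last first.
  by rewrite (negbTE ji) ipC /ip /Rintegral integral0_eq// => x _; rewrite mul0r.
rewrite big1 ?addr0 => [->|j ji]; first by rewrite opprK.
rewrite (negbTE ji) ipC /ip /Rintegral integral0_eq// => x _.
by rewrite /partial derive_cst mul0r.
Qed.

End nonlocal_energy.

Lemma lee_pmul_div {R : realType} (c m : R) (x : \bar R) : 0 < c ->
  (c%:E * x <= m%:E)%E -> (x <= (m / c)%:E)%E.
Proof.
move=> c0; case: x => [r||].
- by rewrite -EFinM !lee_fin ler_pdivlMr// mulrC.
- by rewrite gt0_muley ?lte_fin// leye_eq.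
- by rewrite leNye.
Qed.

(** * Sobolev embedding *)

Section sobolev_embedding.
Context {R : realType} {N : nat}.
Hypothesis N0 : (0 < N)%N.
Local Notation E := 'rV[R]_N.
Local Notation leb := (@lebesgue_rV R N).
Local Notation moment := (@moment R N).
Implicit Types (u v : E -> R) (x z : E) (e l K : R).

Definition energy_le u K := forall e, 0 < e -> (eps_energy e u <= (moment e * K)%:E)%E.

(** A ball of H^1 described by averaged differences at all scales, a form stable under polarization
    and under almost-everywhere limits. *)
Definition in_ball u K := [/\ L2 leb u, n2 leb u <= K & energy_le u K].

Lemma intb_bz e : intb leb (ball_ind e).
Proof.
apply: (@intb_le _ _ _ _ _ (fun z => (incube e z)%:R)); [exact: measurable_ball_ind|exact: intb_incube|].
move=> z; rewrite ger0_norm ?ball_ind_ge0// /ball_ind; case: ltP => h //.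
by rewrite (_ : incube e z)//; apply/incubeP => i; apply: ltW; apply: le_lt_trans h; exact: coord_le_enorm.
Qed.

Definition vol e : R := \int[leb]_z ball_ind e z.

Lemma volE e : nnint leb (ball_ind e) = (vol e)%:E.
Proof. by rewrite nnint_Rint//; exact: intb_bz. Qed.

(** The open cube of half-side e/N is contained in the ball, because the Euclidean norm is at most
    the sum of the coordinates. *)
Lemma vol_ge e : 0 < e -> (2 * e / N%:R) ^+ N <= vol e.
Proof.
move=> e0; rewrite -lee_fin -volE.
have N0' : (0 : R) < N%:R by rewrite ltr0n.
have d0 : 0 < e / N%:R by rewrite divr_gt0.
have := @nnint_inbox R N (fun=> - (e / N%:R)) (fun=> e / N%:R) _ => /(_ _)/wrap[]; first by move=> i; lra.
rewrite prodr_const card_ord (_ : e / N%:R - - (e / N%:R) = 2 * e / N%:R); last by lra.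
move=> <-; apply: nnint_le => //.
- by apply: mfb; exact: measurable_inbox.
- exact: measurable_ball_ind.
move=> x; case: (boolP (inbox _ _ x)) => [/forallP h|_]; last exact: ball_ind_ge0.
rewrite /ball_ind (_ : enorm x < e)//; apply: le_lt_trans (enorm_le_sum _) _.
have -> : e = \sum_(i < N) (e / N%:R).
  by rewrite sumr_const card_ord -[(e / N%:R) *+ N]mulr_natl; field; rewrite gt_eqF.
have [i0 _] : exists i0 : 'I_N, true by exists (Ordinal N0).
rewrite (bigD1 i0)//= [ltRHS](bigD1 i0)//=; apply: ltr_leD.
  by have /andP[h1 h2] := h i0; rewrite ltr_norml h1 h2.
by apply: ler_sum => i _; have /andP[h1 h2] := h i; rewrite ler_norml !ltW.
Qed.

Lemma moment_le_vol e : 0 < e -> moment e <= e ^+ 2 * vol e.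
Proof.
move=> e0; pose i0 := Ordinal N0; rewrite -(ball_momentE e i0) /vol -RintZ; last exact: intb_bz.
apply: Rint_le; [exact: intb_ball_moment|apply: intbZ; exact: intb_bz|] => z.
rewrite mulrC /ball_ind; case: ltP => h; last by rewrite !mulr0.
rewrite !mulr1 -expr2 -[_ ^+ 2]real_normK ?num_real// ler_sqr ?nnegrE ?(ltW e0)//.
by apply: ltW; apply: le_lt_trans h; exact: coord_le_enorm.
Qed.

Definition lev u l : \bar R := nnint leb (fun x => (l < `|u x|)%R%:R).

Lemma measurable_lev u l : measurable_fun setT u ->
  measurable_fun setT (fun x => (l < `|u x|)%R%:R : R).
Proof. by move=> mu_; meas. Qed.

Lemma lev_chebyshev u l : measurable_fun setT u -> 0 < l ->
  ((l ^+ 2)%:E * lev u l <= nnint leb (fun x => (u x ^+ 2)%R))%E.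
Proof.
move=> mu_ l0; rewrite -nnintZ ?sqr_ge0//; last by meas.
apply: nnint_le; [by meas|by meas|by move=> x; rewrite mulr_ge0 ?sqr_ge0|].
move=> x; case: ltP => h; last by rewrite mulr0 sqr_ge0.
by rewrite mulr1 -[_ ^+ 2 in leRHS]real_normK ?num_real// ler_sqr ?nnegrE ltW// (lt_trans l0 h).
Qed.

Lemma lev_le u l K : in_ball u K -> 1 <= l -> (lev u l <= K%:E)%E.
Proof.
move=> [hu nu _] l1; have [mu_ _] := hu.
apply: (@le_trans _ _ (nnint leb (fun x => (u x ^+ 2)%R))); last by rewrite n2E// lee_fin.
apply: nnint_le; [by meas|by meas|by []|].
move=> x; case: ltP => h; last exact: sqr_ge0.
rewrite -[_ ^+ 2]real_normK ?num_real// expr_ge1//; lra.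
Qed.

(** If the set where |u| exceeds l fills at most half a ball of radius e, then around each point
    with |u| > 2l at least half of the ball has |u| <= l, and there u changes by at least l.
    Integrating bounds the measure of the higher level set by the energy. *)
Lemma lev_step u l e K : in_ball u K -> 0 < l -> 0 < e -> 0 <= K ->
  (lev u l <= (vol e / 2)%:E)%E -> (lev u (2 * l) <= (2 * e ^+ 2 * K / l ^+ 2)%:E)%E.
Proof.
move=> [hu _ hE] l0 e0 K0 hl; have [mu_ _] := hu.
have hb := @measurable_ball_ind R N e.
have N0' : (0 : R) < N%:R by rewrite ltr0n.
have V0 : 0 < vol e.
  by apply: lt_le_trans (vol_ge e0); rewrite exprn_gt0// divr_gt0// mulr_gt0.
have low : (((l ^+ 2 * (vol e / 2)))%:E * lev u (2 * l) <= eps_energy e u)%E.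
  rewrite /eps_energy dint_swap; last 2 first.
    exact: measurable2_eps_energy.
    by move=> z x; exact: eps_energy_fun_ge0.
  have mF := measurable2_swap (measurable2_eps_energy e mu_).
  rewrite dintE//; last by move=> x z; exact: eps_energy_fun_ge0.
  rewrite /lev -nnintZ//; last 2 first.
    by meas.
    by rewrite mulr_ge0 ?sqr_ge0// divr_ge0// ltW.
  apply: ge0_le_integral => //.
  - by move=> x _; rewrite lee_fin mulr_ge0// mulr_ge0 ?sqr_ge0// divr_ge0// ltW.
  - by apply/measurable_EFinP; meas.
  - by apply: measurable_nnint_inner => // x z; exact: eps_energy_fun_ge0.
  move=> x _; case: ltP => h; last first.
    by rewrite mulr0; apply: nnint_ge0 => z; exact: eps_energy_fun_ge0.
  rewrite mulr1.
  have mux : measurable_fun setT (fun z => u (x + z)).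
    by under eq_fun do rewrite addrC; exact: measurable_shift.
  pose b (z : E) : R := (`|u (x + z)| <= l)%R%:R.
  have mb : measurable_fun setT b by rewrite /b; meas.
  have m1 : measurable_fun setT (fun z => ball_ind e z * b z) by meas.
  have p1 z : 0 <= ball_ind e z * b z by apply: mulr_ge0; [exact: ball_ind_ge0|exact: ler0n].
  (* The ball is split into its points of low level and the rest; the rest is controlled by
     [lev u l] after a translation. *)
  have h1 : (nnint leb (ball_ind e) <= nnint leb (fun z => (ball_ind e z * b z)%R) + lev u l)%E.
    have m2 := mpres_measurable (mpres_add x) (measurable_lev l mu_).
    rewrite /lev -(mpres_nnint (mpres_add x) (measurable_lev l mu_))//.
    rewrite -(nnintD leb m1 m2 p1 (fun _ => ler0n _ _)).
    apply: nnint_le => //; [exact: (mfD m1 m2)|].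
    move=> z; rewrite /b [z + x]addrC; case: ltP => hz; rewrite ?mulr0 ?mulr1 ?add0r ?addr0//.
    by rewrite /ball_ind; case: ltP.
  have h2 : ((vol e / 2)%:E <= nnint leb (fun z => (ball_ind e z * b z)%R))%E.
    rewrite volE in h1; have h3 := le_trans h1 (leeD2l _ hl).
    have := nnint_ge0 leb p1; move: h3; case: (nnint leb _) => [r||] //.
      by rewrite -EFinD !lee_fin => h3 _; lra.
    by move=> _ _; rewrite leey.
  apply: (@le_trans _ _ ((l ^+ 2)%:E * nnint leb (fun z => (ball_ind e z * b z)%R))%E).
    by rewrite EFinM; apply: lee_wpmul2l => //; rewrite lee_fin sqr_ge0.
  rewrite -(nnintZ leb m1 p1 (sqr_ge0 l)); apply: nnint_le.
  - by meas.
  - by meas.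
  - by move=> z; apply: mulr_ge0; [exact: sqr_ge0|exact: p1].
  move=> z; rewrite mulrCA ler_wpM2l ?ball_ind_ge0// /b; case: (leP (`|u (x + z)|) l) => hz; last first.
    by rewrite (_ : _ * _ = 0) ?sqr_ge0//= mulr0.
  rewrite mulr1 -[leRHS]real_normK ?num_real// ler_sqr ?nnegrE ?(ltW l0)// -normrN opprB.
  by have := lerB_dist (u x) (u (x + z)); lra.
have h := le_trans low (hE _ e0).
have c0 : 0 < l ^+ 2 * (vol e / 2) by rewrite mulr_gt0 ?exprn_gt0// divr_gt0.
have h' : (lev u (2 * l) <= (moment e * K / (l ^+ 2 * (vol e / 2)))%:E)%E.
  exact: lee_pmul_div.
apply: le_trans h' _; rewrite lee_fin ler_pdivrMr//.
have -> : 2 * e ^+ 2 * K / l ^+ 2 * (l ^+ 2 * (vol e / 2)) = (e ^+ 2 * vol e) * K.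
  by field; rewrite gt_eqF.
by rewrite ler_wpM2r// moment_le_vol.
Qed.

End sobolev_embedding.

(** * Decay of level sets and the subcritical embedding *)

Section sobolev_iteration.
Context {R : realType} {N : nat}.
Hypothesis N0 : (0 < N)%N.
Local Notation E := 'rV[R]_N.
Local Notation leb := (@lebesgue_rV R N).
Implicit Types (u v : E -> R) (x z : E) (e l K r s : R).

(** A weak L^s bound, uniform over each energy ball. *)
Definition level_decay s := forall K, 0 <= K -> exists2 C : R, 0 <= C &
  forall u l, in_ball u K -> 1 <= l -> (lev u l <= (C * l `^ (- s))%:E)%E.

Lemma level_decay2 : level_decay 2.
Proof.
move=> K K0; exists K => // u l hu l1; have [Lu nu _] := hu; have [mu_ _] := Lu.
have l0 : 0 < l by lra.
have := lev_chebyshev mu_ l0; rewrite n2E// => h.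
have h' : ((l ^+ 2)%:E * lev u l <= K%:E)%E by apply: le_trans h _; rewrite lee_fin.
rewrite powRN powR_mulrn ?(ltW l0)//; apply: (@lee_pmul_div _ (l ^+ 2)) => //.
by rewrite exprn_gt0.
Qed.

(** Decay l^-s allows balls with e^N of order l^-s in [lev_step], which improves the exponent to 2 +
    2s/N. For N > 2 the fixed point of this map is the critical Sobolev exponent 2N/(N-2). *)
Lemma level_decay_step s : 0 <= s -> level_decay s -> level_decay (2 + 2 * s / N%:R).
Proof.
move=> s0 hs K K0; have [C C0 hC] := hs K K0.
have N0' : (0 : R) < N%:R by rewrite ltr0n.
set s' := 2 + _; have s'0 : 0 <= s' by apply: addr_ge0 => //; apply: divr_ge0; [exact: mulr_ge0|exact: ltW].
pose c0 : R := (2 / N%:R) ^+ N.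
have c00 : 0 < c0 by rewrite exprn_gt0// divr_gt0.
(* Chosen so that half the lower bound [c0 * e^N] for the volume equals (C + 1) l^-s and dominates
   the level set. *)
pose D := 2 * (C + 1) / c0.
have D0 : 0 < D by rewrite divr_gt0// mulr_gt0//; lra.
pose C1 := 2 * D `^ (2 / N%:R) * K.
have C10 : 0 <= C1 by rewrite !mulr_ge0 ?powR_ge0.
have p2 : 0 < 2 `^ s' :> R by rewrite powR_gt0.
exists ((C1 + K) * 2 `^ s'); first by rewrite mulr_ge0 ?addr_ge0// ltW.
move=> u m hu m1; have m0 : 0 < m by lra.
have pm : 0 < m `^ s' by rewrite powR_gt0.
(* Below 2 half the level would drop under 1, where the decay is not known; there the trivial bound
   [K] suffices, at the price of a factor. *)
rewrite powRN; have [m2|m2] := ltP m 2.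
  apply: (@le_trans _ _ K%:E); first exact: (lev_le hu m1).
  rewrite lee_fin ler_pdivlMr//; apply: (@le_trans _ _ (K * 2 `^ s')).
    by rewrite ler_wpM2l// ge0_ler_powR// ?nnegrE; lra.
  by rewrite ler_wpM2r ?(ltW p2)// lerDr.
pose l := m / 2; have l1 : 1 <= l by rewrite /l; lra.
have l0 : 0 < l by lra.
pose e := (D * l `^ (- s)) `^ (N%:R^-1).
have Dl : 0 < D * l `^ (- s) by rewrite mulr_gt0// powR_gt0.
have e0 : 0 < e by rewrite powR_gt0.
have eN : e ^+ N = D * l `^ (- s).
  by rewrite /e -powR_mulrn ?powR_ge0// -powRrM mulVf ?gt_eqF// powRr1// (ltW Dl).
have e2 : e ^+ 2 = D `^ (2 / N%:R) * l `^ (- (2 * s / N%:R)).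
  rewrite /e -powR_mulrn ?powR_ge0// -powRrM powRM ?(ltW D0) ?powR_ge0//.
  by rewrite -powRrM; congr (_ `^ _ * _ `^ _); ring.
have hv : (lev u l <= (vol (N := N) e / 2)%:E)%E.
  apply: (le_trans (hC u l hu l1)); rewrite lee_fin.
  have h := vol_ge N0 e0; apply: (@le_trans _ _ ((2 * e / N%:R) ^+ N / 2)); last by lra.
  have -> : (2 * e / N%:R) ^+ N = c0 * e ^+ N by rewrite /c0 -exprMn; congr (_ ^+ _); ring.
  rewrite eN /D (_ : c0 * _ / 2 = (C + 1) * l `^ (- s)); last by field; rewrite gt_eqF.
  by rewrite ler_wpM2r ?powR_ge0//; lra.
have := lev_step N0 hu l0 e0 K0 hv; rewrite (_ : 2 * l = m); last by rewrite /l; field.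
move/le_trans; apply; rewrite lee_fin e2.
have -> : 2 * (D `^ (2 / N%:R) * l `^ (- (2 * s / N%:R))) * K / l ^+ 2 = C1 * l `^ (- s').
  rewrite /C1 /s' opprD powRD; last by rewrite (gt_eqF l0) implybT.
  by rewrite [l `^ (- 2)]powRN powR_mulrn ?(ltW l0)//; ring.
have -> : l `^ (- s') = 2 `^ s' / m `^ s'.
  rewrite /l powRN powRM ?invr_ge0 ?(ltW m0)// invfM mulrC; congr (_ * _).
  by rewrite -powR_inv1// -powRrM mulN1r powRN invrK.
rewrite -[(C1 + K) * _ / _]mulrA; apply: ler_wpM2r; last by rewrite lerDl.
by apply: divr_ge0; exact: ltW.
Qed.

(** As long as s <= r the iteration gains at least a fixed amount, so r is passed after finitely
    many steps. The condition [r * (N - 2) < 2 * N] expresses subcriticality in every dimension at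
    once. *)
Lemma level_decay_all r : 2 <= r -> r * (N%:R - 2) < 2 * N%:R ->
  exists2 s, r < s & level_decay s.
Proof.
move=> r2 rN; have N0' : (0 : R) < N%:R by rewrite ltr0n.
(* The gain is (2N - s(N-2))/N. For N >= 2 it is smallest at s = r; for N = 1 it is 2 + s, whence
   the minimum with 2. *)
pose d : R := Num.min (2 * N%:R - r * (N%:R - 2)) 2 / N%:R.
have d0 : 0 < d by rewrite divr_gt0// lt_min; apply/andP; split; lra.
have key k : (exists2 s, r < s & level_decay s) \/
    (exists s, [/\ 2 + k%:R * d <= s, s <= r & level_decay s]).
  elim: k => [|k [IH|[s [s1 s2 hs]]]].
  - by right; exists 2; split => //; [rewrite mul0r addr0|exact: level_decay2].
  - by left.
  have sp : 2 <= s by apply: le_trans s1; rewrite lerDl mulr_ge0// ltW.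
  have hs' := level_decay_step (le_trans (ler0n _ 2) sp) hs.
  have [h|h] := ltP r (2 + 2 * s / N%:R); first by left; exists (2 + 2 * s / N%:R).
  right; exists (2 + 2 * s / N%:R); split => //.
  have : d <= 2 + 2 * s / N%:R - s.
    rewrite /d ler_pdivrMr// (_ : (2 + 2 * s / N%:R - s) * N%:R = 2 * N%:R + 2 * s - s * N%:R); last first.
      by field; rewrite gt_eqF.
    rewrite ge_min.
    have [N2|N2] := leqP 2 N; apply/orP; [left|right].
      have N2' : (2 : R) <= N%:R by rewrite ler_nat.
      have : s * (N%:R - 2) <= r * (N%:R - 2) by apply: ler_wpM2r => //; lra.
      lra.
    have -> : N%:R = 1 :> R by have -> : N = 1%N by case: (N) N0 N2 => [|[|]].
    lra.
  by rewrite -natr1 mulrDl mul1r; lra.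
pose k := Num.bound ((r - 2) / d).
have [//|[s [s1 s2 _]]] := key k.
have := @archi_boundP R ((r - 2) / d) _ => /(_ _)/wrap[].
  by apply: divr_ge0; [lra|exact: ltW].
rewrite -/k ltr_pdivrMr// => h; have h3 : k%:R * d <= r - 2 by lra.
by have := lt_le_trans h h3; rewrite ltxx.
Qed.

Lemma powR_dyadic r (t : R) : 2 <= r -> 0 <= t ->
  ((t `^ r)%:E <= (t ^+ 2)%:E + \sum_(0 <= k <oo) ((2 ^+ k.+1) `^ r * ((2 ^+ k < t)%R%:R))%:E)%E.
Proof.
move=> r2 t0; have S0 : (0 <= \sum_(0 <= k <oo) ((2 ^+ k.+1 : R) `^ r * ((2 ^+ k < t)%R%:R))%:E)%E.
  by apply: nneseries_ge0 => n _ _; rewrite lee_fin mulr_ge0 ?powR_ge0.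
have [t1|t1] := leP t 1.
  apply: (@le_trans _ _ (t ^+ 2)%:E); last by rewrite leeDl.
  rewrite lee_fin -powR_mulrn//; have [->|tn0] := eqVneq t 0.
    by rewrite powR0 ?powR_ge0//; apply/eqP; lra.
  by apply: ger_powR => //; rewrite lt_neqAle eq_sym tn0 t0.
have [k [hk1 hk2]] : exists k, 2 ^+ k < t /\ t <= 2 ^+ k.+1.
  have ex : exists n, t <= 2 ^+ n.
    exists (Num.bound t); apply: le_trans (ltW (archi_boundP t0)) _.
    by rewrite -natrX ler_nat ltnW// ltn_expl.
  have [n hn hmin] := ex_minnP ex; case: n hn hmin => [|n] hn hmin.
    by move: hn; rewrite expr0; lra.
  exists n; split => //; rewrite ltNge; apply/negP => /hmin.
  by rewrite ltnn.
apply: (@le_trans _ _ (\sum_(0 <= k <oo) ((2 ^+ k.+1) `^ r * ((2 ^+ k < t)%R%:R))%:E)%E); last first.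
  by rewrite leeDr// lee_fin sqr_ge0.
apply: le_trans (nneseries_lim_ge k.+1 _); last first.
  by move=> n _ _; rewrite lee_fin mulr_ge0 ?powR_ge0.
rewrite big_nat_recr//= hk1 mulr1.
apply: (@le_trans _ _ ((2 ^+ k.+1) `^ r)%:E).
  by rewrite lee_fin ge0_ler_powR// ?nnegrE ?exprn_ge0//; lra.
by rewrite leeDr// sume_ge0// => n _; rewrite lee_fin mulr_ge0 ?powR_ge0.
Qed.

(** Weak decay with some s > r is summed over dyadic levels with ratio 2^(r-s) < 1; values at most 1
    are covered by the L^2 norm. *)
Theorem sobolev r K : 2 <= r -> r * (N%:R - 2) < 2 * N%:R -> 0 <= K ->
  exists2 C : R, 0 <= C & forall u, in_ball u K -> (nnint leb (fun x => (`|u x| `^ r)%R) <= C%:E)%E.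
Proof.
move=> r2 rN K0; have [s rs hs] := level_decay_all r2 rN.
have [C C0 hC] := hs K K0.
pose rho : R := 2 `^ (r - s).
have rho1 : rho < 1.
  have rs0 : r - s < 0 by rewrite subr_lt0.
  have l2 : 0 < ln 2 :> R by rewrite ln_gt0// ltr1n.
  by rewrite /rho /powR gt_eqF//= expR_lt1 nmulr_rlt0.
have rho0 : 0 <= rho by exact: powR_ge0.
have cg : cvgn (series (geometric (C * 2 `^ r) rho)).
  by apply: is_cvg_geometric_series; rewrite ger0_norm.
pose L := limn (series (geometric (C * 2 `^ r) rho)).
have term0 k : 0 <= geometric (C * 2 `^ r) rho k by rewrite /= !mulr_ge0 ?powR_ge0 ?exprn_ge0.
have LE : (\sum_(0 <= k <oo) (geometric (C * 2 `^ r) rho k)%:E)%E = L%:E.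
  rewrite /L -EFin_lim//; apply: (congr1 (fun F : nat -> \bar R => limn F)); apply/funext => n.
  by rewrite /series/= -sumEFin.
have L0 : 0 <= L by rewrite -lee_fin -LE; apply: nneseries_ge0 => k _ _; rewrite lee_fin.
exists (K + L); first exact: addr_ge0.
move=> u hu; have [Lu nu _] := hu; have [mu_ _] := Lu.
have mk k : measurable_fun setT (fun x => (2 ^+ k.+1) `^ r * ((2 ^+ k < `|u x|)%R%:R) : R).
  by apply: mfM; [exact: measurable_cst|exact: measurable_lev].
have pk k x : 0 <= (2 ^+ k.+1) `^ r * ((2 ^+ k < `|u x|)%R%:R) :> R by rewrite mulr_ge0 ?powR_ge0.
have mS : measurable_fun setT (fun x => \sum_(0 <= k <oo) ((2 ^+ k.+1) `^ r * ((2 ^+ k < `|u x|)%R%:R))%:E)%E.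
  apply: ge0_emeasurable_sum => n *; first by rewrite lee_fin.
  exact/measurable_EFinP.
have m2 : measurable_fun setT (fun x => u x ^+ 2) by meas.
apply: (@le_trans _ _ (\int[leb]_x ((u x ^+ 2)%:E + \sum_(0 <= k <oo) ((2 ^+ k.+1) `^ r * ((2 ^+ k < `|u x|)%R%:R))%:E))%E).
  apply: ge0_le_integral => //.
  - by apply/measurable_EFinP; meas.
  - by apply: emeasurable_funD => //; exact/measurable_EFinP.
  - by move=> x _; have := powR_dyadic r2 (normr_ge0 (u x)); rewrite real_normK ?num_real.
rewrite ge0_integralD//; last 3 first.
- by move=> x _; rewrite lee_fin sqr_ge0.
- exact/measurable_EFinP.
- by move=> x _; apply: nneseries_ge0 => n _ _; rewrite lee_fin.
rewrite EFinD; apply: leeD.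
  by have := n2E Lu; rewrite /nnint => ->; rewrite lee_fin.
rewrite integral_nneseries//; last by move=> n; exact/measurable_EFinP.
rewrite -LE; apply: lee_nneseries => [n _ _|k _]; first by apply: nnint_ge0.
have -> : (\int[leb]_x ((2 ^+ k.+1) `^ r * (2 ^+ k < `|u x|)%R%:R)%:E = ((2 ^+ k.+1) `^ r)%:E * lev u (2 ^+ k))%E.
  by rewrite /lev -nnintZ ?powR_ge0//; exact: measurable_lev.
apply: (@le_trans _ _ (((2 ^+ k.+1) `^ r)%:E * (C * (2 ^+ k) `^ (- s))%:E)%E).
  apply: lee_wpmul2l; first by rewrite lee_fin powR_ge0.
  by apply: hC => //; rewrite exprn_ege1// ler1n.
rewrite -EFinM lee_fin /geometric/= exprS powRM ?exprn_ge0//.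
rewrite le_eqVlt; apply/orP; left; apply/eqP.
have e1 (a : R) : ((2 : R) ^+ k) `^ a = (2 `^ a) ^+ k.
  by rewrite -[2 ^+ k]powR_mulrn// -powRrM mulrC powRrM powR_mulrn ?powR_ge0.
rewrite !e1 /rho powRD; last by rewrite pnatr_eq0 implybT.
by rewrite exprMn; ring.
Qed.

End sobolev_iteration.

(** * The Riesz interaction *)

Section layers.
Context {d} {T : measurableType d} {R : realType} (mu : {measure set T -> \bar R}).
Implicit Types (f nu : T -> R) (s C D : R).

(** Dyadic summation in the abstract: on layer k the function is at most a_k, and a_k times the
    measure of the layer decays geometrically. *)
Lemma nnint_layers (b : nat -> T -> bool) (a : nat -> R) f (C rho : R) :
  (forall k, measurable_fun setT (b k)) -> (forall k, 0 <= a k) ->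
  measurable_fun setT f -> (forall x, 0 <= f x) ->
  (forall x, f x = 0 \/ exists2 k, b k x & f x <= a k) ->
  (forall k, ((a k)%:E * nnint mu (fun x => ((b k x)%:R)%R) <= (C * rho ^+ k)%:E)%E) ->
  0 <= C -> 0 <= rho < 1 -> (nnint mu f < +oo)%E.
Proof.
move=> mb a0 mf f0 hf hb C0 /andP[r0 r1].
have t0 k x : 0 <= a k * (b k x)%:R by rewrite mulr_ge0.
have mt k : measurable_fun setT (fun x => a k * (b k x)%:R).
  by apply: mfM; [exact: measurable_cst|exact: mfb].
have mS : measurable_fun setT (fun x => \sum_(0 <= k <oo) (a k * (b k x)%:R)%:E)%E.
  by apply: ge0_emeasurable_sum => n *; [rewrite lee_fin|exact/measurable_EFinP].
have cg : cvgn (series (geometric C rho)) by apply: is_cvg_geometric_series; rewrite ger0_norm.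
have LE : (\sum_(0 <= k <oo) (geometric C rho k)%:E)%E = (limn (series (geometric C rho)))%:E.
  rewrite -EFin_lim//; apply: (congr1 (fun F : nat -> \bar R => limn F)); apply/funext => n.
  by rewrite /series/= -sumEFin.
apply: (@le_lt_trans _ _ (\sum_(0 <= k <oo) (geometric C rho k)%:E)%E); last by rewrite LE ltry.
apply: (@le_trans _ _ (\int[mu]_x (\sum_(0 <= k <oo) (a k * (b k x)%:R)%:E))%E).
  apply: ge0_le_integral => //.
  - by move=> x _; rewrite lee_fin.
  - exact/measurable_EFinP.
  move=> x _; have S0 : (0 <= \sum_(0 <= k <oo) (a k * (b k x)%:R)%:E)%E.
    by apply: nneseries_ge0 => n _ _; rewrite lee_fin.
  have [->//|[k bk hk]] := hf x.
  apply: le_trans (nneseries_lim_ge k.+1 _); last by move=> n _ _; rewrite lee_fin.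
  rewrite big_nat_recr//= bk mulr1; apply: (@le_trans _ _ (a k)%:E); first by rewrite lee_fin.
  by rewrite leeDr// sume_ge0// => n _; rewrite lee_fin.
rewrite integral_nneseries//; last 2 first.
- by move=> n; exact/measurable_EFinP.
- by move=> n x _; rewrite lee_fin.
apply: lee_nneseries => [n _ _|k _]; first by apply: nnint_ge0.
apply: le_trans (hb k); rewrite -nnintZ//.
exact: mfb.
Qed.

Lemma powR_2n (a : R) k : ((2 : R) ^+ k) `^ a = (2 `^ a) ^+ k.
Proof. by rewrite -[2 ^+ k]powR_mulrn// -powRrM mulrC powRrM powR_mulrn ?powR_ge0. Qed.

Lemma powR_half_lt1 (a : R) : a < 0 -> 0 <= (2 : R) `^ a < 1.
Proof.
move=> a0; rewrite powR_ge0/=; have l2 : 0 < ln 2 :> R by rewrite ln_gt0// ltr1n.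
by rewrite /powR gt_eqF//= expR_lt1 nmulr_rlt0.
Qed.

Lemma anti_powR (s a b : R) : 0 <= s -> 0 < a -> a <= b -> b `^ (- s) <= a `^ (- s).
Proof.
move=> s0 a0 ab; have b0 := lt_le_trans a0 ab.
rewrite !powRN lef_pV2 ?posrE ?powR_gt0//.
by rewrite ge0_ler_powR// ?nnegrE ltW.
Qed.

(** The sublevel sets of [nu] grow at most like r^D. The growth bound serves both the half-line (D =
    1, for the Gamma integral) and the Euclidean norm (D = N); dyadic layers shrink towards
    [nu = 0]. *)
Lemma nnint_near nu s C (D : R) : measurable_fun setT nu -> 0 <= C -> 0 <= s -> s < D ->
  (forall r, 0 < r -> (nnint mu (fun x => (0 < nu x <= r)%R%:R) <= (C * r `^ D)%:E)%E) ->
  (nnint mu (fun x => ((0 < nu x < 1)%R%:R * nu x `^ (- s))%R) < +oo)%E.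
Proof.
move=> mn C0 s0 sd hC.
have mb (r : R) : measurable_fun setT (fun x => (0 < nu x <= r)%R).
  by apply: mfand; meas.
apply: (@nnint_layers (fun k x => (0 < nu x <= (2 ^+ k)^-1)%R) (fun k => (2 ^+ k.+1) `^ s) _
  (C * 2 `^ s) (2 `^ (s - D))) => //.
- by apply: mfM; [apply: mfb; apply: mfand|]; meas.
- by move=> x; rewrite mulr_ge0 ?powR_ge0.
- move=> x; case: (boolP (0 < nu x < 1)) => [/andP[n0 n1]|_]; last by left; rewrite mul0r.
  right; rewrite mul1r.
  have ex : exists n, 2 ^- n < nu x.
    exists (Num.bound (nu x)^-1); rewrite invf_plt ?posrE ?exprn_gt0//.
    have := archi_boundP (ltW (_ : 0 < (nu x)^-1)); rewrite invr_gt0 => /(_ n0) h.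
    by apply: lt_trans h _; rewrite -natrX ltr_nat ltn_expl.
  have [n hn hmin] := ex_minnP ex; case: n hn hmin => [|n] hn hmin.
    by move: hn; rewrite expr0 invr1 => /(lt_trans n1); rewrite ltxx.
  have hn' : nu x <= 2 ^- n by rewrite leNgt; apply/negP => /hmin; rewrite ltnn.
  exists n; first by rewrite n0.
  have -> : (2 ^+ n.+1) `^ s = (2 ^- n.+1 : R) `^ (- s).
    by rewrite -powR_inv1 ?exprn_ge0// -powRrM mulN1r opprK.
  by apply: anti_powR => //; exact: ltW.
- move=> k; have p2 : (0 : R) < 2 ^- k by rewrite invr_gt0 exprn_gt0.
  apply: (@le_trans _ _ (((2 ^+ k.+1) `^ s)%:E * (C * (2 ^- k) `^ D)%:E)%E).
    by apply: lee_wpmul2l; [rewrite lee_fin powR_ge0|exact: hC].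
  rewrite -EFinM lee_fin exprS powRM ?exprn_ge0// le_eqVlt; apply/orP; left; apply/eqP.
  have -> : (2 ^- k : R) `^ D = (2 ^+ k) `^ (- D) by rewrite -powR_inv1 ?exprn_ge0// -powRrM mulN1r.
  rewrite !powR_2n powRD; last by rewrite pnatr_eq0 implybT.
  by rewrite exprMn; ring.
- by rewrite mulr_ge0 ?powR_ge0.
- by apply: powR_half_lt1; rewrite subr_lt0.
Qed.

(** The counterpart at infinity, with layers [2^k, 2^(k+1)]. *)
Lemma nnint_far nu s C (D : R) : measurable_fun setT nu -> 0 <= C -> 0 <= s -> D < s ->
  (forall r, 0 < r -> (nnint mu (fun x => (0 < nu x <= r)%R%:R) <= (C * r `^ D)%:E)%E) ->
  (nnint mu (fun x => ((1 <= nu x)%R%:R * nu x `^ (- s))%R) < +oo)%E.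
Proof.
move=> mn C0 s0 sd hC.
have mb (r : R) : measurable_fun setT (fun x => (0 < nu x <= r)%R).
  by apply: mfand; meas.
apply: (@nnint_layers (fun k x => (0 < nu x <= 2 ^+ k.+1)%R) (fun k => (2 ^+ k) `^ (- s)) _
  (C * 2 `^ D) (2 `^ (D - s))) => //.
- by meas.
- by move=> x; rewrite mulr_ge0 ?powR_ge0.
- move=> x; case: (leP 1 (nu x)) => [n1|_]; last by left; rewrite mul0r.
  right; rewrite mul1r; have n0 : 0 < nu x by exact: lt_le_trans n1.
  have ex : exists n, nu x < 2 ^+ n.
    exists (Num.bound (nu x)); apply: lt_trans (archi_boundP (ltW n0)) _.
    by rewrite -natrX ltr_nat ltn_expl.
  have [n hn hmin] := ex_minnP ex; case: n hn hmin => [|n] hn hmin.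
    by move: hn; rewrite expr0 => /(le_lt_trans n1); rewrite ltxx.
  have hn' : 2 ^+ n <= nu x by rewrite leNgt; apply/negP => /hmin; rewrite ltnn.
  exists n; first by rewrite n0 ltW.
  by apply: anti_powR => //; rewrite exprn_gt0.
- move=> k; have p2 : (0 : R) < 2 ^+ k.+1 by rewrite exprn_gt0.
  apply: (@le_trans _ _ (((2 ^+ k) `^ (- s))%:E * (C * (2 ^+ k.+1) `^ D)%:E)%E).
    by apply: lee_wpmul2l; [rewrite lee_fin powR_ge0|exact: hC].
  rewrite -EFinM lee_fin exprS powRM ?exprn_ge0// le_eqVlt; apply/orP; left; apply/eqP.
  rewrite !powR_2n powRD; last by rewrite pnatr_eq0 implybT.
  by rewrite exprMn; ring.
- by rewrite mulr_ge0 ?powR_ge0.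
- by apply: powR_half_lt1; rewrite subr_lt0.
Qed.

End layers.

(** * Positivity of Euler's integral *)

Lemma measurable_near {d} {T : measurableType d} {R : realType} (nu : T -> R) (a : R) :
  measurable_fun setT nu -> measurable_fun setT (fun t => (0 < nu t < 1)%R%:R * nu t `^ a).
Proof. by move=> mn; apply: mfM; [apply: mfb; apply: mfand|]; meas. Qed.

Lemma measurable_far {d} {T : measurableType d} {R : realType} (nu : T -> R) (a : R) :
  measurable_fun setT nu -> measurable_fun setT (fun t => (1 <= nu t)%R%:R * nu t `^ a).
Proof. by move=> mn; meas. Qed.

Lemma measurable_gamma {d} {T : measurableType d} {R : realType} (nu : T -> R) (a : R) :
  measurable_fun setT nu -> measurable_fun setT (fun t => (0 < nu t)%R%:R * (nu t `^ a * expR (- nu t))).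
Proof.
move=> mn; apply: mfM; first by meas.
by apply: mfM; [meas|apply: (@measurableT_comp _ _ _ _ _ _ expR); [exact: measurable_expR|meas]].
Qed.

(** The real integral of a function of infinite integral is 0 by convention, so positivity requires
    finiteness: powers dominate the integrand on either side of 1. *)
Lemma Gamma_gt0 {R : realType} (s : R) : 0 < s -> 0 < Gamma s.
Proof.
move=> s0; pose mu := @lebesgue_measure R.
have hmu (r : R) : 0 < r -> (nnint mu (fun t : R => (0 < t <= r)%R%:R) <= (1 * r `^ 1)%:E)%E.
  move=> r0; rewrite powRr1 ?(ltW r0)// mul1r nnint_indic; last by apply: mfand; [apply: mflt; [exact: measurable_cst|exact: measurable_id]|apply: mfle; [exact: measurable_id|exact: measurable_cst]].
  rewrite (_ : [set x | _] = `]0, r]%classic); last by apply/seteqP; split => x /=; rewrite in_itv.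
  apply: (@le_trans _ _ (lebesgue_measure (`]0%R, r]%classic : set R))); first exact: lexx.
  by rewrite lebesgue_measure_itv/= lte_fin r0 -EFinD subr0.
pose f (t : R) : R := (0 < t)%R%:R * (t `^ (s - 1) * expR (- t)).
have mf : measurable_fun setT f by exact: (measurable_gamma _ (@measurable_id _ _ _)).
have f0 t : 0 <= f t by rewrite !mulr_ge0 ?powR_ge0 ?expR_ge0.
have GE : Gamma s = fine (nnint mu f).
  rewrite /Gamma /Rintegral; congr fine; rewrite integral_mkcond; apply: eq_integral => t _.
  rewrite /patch mem_setE in_itv/= andbT /f; case: ltP => h; first by rewrite mul1r.
  by rewrite mul0r.
(* The exponent 1 - s is raised to at least 1/2 to stay nonnegative, and remains below 1. *)
pose b : R := Num.max (1 - s) 2^-1.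
have b1 : b < 1 by rewrite /b gt_max; apply/andP; split; lra.
have b0 : 0 <= b by rewrite le_max; apply/orP; right; rewrite invr_ge0.
have h1 := @nnint_near _ _ _ mu id b 1 1 (@measurable_id _ _ _) ler01 b0 b1 hmu.
have h2 := @nnint_far _ _ _ mu id 2 1 1 (@measurable_id _ _ _) ler01 (ler0n _ 2) (ltr1n _ 2) hmu.
(* For t >= 1 this gives t^(s+1) <= t^(n+1) <= (n+1)! e^t, hence domination by a multiple of
   t^-2. *)
pose n := Num.bound (s + 1).
have fin : (nnint mu f < +oo)%E.
  pose g (t : R) : R := (0 < t < 1)%R%:R * t `^ (- b) + (n.+1)`!%:R * ((1 <= t)%R%:R * t `^ (- 2)).
  have m1 : measurable_fun setT (fun t : R => (0 < t < 1)%R%:R * t `^ (- b)).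
    exact: (measurable_near _ (@measurable_id _ _ _)).
  have m2 : measurable_fun setT (fun t : R => (1 <= t)%R%:R * t `^ (- 2)).
    exact: (measurable_far _ (@measurable_id _ _ _)).
  apply: (@le_lt_trans _ _ (nnint mu g)); last first.
    rewrite nnintD//; last 3 first.
    - by apply: mfM => //; exact: measurable_cst.
    - by move=> x; rewrite mulr_ge0 ?powR_ge0.
    - by move=> x; rewrite !mulr_ge0 ?powR_ge0.
    rewrite nnintZ//; last by move=> x; rewrite mulr_ge0 ?powR_ge0.
    apply: lte_add_pinfty => //.
    by apply: lte_mul_pinfty.
  apply: nnint_le => //.
    by apply: mfD => //; apply: mfM => //; exact: measurable_cst.
  move=> t; rewrite /f /g; case: (ltP 0 t) => t0; last first.
    rewrite mul0r addr_ge0 ?mulr_ge0 ?powR_ge0//.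
  rewrite mul1r; have [t1|t1] := ltP t 1.
    rewrite /= mul0r mulr0 addr0 mul1r -[leRHS]mulr1; apply: ler_pM; rewrite ?powR_ge0 ?expR_ge0//.
      apply: ger_powR; first by rewrite t0 ltW.
      by rewrite lerNl opprB le_max lexx.
    by rewrite expR_le1; lra.
  rewrite /= mul0r add0r mul1r expRN ler_pdivrMr ?expR_gt0//.
  have et : t ^+ n.+1 <= (n.+1)`!%:R * expR t.
    have := expR_ge1Dxn n (ltW t0); have fp : (0 : R) < (n.+1)`!%:R by rewrite ltr0n fact_gt0.
    move=> h; have {}h : t ^+ n.+1 / (n.+1)`!%:R <= expR t by lra.
    by move: h; rewrite ler_pdivrMr// mulrC.
  have -> : t `^ (s - 1) = t `^ (s + 1) * t `^ (- 2).
    by rewrite -powRD; [congr (_ `^ _); ring|rewrite (gt_eqF t0) implybT].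
  rewrite [leRHS](_ : _ = (n.+1)`!%:R * expR t * t `^ (- 2)); last by ring.
  apply: ler_wpM2r; first exact: powR_ge0.
  apply: le_trans et; rewrite -powR_mulrn ?(ltW t0)//; apply: ler_powR => //.
  have h : 0 <= s + 1 by lra.
  by have := archi_boundP h; rewrite -/n -natr1; lra.
rewrite GE fine_gt0// fin andbT lt_neqAle eq_sym nnint_ge0// andbT.
apply/negP => /eqP h; have := @nnint_eq0 _ _ _ mu f mf f0 h.
move=> [X [mX X0 sX]].
have : (lebesgue_measure (`]0%R, 1%R[%classic : set R) <= lebesgue_measure X)%E.
  apply: le_measure; [by apply: mem_set; exact: (@measurable_itv R)|by apply: mem_set|].
  move=> t /=; rewrite in_itv/= => /andP[t0 _]; apply: sX => /= /eqP.
  by rewrite /f t0 mul1r mulf_eq0 !gt_eqF ?powR_gt0 ?expR_gt0.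
rewrite (X0 : lebesgue_measure X = 0%E) lebesgue_measure_itv/= lte_fin ltr01 -EFinD subr0 lee_fin.
by rewrite ler10.
Qed.

(** * The Riesz kernel and a convolution inequality *)

Section riesz_kernel.
Context {R : realType} {N : nat} (alpha : R).
Hypotheses (N0 : (0 < N)%N) (al0 : 0 < alpha) (alN : alpha < N%:R).
Local Notation E := 'rV[R]_N.
Local Notation leb := (@lebesgue_rV R N).
Local Notation k := (@riesz R N alpha).
Implicit Types (f g h K : E -> R) (x y z : E).

Lemma riesz_const_gt0 : 0 < riesz_const N alpha.
Proof.
rewrite /riesz_const divr_gt0 ?Gamma_gt0// ?divr_gt0 ?subr_gt0//.
by rewrite !mulr_gt0 ?powR_gt0 ?pi_gt0 ?Gamma_gt0 ?divr_gt0.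
Qed.

Lemma riesz_ge0 z : 0 <= k z.
Proof. by rewrite divr_ge0 ?powR_ge0// ltW// riesz_const_gt0. Qed.

Lemma rieszN z : k (- z) = k z.
Proof. by rewrite /riesz enormN. Qed.

(** A default value: a positive power of 0 is 0 and so is its inverse. Monotonicity in the distance
    therefore fails at the origin, and later comparisons exclude it. *)
Lemma riesz0 : k 0 = 0.
Proof.
have s0 : sqn (0 : E) = 0 by rewrite /sqn big1// => i _; rewrite mxE expr0n.
by rewrite /riesz enormE s0 sqrtr0 powR0 ?invr0 ?mulr0// gt_eqF// subr_gt0.
Qed.

Lemma enorm_gt0 z : (0 < enorm z) = (z != 0).
Proof.
rewrite enormE sqrtr_gt0 lt_neqAle sqn_ge0 andbT eq_sym; congr (~~ _).
apply/eqP/eqP => [h|->]; last by rewrite /sqn big1// => i _; rewrite mxE expr0n.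
apply/rowP => i; rewrite mxE; apply/eqP; rewrite -sqrf_eq0; apply/eqP.
have := h; rewrite /sqn => /eqP; rewrite psumr_eq0 => [/allP/(_ i)|j _]; last exact: sqr_ge0.
by rewrite mem_index_enum => /(_ isT)/eqP.
Qed.

Lemma riesz_le x y : x != 0 -> enorm x <= enorm y -> k y <= k x.
Proof.
move=> x0 xy; have x0' : 0 < enorm x by rewrite enorm_gt0.
rewrite /riesz ler_wpM2l ?(ltW riesz_const_gt0)// lef_pV2 ?posrE ?powR_gt0//; last exact: lt_le_trans xy.
by rewrite ge0_ler_powR ?nnegrE ?subr_ge0 ?enorm_ge0// ltW.
Qed.

Lemma riesz_gt0 z : z != 0 -> 0 < k z.
Proof. by move=> z0; rewrite divr_gt0 ?riesz_const_gt0// powR_gt0// enorm_gt0. Qed.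

Lemma measurable_riesz : measurable_fun setT k.
Proof.
rewrite (_ : k = fun z => riesz_const N alpha * (enorm z `^ (N%:R - alpha)) `^ (-1)).
  by have h := @measurable_enorm R N; meas.
by apply/funext => z; rewrite powR_inv1 ?powR_ge0.
Qed.

Lemma enorm_ball_le (r : R) : 0 < r ->
  (nnint leb (fun x => (0 < enorm x <= r)%R%:R) <= (2 ^+ N * r `^ N%:R)%:E)%E.
Proof.
move=> r0; rewrite powR_mulrn ?(ltW r0)// -exprMn -nnint_incube ?(ltW r0)//.
have h := @measurable_enorm R N.
apply: nnint_le => //; first by apply: mfb; apply: mfand; meas.
  by apply: mfb; exact: measurable_incube.
move=> x; case: (boolP (0 < enorm x <= r)) => [/andP[_ xr]|_] //.
rewrite (_ : incube r x)//; apply/incubeP => i.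
exact: le_trans (coord_le_enorm x i) xr.
Qed.

(** The b-th power of the kernel is integrable near 0 for b(N - alpha) < N and at infinity for b(N -
    alpha) > N, so the two parts need different exponents. *)
Definition near_kernel z : R := (enorm z < 1)%R%:R * k z.
Definition far_kernel z : R := (1 <= enorm z)%R%:R * k z.

Lemma near_far z : k z = near_kernel z + far_kernel z.
Proof. by rewrite /near_kernel /far_kernel; case: ltP; rewrite !(mul0r, mul1r, add0r, addr0). Qed.

Lemma near_kernel_ge0 z : 0 <= near_kernel z.
Proof. by rewrite mulr_ge0 ?riesz_ge0. Qed.
Lemma far_kernel_ge0 z : 0 <= far_kernel z.
Proof. by rewrite mulr_ge0 ?riesz_ge0. Qed.

Lemma measurable_near_kernel : measurable_fun setT near_kernel.
Proof. by have h := @measurable_enorm R N; have h' := measurable_riesz; rewrite /near_kernel; meas. Qed.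
Lemma measurable_far_kernel : measurable_fun setT far_kernel.
Proof. by have h := @measurable_enorm R N; have h' := measurable_riesz; rewrite /far_kernel; meas. Qed.

Lemma riesz_powR (b : R) z : 0 < b ->
  k z `^ b = (0 < enorm z)%R%:R * (riesz_const N alpha `^ b * enorm z `^ (- (b * (N%:R - alpha)))).
Proof.
move=> b0; rewrite enorm_gt0; case: eqVneq => [->|z0] /=.
  by rewrite riesz0 mul0r powR0// gt_eqF.
have z0' : 0 < enorm z by rewrite enorm_gt0.
rewrite mul1r /riesz powRM ?(ltW riesz_const_gt0) ?invr_ge0 ?powR_ge0//; congr (_ * _).
by rewrite -powR_inv1 ?powR_ge0// -!powRrM; congr (_ `^ _); ring.
Qed.

Lemma near_kernel_int (b : R) : 0 < b -> b * (N%:R - alpha) < N%:R ->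
  (nnint leb (fun z => (near_kernel z `^ b)%R) < +oo)%E.
Proof.
move=> b0 hb; have me_ := @measurable_enorm R N.
have h := nnint_near me_ (exprn_ge0 N (ler0n R 2)) (_ : 0 <= b * (N%:R - alpha)) hb enorm_ball_le.
have c0 := powR_ge0 (riesz_const N alpha) b.
rewrite (_ : (fun z => _) = (fun z => riesz_const N alpha `^ b *
    ((0 < enorm z < 1)%R%:R * enorm z `^ (- (b * (N%:R - alpha)))))); last first.
  apply/funext => z; rewrite /near_kernel; case: ltP => z1; rewrite ?mul1r ?mul0r ?powR0 ?gt_eqF//.
    by rewrite riesz_powR// andbT mulrCA.
  by rewrite andbF mul0r mulr0.
rewrite nnintZ//; last 2 first.
- exact: measurable_near.
- by move=> x; rewrite mulr_ge0 ?powR_ge0.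
apply: lte_mul_pinfty => //; apply: h.
by rewrite mulr_ge0 ?(ltW b0)// subr_ge0 ltW.
Qed.

Lemma far_kernel_int (b : R) : 0 < b -> N%:R < b * (N%:R - alpha) ->
  (nnint leb (fun z => (far_kernel z `^ b)%R) < +oo)%E.
Proof.
move=> b0 hb; have me_ := @measurable_enorm R N.
have h := nnint_far me_ (exprn_ge0 N (ler0n R 2)) (_ : 0 <= b * (N%:R - alpha)) hb enorm_ball_le.
have c0 := powR_ge0 (riesz_const N alpha) b.
rewrite (_ : (fun z => _) = (fun z => riesz_const N alpha `^ b *
    ((1 <= enorm z)%R%:R * enorm z `^ (- (b * (N%:R - alpha)))))); last first.
  apply/funext => z; rewrite /far_kernel; case: leP => z1; rewrite ?mul1r ?mul0r ?powR0 ?gt_eqF//.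
    by rewrite riesz_powR// (lt_le_trans ltr01 z1) mul1r.
  by rewrite mulr0.
rewrite nnintZ//; last 2 first.
- exact: measurable_far.
- by move=> x; rewrite mulr_ge0 ?powR_ge0.
apply: lte_mul_pinfty => //; apply: h.
by rewrite mulr_ge0 ?(ltW b0)// subr_ge0 ltW.
Qed.

(** With X, Y, Z the three terms on the right, K f g is X^t1 Y^t2 Z^t2 with exponents adding up to
    1, hence at most the largest of them. *)
Lemma young3 (a b f g K : R) : 1 < a -> 1 < b -> 2 / a + 1 / b = 2 ->
  0 <= f -> 0 <= g -> 0 <= K ->
  K * f * g <= f `^ a * g `^ a + f `^ a * K `^ b + g `^ a * K `^ b.
Proof.
move=> a1 b1 hab f0 g0 K0.
have a0 : 0 < a by lra.
have b0 : 0 < b by lra.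
have S0 : 0 <= f `^ a * g `^ a + f `^ a * K `^ b + g `^ a * K `^ b.
  by rewrite !addr_ge0// mulr_ge0// powR_ge0.
have [f00|fn] := eqVneq f 0; first by apply: le_trans S0; rewrite f00 mulr0 mul0r.
have [g00|gn] := eqVneq g 0; first by apply: le_trans S0; rewrite g00 mulr0.
have [K00|Kn] := eqVneq K 0; first by apply: le_trans S0; rewrite K00 !mul0r.
have fp : 0 < f by rewrite lt_neqAle eq_sym fn.
have gp : 0 < g by rewrite lt_neqAle eq_sym gn.
have Kp : 0 < K by rewrite lt_neqAle eq_sym Kn.
(* The relation between [a] and [b] says exactly that these weights reproduce the first powers of f,
   g and K. *)
pose t1 : R := 1 - 1 / b; pose t2 : R := 1 - 1 / a.
have t10 : 0 <= t1 by rewrite subr_ge0 ler_pdivrMr// mul1r ltW.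
have t20 : 0 <= t2 by rewrite subr_ge0 ler_pdivrMr// mul1r ltW.
have ia : a * (1 / a) = 1 by rewrite mulrC divfK ?gt_eqF.
have ib : b * (1 / b) = 1 by rewrite mulrC divfK ?gt_eqF.
have [e1 ef eK] : [/\ t1 + t2 + t2 = 1, a * t1 + a * t2 = 1 & b * t2 + b * t2 = 1].
  move: hab ia ib; rewrite /t1 /t2 (_ : 2 / a = 2 * (1 / a)); last by rewrite mul1r.
  move: (1 / a) (1 / b) => c d h1 h2 h3; have -> : d = 2 - 2 * c by lra.
  split; first by ring.
    by rewrite -[RHS]h2; ring.
  by rewrite -[RHS]h3 (_ : d = 2 - 2 * c); [ring|lra].
pose X := f `^ a * g `^ a; pose Y := f `^ a * K `^ b; pose Z := g `^ a * K `^ b.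
pose M := X + Y + Z.
have X0 : 0 < X by rewrite mulr_gt0 ?powR_gt0.
have Y0 : 0 < Y by rewrite mulr_gt0 ?powR_gt0.
have Z0 : 0 < Z by rewrite mulr_gt0 ?powR_gt0.
have M0 : 0 < M by rewrite !addr_gt0.
have hM : [/\ X <= M, Y <= M & Z <= M] by rewrite /M; split; lra.
have [hX hY hZ] := hM.
have XM : X `^ t1 <= M `^ t1 by apply: ge0_ler_powR; rewrite ?nnegrE ?(ltW X0) ?(ltW M0).
have YM : Y `^ t2 <= M `^ t2 by apply: ge0_ler_powR; rewrite ?nnegrE ?(ltW Y0) ?(ltW M0).
have ZM : Z `^ t2 <= M `^ t2 by apply: ge0_ler_powR; rewrite ?nnegrE ?(ltW Z0) ?(ltW M0).
have -> : K * f * g = X `^ t1 * Y `^ t2 * Z `^ t2.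
  have Xe : X `^ t1 = f `^ (a * t1) * g `^ (a * t1) by rewrite powRM ?powR_ge0// -!powRrM.
  have Ye : Y `^ t2 = f `^ (a * t2) * K `^ (b * t2) by rewrite powRM ?powR_ge0// -!powRrM.
  have Ze : Z `^ t2 = g `^ (a * t2) * K `^ (b * t2) by rewrite powRM ?powR_ge0// -!powRrM.
  have fe : f = f `^ (a * t1) * f `^ (a * t2) by rewrite -powRD ?ef ?powRr1// (gt_eqF fp) implybT.
  have ge : g = g `^ (a * t1) * g `^ (a * t2) by rewrite -powRD ?ef ?powRr1// (gt_eqF gp) implybT.
  have Ke : K = K `^ (b * t2) * K `^ (b * t2) by rewrite -powRD ?eK ?powRr1// (gt_eqF Kp) implybT.
  rewrite Xe Ye Ze [in LHS]fe [in LHS]ge [in LHS]Ke.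
  move: (f `^ _) (f `^ _) (g `^ _) (g `^ _) (K `^ _) => c1 c2 c3 c4 c5; ring.
apply: le_trans (_ : M `^ t1 * M `^ t2 * M `^ t2 <= _).
  have XYM := ler_pM (powR_ge0 X t1) (powR_ge0 Y t2) XM YM.
  by apply: (ler_pM _ _ XYM ZM); rewrite ?mulr_ge0 ?powR_ge0.
have Mn (s t : R) : (s + t == 0) ==> (M != 0) by rewrite (gt_eqF M0) implybT.
by rewrite -!(powRD (Mn _ _)) e1 powRr1 ?(ltW M0)// lexx.
Qed.

Lemma dint_factor (F : E -> E -> R) h (c : \bar R) : measurable2 F -> (forall x y, 0 <= F x y) ->
  measurable_fun setT h -> (forall x, 0 <= h x) -> (0 <= c)%E ->
  (forall x, nnint leb (F x) = (h x)%:E * c)%E -> dint F = (nnint leb h * c)%E.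
Proof.
move=> mF F0 mh h0 c0 hF; rewrite dintE// (eq_integral (fun x => (h x)%:E * c)%E) => [|x _]; last exact: hF.
rewrite ge0_integralZr//; first exact/measurable_EFinP.
by move=> x _; rewrite lee_fin.
Qed.

(** Young's convolution inequality with a sum in place of the product of norms: each term of the
    pointwise inequality misses one of the three factors, and its double integral factors by
    translation invariance. *)
Lemma Q_bound (a b : R) K f g : 1 < a -> 1 < b -> 2 / a + 1 / b = 2 ->
  measurable_fun setT K -> measurable_fun setT f -> measurable_fun setT g ->
  (forall x, 0 <= K x) -> (forall x, 0 <= f x) -> (forall x, 0 <= g x) ->
  (dint (fun x y => (K (x - y) * f y * g x)%R) <=
   nnint leb (fun x => (f x `^ a)%R) * nnint leb (fun x => (g x `^ a)%R) +
   nnint leb (fun x => (f x `^ a)%R) * nnint leb (fun x => (K x `^ b)%R) +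
   nnint leb (fun x => (g x `^ a)%R) * nnint leb (fun x => (K x `^ b)%R))%E.
Proof.
move=> a1 b1 hab mK mf mg K0 f0 g0.
have mf1 : measurable2 (fun x y => f y).
  by apply: (@measurableT_comp _ _ _ _ _ _ f) => //; exact: measurable_snd.
have mg1 : measurable2 (fun x y => g x).
  by apply: (@measurableT_comp _ _ _ _ _ _ g) => //; exact: measurable_fst.
have mK1 : measurable2 (fun x y => K (x - y)).
  by apply: (@measurableT_comp _ _ _ _ _ _ K) => //; meas.
rewrite /measurable2 in mf1 mg1 mK1.
have m12 : measurable2 (fun x y => f y `^ a * g x `^ a) by rewrite /measurable2; meas.
have m13 : measurable2 (fun x y => f y `^ a * K (x - y) `^ b) by rewrite /measurable2; meas.
have m23 : measurable2 (fun x y => g x `^ a * K (x - y) `^ b) by rewrite /measurable2; meas.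
have p0 (r s c d : R) : 0 <= r `^ s * c `^ d by rewrite mulr_ge0 ?powR_ge0.
have mfa : measurable_fun setT (fun x => f x `^ a) by meas.
have mga : measurable_fun setT (fun x => g x `^ a) by meas.
have mKb : measurable_fun setT (fun x => K x `^ b) by meas.
have q0 (h : E -> R) (r : R) x : 0 <= h x `^ r by exact: powR_ge0.
have <- : dint (fun x y => (f y `^ a * g x `^ a)%R) =
    (nnint leb (fun x => (f x `^ a)%R) * nnint leb (fun x => (g x `^ a)%R))%E.
  rewrite muleC; apply: dint_factor => // [|x]; first by apply: nnint_ge0 => z; exact: powR_ge0.
  rewrite -(nnintZ leb mfa (q0 f a) (q0 g a x)); apply: eq_nnint => y; exact: mulrC.
have <- : dint (fun x y => (g x `^ a * K (x - y) `^ b)%R) =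
    (nnint leb (fun x => (g x `^ a)%R) * nnint leb (fun x => (K x `^ b)%R))%E.
  apply: dint_factor => // [|x]; first by apply: nnint_ge0 => z; exact: powR_ge0.
  have mKx := mpres_measurable (mpres_subl x) mKb.
  rewrite -(mpres_nnint (mpres_subl x) mKb (q0 K b)).
  exact: (nnintZ leb mKx (fun y => q0 K b (x - y)) (q0 g a x)).
have <- : dint (fun x y => (f y `^ a * K (x - y) `^ b)%R) =
    (nnint leb (fun x => (f x `^ a)%R) * nnint leb (fun x => (K x `^ b)%R))%E.
  have n0 x y : 0 <= f y `^ a * K (x - y) `^ b by rewrite mulr_ge0.
  rewrite (dint_swap m13 n0).
  apply: (dint_factor (measurable2_swap m13) (fun x y => n0 y x) mfa (q0 f a)) => [|x].
    by apply: nnint_ge0 => z; exact: powR_ge0.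
  have mKx := mpres_measurable (mpres_sub x) mKb.
  rewrite -(mpres_nnint (mpres_sub x) mKb (q0 K b)).
  exact: (nnintZ leb mKx (fun y => q0 K b (y - x)) (q0 f a x)).
rewrite /dint -!nnintD//; last by move=> *; rewrite addr_ge0.
  apply: nnint_le.
  - by meas.
  - by apply: mfD => //; exact: mfD.
  - by move=> z; rewrite !mulr_ge0.
  - by move=> z; exact: young3.
exact: mfD.
Qed.

End riesz_kernel.

(** Finitely many strict linear conditions survive a small change of the variable; this perturbs
    exponents. *)
Lemma lin_open {R : realType} (s : seq (R * R)) (a : R) : all (fun c => c.1 * a < c.2) s ->
  exists2 e : R, 0 < e & forall h : R, `|h| < e -> all (fun c => c.1 * (a + h) < c.2) s.
Proof.
elim: s => [|[c d] s IH] /=; first by exists 1.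
move=> /andP[h1 /IH[e e0 he]].
have cp : 0 < `|c| + 1 by rewrite ltr_wpDl.
have g0 : 0 < (d - c * a) / (`|c| + 1) by rewrite divr_gt0 ?subr_gt0.
exists (Num.min e ((d - c * a) / (`|c| + 1))); first by rewrite lt_min e0.
move=> h; rewrite lt_min => /andP[hh1 hh2]; rewrite he// andbT.
move: hh2; rewrite ltr_pdivlMr// => hh2.
have h3 : c * h <= `|c| * `|h| by rewrite -normrM ler_norm.
have h4 := normr_ge0 h.
by rewrite mulrDr; lra.
Qed.

(** Uniform continuity of the power, valid for every positive exponent. If the smaller number is at
    least [rho] times the larger, the difference of powers is a small multiple of the larger one;
    otherwise the larger number is at most (1 - rho)^-1 times the distance. *)
Lemma powR_diff {R : realType} (p a d : R) : 0 < p -> 0 < a -> 0 < d ->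
  exists2 C : R, 0 <= C & forall s t : R, 0 <= s -> 0 <= t ->
    `|s `^ p - t `^ p| `^ a <= d * (s `^ (p * a) + t `^ (p * a)) + C * `|s - t| `^ (p * a).
Proof.
move=> p0 a0 d0; pose e : R := Num.min (d `^ a^-1) 2^-1.
have e0 : 0 < e by rewrite lt_min powR_gt0//= invr_gt0.
have e1 : e <= 2^-1 by rewrite ge_min lexx orbT.
have ed : e `^ a <= d.
  apply: (@le_trans _ _ ((d `^ a^-1) `^ a)); last by rewrite -powRrM mulVf ?gt_eqF// powRr1// ltW.
  by apply: ge0_ler_powR; rewrite ?nnegrE ?powR_ge0 ?(ltW a0) ?(ltW e0)// ge_min lexx.
have h1e : 0 < 1 - e by lra.
pose rho : R := (1 - e) `^ p^-1.
have rho0 : 0 < rho by exact: powR_gt0.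
have rhop : rho `^ p = 1 - e by rewrite /rho -powRrM mulVf ?gt_eqF// powRr1// ltW.
have rho1 : rho < 1.
  rewrite ltNge; apply/negP => h.
  have : 1 `^ p <= rho `^ p by apply: ge0_ler_powR; rewrite ?nnegrE ?(ltW p0) ?(ltW rho0).
  by rewrite powR1 rhop; lra.
have r1 : 0 < 1 - rho by lra.
pose C : R := (1 - rho)^-1 `^ (p * a).
exists C => [|s t]; first exact: powR_ge0.
wlog st : s t / s <= t.
  move=> H s0 t0; case: (leP s t) => [h|/ltW h]; first exact: H.
  by rewrite distrC [`|s - t|]distrC [s `^ _ + _]addrC; exact: H.
move=> s0 t0; have pa0 : 0 <= p * a by rewrite mulr_ge0 ?ltW.
have mono : s `^ p <= t `^ p by apply: ge0_ler_powR; rewrite ?nnegrE ?(ltW p0).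
rewrite distrC ger0_norm ?subr_ge0// [`|s - t|]distrC ger0_norm ?subr_ge0//.
have q0 (x y : R) : 0 <= x `^ y by exact: powR_ge0.
have [h|h] := leP (rho * t) s.
  apply: (@le_trans _ _ (d * t `^ (p * a))); last first.
    rewrite mulrDr; have := q0 s (p * a); have := q0 (t - s) (p * a); have := q0 (1 - rho)^-1 (p * a).
    rewrite -/C => C0 A0 B0; have := mulr_ge0 C0 A0; have := mulr_ge0 (ltW d0) B0; lra.
  have h2 : t `^ p - s `^ p <= e * t `^ p.
    have : (rho * t) `^ p <= s `^ p by apply: ge0_ler_powR; rewrite ?nnegrE ?(ltW p0) ?mulr_ge0 ?(ltW rho0).
    by rewrite powRM ?(ltW rho0)// rhop mulrBl; lra.
  apply: (@le_trans _ _ ((e * t `^ p) `^ a)).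
    by apply: ge0_ler_powR; rewrite ?nnegrE ?(ltW a0) ?subr_ge0// mulr_ge0 ?(ltW e0).
  by rewrite powRM ?(ltW e0)// -powRrM ler_wpM2r.
apply: (@le_trans _ _ (C * (t - s) `^ (p * a))); last first.
  by rewrite lerDr mulr_ge0 ?addr_ge0// ltW.
rewrite /C -powRM ?invr_ge0 ?subr_ge0 ?(ltW rho1)// powRrM; apply: ge0_ler_powR; rewrite ?nnegrE ?(ltW a0) ?subr_ge0//.
apply: (@le_trans _ _ (t `^ p)); first by rewrite lerBlDr lerDl.
apply: ge0_ler_powR; rewrite ?nnegrE ?(ltW p0)// ?mulr_ge0 ?invr_ge0 ?subr_ge0 ?(ltW rho1)//.
by rewrite mulrC ler_pdivlMr// mulrBr mulr1 mulrC; lra.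
Qed.

(** * The interaction on the energy space *)

Section choquard_energy.
Context {R : realType} {N : nat} (alpha p q : R).
Hypotheses (N0 : (0 < N)%N) (al0 : 0 < alpha) (alN : alpha < N%:R).
Hypotheses (hp : (N%:R + alpha) / N%:R < p) (hp' : p * (N%:R - 2) < N%:R + alpha).
Hypotheses (hq : (N%:R + alpha) / N%:R < q) (hq' : q * (N%:R - 2) < N%:R + alpha).
Local Notation E := 'rV[R]_N.
Local Notation leb := (@lebesgue_rV R N).
Local Notation k := (@riesz R N alpha).
Implicit Types (f g h u v : E -> R) (x y z : E).

Definition subcritical (r : R) := 2 < r /\ r * (N%:R - 2) < 2 * N%:R.

Let Np : (0 : R) < N%:R. Proof. by rewrite ltr0n. Qed.

Lemma exponent_gt1 (s : R) : (N%:R + alpha) / N%:R < s -> 1 < s.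
Proof. by apply: le_lt_trans; rewrite ler_pdivlMr// mul1r lerDl ltW. Qed.

(** At a = 2N/(N + alpha) the relation gives b = N/(N - alpha), the borderline for integrability of
    the kernel at both ends. A slightly larger a serves the near part and a slightly smaller one the
    far part. The hypotheses on p and q say that p a and q a are strictly subcritical there, which
    is an open condition. *)
Lemma exponents : exists a1 b1 a2 b2 : R,
  [/\ [/\ 1 < a1, 1 < b1, 2 / a1 + 1 / b1 = 2 & b1 * (N%:R - alpha) < N%:R],
      [/\ 1 < a2, 1 < b2, 2 / a2 + 1 / b2 = 2 & N%:R < b2 * (N%:R - alpha)],
      a1 < 2 /\ a2 < 2, subcritical (p * a1) /\ subcritical (q * a1)
    & subcritical (p * a2) /\ subcritical (q * a2)].
Proof.
pose a0 : R := 2 * N%:R / (N%:R + alpha).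
move: (Np) (al0) (alN) (hp') (hq') => Np_ al_ aN_ hp_ hq_.
have Na : 0 < N%:R + alpha by lra.
have a0E : a0 * (N%:R + alpha) = 2 * N%:R by rewrite /a0 mulfVK// gt_eqF.
have hA : [&& - 1 * a0 < - 1, 1 * a0 < 2, - p * a0 < - 2, - q * a0 < - 2,
    p * (N%:R - 2) * a0 < 2 * N%:R & q * (N%:R - 2) * a0 < 2 * N%:R].
  have a00 : 0 < a0 by rewrite divr_gt0// mulr_gt0.
  have e (s : R) : (N%:R + alpha) / N%:R < s -> - s * a0 < - 2.
    rewrite ltr_pdivrMr// => h; rewrite mulNr ltrN2 /a0 mulrA ltr_pdivlMr//; lra.
  have e' (s : R) : s * (N%:R - 2) < N%:R + alpha -> s * (N%:R - 2) * a0 < 2 * N%:R.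
    by move=> h; rewrite -a0E [X in _ < X]mulrC ltr_pM2r.
  rewrite !e// !e'// !andbT; apply/andP; split.
    by rewrite mulN1r ltrN2 /a0 ltr_pdivlMr//; lra.
  by rewrite mul1r /a0 ltr_pdivrMr//; lra.
have /lin_open[e e0 he] : all (fun c => c.1 * a0 < c.2) [:: (- 1, - 1); (1, 2); (- p, - 2); (- q, - 2);
   (p * (N%:R - 2), 2 * N%:R); (q * (N%:R - 2), 2 * N%:R)] by rewrite /= andbT.
have key (h : R) : `|h| < e -> exists a b : R, [/\ a = a0 + h, b = a / (2 * a - 2), 0 < 2 * a - 2,
     [/\ 1 < a, 1 < b, 2 / a + 1 / b = 2 & a < 2] & subcritical (p * a) /\ subcritical (q * a)].
  move=> hh; have hA' := he _ hh; rewrite /= andbT in hA'.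
  have [h1 [h2 [h3 [h4 [h5 h6]]]]] : -1 * (a0 + h) < -1 /\ 1 * (a0 + h) < 2 /\ - p * (a0 + h) < - 2 /\
     - q * (a0 + h) < - 2 /\ p * (N%:R - 2) * (a0 + h) < 2 * N%:R /\ q * (N%:R - 2) * (a0 + h) < 2 * N%:R.
    by move: hA' => /andP[-> /andP[-> /andP[-> /andP[-> /andP[-> ->]]]]].
  pose a := a0 + h; pose b := a / (2 * a - 2).
  rewrite -/a in h1 h2 h3 h4 h5 h6.
  have a1 : 1 < a by lra.
  have a2 : a < 2 by lra.
  have c0 : 0 < 2 * a - 2 by lra.
  exists a, b; split => //.
    split => //; first by rewrite /b ltr_pdivlMr//; lra.
    by rewrite /b; field; apply/andP; split; apply/negP => /eqP; lra.
  by rewrite /subcritical; split; split; lra.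
have e2 : 0 < e / 2 by rewrite divr_gt0.
have ke : `|e / 2| < e by rewrite gtr0_norm//; lra.
have ke' : `|- (e / 2)| < e by rewrite normrN.
have [a1 [b1 [A1 B1 C1 [D1 D2 D3 D4] [S1 S2]]]] := key _ ke.
have [a2 [b2 [A2 B2 C2 [F1 F2 F3 F4] [S3 S4]]]] := key _ ke'.
exists a1, b1, a2, b2; split => //; split => //.
- rewrite B1 mulrAC ltr_pdivrMr//.
  have : a0 * (N%:R + alpha) < a1 * (N%:R + alpha) by rewrite ltr_pM2r// A1 ltrDl.
  rewrite a0E; lra.
- rewrite B2 mulrAC ltr_pdivlMr//.
  have : a2 * (N%:R + alpha) < a0 * (N%:R + alpha) by rewrite ltr_pM2r// A2 gtrDl oppr_lt0.
  rewrite a0E; lra.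
Qed.

Definition riesz_form f g : \bar R := dint (fun x y => (k (x - y) * f y * g x)%R).

Lemma mul3_ge0 (a b c : R) : 0 <= a -> 0 <= b -> 0 <= c -> 0 <= a * b * c.
Proof. by move=> a0 b0 c0; apply: mulr_ge0 => //; exact: mulr_ge0. Qed.

Lemma measurable_riesz_form (K : E -> R) f g : measurable_fun setT K -> measurable_fun setT f -> measurable_fun setT g ->
  measurable2 (fun x y => K (x - y) * f y * g x).
Proof.
move=> mK mf mg.
have mf1 : measurable2 (fun x y => f y).
  by apply: (@measurableT_comp _ _ _ _ _ _ f) => //; exact: measurable_snd.
have mg1 : measurable2 (fun x y => g x).
  by apply: (@measurableT_comp _ _ _ _ _ _ g) => //; exact: measurable_fst.
have mK1 : measurable2 (fun x y => K (x - y)).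
  by apply: (@measurableT_comp _ _ _ _ _ _ K) => //; meas.
by rewrite /measurable2 in mf1 mg1 mK1 *; meas.
Qed.

Let mk : measurable_fun setT k. Proof. exact: measurable_riesz. Qed.
Let k0 z : 0 <= k z. Proof. exact: riesz_ge0. Qed.

Lemma riesz_form_ge0 f g : (forall x, 0 <= f x) -> (forall x, 0 <= g x) -> (0 <= riesz_form f g)%E.
Proof. by move=> f0 g0; apply: nnint_ge0 => z; apply: mul3_ge0; rewrite ?k0. Qed.

Lemma riesz_form_mono f g f' g' : measurable_fun setT f -> measurable_fun setT g ->
  measurable_fun setT f' -> measurable_fun setT g' ->
  (forall x, 0 <= f x) -> (forall x, 0 <= g x) -> (forall x, f x <= f' x) -> (forall x, g x <= g' x) ->
  (riesz_form f g <= riesz_form f' g')%E.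
Proof.
move=> mf mg mf' mg' f0 g0 ff gg; apply: nnint_le.
- exact: measurable_riesz_form.
- exact: measurable_riesz_form.
- by move=> z; apply: mul3_ge0; rewrite ?k0.
- move=> z; apply: ler_pM => //; [by apply: mulr_ge0; rewrite ?k0|by apply: ler_wpM2l; rewrite ?k0].
Qed.

Lemma riesz_form_addl f f' g : measurable_fun setT f -> measurable_fun setT f' -> measurable_fun setT g ->
  (forall x, 0 <= f x) -> (forall x, 0 <= f' x) -> (forall x, 0 <= g x) ->
  riesz_form (fun x => f x + f' x) g = (riesz_form f g + riesz_form f' g)%E.
Proof.
move=> mf mf' mg f0 f'0 g0; rewrite /riesz_form /dint -nnintD; last 4 first.
- exact: measurable_riesz_form.
- exact: measurable_riesz_form.
- by move=> z; apply: mul3_ge0; rewrite ?k0.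
- by move=> z; apply: mul3_ge0; rewrite ?k0.
by apply: eq_nnint => z; rewrite mulrDr mulrDl.
Qed.

Lemma riesz_formC f g : measurable_fun setT f -> measurable_fun setT g ->
  (forall x, 0 <= f x) -> (forall x, 0 <= g x) -> riesz_form f g = riesz_form g f.
Proof.
move=> mf mg f0 g0.
have n0 x y : 0 <= k (x - y) * f y * g x by apply: mul3_ge0; rewrite ?k0.
rewrite /riesz_form (dint_swap (measurable_riesz_form mk mf mg) n0); apply: eq_nnint => z.
by rewrite -(rieszN alpha (z.2 - z.1)) opprB mulrAC.
Qed.

Lemma riesz_form_scalel (c : R) f g : measurable_fun setT f -> measurable_fun setT g ->
  (forall x, 0 <= f x) -> (forall x, 0 <= g x) -> 0 <= c ->
  riesz_form (fun x => c * f x) g = (c%:E * riesz_form f g)%E.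
Proof.
move=> mf mg f0 g0 c0.
have n0 (z : E * E) : 0 <= k (z.1 - z.2) * f z.2 * g z.1 by apply: mul3_ge0; rewrite ?k0.
rewrite /riesz_form /dint -(nnintZ _ (measurable_riesz_form mk mf mg) n0 c0).
by apply: eq_nnint => z; ring.
Qed.

(** At a point x with g(x) nonzero the inner integral vanishes; the kernel is positive off y = x, so
    f vanishes almost everywhere. *)
Lemma riesz_form_eq0 f g : measurable_fun setT f -> measurable_fun setT g ->
  (forall x, 0 <= f x) -> (forall x, 0 <= g x) -> riesz_form f g = 0%E ->
  {ae leb, forall x, f x = 0} \/ {ae leb, forall x, g x = 0}.
Proof.
move=> mf mg f0 g0 h; case: (pselect {ae leb, forall x, f x = 0}) => [|nf]; [by left|right].
have n0 x y : 0 <= k (x - y) * f y * g x by apply: mul3_ge0; rewrite ?k0.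
have mF := measurable_riesz_form mk mf mg.
have m1 := measurable_nnint_inner mF n0.
move: h; rewrite /riesz_form dintE// => h.
have h2 : {ae leb, forall x, nnint leb (fun y => (k (x - y) * f y * g x)%R) = 0%E}.
  have := (ae_eq_integral_abs leb measurableT m1).1.
  rewrite (_ : integral _ _ _ = 0%E) => [/(_ erefl)|]; first by apply: filterS => x /(_ I).
  rewrite -[RHS]h; apply: eq_integral => x _; rewrite gee0_abs//; exact: nnint_ge0.
apply: filterS h2 => x hx; apply/eqP; apply: contra_notT nf => gx.
have gx0 : 0 < g x by rewrite lt_neqAle eq_sym gx g0.
have := nnint_eq0 (measurable2_inner x mF) (n0 x) hx.
move=> h1; have h3 := ae_neq x N0.
have {}h1 : {ae leb, forall y, k (x - y) * f y * g x = 0 /\ y <> x} by apply: filterS2 h1 h3.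
apply: filterS h1 => y [hy yx].
have ky : 0 < k (x - y) by apply: riesz_gt0 => //; rewrite subr_eq0 eq_sym; apply/eqP.
by move: hy => /eqP; rewrite mulf_eq0 (gt_eqF gx0) orbF mulf_eq0 (gt_eqF ky)/= => /eqP.
Qed.

Definition pint (a : R) f := nnint leb (fun x => (f x `^ a)%R).

Lemma pint_ge0 a f : (0 <= pint a f)%E.
Proof. by apply: nnint_ge0 => z; exact: powR_ge0. Qed.

Lemma ge0_finite (x : \bar R) : (0 <= x)%E -> (x < +oo)%E -> exists2 r : R, 0 <= r & x = r%:E.
Proof. by case: x => [r||] // r0 _; exists r. Qed.

Lemma riesz_form_le : exists a1 a2 kap : R, [/\ 0 <= kap, 1 < a1 < 2, 1 < a2 < 2,
  [/\ subcritical (p * a1), subcritical (q * a1), subcritical (p * a2) & subcritical (q * a2)]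
  & forall f g, measurable_fun setT f -> measurable_fun setT g ->
    (forall x, 0 <= f x) -> (forall x, 0 <= g x) ->
   (riesz_form f g <= (pint a1 f * pint a1 g + pint a1 f * kap%:E + pint a1 g * kap%:E) +
              (pint a2 f * pint a2 g + pint a2 f * kap%:E + pint a2 g * kap%:E))%E].
Proof.
have [a1 [b1 [a2 [b2 [[A1 A2 A3 A4] [B1 B2 B3 B4] [C1 C2] [S1 S2] [S3 S4]]]]]] := exponents.
have [n1 n10 e1] := ge0_finite (pint_ge0 b1 (near_kernel alpha)) (near_kernel_int al0 alN (lt_trans ltr01 A2) A4).
have [n2 n20 e2] := ge0_finite (pint_ge0 b2 (far_kernel alpha)) (far_kernel_int al0 alN (lt_trans ltr01 B2) B4).
exists a1, a2, (Num.max n1 n2); split.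
- by rewrite le_max n10.
- by rewrite A1 C1.
- by rewrite B1 C2.
- by [].
move=> f g mf mg f0 g0.
have F0 a : (0 <= pint a f)%E by exact: pint_ge0.
have G0 a : (0 <= pint a g)%E by exact: pint_ge0.
have mnk := @measurable_near_kernel R N alpha; have mfk := @measurable_far_kernel R N alpha.
have nk0 := @near_kernel_ge0 R N _ al0 alN; have fk0 := @far_kernel_ge0 R N _ al0 alN.
have m1 := measurable_riesz_form mnk mf mg; have m2 := measurable_riesz_form mfk mf mg.
have -> : riesz_form f g = (dint (fun x y => (near_kernel alpha (x - y) * f y * g x)%R) +
    dint (fun x y => (far_kernel alpha (x - y) * f y * g x)%R))%E.
  rewrite -[RHS](nnintD _ m1 m2).
  - by apply: eq_nnint => z; rewrite near_far !mulrDl.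
  - by move=> z; exact: mul3_ge0.
  - by move=> z; exact: mul3_ge0.
apply: leeD.
  apply: (le_trans (Q_bound A1 A2 A3 mnk mf mg nk0 f0 g0)); rewrite -!/(pint _ _) e1.
  by apply: leeD; [apply: leeD => //|]; apply: lee_wpmul2l => //; rewrite lee_fin le_max lexx.
apply: (le_trans (Q_bound B1 B2 B3 mfk mf mg fk0 f0 g0)); rewrite -!/(pint _ _) e2.
by apply: leeD; [apply: leeD => //|]; apply: lee_wpmul2l => //; rewrite lee_fin le_max lexx orbT.
Qed.

Lemma pint_scale (a l : R) f : measurable_fun setT f -> (forall x, 0 <= f x) -> 0 <= l ->
  pint a (fun x => l * f x) = ((l `^ a)%:E * pint a f)%E.
Proof.
move=> mf f0 l0; have mfa : measurable_fun setT (fun x => f x `^ a) by meas.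
rewrite -(nnintZ leb mfa (fun x => powR_ge0 (f x) a) (powR_ge0 l a)).
by apply: eq_nnint => x; rewrite powRM.
Qed.

(** The sum in [riesz_form_le] contains a term free of f, so smallness of f alone is not visible in
    it. Replacing f by l f and dividing by l makes that term small, after which f is taken small
    relative to l. *)
Lemma riesz_form_small : exists a1 a2 : R, [/\ 1 < a1 < 2, 1 < a2 < 2,
  [/\ subcritical (p * a1), subcritical (q * a1), subcritical (p * a2) & subcritical (q * a2)]
  & forall G e : R, 0 <= G -> 0 < e -> exists2 d : R, 0 < d &
  forall f g, measurable_fun setT f -> measurable_fun setT g ->
    (forall x, 0 <= f x) -> (forall x, 0 <= g x) ->
    (forall a, a = a1 \/ a = a2 -> (pint a f <= d%:E)%E /\ (pint a g <= G%:E)%E) -> (riesz_form f g <= e%:E)%E].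
Proof.
have [a1 [a2 [kap [k00 A1 A2 S H]]]] := riesz_form_le.
exists a1, a2; split => // G e G0 e0.
(* Makes the term without f, divided by l, at most e/4. *)
pose l : R := 1 + 4 * G * kap / e.
have l1 : 1 <= l by rewrite lerDl divr_ge0 ?(ltW e0)//; exact: mul3_ge0.
have l0 : 0 < l by exact: lt_le_trans l1.
(* Makes the terms containing f at most l e/4; the exponents are below 2, so scaling by l costs at
   most l^2. *)
pose c : R := 1 + 4 * l * (G + kap) / e.
have c0 : 0 < c.
  rewrite ltr_wpDr// divr_ge0 ?(ltW e0)//; apply: mul3_ge0 => //; [exact: ltW|exact: addr_ge0].
exists c^-1; first by rewrite invr_gt0.
move=> f g mf mg f0 g0 hfg.
have mlf : measurable_fun setT (fun x => l * f x) by meas.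
have lf0 x : 0 <= l * f x by rewrite mulr_ge0// ltW.
have key a : a = a1 \/ a = a2 -> 1 < a < 2 ->
   (pint a (fun x => l * f x)%R * pint a g + pint a (fun x => l * f x)%R * kap%:E + pint a g * kap%:E <= (l * e / 2)%:E)%E.
  move=> ha /andP[a_1 a_2]; have [h1 h2] := hfg a ha.
  have E1 : (pint a (fun x => l * f x)%R <= (l ^+ 2 * c^-1)%:E)%E.
    rewrite (pint_scale _ mf f0 (ltW l0)) EFinM.
    apply: (lee_pmul _ (pint_ge0 a f) _ h1); rewrite lee_fin ?powR_ge0//.
    by rewrite -powR_mulrn ?(ltW l0)// ler_powR// ltW.
  have E1' := pint_ge0 a (fun x => l * f x)%R.
  have E2' := pint_ge0 a g.
  have k00' : (0 <= kap%:E)%E by rewrite lee_fin.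
  have X1 := lee_pmul E1' E2' E1 h2.
  have X2 := lee_pmul E1' k00' E1 (lexx kap%:E).
  have X3 := lee_pmul E2' k00' h2 (lexx kap%:E).
  apply: (le_trans (leeD (leeD X1 X2) X3)); rewrite -!EFinM -!EFinD lee_fin.
  have h3 : 4 * G * kap <= (l - 1) * e by rewrite /l addrAC subrr add0r divfK// gt_eqF.
  have h4 : l ^+ 2 * c^-1 * (G + kap) <= l * e / 4.
    rewrite mulrAC ler_pdivrMr//.
    have -> : l * e / 4 * c = l * e / 4 + l ^+ 2 * (G + kap).
      by rewrite /c; field; rewrite gt_eqF.
    by rewrite lerDr divr_ge0// mulr_ge0 ?ltW.
  have h5 : G * kap <= l * e / 4.
    have := ltW e0; move: h3; have -> : 4 * G * kap = 4 * (G * kap) by ring.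
    by rewrite mulrBl mul1r; lra.
  rewrite -mulrDr; have -> : l * e / 2 = l * e / 4 + l * e / 4 by field.
  exact: lerD.
have hh := H _ _ mlf mg lf0 g0.
have h := le_trans hh (leeD (key a1 (or_introl erefl) A1) (key a2 (or_intror erefl) A2)).
move: h; rewrite (riesz_form_scalel mf mg f0 g0 (ltW l0)) -EFinD => h.
have := lee_pmul_div l0 h; rewrite (_ : _ / l = e)//; by field; rewrite gt_eqF.
Qed.

(** Continuity of u -> |u|^s from L^(sa) to L^a, uniform on bounded sets. *)
Lemma pint_diff (s a d0 G : R) : 0 < s -> 0 < a -> 0 < d0 -> 0 <= G -> exists2 d : R, 0 < d &
  forall u v, measurable_fun setT u -> measurable_fun setT v ->
  (pint (s * a) (fun x => `|u x|)%R <= G%:E)%E -> (pint (s * a) (fun x => `|v x|)%R <= G%:E)%E ->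
  (pint (s * a) (fun x => `|u x - v x|)%R <= d%:E)%E ->
  (pint a (fun x => `| `|u x| `^ s - `|v x| `^ s|)%R <= d0%:E)%E.
Proof.
move=> s0 a0 d00 G0; pose t : R := d0 / (4 * (G + 1)).
have t0 : 0 < t by rewrite divr_gt0// mulr_gt0// ltr_wpDl.
have [C C0 hC] := powR_diff s0 a0 t0.
exists (d0 / (2 * (C + 1))); first by rewrite divr_gt0// mulr_gt0// ltr_wpDl.
move=> u v mu_ mv hu hv huv.
have q0 (h : E -> R) (r : R) x : 0 <= `|h x| `^ r by exact: powR_ge0.
have m1 : measurable_fun setT (fun x => `|u x| `^ (s * a)) by meas.
have m2 : measurable_fun setT (fun x => `|v x| `^ (s * a)) by meas.
have m3 : measurable_fun setT (fun x => `|u x - v x| `^ (s * a)) by meas.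
have m12 : measurable_fun setT (fun x => `|u x| `^ (s * a) + `|v x| `^ (s * a)) by meas.
have m12t : measurable_fun setT (fun x => t * (`|u x| `^ (s * a) + `|v x| `^ (s * a))) by meas.
have m3C : measurable_fun setT (fun x => C * `|u x - v x| `^ (s * a)) by meas.
have n12 x : 0 <= `|u x| `^ (s * a) + `|v x| `^ (s * a) by exact: addr_ge0.
have n12t x : 0 <= t * (`|u x| `^ (s * a) + `|v x| `^ (s * a)) by rewrite mulr_ge0// ltW.
have n3C x : 0 <= C * `|u x - v x| `^ (s * a) by exact: mulr_ge0.
apply: (@le_trans _ _ (nnint leb (fun x => (t * (`|u x| `^ (s * a) + `|v x| `^ (s * a)) + C * `|u x - v x| `^ (s * a))%R))).
  apply: nnint_le; [by meas|exact: mfD|by move=> x; exact: powR_ge0|].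
  move=> x; apply: (le_trans (hC _ _ (normr_ge0 _) (normr_ge0 _))); rewrite lerD2l ler_wpM2l//.
  apply: ge0_ler_powR; rewrite ?nnegrE ?mulr_ge0 ?(ltW s0) ?(ltW a0)//.
  exact: ler_dist_dist.
rewrite (nnintD leb m12t m3C n12t n3C) (nnintZ leb m12 n12 (ltW t0)) (nnintD leb m1 m2) //.
rewrite (nnintZ leb m3 (fun x => powR_ge0 _ _) C0).
have tE : (0 <= t%:E)%E by rewrite lee_fin ltW.
have CE : (0 <= C%:E)%E by rewrite lee_fin.
apply: (le_trans (leeD (lee_wpmul2l tE (leeD hu hv)) (lee_wpmul2l CE huv))).
rewrite -[X in (X <= _)%E]/((t * (G + G) + C * (d0 / (2 * (C + 1))))%:E) lee_fin.
have h1 : t * (G + G) <= d0 / 2.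
  rewrite /t mulrAC ler_pdivrMr ?mulr_gt0 ?ltr_wpDl//.
  have -> : d0 / 2 * (4 * (G + 1)) = d0 * (G + G) + 2 * d0 by field.
  by rewrite lerDl mulr_ge0// ltW.
have h2 : C * (d0 / (2 * (C + 1))) <= d0 / 2.
  rewrite mulrA ler_pdivrMr ?mulr_gt0 ?ltr_wpDl//.
  have -> : d0 / 2 * (2 * (C + 1)) = C * d0 + d0 by field.
  by rewrite lerDl ltW.
lra.
Qed.

Definition interaction u v := riesz_form (fun y => `|u y| `^ p) (fun x => `|v x| `^ q).

Lemma pint_powR (s a : R) u : pint a (fun x => `|u x| `^ s) = pint (s * a) (fun x => `|u x|).
Proof. by apply: eq_nnint => x; rewrite powRrM. Qed.

Lemma subcritical_bound K : 0 <= K -> forall s : seq R, (forall r, r \in s -> subcritical r) ->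
  exists2 G : R, 0 <= G & forall u r, in_ball u K -> r \in s -> (pint r (fun x => `|u x|)%R <= G%:E)%E.
Proof.
move=> K0; elim=> [|r s IH] hs; first by exists 0.
have [G G0 hG] := IH (fun t ht => hs t (mem_behead (s := r :: s) ht)).
have [r2 r3] := hs r (mem_head _ _).
have [C C0 hC] := sobolev N0 (ltW r2) r3 K0.
exists (G + C); first exact: addr_ge0.
move=> u t hu; rewrite in_cons => /orP[/eqP->|ht].
  by apply: (le_trans (hC u hu)); rewrite lee_fin lerDr.
by apply: (le_trans (hG u t hu ht)); rewrite lee_fin lerDl.
Qed.

Lemma interaction_bound K : 0 <= K -> exists2 C : R, 0 <= C &
  forall u v, in_ball u K -> in_ball v K -> (interaction u v <= C%:E)%E.
Proof.
move=> K0; have [a1 [a2 [kap [k00 A1 A2 [S1 S2 S3 S4] H]]]] := riesz_form_le.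
have hs r : r \in [:: p * a1; q * a1; p * a2; q * a2] -> subcritical r.
  by rewrite !inE => /or4P[] /eqP->.
have [G G0 hG] := subcritical_bound K0 hs.
exists ((G * G + G * kap + G * kap) + (G * G + G * kap + G * kap)).
  by rewrite !addr_ge0 ?mulr_ge0.
move=> u v hu hv; have [[mu_ _] _ _] := hu; have [[mv_ _] _ _] := hv.
have mfu : measurable_fun setT (fun x => `|u x| `^ p) by meas.
have mfv : measurable_fun setT (fun x => `|v x| `^ q) by meas.
apply: (le_trans (H _ _ mfu mfv (fun x => powR_ge0 _ _) (fun x => powR_ge0 _ _))).
have k00' : (0 <= kap%:E)%E by rewrite lee_fin.
have key a : p * a \in [:: p * a1; q * a1; p * a2; q * a2] -> q * a \in [:: p * a1; q * a1; p * a2; q * a2] ->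
  (pint a (fun x => `|u x| `^ p)%R * pint a (fun x => `|v x| `^ q)%R + pint a (fun x => `|u x| `^ p)%R * kap%:E
    + pint a (fun x => `|v x| `^ q)%R * kap%:E <= (G * G + G * kap + G * kap)%:E)%E.
  move=> ha hb; rewrite !pint_powR.
  have h1 := hG _ _ hu ha; have h2 := hG _ _ hv hb.
  have P1 := pint_ge0 (p * a) (fun x => `|u x|); have P2 := pint_ge0 (q * a) (fun x => `|v x|).
  have X1 := lee_pmul P1 P2 h1 h2.
  have X2 := lee_pmul P1 k00' h1 (lexx kap%:E).
  have X3 := lee_pmul P2 k00' h2 (lexx kap%:E).
  exact: (leeD (leeD X1 X2) X3).
by rewrite EFinD; apply: leeD; apply: key; rewrite !inE eqxx ?orbT.
Qed.

Lemma interaction_ge0 u v : (0 <= interaction u v)%E.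
Proof. by apply: riesz_form_ge0 => x; exact: powR_ge0. Qed.

Lemma interaction_scale (c : R) u v : measurable_fun setT u -> measurable_fun setT v -> 0 <= c ->
  interaction (fun x => c * u x) (fun x => c * v x) = ((c `^ (p + q))%:E * interaction u v)%E.
Proof.
move=> mu_ mv c0; have [->|cn] := eqVneq c 0.
  have p1 := exponent_gt1 hp; have q1 := exponent_gt1 hq.
  have q0 : p + q != 0 by apply/eqP; lra.
  have p0 : p != 0 by apply/eqP; lra.
  rewrite powR0// mul0e /interaction /riesz_form /dint (eq_nnint _ (g := fun=> 0)) => [|z].
    by rewrite /nnint integral0.
  by rewrite mul0r normr0 powR0// mulr0 mul0r.
have mfu : measurable_fun setT (fun x => `|u x| `^ p) by meas.
have mfv : measurable_fun setT (fun x => `|v x| `^ q) by meas.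
have p0 (h : E -> R) (s : R) x : 0 <= `|h x| `^ s by exact: powR_ge0.
have n0 (z : E * E) : 0 <= k (z.1 - z.2) * `|u z.2| `^ p * `|v z.1| `^ q.
  by apply: mul3_ge0; rewrite ?k0.
rewrite /interaction /riesz_form /dint -(nnintZ _ (measurable_riesz_form mk mfu mfv) n0 (powR_ge0 _ _)); apply: eq_nnint => z.
rewrite !normrM (ger0_norm c0) !powRM// powRD; last by rewrite (negbTE cn) implybT.
ring.
Qed.

Lemma interaction_mono u v u' v' : measurable_fun setT u -> measurable_fun setT v ->
  measurable_fun setT u' -> measurable_fun setT v' ->
  (forall x, `|u x| <= `|u' x|) -> (forall x, `|v x| <= `|v' x|) -> (interaction u v <= interaction u' v')%E.
Proof.
have p1 := exponent_gt1 hp; have q1 := exponent_gt1 hq.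
move=> mu_ mv mu' mv' hu hv; apply: riesz_form_mono; try by meas.
- by move=> x; apply: ge0_ler_powR; rewrite ?nnegrE//; lra.
- by move=> x; apply: ge0_ler_powR; rewrite ?nnegrE//; lra.
Qed.

Lemma interaction_ae_eq u v u' v' : measurable_fun setT u -> measurable_fun setT v ->
  measurable_fun setT u' -> measurable_fun setT v' ->
  {ae leb, forall x, u x = u' x} -> {ae leb, forall x, v x = v' x} -> interaction u v = interaction u' v'.
Proof.
move=> mu_ mv mu' mv' hu hv.
have mF := measurable_riesz_form mk (_ : measurable_fun setT (fun x => `|u x| `^ p)) (_ : measurable_fun setT (fun x => `|v x| `^ q)).
have mF' := measurable_riesz_form mk (_ : measurable_fun setT (fun x => `|u' x| `^ p)) (_ : measurable_fun setT (fun x => `|v' x| `^ q)).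
have p0 (f g : E -> R) x y : 0 <= k (x - y) * `|f y| `^ p * `|g x| `^ q.
  by apply: mul3_ge0; rewrite ?k0 ?powR_ge0.
have {}mF : measurable2 (fun x y => k (x - y) * `|u y| `^ p * `|v x| `^ q) by apply: mF; meas.
have {}mF' : measurable2 (fun x y => k (x - y) * `|u' y| `^ p * `|v' x| `^ q) by apply: mF'; meas.
rewrite /interaction /riesz_form (dintE mF (p0 u v)) (dintE mF' (p0 u' v')).
apply: ae_eq_integral => //; [exact: measurable_nnint_inner|exact: measurable_nnint_inner|].
apply: filterS hv => x hx _; apply: nnint_ae_eq; [exact: (measurable2_inner x mF)|exact: (measurable2_inner x mF')|].
by apply: filterS hu => y hy; rewrite hx hy.
Qed.

Lemma interaction_convolution u v : measurable_fun setT u -> measurable_fun setT v ->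
  (\int[leb]_x (convolution (riesz alpha) (fun y => (`|u y| `^ p)%R) x * ((`|v x| `^ q)%R)%:E) = interaction u v)%E.
Proof.
move=> mu_ mv; have mfu : measurable_fun setT (fun x => `|u x| `^ p) by meas.
have mfv : measurable_fun setT (fun x => `|v x| `^ q) by meas.
have mF := measurable_riesz_form mk mfu mfv.
have n0 x y : 0 <= k (x - y) * `|u y| `^ p * `|v x| `^ q by apply: mul3_ge0; rewrite ?k0 ?powR_ge0.
rewrite /interaction /riesz_form dintE//; apply: eq_integral => x _; rewrite muleC /convolution.
have m1 : measurable2 (fun x y => k (x - y) * `|u y| `^ p).
  have mk1 : measurable2 (fun x y => k (x - y)).
    by apply: (@measurableT_comp _ _ _ _ _ _ k) => //; meas.
  have mf1 : measurable2 (fun x y => `|u y| `^ p).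
    by apply: (@measurableT_comp _ _ _ _ _ _ (fun y => `|u y| `^ p)) => //; exact: measurable_snd.
  exact: (mfM mk1 mf1).
have n1 y : 0 <= k (x - y) * `|u y| `^ p by apply: mulr_ge0; rewrite ?k0 ?powR_ge0.
rewrite -(nnintZ leb (measurable2_inner x m1) n1 (powR_ge0 _ _)).
by apply: eq_nnint => y; exact: mulrC.
Qed.

(** Bilinearity gives D(u',v') <= D(u,v) plus a form in | |u'|^p - |u|^p | and one in | |v'|^q -
    |v|^q |. Only this one-sided bound is needed, for limits of maximising sequences. *)
Lemma interaction_upper K e : 0 <= K -> 0 < e -> exists2 d, 0 < d & exists2 s : seq R, (forall r, r \in s -> subcritical r) &
  forall u v u' v', in_ball u K -> in_ball v K -> in_ball u' K -> in_ball v' K ->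
   (forall r, r \in s -> (pint r (fun x => `|u' x - u x|)%R <= d%:E)%E) ->
   (forall r, r \in s -> (pint r (fun x => `|v' x - v x|)%R <= d%:E)%E) ->
   (interaction u' v' <= interaction u v + e%:E)%E.
Proof.
move=> K0 e0; have p1 := exponent_gt1 hp; have q1 := exponent_gt1 hq.
have p0 : 0 < p by lra. have q0 : 0 < q by lra.
have [a1 [a2 [/andP[A1 _] /andP[A2 _] [S1 S2 S3 S4] H]]] := riesz_form_small.
pose s := [:: p * a1; q * a1; p * a2; q * a2].
have hs r : r \in s -> subcritical r by rewrite !inE => /or4P[] /eqP->.
have [G G0 hG] := subcritical_bound K0 hs.
have e2 : 0 < e / 2 by rewrite divr_gt0.
have [d0 d00 hd] := H G (e / 2) G0 e2.
have a10 : 0 < a1 by lra. have a20 : 0 < a2 by lra.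
have [d1 d10 h1] := pint_diff p0 a10 d00 G0.
have [d2 d20 h2] := pint_diff q0 a10 d00 G0.
have [d3 d30 h3] := pint_diff p0 a20 d00 G0.
have [d4 d40 h4] := pint_diff q0 a20 d00 G0.
pose d : R := Num.min (Num.min d1 d2) (Num.min d3 d4).
exists d; first by rewrite !lt_min d10 d20 d30 d40.
exists s => // u v u' v' hu hv hu' hv' du dv.
have [[mu_ _] _ _] := hu; have [[mv _] _ _] := hv.
have [[mu' _] _ _] := hu'; have [[mv' _] _ _] := hv'.
have i1 : p * a1 \in s by rewrite !inE eqxx.
have i2 : q * a1 \in s by rewrite !inE eqxx ?orbT.
have i3 : p * a2 \in s by rewrite !inE eqxx ?orbT.
have i4 : q * a2 \in s by rewrite !inE eqxx ?orbT.
have dd : [/\ d <= d1, d <= d2, d <= d3 & d <= d4] by rewrite /d !ge_min !lexx ?orbT.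
have [dd1 dd2 dd3 dd4] := dd.
have up (x y : R) (z : \bar R) : x <= y -> (z <= x%:E -> z <= y%:E)%E by move=> xy /le_trans; apply; rewrite lee_fin.
pose f x := `|u x| `^ p; pose g x := `|v x| `^ q.
pose f' x := `|u' x| `^ p; pose g' x := `|v' x| `^ q.
pose df x := `|f' x - f x|; pose dg x := `|g' x - g x|.
have mf : measurable_fun setT f by rewrite /f; meas.
have mg : measurable_fun setT g by rewrite /g; meas.
have mf' : measurable_fun setT f' by rewrite /f'; meas.
have mg' : measurable_fun setT g' by rewrite /g'; meas.
have mdf : measurable_fun setT df by rewrite /df; meas.
have mdg : measurable_fun setT dg by rewrite /dg; meas.
have f0 x : 0 <= f x by exact: powR_ge0.
have g0 x : 0 <= g x by exact: powR_ge0.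
have f'0 x : 0 <= f' x by exact: powR_ge0.
have g'0 x : 0 <= g' x by exact: powR_ge0.
have df0 x : 0 <= df x by exact: normr_ge0.
have dg0 x : 0 <= dg x by exact: normr_ge0.
have B1 : (riesz_form df g' <= (e / 2)%:E)%E.
  apply: hd => // a [->|->]; rewrite pint_powR; split; try by apply: hG.
    by apply: h1 => //; try exact: hG; apply: (up _ _ _ dd1); exact: du.
  by apply: h3 => //; try exact: hG; apply: (up _ _ _ dd3); exact: du.
have B2 : (riesz_form dg f <= (e / 2)%:E)%E.
  apply: hd => // a [->|->]; rewrite pint_powR; split; try by apply: hG.
    by apply: h2 => //; try exact: hG; apply: (up _ _ _ dd2); exact: dv.
  by apply: h4 => //; try exact: hG; apply: (up _ _ _ dd4); exact: dv.
have C1 : (riesz_form f' g' <= riesz_form f g' + riesz_form df g')%E.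
  rewrite -(riesz_form_addl mf mdf mg' f0 df0 g'0); apply: riesz_form_mono => //; first exact: mfD.
  by move=> x; rewrite /df -lerBlDl; exact: ler_norm.
have C2 : (riesz_form g' f <= riesz_form g f + riesz_form dg f)%E.
  rewrite -(riesz_form_addl mg mdg mf g0 dg0 f0); apply: riesz_form_mono => //; first exact: mfD.
  by move=> x; rewrite /dg -lerBlDl; exact: ler_norm.
rewrite /interaction -/f -/g -/f' -/g' -/f' -/g'.
rewrite (riesz_formC mf mg') // in C1; rewrite (riesz_formC mg mf)// in C2.
apply: (le_trans C1); apply: (le_trans (leeD C2 B1)).
rewrite -addeA; apply: leeD => //.
by apply: (le_trans (leeD B2 (lexx _))); rewrite -EFinD lee_fin; lra.
Qed.

End choquard_energy.

(** * Ultrafilters and extraction of subsequences *)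

Lemma ultra_eventually : exists U : set_system nat, UltraFilter U /\ forall m, U [set k | (m <= k)%N].
Proof.
have [U [UU sU]] := @ultraFilterLemma nat \oo _.
by exists U; split => // m; apply: sU; exists m.
Qed.

(** The limit is the supremum of the t for which t <= a_k on a large set; above it the ultrafilter
    contains the complementary set. *)
Lemma ultra_bounded_cvg {R : realType} (U : set_system nat) (a : nat -> R) (b : R) :
  UltraFilter U -> (forall k, `|a k| <= b) ->
  exists l : R, forall e, 0 < e -> U [set k | `|a k - l| < e].
Proof.
move=> UU ab; have PU : ProperFilter U by exact: ultra_proper.
pose S : set R := [set t | U [set k | t <= a k]].
have Sub t : S t -> t <= b.
  move=> St; rewrite leNgt; apply/negP => bt; have [k /= hk] := filter_ex St.
  by have := le_lt_trans (le_trans hk (ler_norm _)) (le_lt_trans (ab k) bt) => //; rewrite ltxx.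
have Sb : S (- b) by apply: filterE => k /=; have := ab k; rewrite ler_norml => /andP[].
have hS : has_sup S by split; [exists (- b)|exists b => t /Sub].
exists (sup S) => e e0; have [t St ht] := sup_adherent e0 hS.
have nS : ~ S (sup S + e / 2).
  move=> h; have := sup_upper_bound hS h; rewrite gerDl => h2.
  by have : 0 < e / 2 by [rewrite divr_gt0]; rewrite ltNge h2.
have [//|UC] := in_ultra_setVsetC [set k | sup S + e / 2 <= a k] UU.
apply: filterS2 St UC => k /= h1 /negP; rewrite -ltNge => h2.
by rewrite ltr_norml; apply/andP; split; lra.
Qed.

(** Large sets are closed under finite intersections, so countably many properties are met by one
    subsequence at once, in place of nested extractions and a diagonal. *)
Lemma ultra_extract (U : set_system nat) (P : nat -> nat -> Prop) :
  UltraFilter U -> (forall m, U [set k | (m <= k)%N]) -> (forall n, U [set k | P n k]) ->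
  exists phi : nat -> nat, (forall n, (phi n < phi n.+1)%N) /\ forall n i, (i <= n)%N -> P i (phi n).
Proof.
move=> UU tails hP; have PU : ProperFilter U by exact: ultra_proper.
have all_P n : U [set k | forall i, (i <= n)%N -> P i k].
  elim: n => [|n IH]; first by apply: filterS (hP 0%N) => k hk [].
  apply: filterS2 IH (hP n.+1) => k h1 h2 i; rewrite leq_eqVlt => /orP[/eqP->//|]; rewrite ltnS; exact: h1.
have ex (nm : nat * nat) : exists k, (nm.2 < k)%N /\ forall i, (i <= nm.1)%N -> P i k.
  have : U ([set k | (nm.2.+1 <= k)%N] `&` [set k | forall i, (i <= nm.1)%N -> P i k]) by exact: filterI.
  by move=> /filter_ex[k [h1 h2]]; exists k.
have [f hf] := choice ex.
exists (fix phi n := if n is m.+1 then f (m.+1, phi m) else f (0%N, 0%N)); split.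
  by move=> n; have [] := hf (n.+1, (fix phi n := if n is m.+1 then f (m.+1, phi m) else f (0%N, 0%N)) n).
by case=> [|n] i hi; [have [_] := hf (0%N, 0%N)|have [_] := hf (n.+1, (fix phi n := if n is m.+1 then f (m.+1, phi m) else f (0%N, 0%N)) n)]; exact.
Qed.

Lemma ltn_phi_ge (phi : nat -> nat) : (forall n, (phi n < phi n.+1)%N) -> forall n, (n <= phi n)%N.
Proof. by move=> h; elim=> // n IH; apply: leq_ltn_trans IH (h n). Qed.

(** * Compactness *)

Section local_compactness.
Context {R : realType} {N : nat}.
Hypothesis N0 : (0 < N)%N.
Local Notation E := 'rV[R]_N.
Local Notation leb := (@lebesgue_rV R N).
Local Notation moment := (@moment R N).
Implicit Types (u v : E -> R) (x y z : E) (e l K M h : R).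

Lemma eps_energy_sub e u v : measurable_fun setT u -> measurable_fun setT v ->
  (eps_energy e (fun x => (u x - v x)%R) <= 2%:E * eps_energy e u + 2%:E * eps_energy e v)%E.
Proof.
move=> mu_ mv; have m1 := measurable2_eps_energy e mu_; have m2 := measurable2_eps_energy e mv.
have n1 (z : E * E) := eps_energy_fun_ge0 e u z.1 z.2; have n2 (z : E * E) := eps_energy_fun_ge0 e v z.1 z.2.
have m1' := mfM (@measurable_cst _ _ (E * E)%type R setT 2) m1.
have m2' := mfM (@measurable_cst _ _ (E * E)%type R setT 2) m2.
have n1' (z : E * E) := mulr_ge0 (ler0n R 2) (n1 z); have n2' (z : E * E) := mulr_ge0 (ler0n R 2) (n2 z).
rewrite /eps_energy /dint -(nnintZ _ m1 n1 (ler0n _ 2)) -(nnintZ _ m2 n2 (ler0n _ 2)) -(nnintD _ m1' m2' n1' n2').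
apply: nnint_le.
- exact: (measurable2_eps_energy e (mfB mu_ mv)).
- exact: (mfD m1' m2').
- by move=> z; apply: mulr_ge0; [exact: ball_ind_ge0|exact: sqr_ge0].
move=> z; rewrite /cst; have := ball_ind_ge0 e z.1.
move: (u _) (u _) (v _) (v _) (ball_ind e z.1) => a b c d t t0; rewrite -subr_ge0.
rewrite (_ : _ - _ = t * ((a - b) + (c - d)) ^+ 2); last by ring.
by apply: mulr_ge0 => //; exact: sqr_ge0.
Qed.

Lemma in_ball_sub u v K : in_ball u K -> in_ball v K -> in_ball (fun x => u x - v x) (4 * K).
Proof.
move=> [Lu nu eu] [Lv nv ev]; split; first exact: L2B.
  have := n2D_le Lu (L2N Lv); rewrite n2N; lra.
move=> e e0; apply: (le_trans (eps_energy_sub e Lu.1 Lv.1)).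
have t0 : (0 <= 2%:E :> \bar R)%E by rewrite lee_fin.
apply: (le_trans (leeD (lee_wpmul2l t0 (eu e e0)) (lee_wpmul2l t0 (ev e e0)))).
by rewrite -!EFinM -EFinD lee_fin; lra.
Qed.

Lemma measurable2_eps_energy_diff e v : measurable_fun setT v -> measurable2 (fun x y => ball_ind e (y - x) * (v y - v x) ^+ 2).
Proof.
move=> mv; have mb : measurable_fun setT (fun z : E * E => ball_ind e (z.2 - z.1)).
  by apply: (@measurableT_comp _ _ _ _ _ _ (ball_ind e)); [exact: measurable_ball_ind|meas].
have mv1 : measurable_fun setT (fun z : E * E => v z.1).
  by apply: (@measurableT_comp _ _ _ _ _ _ v) => //; exact: measurable_fst.
have mv2 : measurable_fun setT (fun z : E * E => v z.2).
  by apply: (@measurableT_comp _ _ _ _ _ _ v) => //; exact: measurable_snd.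
by rewrite /measurable2; meas.
Qed.

Lemma eps_energy_diff_ge0 e v x y : 0 <= ball_ind e (y - x) * (v y - v x) ^+ 2.
Proof. by apply: mulr_ge0; [exact: ball_ind_ge0|exact: sqr_ge0]. Qed.

(** The substitution y = x + z makes the two points symmetric, as cells and reflections require. *)
Lemma eps_energy_diffE e v : measurable_fun setT v -> eps_energy e v = dint (fun x y => (ball_ind e (y - x) * (v y - v x) ^+ 2)%R).
Proof.
move=> mv; rewrite /eps_energy (dint_swap (measurable2_eps_energy e mv) (fun z x => eps_energy_fun_ge0 e v z x)).
apply: eq_dint_inner; [exact: (measurable2_swap (measurable2_eps_energy e mv))|by move=> x z; exact: eps_energy_fun_ge0|exact: measurable2_eps_energy_diff|exact: eps_energy_diff_ge0|].
move=> x; have mz := measurable2_inner x (measurable2_swap (measurable2_eps_energy e mv)).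
rewrite -(mpres_nnint (mpres_sub x) mz (fun z => eps_energy_fun_ge0 e v z x)).
by apply: eq_nnint => y; rewrite [x + _]addrC subrK.
Qed.

(** * A Poincare inequality on a grid *)

Section cells.
Variables (M : R) (L : nat).
Hypotheses (M0 : 0 < M) (L0 : (0 < L)%N).
Let h : R := 2 * M / L%:R.

Let L0' : 0 < L%:R :> R. Proof. by rewrite ltr0n. Qed.
Let h0 : 0 < h. Proof. by rewrite /h !mulr_gt0 ?invr_gt0 ?ltr0n. Qed.

(** Half-open cells of side h, so that each point of the open cube lies in exactly one. *)
Definition cell (j : {ffun 'I_N -> 'I_L}) x : bool :=
  [forall i, (- M + h * (j i)%:R <= x ord0 i) && (x ord0 i < - M + h * (j i).+1%:R)].

Definition cellf j x : R := (cell j x)%:R.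

Lemma cell_setE j : [set x | cell j x] =
  box (fun i => `[- M + h * (j i)%:R, - M + h * (j i).+1%:R[%classic).
Proof.
apply/seteqP; split => x /=; first by move=> /forallP hx i; have := hx i; rewrite /= in_itv.
by move=> hx; apply/forallP => i; have := hx i; rewrite /= in_itv.
Qed.

Lemma measurable_cell j : measurable_fun setT (cell j).
Proof.
apply: (measurable_fun_bool true) => //.
rewrite (_ : _ `&` _ = [set x | cell j x]); last by apply/seteqP; split => x //= -[].
by rewrite cell_setE; apply: measurable_box => i; exact: measurable_itv.
Qed.

Lemma nnint_cell j : nnint leb (cellf j) = (h ^+ N)%:E.
Proof.
rewrite /cellf nnint_indic; last exact: measurable_cell.
transitivity (leb (box (fun i => `[- M + h * (j i)%:R, - M + h * (j i).+1%:R[%classic))).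
  by apply: (congr1 (leb : set E -> \bar R)); exact: cell_setE.
rewrite leb_box; last by move=> i; exact: measurable_itv.
rewrite (eq_bigr (fun=> h%:E)) => [|i _].
  by rewrite prodEFin big_const_ord iter_mulr_1.
rewrite lebesgue_measure_itv/= lte_fin ltrD2l ltr_pM2l ?h0// ltr_nat ltnSn -EFinD; congr EFin.
by rewrite -natr1; ring.
Qed.

Lemma cell_uniq j j' x : cell j x -> cell j' x -> j = j'.
Proof.
move=> /forallP h1 /forallP h2; apply/ffunP => i; apply: val_inj.
have /andP[a1 a2] := h1 i; have /andP[b1 b2] := h2 i.
have c1 := le_lt_trans a1 b2; have c2 := le_lt_trans b1 a2.
move: c1 c2; rewrite !ltrD2l !ltr_pM2l ?h0// !ltr_nat !ltnS => c1 c2.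
by apply/eqP; rewrite eqn_leq c1 c2.
Qed.

Lemma cell_cover x : (forall i, `|x ord0 i| < M) -> exists j, cell j x.
Proof.
move=> hx; have ex i : exists k : 'I_L, (- M + h * k%:R <= x ord0 i) && (x ord0 i < - M + h * k.+1%:R).
  have := hx i; rewrite ltr_norml => /andP[x1 x2].
  have t0 : 0 <= (x ord0 i + M) / h by rewrite divr_ge0 ?(ltW h0)//; lra.
  have /andP[t1 t2] := truncn_itv t0.
  have tL : (Num.truncn ((x ord0 i + M) / h) < L)%N.
    rewrite -(ltr_nat R); apply: (le_lt_trans t1); rewrite ltr_pdivrMr ?h0//.
    have -> : L%:R * h = 2 * M by rewrite /h mulrC divfK// gt_eqF// ltr0n.
    lra.
  exists (Ordinal tL) => /=; move: t1 t2; rewrite ler_pdivlMr ?h0// ltr_pdivrMr ?h0// => t1 t2.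
  by apply/andP; split; rewrite [h * _]mulrC; lra.
have [f hf] := choice ex.
by exists [ffun i => f i]; apply/forallP => i; rewrite ffunE.
Qed.

(** Distinct cells are disjoint, so the sum is 0 or 1, and it is 1 only for two points of one cell,
    whose distance is less than N h. *)
Lemma cell_pair x y : \sum_j cellf j x * cellf j y <= ball_ind (N%:R * h) (y - x).
Proof.
case: (pselect (exists j, cell j x && cell j y)) => [[j /andP[jx jy]]|no]; last first.
  rewrite big1 ?ball_ind_ge0// => j _; rewrite /cellf -natrM mulnb; case: (boolP (_ && _)) => // hj.
  by case: no; exists j.
rewrite (bigD1 j)//= big1 ?addr0; last first.
  move=> j' jj'; rewrite /cellf; case: (boolP (cell j' x)) => [hx|_]; last by rewrite mul0r.
  by move: jj'; rewrite (cell_uniq hx jx) eqxx.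
rewrite /cellf jx jy mulr1 /ball_ind (_ : enorm (y - x) < N%:R * h)//.
apply: (le_lt_trans (enorm_le_sum _)).
have -> : N%:R * h = \sum_(i < N) h by rewrite sumr_const card_ord mulr_natl.
apply: ltr_sum; first by apply/hasP; exists (Ordinal N0); rewrite ?mem_index_enum.
move=> i _; rewrite !mxE; move/forallP: jx => /(_ i)/andP[a1 a2]; move/forallP: jy => /(_ i)/andP[b1 b2].
have e1 : h * (j i).+1%:R = h * (j i)%:R + h by rewrite -natr1; ring.
by rewrite e1 in a2 b2; rewrite ltr_norml; apply/andP; split; lra.
Qed.

Lemma L2_cellf j : L2 leb (cellf j).
Proof.
split; first by apply: mfb; exact: measurable_cell.
rewrite (_ : nnint _ _ = nnint leb (cellf j)); first by rewrite nnint_cell ltry.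
by apply: eq_nnint => x; rewrite /cellf; case: cell; rewrite ?expr0n ?expr1n.
Qed.

Lemma cellfK j x : cellf j x ^+ 2 = cellf j x.
Proof. by rewrite /cellf; case: cell; rewrite ?expr0n ?expr1n. Qed.

(** The double integral of squared differences over a cell is twice its volume times the integral of
    v^2, minus twice the squared integral of v. *)
Lemma cell_variance j v : L2 leb v ->
  dint (fun x y => (cellf j x * cellf j y * (v y - v x) ^+ 2)%R) =
  (2 * (h ^+ N * n2 leb (fun x => cellf j x * v x)) - 2 * ip leb v (cellf j) ^+ 2)%:E.
Proof.
move=> Lv; have mv := Lv.1; have Lc := L2_cellf j; have mc := Lc.1.
pose G x := cellf j x * v x; have mG : measurable_fun setT G by exact: mfM.
have LG : L2 leb G.
  apply: (L2_le mG Lv) => x; rewrite /G /cellf normrM; case: cell; rewrite ?normr1 ?mul1r//.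
  by rewrite normr0 mul0r.
have nc : n2 leb (cellf j) = h ^+ N.
  apply/EFin_inj; rewrite -n2E// -(nnint_cell j); apply: eq_nnint => x; exact: cellfK.
pose V := ip leb v (cellf j).
have GV : ip leb G (cellf j) = V.
  by apply: eq_Rintegral => x _; rewrite /G mulrAC -expr2 cellfK mulrC.
have mF : measurable2 (fun x y => cellf j x * cellf j y * (v y - v x) ^+ 2).
  have mc1 : measurable_fun setT (fun z : E * E => cellf j z.1).
    by apply: (@measurableT_comp _ _ _ _ _ _ (cellf j)) => //; exact: measurable_fst.
  have mc2 : measurable_fun setT (fun z : E * E => cellf j z.2).
    by apply: (@measurableT_comp _ _ _ _ _ _ (cellf j)) => //; exact: measurable_snd.
  have mv1 : measurable_fun setT (fun z : E * E => v z.1).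
    by apply: (@measurableT_comp _ _ _ _ _ _ v) => //; exact: measurable_fst.
  have mv2 : measurable_fun setT (fun z : E * E => v z.2).
    by apply: (@measurableT_comp _ _ _ _ _ _ v) => //; exact: measurable_snd.
  by rewrite /measurable2; meas.
have c0 i x : 0 <= cellf i x by exact: ler0n.
have n0 x y : 0 <= cellf j x * cellf j y * (v y - v x) ^+ 2.
  by apply: mulr_ge0; [exact: mulr_ge0|exact: sqr_ge0].
rewrite (dintE mF n0).
pose f x := (h ^+ N * (G x * G x) - 2 * V * G x * cellf j x + n2 leb G * (cellf j x * cellf j x)).
have inner x : nnint leb (fun y => (cellf j x * cellf j y * (v y - v x) ^+ 2)%R) = (f x)%:E.
  have L1 := L2B LG (L2Z (v x) Lc).
  have m1 : measurable_fun setT (fun y => (G y - v x * cellf j y) ^+ 2) by meas.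
  transitivity (nnint leb (fun y => cellf j x * (G y - v x * cellf j y) ^+ 2)).
    apply: eq_nnint => y; rewrite /G -mulrA; congr (_ * _).
    by rewrite -{1}cellfK -exprMn; congr (_ ^+ 2); ring.
  rewrite (nnintZ leb m1 (fun y => sqr_ge0 _) (c0 j x)) (n2E L1) -EFinM; congr EFin.
  have n2c : n2 leb (fun y => v x * cellf j y) = v x ^+ 2 * h ^+ N.
    by rewrite -nc; exact: n2Z.
  rewrite (n2B LG (L2Z (v x) Lc)) n2c [ip leb G _]ipC (ipZl (v x) Lc LG) [ip leb _ G]ipC GV /f /G.
  have := cellfK j x; rewrite expr2; move: (cellf j x) (v x) (n2 _ _) (h ^+ N) => c a b d hc.
  rewrite (_ : d * (c * a * (c * a)) = d * (c * c) * a ^+ 2); last by ring.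
  have e : 2 * V * (c * a) * c = 2 * V * a * (c * c) by ring.
  by rewrite e hc; ring.
have i1 := intbM LG LG; have i2 := intbM LG Lc; have i3 := intbM Lc Lc.
have j1 := intbZ (h ^+ N) i1; have j3 := intbZ (n2 leb G) i3.
have j2 : intb leb (fun x => 2 * V * G x * cellf j x).
  by have := intbZ (2 * V) i2; congr (intb _ _); apply/funext => x; rewrite mulrA.
have jf : intb leb f by exact: (intbD (intbB j1 j2) j3).
have f0 x : 0 <= f x by rewrite -lee_fin -inner; apply: nnint_ge0.
rewrite (eq_integral (fun x => (f x)%:E)) => [|x _]; last exact: inner.
rewrite -/(nnint leb f) (nnint_Rint jf f0); congr EFin.
rewrite (RintD (intbB j1 j2) j3) (RintB j1 j2) (RintZ _ i1) (RintZ _ i3).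
rewrite (_ : Rintegral _ _ (fun x => 2 * V * G x * cellf j x) = 2 * V * ip leb G (cellf j)); last first.
  by rewrite -(RintZ _ i2); apply: eq_Rintegral => x _; rewrite mulrA.
have e1 : \int[leb]_x (G x * G x) = n2 leb G by [].
have e2 : \int[leb]_x (cellf j x * cellf j x) = h ^+ N := nc.
rewrite GV e1 e2 -/G -/V; move: (n2 leb G) (h ^+ N) => a c; ring.
Qed.

Lemma poincare v : L2 leb v ->
  (nnint leb (fun x => ([forall i, `|x ord0 i| < M]%:R * v x ^+ 2)%R) <=
   ((2 * h ^+ N)^-1)%:E * eps_energy (N%:R * h) v + ((h ^+ N)^-1 * \sum_j ip leb v (cellf j) ^+ 2)%:E)%E.
Proof.
move=> Lv; have mv := Lv.1.
have hN : 0 < h ^+ N by rewrite exprn_gt0 ?h0.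
have c0 i x : 0 <= cellf i x by exact: ler0n.
have LG j : L2 leb (fun x => cellf j x * v x).
  apply: (L2_le (mfM (L2_cellf j).1 mv) Lv) => x; rewrite /cellf normrM; case: cell; rewrite ?normr1 ?mul1r//.
  by rewrite normr0 mul0r.
have mc j := (L2_cellf j).1.
have mF j : measurable2 (fun x y => cellf j x * cellf j y * (v y - v x) ^+ 2).
  have mc1 : measurable_fun setT (fun z : E * E => cellf j z.1).
    by apply: (@measurableT_comp _ _ _ _ _ _ (cellf j)) => //; exact: measurable_fst.
  have mc2 : measurable_fun setT (fun z : E * E => cellf j z.2).
    by apply: (@measurableT_comp _ _ _ _ _ _ (cellf j)) => //; exact: measurable_snd.
  have mv1 : measurable_fun setT (fun z : E * E => v z.1).
    by apply: (@measurableT_comp _ _ _ _ _ _ v) => //; exact: measurable_fst.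
  have mv2 : measurable_fun setT (fun z : E * E => v z.2).
    by apply: (@measurableT_comp _ _ _ _ _ _ v) => //; exact: measurable_snd.
  by rewrite /measurable2; meas.
have n0 j x y : 0 <= cellf j x * cellf j y * (v y - v x) ^+ 2.
  by apply: mulr_ge0; [exact: mulr_ge0|exact: sqr_ge0].
pose e : R := N%:R * h.
have mB := measurable2_eps_energy_diff e mv; have nB := @eps_energy_diff_ge0 e v; have EE := eps_energy_diffE e mv.
have S1 : (\sum_j dint (fun x y => (cellf j x * cellf j y * (v y - v x) ^+ 2)%R) <= eps_energy e v)%E.
  rewrite EE /dint -(nnint_sum _ _ mF (fun j (z : E * E) => n0 j z.1 z.2)); apply: nnint_le => //.
  - by apply: mfsum => j; exact: mF.
  - by move=> z; apply: sumr_ge0 => j _.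
  move=> z; rewrite -mulr_suml; apply: ler_wpM2r; [exact: sqr_ge0|exact: cell_pair].
have S2 : ((\sum_j (2 * (h ^+ N * n2 leb (fun x => cellf j x * v x)) - 2 * ip leb v (cellf j) ^+ 2))%:E <= eps_energy e v)%E.
  by rewrite -sumEFin; under eq_bigr do rewrite -cell_variance//.
apply: (@le_trans _ _ (\sum_j n2 leb (fun x => cellf j x * v x))%:E).
  rewrite -sumEFin; under eq_bigr => j _ do rewrite -(n2E (LG j)).
  have mj j : measurable_fun setT (fun x => (cellf j x * v x) ^+ 2) by have mcj := mc j; meas.
  rewrite -(nnint_sum _ _ mj (fun j x => sqr_ge0 _)); apply: nnint_le.
  - apply: mfM; last by meas.
    apply: mfb; rewrite (_ : (fun x => _) = fun x => \big[andb/true]_i (`|x ord0 i| < M)); last first.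
      by apply/funext => x; rewrite big_andE.
    elim: (index_enum _) => [|i s IH]; first by under eq_fun do rewrite big_nil; exact: measurable_cst.
    by under eq_fun do rewrite big_cons; apply: mfand => //; meas.
  - by apply: mfsum => j; exact: mj.
  - by move=> x; apply: mulr_ge0; [exact: ler0n|exact: sqr_ge0].
  move=> x; case: forallP => [hx|_]; last by rewrite mul0r; apply: sumr_ge0 => j _; exact: sqr_ge0.
  have [j jx] := cell_cover hx; rewrite mul1r (bigD1 j)//= {1}/cellf jx mul1r lerDl.
  by apply: sumr_ge0 => i _; exact: sqr_ge0.
have g0 : 0 < 2 * h ^+ N by rewrite mulr_gt0.
have S3 := lee_wpmul2l (_ : (0 <= ((2 * h ^+ N)^-1)%:E)%E) S2.
rewrite lee_fin invr_ge0 (ltW g0) -EFinM in S3.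
apply: (le_trans _ (leeD (S3 isT) (lexx _))); rewrite -EFinD lee_fin sumrB -!mulr_sumr.
have id3 (H a b : R) : 0 < H -> (2 * H)^-1 * (2 * (H * a) - 2 * b) + H^-1 * b = a.
  by move=> H0; field; exact: lt0r_neq0.
by rewrite id3.
Qed.

End cells.

Lemma vol_le e : 0 <= e -> vol (N := N) e <= (2 * e) ^+ N.
Proof.
move=> e0; rewrite -lee_fin -volE -nnint_incube//; apply: nnint_le.
- exact: measurable_ball_ind.
- by apply: mfb; exact: measurable_incube.
- by move=> z; exact: ball_ind_ge0.
move=> z; rewrite /ball_ind; case: ltP => hz; last exact: ler0n.
rewrite (_ : incube e z)//; apply/incubeP => i.
exact: le_trans (coord_le_enorm z i) (ltW hz).
Qed.

(** On an energy ball the energy term of [poincare] is of order h^2, since the moment at scale N h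
    is at most a multiple of h^2 h^N. Up to an error [d] the local norm is thus seen by finitely
    many functionals. *)
Lemma local_bound (M K d : R) : 0 < M -> 0 <= K -> 0 < d ->
  exists (J : finType) (F : J -> E -> R) (C : R), [/\ 0 < C, forall j, L2 leb (F j) &
  forall v, in_ball v K ->
   (nnint leb (fun x => ([forall i, `|x ord0 i| < M]%:R * v x ^+ 2)%R) <= (d + C * \sum_j ip leb v (F j) ^+ 2)%:E)%E].
Proof.
(* From moment(N h) <= (N h)^2 vol(N h) and vol(N h) <= (2 N h)^N. *)
move=> M0 K0 d0; pose c : R := N%:R ^+ 2 * (2 * N%:R) ^+ N * K.
have c0 : 0 <= c by apply: mulr_ge0 => //; apply: mulr_ge0; apply: exprn_ge0 => //; exact: mulr_ge0.
have cd : 0 <= c / d by rewrite divr_ge0// ltW.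
(* So many cells that h (1 + c/d) <= 1, hence both h <= 1 and h c <= d. *)
pose L := (Num.bound (2 * M * (1 + c / d))).+1.
have LL : 2 * M * (1 + c / d) < L%:R.
  have h : 0 <= 2 * M * (1 + c / d) by rewrite !mulr_ge0 ?(ltW M0)// addr_ge0.
  by apply: (lt_trans (archi_boundP h)); rewrite ltr_nat.
have L0 : (0 < L)%N by [].
have L0' : 0 < L%:R :> R by rewrite ltr0n.
pose h : R := 2 * M / L%:R.
have h0 : 0 < h by rewrite !mulr_gt0 ?invr_gt0.
have h1 : h * (1 + c / d) <= 1 by rewrite /h mulrAC ler_pdivrMr// mul1r ltW.
have hN : 0 < h ^+ N by rewrite exprn_gt0.
exists {ffun 'I_N -> 'I_L}, (fun j => cellf M j), (h ^+ N)^-1; split.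
- by rewrite invr_gt0.
- by move=> j; exact: L2_cellf.
move=> v [Lv _ ev]; apply: (le_trans (poincare M0 L0 Lv)); rewrite -/h EFinD; apply: leeD => //.
have Nh : 0 < N%:R * h by rewrite mulr_gt0 ?ltr0n.
have i0 : (0 <= ((2 * h ^+ N)^-1)%:E)%E by rewrite lee_fin invr_ge0 mulr_ge0// ltW.
apply: (le_trans (lee_wpmul2l i0 (ev _ Nh))); rewrite -EFinM lee_fin.
rewrite ler_pdivrMl ?mulr_gt0//.
have m1 := moment_le_vol N0 Nh; have m2 := vol_le (ltW Nh).
have m3 : moment (N%:R * h) * K <= h ^+ 2 * h ^+ N * c.
  rewrite /c; apply: (@le_trans _ _ ((N%:R * h) ^+ 2 * (2 * (N%:R * h)) ^+ N * K)); last first.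
    by rewrite [2 * (N%:R * h)]mulrA !exprMn le_eqVlt; apply/orP; left; apply/eqP; ring.
  by apply: ler_wpM2r => //; apply: (le_trans m1); apply: ler_wpM2l => //; exact: sqr_ge0.
apply: (le_trans m3).
have hc : h * c <= d.
  move: h1; rewrite mulrDr mulr1 mulrA => h1; have : h * c / d <= 1 by lra.
  by rewrite ler_pdivrMr// mul1r.
have hh1 : h <= 1 by move: h1; rewrite mulrDr mulr1; have := mulr_ge0 (ltW h0) cd; lra.
have hhc : h ^+ 2 * c <= d.
  apply: le_trans hc; rewrite expr2 -mulrA -[leRHS]mul1r.
  by apply: ler_wpM2r => //; exact: (mulr_ge0 (ltW h0) c0).
rewrite (_ : h ^+ 2 * h ^+ N * c = h ^+ N * (h ^+ 2 * c)); last by ring.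
apply: (le_trans (ler_wpM2l (ltW hN) hhc)).
have := mulr_ge0 (ltW hN) (ltW d0); rewrite -mulrA; move: (_ ^+ N * _) => t; lra.
Qed.

(** Translations preserve null sets, so for almost every pair both x and x + z avoid the exceptional
    set. *)
Lemma ae_pair (P : E -> Prop) : {ae leb, forall x, P x} ->
  {ae (leb \x leb)%E, forall w : E * E, P w.2 /\ P (w.2 + w.1)}.
Proof.
move=> [A [mA A0 sA]].
pose b (z x : E) := (x \notin A) && (x + z \notin A).
have mA' : measurable_fun setT (fun x => x \notin A).
  apply: mfneg; apply: (measurable_fun_bool true) => //.
  by rewrite (_ : _ `&` _ = A)//; apply/seteqP; split => x /=; [by move=> [_ /set_mem]|by move=> /mem_set].
have mb : measurable_fun setT (fun w : E * E => b w.1 w.2).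
  apply: mfand; first by apply: (@measurableT_comp _ _ _ _ _ _ (fun x => x \notin A)) => //; exact: measurable_snd.
  by apply: (@measurableT_comp _ _ _ _ _ _ (fun x => x \notin A)) => //; meas.
have hb z : {ae leb, forall x, b z x}.
  have a1 : {ae leb, forall x, x \notin A}.
    by exists A; split => // x /= /negP; rewrite negbK in_setE.
  have a2 := mpres_ae (mpres_add z) a1.
  by apply: filterS2 a1 a2 => x h1 h2; rewrite /b h1.
have PA x : x \notin A -> P x by rewrite notin_setE; apply: contra_notP => nP; exact: sA.
by apply: filterS (ae_ae_prod mb hb) => w /andP[h1 h2]; split; exact: PA.
Qed.

(** Local Rellich compactness. For each n the finitely many functionals of [local_bound] converge
    along the ultrafilter, which makes a large set of members pairwise 16^-n close on the n-th cube;
    the extracted subsequence then enters [riesz_fischer]. *)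
Theorem compactness (u : nat -> E -> R) K : 0 <= K -> (forall n, in_ball (u n) K) ->
  exists (phi : nat -> nat) (w : E -> R), [/\ forall n, (phi n < phi n.+1)%N, measurable_fun setT w,
   {ae leb, forall x, u (phi n) x @[n --> \oo] --> w x} &
   forall n, (nnint leb (fun x => ([forall i, `|x ord0 i| < n.+1%:R]%:R * (u (phi n) x - w x) ^+ 2)%R) <= (16^-1 ^+ n)%:E)%E].
Proof.
move=> K0 hu; have [U [UU tails]] := ultra_eventually; have PU : ProperFilter U by exact: ultra_proper.
have d0 n : 0 < 16^-1 ^+ n / 2 :> R by rewrite divr_gt0// exprn_gt0// invr_gt0.
have K40 : 0 <= 4 * K by rewrite mulr_ge0.
have stage n : exists P : nat -> Prop, U [set k | P k] /\ forall k m, P k -> P m ->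
    (nnint leb (fun x => ([forall i, `|x ord0 i| < n.+1%:R]%:R * (u k x - u m x) ^+ 2)%R) <= (16^-1 ^+ n)%:E)%E.
  have n1 : 0 < n.+1%:R :> R by rewrite ltr0n.
  have [J [F [C [C0 LF HC]]]] := local_bound n1 K40 (d0 n).
  (* The functionals differ by at most 2e, and C times their summed squares stays below half of
     16^-n; the other half is the error d. *)
  pose e : R := Num.sqrt (16^-1 ^+ n / (8 * C * (#|J|%:R + 1))).
  have J0 : 0 < #|J|%:R + 1 :> R by rewrite ltr_wpDl.
  have e0 : 0 < e by rewrite sqrtr_gt0 divr_gt0 ?mulr_gt0// exprn_gt0 ?invr_gt0.
  have e2 : 8 * C * (#|J|%:R + 1) * e ^+ 2 = 16^-1 ^+ n.
    rewrite sqr_sqrtr; last by apply: divr_ge0; [rewrite exprn_ge0 ?invr_ge0|rewrite !mulr_ge0// ltW].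
    by rewrite mulrC divfK// gt_eqF// !mulr_gt0.
  have lim j : exists l : R, forall e, 0 < e -> U [set k | `|ip leb (u k) (F j) - l| < e].
    apply: (@ultra_bounded_cvg _ U _ (Num.sqrt K * Num.sqrt (n2 leb (F j))) UU) => k.
    have [Lk nk _] := hu k; apply: (le_trans (ip_bound Lk (LF j))).
    by apply: ler_wpM2r; [exact: sqrtr_ge0|rewrite ler_sqrt].
  have [l hl] := choice lim.
  exists (fun k => forall j, `|ip leb (u k) (F j) - l j| < e); split.
    have all_s (s : seq J) : U [set k | forall j, j \in s -> `|ip leb (u k) (F j) - l j| < e].
      elim: s => [|j s IH]; first by apply: filterE => k j.
      by apply: filterS2 IH (hl j e e0) => k h1 h2 i; rewrite in_cons => /orP[/eqP->|/h1].
    by apply: filterS (all_s (enum J)) => k hk j; apply: hk; rewrite mem_enum.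
  move=> k m hk hm; apply: (le_trans (HC _ (in_ball_sub (hu k) (hu m)))); rewrite lee_fin.
  have S : \sum_j ip leb (fun x => u k x - u m x) (F j) ^+ 2 <= \sum_(j : J) 4 * e ^+ 2.
    apply: ler_sum => j _; have [Lk _ _] := hu k; have [Lm _ _] := hu m.
    rewrite (ipBl Lk Lm (LF j)).
    have := hk j; have := hm j; rewrite !ltr_norml => /andP[a1 a2] /andP[b1 b2].
    have : `|ip leb (u k) (F j) - ip leb (u m) (F j)| <= 2 * e by rewrite ler_norml; apply/andP; split; lra.
    rewrite (_ : 4 * e ^+ 2 = (2 * e) ^+ 2); last by ring.
    by move=> hh; rewrite -[leLHS]real_normK ?num_real// ler_sqr ?nnegrE ?mulr_ge0 ?(ltW e0).
  move: S; rewrite sumr_const -[(4 * e ^+ 2) *+ #|J|]mulr_natl => S.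
  have := ler_wpM2l (ltW C0) S; have := mulr_ge0 (ltW C0) (sqr_ge0 e); rewrite -e2; lra.
have [P hP] := choice stage.
have [phi [phi1 phi2]] := ultra_extract UU tails (fun n => (hP n).1).
pose B n x := [forall i : 'I_N, `|x ord0 i| < n.+1%:R :> R].
have mB n : measurable_fun setT (B n).
  rewrite (_ : B n = fun x => \big[andb/true]_i (`|x ord0 i| < n.+1%:R :> R)); last first.
    by apply/funext => x; rewrite big_andE.
  elim: (index_enum _) => [|i s IH]; first by under eq_fun do rewrite big_nil; exact: measurable_cst.
  by under eq_fun do rewrite big_cons; apply: mfand => //; meas.
have [||||w [mw cw hw]] := @riesz_fischer _ _ R leb B (fun n => u (phi n)) mB.
- by move=> n; have [[]] := hu (phi n).
- move=> n m x nm /forallP h; apply/forallP => i; apply: (lt_le_trans (h i)); by rewrite ler_nat ltnS.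
- move=> x; exists (Num.bound (enorm x)); apply/forallP => i.
  apply: (le_lt_trans (coord_le_enorm x i)); apply: (lt_trans (archi_boundP (enorm_ge0 x))).
  by rewrite ltr_nat.
- by move=> n m nm; apply: (hP n).2; [exact: phi2|exact: phi2].
by exists phi, w; split.
Qed.

End local_compactness.

(** * The energy of a pair *)

Section pair_energy.
Context {R : realType} {N : nat} (A B : R).
Hypotheses (N0 : (0 < N)%N) (A0 : 0 < A) (B0 : 0 < B).
Local Notation E := 'rV[R]_N.
Local Notation leb := (@lebesgue_rV R N).
Local Notation moment := (@moment R N).
Implicit Types (u v : E -> R) (x y z : E) (e M : R).

Definition potential u v x : R := A * u x ^+ 2 + B * v x ^+ 2.

(** The potential is spread over the ball with weight z_0^2, whose integral is [moment e]. The full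
    energy becomes a single double integral of nonnegative terms, to which Fatou's lemma applies at
    once. *)
Definition pair_eps_density e u v z x : R := ball_ind e z * ((u (x + z) - u x) ^+ 2) + ball_ind e z * ((v (x + z) - v x) ^+ 2) +
  ball_ind e z * (z ord0 (Ordinal N0) * z ord0 (Ordinal N0)) * potential u v x.

Definition pair_eps_energy e u v : \bar R := dint (pair_eps_density e u v).

Lemma potential_ge0 u v x : 0 <= potential u v x.
Proof. by rewrite addr_ge0// mulr_ge0 ?sqr_ge0// ltW. Qed.

Lemma measurable_potential u v : measurable_fun setT u -> measurable_fun setT v ->
  measurable_fun setT (potential u v).
Proof. by move=> mu_ mv; rewrite /potential; meas. Qed.

Definition third e (h : E -> R) z x : R := ball_ind e z * (z ord0 (Ordinal N0) * z ord0 (Ordinal N0)) * h x.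

Lemma third_ge0 e (h : E -> R) z x : (forall x, 0 <= h x) -> 0 <= third e h z x.
Proof. by move=> h0; apply: mulr_ge0 => //; apply: mulr_ge0; [exact: ball_ind_ge0|exact: sqr_ge0]. Qed.

Lemma measurable2_third e (h : E -> R) : measurable_fun setT h -> measurable2 (third e h).
Proof.
move=> mh; have mb : measurable_fun setT (fun w : E * E => ball_ind e w.1).
  by apply: (@measurableT_comp _ _ _ _ _ _ (ball_ind e)); [exact: measurable_ball_ind|exact: measurable_fst].
have mh1 : measurable_fun setT (fun w : E * E => h w.2).
  by apply: (@measurableT_comp _ _ _ _ _ _ h) => //; exact: measurable_snd.
by rewrite /measurable2 /third; meas.
Qed.

Lemma pair_eps_density_ge0 e u v z x : 0 <= pair_eps_density e u v z x.
Proof.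
apply: addr_ge0; first by apply: addr_ge0; exact: eps_energy_fun_ge0.
exact: (third_ge0 e z x (potential_ge0 u v)).
Qed.

Lemma measurable2_Etf e u v : measurable_fun setT u -> measurable_fun setT v -> measurable2 (pair_eps_density e u v).
Proof.
move=> mu_ mv; apply: mfD; last exact: (measurable2_third e (measurable_potential mu_ mv)).
exact: (mfD (measurable2_eps_energy e mu_) (measurable2_eps_energy e mv)).
Qed.

Lemma nnint_potential u v : L2 leb u -> L2 leb v ->
  nnint leb (potential u v) = (A * n2 leb u + B * n2 leb v)%:E.
Proof.
move=> Lu Lv; have mu_ := Lu.1; have mv := Lv.1.
have m1 : measurable_fun setT (fun x => u x ^+ 2) by meas.
have m2 : measurable_fun setT (fun x => v x ^+ 2) by meas.
have m1' : measurable_fun setT (fun x => A * u x ^+ 2) by meas.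
have m2' : measurable_fun setT (fun x => B * v x ^+ 2) by meas.
rewrite (nnintD leb m1' m2') => [|x|x]; try by rewrite mulr_ge0 ?sqr_ge0// ltW.
rewrite (nnintZ leb m1 (fun x => sqr_ge0 _) (ltW A0)) (nnintZ leb m2 (fun x => sqr_ge0 _) (ltW B0)).
by rewrite !n2E.
Qed.

Lemma pair_eps_energyE e u v : L2 leb u -> L2 leb v ->
  pair_eps_energy e u v = (eps_energy e u + eps_energy e v + (moment e * (A * n2 leb u + B * n2 leb v))%:E)%E.
Proof.
move=> Lu Lv; have mu_ := Lu.1; have mv := Lv.1.
have m1 := measurable2_eps_energy e mu_; have m2 := measurable2_eps_energy e mv.
have mp := measurable_potential mu_ mv; have m3 := measurable2_third e mp.
have p0 := potential_ge0 u v.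
rewrite /pair_eps_energy /dint (nnintD _ (mfD m1 m2) m3); last 2 first.
- by move=> w; apply: addr_ge0; exact: eps_energy_fun_ge0.
- by move=> w; exact: (third_ge0 e w.1 w.2 p0).
rewrite (nnintD _ m1 m2 (fun w => eps_energy_fun_ge0 _ _ _ _) (fun w => eps_energy_fun_ge0 _ _ _ _)); congr (_ + _)%E.
pose b z : R := ball_ind e z * (z ord0 (Ordinal N0) * z ord0 (Ordinal N0)).
have mb : measurable_fun setT b by have h := @measurable_ball_ind R N e; rewrite /b; meas.
have b0 z : 0 <= b z by apply: mulr_ge0; [exact: ball_ind_ge0|exact: sqr_ge0].
rewrite -/(dint (third e (potential u v))).
rewrite (dint_factor m3 (fun z x => third_ge0 e z x p0) mb b0 (nnint_ge0 leb p0)); last first.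
  by move=> z; rewrite -(nnintZ leb mp p0 (b0 z)).
rewrite (nnint_potential Lu Lv) (nnint_Rint _ b0); last exact: intb_ball_moment.
by rewrite -EFinM -(ball_momentE e (Ordinal N0)).
Qed.

(** By [energy_ball] and [ball_energy_le] these are exactly the pairs in H^1 of energy at most
    [M]. *)
Definition ball M u v := [/\ L2 leb u, L2 leb v & forall e, 0 < e -> (pair_eps_energy e u v <= (moment e * M)%:E)%E].

Lemma eps_energy_ge0 e u : (0 <= eps_energy e u)%E.
Proof. by apply: nnint_ge0 => w; exact: eps_energy_fun_ge0. Qed.

Lemma ball_facts M u v : ball M u v -> [/\ 0 <= M, A * n2 leb u + B * n2 leb v <= M,
  energy_le u M & energy_le v M].
Proof.
move=> [Lu Lv h]; have P : 0 <= A * n2 leb u + B * n2 leb v.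
  by apply: addr_ge0; apply: mulr_ge0; rewrite ?n2_ge0// ltW.
have m0 e : 0 < e -> 0 < moment e by exact: moment_gt0.
have h1 : A * n2 leb u + B * n2 leb v <= M.
  have := h 1 ltr01; rewrite (pair_eps_energyE 1 Lu Lv) => h1.
  have h2 : ((moment 1 * (A * n2 leb u + B * n2 leb v))%:E <= (moment 1 * M)%:E)%E.
    by apply: le_trans h1; rewrite leeDr// adde_ge0// eps_energy_ge0.
  by move: h2; rewrite lee_fin ler_pM2l ?m0.
split => //; first exact: le_trans h1.
- move=> e e0; have := h e e0; rewrite (pair_eps_energyE e Lu Lv); apply: le_trans.
  by rewrite -addeA leeDl// adde_ge0 ?eps_energy_ge0// lee_fin mulr_ge0// ltW// m0.
- move=> e e0; have := h e e0; rewrite (pair_eps_energyE e Lu Lv); apply: le_trans.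
  by rewrite [X in (X + _)%E]addeC -addeA leeDl// adde_ge0 ?eps_energy_ge0// lee_fin mulr_ge0// ltW// m0.
Qed.

Definition ball_const M : R := M * (1 + A^-1 + B^-1).

Lemma ball_const_ge0 M : 0 <= M -> 0 <= ball_const M.
Proof. by move=> M0; rewrite mulr_ge0// !addr_ge0 ?invr_ge0// ltW. Qed.

Lemma ball_in_ball M u v : ball M u v -> in_ball u (ball_const M) /\ in_ball v (ball_const M).
Proof.
move=> h; have [Lu Lv _] := h; have [M0 nn eu ev] := ball_facts h.
have n1 := n2_ge0 leb u; have n2_ := n2_ge0 leb v.
have a1 : 0 < A^-1 by rewrite invr_gt0. have b1 : 0 < B^-1 by rewrite invr_gt0.
have p1 := mulr_ge0 M0 (ltW a1); have p2 := mulr_ge0 M0 (ltW b1).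
have ball_constE : ball_const M = M + M * A^-1 + M * B^-1 by rewrite /ball_const; ring.
have MK : M <= ball_const M by rewrite ball_constE; lra.
have hA : 0 <= A * n2 leb u by rewrite mulr_ge0// ltW.
have hB : 0 <= B * n2 leb v by rewrite mulr_ge0// ltW.
have nu : n2 leb u <= M * A^-1 by rewrite ler_pdivlMr// mulrC; lra.
have nv : n2 leb v <= M * B^-1 by rewrite ler_pdivlMr// mulrC; lra.
have en (w : E -> R) : energy_le w M -> energy_le w (ball_const M).
  move=> ew e e0; apply: (le_trans (ew e e0)); rewrite lee_fin; apply: ler_wpM2l => //; exact: ltW (moment_gt0 N0 e0).
by split; split => //; [lra|exact: en|lra|exact: en].
Qed.

Lemma ball_le M M' u v : M <= M' -> ball M u v -> ball M' u v.
Proof.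
move=> MM [Lu Lv h]; split => // e e0; apply: (le_trans (h e e0)).
by rewrite lee_fin; apply: ler_wpM2l => //; exact: ltW (moment_gt0 N0 e0).
Qed.

Lemma H1_of_energy u M : L2 leb u -> energy_le u M -> H1 u.
Proof.
move=> Lu eu; have hd (d : R) : 0 < d -> exists2 e, 0 < e < d & (eps_energy e u <= (moment e * M)%:E)%E.
  move=> d0; exists (d / 2); last by apply: eu; rewrite divr_gt0.
  by apply/andP; split; lra.
have [g hg _] := wgrad_of_eps_energy N0 Lu hd.
by apply/H1P; split => //; exists g.
Qed.

Definition energy u v : R := dirichlet u + A * n2 leb u + (dirichlet v + B * n2 leb v).

Lemma energyE u v : energy u v = dirichlet u + dirichlet v + (A * n2 leb u + B * n2 leb v).
Proof. by rewrite /energy addrACA. Qed.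

Lemma energy_ge0 u v : 0 <= energy u v.
Proof. by rewrite !addr_ge0 ?dirichlet_ge0// mulr_ge0 ?n2_ge0// ltW. Qed.

Lemma H1_L2 u : H1 u -> L2 leb u. Proof. by move=> /H1P[]. Qed.

Lemma energy_ball u v : H1 u -> H1 v -> ball (energy u v) u v.
Proof.
move=> hu hv; have Lu := H1_L2 hu; have Lv := H1_L2 hv; split => // e e0.
rewrite (pair_eps_energyE e Lu Lv).
apply: (le_trans (leeD (leeD (eps_energy_le_wgrad e Lu (gradP hu)) (eps_energy_le_wgrad e Lv (gradP hv))) (lexx _))).
by rewrite -!EFinD lee_fin -!mulrDr energyE.
Qed.

(** The contrapositive of [wgrad_of_eps_energy]: averaged energies bounded by [a] at arbitrarily
    small scales would give a weak gradient of energy at most [a]. *)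
Lemma eps_energy_gt_dirichlet u (a : R) : H1 u -> a < dirichlet u ->
  exists2 d : R, 0 < d & forall e, 0 < e < d -> ((moment e * a)%:E < eps_energy e u)%E.
Proof.
move=> hu au; have Lu := H1_L2 hu.
case: (pselect (exists2 d : R, 0 < d & forall e, 0 < e < d -> ((moment e * a)%:E < eps_energy e u)%E)) => // no.
have hd (d : R) : 0 < d -> exists2 e, 0 < e < d & (eps_energy e u <= (moment e * a)%:E)%E.
  move=> d0; apply: contrapT => nd; apply: no; exists d => // e ed.
  by rewrite ltNge; apply/negP => h; apply: nd; exists e.
have [g hg] := wgrad_of_eps_energy N0 Lu hd.
by rewrite -(dirichletE hu hg) leNgt au.
Qed.

(** The bound on the averaged energy concerns the sum over both components; if the limit exceeded
    [M], a third of the excess could be left to each Dirichlet part at one small common scale. *)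
Lemma ball_energy_le M u v : ball M u v -> [/\ H1 u, H1 v & energy u v <= M].
Proof.
move=> h; have [Lu Lv hE] := h; have [M0 nn eu ev] := ball_facts h.
have hu := H1_of_energy Lu eu; have hv := H1_of_energy Lv ev; split => //.
rewrite leNgt; apply/negP => lt.
pose P := A * n2 leb u + B * n2 leb v.
pose t : R := (energy u v - M) / 3; have t0 : 0 < t by rewrite divr_gt0 ?subr_gt0.
have lt_t (w : E -> R) : dirichlet w - t < dirichlet w by rewrite gtrDl oppr_lt0.
have [d1 d10 h1] := eps_energy_gt_dirichlet hu (lt_t u).
have [d2 d20 h2] := eps_energy_gt_dirichlet hv (lt_t v).
pose e : R := Num.min d1 d2 / 2.
have dm : 0 < Num.min d1 d2 by rewrite lt_min d10.
have e0 : 0 < e by rewrite divr_gt0.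
have em : e < Num.min d1 d2 by rewrite /e; lra.
have e1 : e < d1 by apply: lt_le_trans em _; rewrite ge_min lexx.
have e2 : e < d2 by apply: lt_le_trans em _; rewrite ge_min lexx orbT.
have := hE e e0; rewrite (pair_eps_energyE e Lu Lv) leNgt => /negP; apply.
have k1 := h1 e; have k2 := h2 e; rewrite e0 e1 in k1; rewrite e0 e2 in k2.
apply: (@lt_le_trans _ _ ((moment e * (dirichlet u - t))%:E + (moment e * (dirichlet v - t))%:E + (moment e * P)%:E)%E).
  rewrite -!EFinD lte_fin -!mulrDr ltr_pM2l ?moment_gt0//.
  have : t * 3 = dirichlet u + dirichlet v + P - M by rewrite /t energyE divfK.
  have aux (a b c m r : R) : 0 < r -> r * 3 = a + b + c - m -> m < a - r + (b - r) + c by lra.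
  exact: aux.
by apply: leeD => //; apply: leeD; apply: ltW; [exact: k1|exact: k2].
Qed.

Lemma ae_cvg_pair (un : nat -> E -> R) u : {ae leb, forall x, un n x @[n --> \oo] --> u x} ->
  {ae (leb \x leb)%E, forall w : E * E, (un n w.2 @[n --> \oo] --> u w.2) /\
     (un n (w.2 + w.1) @[n --> \oo] --> u (w.2 + w.1))}.
Proof. exact: ae_pair. Qed.

(** Lower semicontinuity under almost-everywhere convergence is Fatou's lemma for differences, so no
    weak limits of gradients are taken. *)
Lemma ball_limit (un vn : nat -> E -> R) u v M : measurable_fun setT u -> measurable_fun setT v ->
  {ae leb, forall x, un n x @[n --> \oo] --> u x} -> {ae leb, forall x, vn n x @[n --> \oo] --> v x} ->
  (forall n, ball M (un n) (vn n)) -> ball M u v.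
Proof.
move=> mu_ mv cu cv h.
have mun n : measurable_fun setT (un n) by have [[]] := h n.
have mvn n : measurable_fun setT (vn n) by have [_ []] := h n.
have sq (wn : nat -> E -> R) (w : E -> R) (K : R) : measurable_fun setT w -> (forall n, in_ball (wn n) K) ->
    {ae leb, forall x, wn n x @[n --> \oo] --> w x} -> L2 leb w.
  move=> mw hw cw; split => //; have mwn n : measurable_fun setT (wn n) by have [[]] := hw n.
  apply: (@fine_le_lty _ _ K); apply: (@nnint_fatou _ _ _ leb (fun n x => wn n x ^+ 2) _ _ 0%N) => //.
  - by move=> n; have := mwn n => ?; meas.
  - by meas.
  - by move=> n x; exact: sqr_ge0.
  - by move=> x; exact: sqr_ge0.
  - by apply: filterS cw => x hx; rewrite expr2; under eq_fun do rewrite expr2; exact: cvgM.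
  by move=> n _; have [Ln nn _] := hw n; rewrite n2E// lee_fin.
have Lu : L2 leb u by apply: (sq un u (ball_const M)) => // n; have [] := ball_in_ball (h n).
have Lv : L2 leb v by apply: (sq vn v (ball_const M)) => // n; have [] := ball_in_ball (h n).
split => // e e0.
apply: (@nnint_fatou _ _ _ (leb \x leb)%E (fun n w => pair_eps_density e (un n) (vn n) w.1 w.2) _ _ 0%N).
- by move=> n; exact: measurable2_Etf.
- exact: measurable2_Etf.
- by move=> n w; exact: pair_eps_density_ge0.
- by move=> w; exact: pair_eps_density_ge0.
- apply: filterS2 (ae_cvg_pair cu) (ae_cvg_pair cv) => w [c1 c2] [c3 c4].
  have sqc (f : nat -> R) (l : R) : f n @[n --> \oo] --> l -> f n ^+ 2 @[n --> \oo] --> l ^+ 2.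
    by move=> hf; under eq_fun do rewrite expr2; exact: cvgM.
  have cst_ (c : R) : (fun n : nat => c) @ \oo --> c by exact: cvg_cst.
  apply: cvgD; first by apply: cvgD; apply: cvgM => //; apply: sqc; exact: cvgB.
  apply: cvgM => //; apply: cvgD; by apply: cvgM => //; exact: sqc.
- by move=> n _; have [_ _ ] := h n; exact.
Qed.

Lemma pair_eps_energy_scale (c e : R) u v : measurable_fun setT u -> measurable_fun setT v ->
  pair_eps_energy e (fun x => c * u x) (fun x => c * v x) = ((c ^+ 2)%:E * pair_eps_energy e u v)%E.
Proof.
move=> mu_ mv; rewrite /pair_eps_energy /dint.
rewrite -(nnintZ _ (measurable2_Etf e mu_ mv) (fun w => pair_eps_density_ge0 e u v w.1 w.2) (sqr_ge0 c)).
by apply: eq_nnint => w; rewrite /pair_eps_density /potential; move: (ball_ind e _) (_ ord0 _) => b t; ring.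
Qed.

Lemma ball_scale (c M : R) u v : ball M u v -> ball (c ^+ 2 * M) (fun x => c * u x) (fun x => c * v x).
Proof.
move=> [Lu Lv h]; split; [exact: L2Z|exact: L2Z|].
move=> e e0; rewrite (pair_eps_energy_scale c e Lu.1 Lv.1) (_ : moment e * _ = c ^+ 2 * (moment e * M)); last by ring.
by rewrite [leRHS]EFinM; apply: lee_wpmul2l; [rewrite lee_fin sqr_ge0|exact: h].
Qed.

Lemma ball_abs M u v : ball M u v -> ball M (fun x => `|u x|) (fun x => `|v x|).
Proof.
move=> [Lu Lv h]; have mu_ := Lu.1; have mv := Lv.1.
have mau : measurable_fun setT (fun x => `|u x|) by meas.
have mav : measurable_fun setT (fun x => `|v x|) by meas.
split; [by apply: (L2_le mau Lu) => x; rewrite normr_id|by apply: (L2_le mav Lv) => x; rewrite normr_id|].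
move=> e e0; apply: le_trans (h e e0); apply: nnint_le.
- exact: measurable2_Etf.
- exact: measurable2_Etf.
- by move=> w; exact: pair_eps_density_ge0.
have sq (a b : R) : (`|a| - `|b|) ^+ 2 <= (a - b) ^+ 2.
  rewrite -[leLHS]real_normK ?num_real// -[leRHS]real_normK ?num_real//.
  by rewrite ler_sqr ?nnegrE//; exact: ler_dist_dist.
move=> w; apply: lerD; last by rewrite /potential !real_normK ?num_real.
by apply: lerD; apply: ler_wpM2l; rewrite ?ball_ind_ge0.
Qed.

End pair_energy.

(** * Polarization *)

Section rearrangement_inequalities.
Context {R : realType}.
Implicit Types p q a b : R.

(** Two-point rearrangement: ordering both pairs alike moves product mass to the larger weight, and
    the gain is (a - b) times the product of the two gaps. *)
Lemma rearr_prod (p p' q q' a b : R) : b <= a ->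
  a * (p * q + p' * q') + b * (p' * q + p * q') <=
  a * (Num.max p p' * Num.max q q' + Num.min p p' * Num.min q q') +
  b * (Num.min p p' * Num.max q q' + Num.max p p' * Num.min q q').
Proof.
move=> ba; have ab : 0 <= a - b by rewrite subr_ge0.
case: (leP p p') => h1; case: (leP q q') => h2.
- have -> : p' * q' + p * q = p * q + p' * q' by ring.
  by have -> : p * q' + p' * q = p' * q + p * q' by ring.
- have h3 : 0 <= (a - b) * ((p' - p) * (q - q')).
    by apply: mulr_ge0 => //; apply: mulr_ge0; rewrite subr_ge0// ltW.
  rewrite -subr_ge0; apply: (le_trans h3); rewrite le_eqVlt; apply/orP; left; apply/eqP; ring.
- have h3 : 0 <= (a - b) * ((p - p') * (q' - q)).
    by apply: mulr_ge0 => //; apply: mulr_ge0; rewrite subr_ge0// ltW.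
  rewrite -subr_ge0; apply: (le_trans h3); rewrite le_eqVlt; apply/orP; left; apply/eqP; ring.
- by [].
Qed.

Lemma prod_expand (a b p p' q q' P P' Q Q' : R) :
  a * (p * q + p' * q') + b * (p' * q + p * q') <= a * (P * Q + P' * Q') + b * (P' * Q + P * Q') ->
  a * p * q + a * p' * q' + (b * p * q' + b * p' * q) <= a * P * Q + a * P' * Q' + (b * P * Q' + b * P' * Q).
Proof.
have e (c d x x' y y' : R) : c * x * y + c * x' * y' + (d * x * y' + d * x' * y) =
  c * (x * y + x' * y') + d * (x' * y + x * y') by ring.
by rewrite !e.
Qed.

(** Sorting preserves the sum of the two squares, so the weighted mass changes by the difference of
    weights times the exchanged mass. *)
Lemma weight_exchange (P P' p p' Q Q' q q' r r' : R) :
  P ^+ 2 + P' ^+ 2 = p ^+ 2 + p' ^+ 2 -> Q ^+ 2 + Q' ^+ 2 = q ^+ 2 + q' ^+ 2 ->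
  (p ^+ 2 + q ^+ 2) * r + (p' ^+ 2 + q' ^+ 2) * r' - ((P ^+ 2 + Q ^+ 2) * r + (P' ^+ 2 + Q' ^+ 2) * r') =
  (r' - r) * ((P ^+ 2 - p ^+ 2) + (Q ^+ 2 - q ^+ 2)).
Proof.
move=> h1 h2; have -> : p' ^+ 2 = P ^+ 2 + P' ^+ 2 - p ^+ 2 by lra.
have -> : q' ^+ 2 = Q ^+ 2 + Q' ^+ 2 - q ^+ 2 by lra.
ring.
Qed.

Lemma max_min_sqr (p p' : R) : Num.max p p' ^+ 2 + Num.min p p' ^+ 2 = p ^+ 2 + p' ^+ 2.
Proof. by case: (leP p p') => _ //; rewrite addrC. Qed.

(** Expanding leaves sums of squares, which sorting preserves, and minus twice the products of
    [rearr_prod]. *)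
Lemma rearr_sqr (p p' q q' a b : R) : b <= a ->
  a * ((Num.max q q' - Num.max p p') ^+ 2 + (Num.min q q' - Num.min p p') ^+ 2) +
  b * ((Num.max q q' - Num.min p p') ^+ 2 + (Num.min q q' - Num.max p p') ^+ 2) <=
  a * ((q - p) ^+ 2 + (q' - p') ^+ 2) + b * ((q - p') ^+ 2 + (q' - p) ^+ 2).
Proof.
move=> ba; have h := rearr_prod p p' q q' ba.
have h1 := max_min_sqr p p'; have h2 := max_min_sqr q q'.
move: h h1 h2; move: (Num.max p p') (Num.min p p') (Num.max q q') (Num.min q q') => P P' Q Q' h h1 h2.
have e1 : a * ((Q - P) ^+ 2 + (Q' - P') ^+ 2) + b * ((Q - P') ^+ 2 + (Q' - P) ^+ 2) =
   (a + b) * ((P ^+ 2 + P' ^+ 2) + (Q ^+ 2 + Q' ^+ 2)) - 2 * (a * (P * Q + P' * Q') + b * (P' * Q + P * Q')) by ring.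
have e2 : a * ((q - p) ^+ 2 + (q' - p') ^+ 2) + b * ((q - p') ^+ 2 + (q' - p) ^+ 2) =
   (a + b) * ((p ^+ 2 + p' ^+ 2) + (q ^+ 2 + q' ^+ 2)) - 2 * (a * (p * q + p' * q') + b * (p' * q + p * q')) by ring.
by rewrite e1 e2 h1 h2 lerD2l lerN2 ler_pM2l.
Qed.

End rearrangement_inequalities.

(** * Polarizers and four-point inequalities *)

Section polarization.
Context {R : realType} {N : nat}.
Hypothesis N0 : (0 < N)%N.
Local Notation E := 'rV[R]_N.
Local Notation leb := (@lebesgue_rV R N).
Implicit Types (u v f g a : E -> R) (s : E -> E) (x y z : E).

(* [a] is proportional to the signed distance to a hyperplane missing the origin,
   positive on the side of the origin, and [s] is the reflection in it. *)
Definition polarizer s a := [/\ mpres s, measurable_fun setT a, involutive s,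
  forall x y, sqn (s x - s y) = sqn (x - y) &
  (exists2 c : R, 0 < c & forall x y, sqn (x - s y) - sqn (x - y) = c * (a x * a y)) /\
  (exists2 c : R, 0 < c & forall x, sqn (s x) - sqn x = c * a x)].

Definition polar s a u x : R :=
  if 0 <= a x then Num.max (u x) (u (s x)) else Num.min (u x) (u (s x)).

Lemma sqn_eq0 z : sqn z = 0 -> z = 0.
Proof.
move=> h; apply/eqP; apply/negPn/negP; rewrite -enorm_gt0 => h1.
by move: (exprn_gt0 2 h1); rewrite enorm_sqr h ltxx.
Qed.

Lemma sqn_sub_sym x y : sqn (x - y) = sqn (y - x).
Proof. by rewrite -sqnN opprB. Qed.

Lemma ball_ind_mono (e : R) x y : sqn x <= sqn y -> ball_ind e y <= ball_ind e x.
Proof.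
move=> h; rewrite /ball_ind; case: (ltP (enorm y) e) => hy; last exact: ler0n.
by rewrite (_ : enorm x < e)//; apply: le_lt_trans hy; rewrite ler_enorm.
Qed.

Lemma ball_ind_sqn (e : R) x y : sqn x = sqn y -> ball_ind e x = ball_ind e y.
Proof. by move=> h; apply/eqP; rewrite eq_le !ball_ind_mono// h. Qed.

Lemma riesz_sqn (al : R) x y : sqn x = sqn y -> riesz al x = riesz al y.
Proof. by move=> h; rewrite /riesz !enormE h. Qed.

Section fixed_polarizer.
Variables (s : E -> E) (a : E -> R).
Hypothesis H : polarizer s a.

Let ms : mpres s. Proof. by case: H. Qed.
Let ma : measurable_fun setT a. Proof. by case: H. Qed.
Let sK : involutive s. Proof. by case: H. Qed.
Let iso x y : sqn (s x - s y) = sqn (x - y). Proof. by case: H. Qed.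

(** The second-moment identity at x and at s x has opposite left sides. *)
Lemma polarizer_neg x : a (s x) = - a x.
Proof.
have [_ _ _ _ [_ [c c0 h]]] := H.
have h1 := h x; have := h (s x); rewrite sK => h2.
have : c * (a (s x) + a x) = 0 by rewrite mulrDr; lra.
by move/eqP; rewrite mulf_eq0 (gt_eqF c0)/= addr_eq0 => /eqP.
Qed.

Lemma polarizer_fix x : a x = 0 -> s x = x.
Proof.
have [_ _ _ _ [[c c0 h] _]] := H; move=> ax; have := h x x.
rewrite subrr (_ : sqn 0 = 0) ?subr0; last by rewrite /sqn big1// => i _; rewrite mxE expr0n.
by rewrite ax mul0r mulr0 => /sqn_eq0/eqP; rewrite subr_eq0 => /eqP.
Qed.

(** Covers the hyperplane as well: there s x = x, so maximum and minimum coincide and the two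
    branches agree. *)
Lemma polar_at u x : 0 <= a x ->
  polar s a u x = Num.max (u x) (u (s x)) /\ polar s a u (s x) = Num.min (u x) (u (s x)).
Proof.
move=> ax; rewrite /polar ax; split => //; rewrite polarizer_neg oppr_ge0 sK.
case: (leP (a x) 0) => h; last by rewrite minC.
have a0 : a x = 0 by apply/eqP; rewrite eq_le h ax.
by rewrite (polarizer_fix a0) maxxx minxx.
Qed.

Lemma polarizer_closer x y : 0 <= a x -> 0 <= a y -> sqn (x - y) <= sqn (x - s y).
Proof.
have [_ _ _ _ [[c c0 h] _]] := H; move=> ax ay.
by rewrite -subr_ge0 h mulr_ge0 ?mulr_ge0// ltW.
Qed.

Lemma polarizer_cross x y : sqn (s x - y) = sqn (x - s y).
Proof. by rewrite -(iso (s x) y) sK. Qed.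

(** Symmetrisation over the reflections of either variable. *)
Definition sum4 (F : E -> E -> R) x y := F x y + F (s x) (s y) + (F (s x) y + F x (s y)).

(** The symmetrised function is unchanged when x or y is reflected, so both points may be taken on
    the side of the origin. *)
Lemma sum4_wlog (F G : E -> E -> R) (P : E -> E -> Prop) :
  (forall x y, P x y -> P (s x) y /\ P x (s y)) ->
  (forall x y, 0 <= a x -> 0 <= a y -> P x y -> sum4 F x y <= sum4 G x y) ->
  forall x y, P x y -> sum4 F x y <= sum4 G x y.
Proof.
move=> hP h; have sx (F' : E -> E -> R) x y : sum4 F' (s x) y = sum4 F' x y.
  by rewrite /sum4 sK; ring.
have sy (F' : E -> E -> R) x y : sum4 F' x (s y) = sum4 F' x y.
  by rewrite /sum4 sK; ring.
have h1 x y : 0 <= a y -> P x y -> sum4 F x y <= sum4 G x y.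
  move=> ay Pxy; have [ax|ax] := leP 0 (a x); first exact: h.
  rewrite -(sx F) -(sx G); apply: h => //; last by have [] := hP _ _ Pxy.
  by rewrite polarizer_neg oppr_ge0 ltW.
move=> x y Pxy; have [ay|ay] := leP 0 (a y); first exact: h1.
rewrite -(sy F) -(sy G); apply: h1 => //; last by have [] := hP _ _ Pxy.
by rewrite polarizer_neg oppr_ge0 ltW.
Qed.

Lemma ereal_4_le (x y : \bar R) : (0 <= x)%E -> (0 <= y)%E ->
  (x + x + (x + x) <= y + y + (y + y))%E -> (x <= y)%E.
Proof.
case: x => [r||]; case: y => [t||] //; first by rewrite -!EFinD !lee_fin => _ _ ?; lra.
by move=> *; rewrite leey.
Qed.

Lemma nnint_sum4 (F : E -> E -> R) : measurable2 F -> (forall x y, 0 <= F x y) ->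
  measurable2 (sum4 F) /\ dint (sum4 F) = (dint F + dint F + (dint F + dint F))%E.
Proof.
move=> mF F0.
have m1 : measurable2 (fun x y => F (s x) y).
  apply: (@measurableT_comp _ _ _ _ _ _ (fun w : E * E => F w.1 w.2) _ (fun w : E * E => (s w.1, w.2))) => //.
  apply/measurable_fun_pairP; split; last exact: measurable_snd.
  by apply: (measurableT_comp ms.1); exact: measurable_fst.
have m2' F' : measurable2 F' -> measurable2 (fun x y => F' x (s y)).
  move=> mF'.
  apply: (@measurableT_comp _ _ _ _ _ _ (fun w : E * E => F' w.1 w.2) _ (fun w : E * E => (w.1, s w.2))) => //.
  apply/measurable_fun_pairP; split; first exact: measurable_fst.
  by apply: (measurableT_comp ms.1); exact: measurable_snd.
have m2 := m2' F mF; have m3 := m2' _ m1.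
split; first exact: (mfD (mfD mF m3) (mfD m1 m2)).
have p1 (w : E * E) : 0 <= F w.1 w.2 + F (s w.1) (s w.2) by exact: addr_ge0.
have p2 (w : E * E) : 0 <= F (s w.1) w.2 + F w.1 (s w.2) by exact: addr_ge0.
rewrite /dint (nnintD _ (mfD mF m3) (mfD m1 m2) p1 p2).
rewrite (nnintD _ mF m3 (fun w : E * E => F0 w.1 w.2) (fun w : E * E => F0 (s w.1) (s w.2))).
rewrite (nnintD _ m1 m2 (fun w : E * E => F0 (s w.1) w.2) (fun w : E * E => F0 w.1 (s w.2))).
have e1 := dint_mpres1 ms mF F0; have e2 := dint_mpres2 ms mF F0.
have e3 := dint_mpres2 ms m1 (fun x y => F0 (s x) y).
by rewrite /dint in e1 e2 e3; rewrite e3 e1 e2.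
Qed.

(** Reflections preserve the measure, so the symmetrised integral is four times the original one.
    The predicate [b] discards a null set of pairs where the pointwise comparison may fail. *)
Lemma dint_sum4_le (F G : E -> E -> R) (b : E -> E -> bool) : measurable2 F -> (forall x y, 0 <= F x y) ->
  measurable2 G -> (forall x y, 0 <= G x y) ->
  measurable_fun setT (fun w : E * E => b w.1 w.2) -> (forall x, {ae leb, forall y, b x y}) ->
  (forall x y, b x y -> sum4 F x y <= sum4 G x y) -> (dint F <= dint G)%E.
Proof.
move=> mF F0 mG G0 mb hb h.
have [mF4 eF] := nnint_sum4 mF F0; have [mG4 eG] := nnint_sum4 mG G0.
apply: ereal_4_le; [by apply: nnint_ge0 => w|by apply: nnint_ge0 => w|].
rewrite -eF -eG; apply: nnint_ae_le => //.
- by move=> w; rewrite /sum4 !addr_ge0.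
- by move=> w; rewrite /sum4 !addr_ge0.
by apply: filterS (ae_ae_prod mb hb) => w; exact: h.
Qed.

Lemma measurable_polar u : measurable_fun setT u -> measurable_fun setT (polar s a u).
Proof.
move=> mu_; have mus : measurable_fun setT (fun x => u (s x)) by exact: (mpres_measurable ms mu_).
apply: mfif; by meas.
Qed.

(** For two points on the same side, y is nearer to x than to its mirror image, so the ball
    indicator provides the ordered weights of [rearr_sqr]. *)
Lemma eps_energy_polar e u : measurable_fun setT u -> (eps_energy e (polar s a u) <= eps_energy e u)%E.
Proof.
move=> mu_; have mp := measurable_polar mu_; rewrite (eps_energy_diffE e mp) (eps_energy_diffE e mu_).
apply: (@dint_sum4_le _ _ (fun _ _ => true)) => //.
- exact: measurable2_eps_energy_diff.
- by move=> x y; exact: eps_energy_diff_ge0.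
- exact: measurable2_eps_energy_diff.
- by move=> x y; exact: eps_energy_diff_ge0.
- by move=> x; exact: nearW.
move=> x y _.
apply: (@sum4_wlog _ _ (fun _ _ => True)) => // {}x {}y ax ay _.
have [Px Psx] := polar_at u ax; have [Py Psy] := polar_at u ay.
have b1 : ball_ind e (s y - s x) = ball_ind e (y - x) by apply: ball_ind_sqn; exact: iso.
have b2 : ball_ind e (y - s x) = ball_ind e (s y - x) by apply: ball_ind_sqn; rewrite -(polarizer_cross y x).
have b3 : ball_ind e (s y - x) <= ball_ind e (y - x).
  by apply: ball_ind_mono; rewrite sqn_sub_sym [leRHS]sqn_sub_sym; exact: polarizer_closer.
have := rearr_sqr (u x) (u (s x)) (u y) (u (s y)) b3.
by rewrite /sum4 Px Psx Py Psy b1 b2 -!mulrDr.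
Qed.

Lemma n2_polar u : L2 leb u -> L2 leb (polar s a u) /\ n2 leb (polar s a u) = n2 leb u.
Proof.
move=> Lu; have mu_ := Lu.1; have mp := measurable_polar mu_.
have m1 : measurable_fun setT (fun x => u x ^+ 2) by meas.
have m2 : measurable_fun setT (fun x => polar s a u x ^+ 2) by meas.
have sumE (f : E -> R) : measurable_fun setT f -> (forall x, 0 <= f x) ->
    nnint leb (fun x => f x + f (s x)) = (nnint leb f + nnint leb f)%E.
  move=> mf f0; have mfs := mpres_measurable ms mf.
  by rewrite (nnintD leb mf mfs f0 (fun x => f0 (s x))) (mpres_nnint ms mf f0).
have e : nnint leb (fun x => polar s a u x ^+ 2) = nnint leb (fun x => u x ^+ 2).
  have h : (nnint leb (fun x => (polar s a u x ^+ 2)%R) + nnint leb (fun x => (polar s a u x ^+ 2)%R) =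
      nnint leb (fun x => (u x ^+ 2)%R) + nnint leb (fun x => (u x ^+ 2)%R))%E.
    rewrite -(sumE _ m1 (fun x => sqr_ge0 _)) -(sumE _ m2 (fun x => sqr_ge0 _)); apply: eq_nnint => x.
    have [ax|ax] := leP 0 (a x).
      by have [-> ->] := polar_at u ax; exact: max_min_sqr.
    have ax' : 0 <= a (s x) by rewrite polarizer_neg oppr_ge0 ltW.
    have [] := polar_at u ax'; rewrite sK => -> ->; rewrite addrC max_min_sqr addrC //.
  have hY := n2E Lu; rewrite hY in h *; move: h.
  by case: (nnint leb (fun x => (polar s a u x ^+ 2)%R)) => [r||] // -[h]; congr (_%:E); lra.
have LP : L2 leb (polar s a u) by split => //; rewrite e; exact: Lu.2.
by split => //; apply: EFin_inj; rewrite -(n2E LP) -(n2E Lu).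
Qed.

Lemma polar_ge0 u : (forall x, 0 <= u x) -> forall x, 0 <= polar s a u x.
Proof. by move=> u0 x; rewrite /polar; case: ifP => _; rewrite ?le_max ?le_min !u0. Qed.

Lemma polar_powR (r : R) u x : 0 <= r -> (forall x, 0 <= u x) ->
  polar s a u x `^ r = polar s a (fun x => u x `^ r) x.
Proof.
move=> r0 u0; have mono b c : 0 <= b -> b <= c -> b `^ r <= c `^ r.
  by move=> b0 bc; apply: ge0_ler_powR; rewrite ?nnegrE// (le_trans b0).
rewrite /polar; case: ifP => _; case: (leP (u x) (u (s x))) => h.
- by rewrite (max_idPr _)// mono.
- by rewrite (max_idPl _)// mono// ltW.
- by rewrite (min_idPl _)// mono.
- by rewrite (min_idPr _)// mono// ltW.
Qed.

(** The same argument with the kernel as weight and [rearr_prod]. *)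
Lemma riesz_form_polar (al : R) f g : 0 < al -> al < N%:R -> measurable_fun setT f -> measurable_fun setT g ->
  (forall x, 0 <= f x) -> (forall x, 0 <= g x) -> (riesz_form al f g <= riesz_form al (polar s a f) (polar s a g))%E.
Proof.
move=> al0 alN mf mg f0 g0; have mpf := measurable_polar mf; have mpg := measurable_polar mg.
have mk := @measurable_riesz R N al; have k0 := @riesz_ge0 R N al al0 alN.
(* The pairs y = x and y = s x are excluded: the default value of the kernel at 0 breaks its
   monotonicity. *)
pose b x y := (0 < enorm (x - y)) && (0 < enorm (x - s y)).
have bE x y : b x y = (y != x) && (y != s x).
  rewrite /b !enorm_gt0 !subr_eq0 eq_sym; congr (_ && ~~ _).
  by apply/eqP/eqP => [->|->]; rewrite sK.
apply: (@dint_sum4_le _ _ b).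
- exact: measurable_riesz_form.
- by move=> x y; apply: mul3_ge0.
- exact: measurable_riesz_form.
- by move=> x y; apply: mul3_ge0 => //; exact: polar_ge0.
- have me_ := @measurable_enorm R N.
  have m1 : measurable_fun setT (fun w : E * E => enorm (w.1 - w.2)).
    by apply: (@measurableT_comp _ _ _ _ _ _ (@enorm R N)) => //; meas.
  have m2 : measurable_fun setT (fun w : E * E => enorm (w.1 - s w.2)).
    apply: (@measurableT_comp _ _ _ _ _ _ (@enorm R N)) => //; apply: mE_add; first exact: measurable_fst.
    apply: mE_opp; apply: (measurableT_comp ms.1); exact: measurable_snd.
  by apply: mfand; meas.
- move=> x; apply: filterS2 (ae_neq x N0) (ae_neq (s x) N0) => y h1 h2.
  by rewrite bE; apply/andP; split; apply/eqP.
apply: sum4_wlog => [x y|x y ax ay].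
  have e1 : (s y == x) = (y == s x) by apply/eqP/eqP => [<-|->]; rewrite sK.
  have e2 : (s y == s x) = (y == x) := inj_eq (inv_inj sK) y x.
  by rewrite !bE sK e1 e2 => /andP[-> ->].
move=> /andP[h1 h2].
have [Px Psx] := polar_at f ay; have [Py Psy] := polar_at g ax.
have b1 : riesz al (s x - s y) = riesz al (x - y) by apply: riesz_sqn; exact: iso.
have b2 : riesz al (s x - y) = riesz al (x - s y) by apply: riesz_sqn; exact: polarizer_cross.
have b3 : riesz al (x - s y) <= riesz al (x - y).
  have x0 : x - y != 0 by rewrite -enorm_gt0.
  have le : enorm (x - y) <= enorm (x - s y) by rewrite ler_enorm; exact: polarizer_closer.
  exact: (riesz_le al0 alN x0 le).
have h := rearr_prod (f y) (f (s y)) (g x) (g (s x)) b3.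
by rewrite /sum4 Px Psx Py Psy b1 b2; exact: prod_expand.
Qed.

Definition weighted_mass u v : \bar R := nnint leb (fun x => (u x ^+ 2 + v x ^+ 2) * sqn x).

(** Paired over x and s x, the loss of second moment has the nonnegative density c a(x) times the
    mass moved towards the origin. If nothing is lost this density vanishes almost everywhere, so
    both components were already ordered. *)
Lemma weighted_mass_polar u v : measurable_fun setT u -> measurable_fun setT v ->
  (forall x, 0 <= u x) -> (forall x, 0 <= v x) -> (weighted_mass u v < +oo)%E ->
  (weighted_mass u v <= weighted_mass (polar s a u) (polar s a v))%E ->
  {ae leb, forall x, 0 < a x -> u (s x) <= u x /\ v (s x) <= v x}.
Proof.
move=> mu_ mv u0 v0 fin le; have mpu := measurable_polar mu_; have mpv := measurable_polar mv.
have mq := @measurable_sqn R N.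
pose f x := (u x ^+ 2 + v x ^+ 2) * sqn x.
pose F x := (polar s a u x ^+ 2 + polar s a v x ^+ 2) * sqn x.
have f0 x : 0 <= f x by rewrite mulr_ge0 ?sqn_ge0// addr_ge0 ?sqr_ge0.
have F0 x : 0 <= F x by rewrite mulr_ge0 ?sqn_ge0// addr_ge0 ?sqr_ge0.
have mf : measurable_fun setT f by rewrite /f; meas.
have mF : measurable_fun setT F by rewrite /F; meas.
have mfs := mpres_measurable ms mf; have mFs := mpres_measurable ms mF.
pose d x := f x + f (s x) - (F x + F (s x)).
have md : measurable_fun setT d by exact: (mfB (mfD mf mfs) (mfD mF mFs)).
have [_ _ _ _ [_ [c c0 hc]]] := H.
have dE x : 0 <= a x -> d x = c * a x * ((Num.max (u x) (u (s x)) ^+ 2 - u x ^+ 2) + (Num.max (v x) (v (s x)) ^+ 2 - v x ^+ 2)).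
  move=> ax; rewrite /d /f /F; have [-> ->] := polar_at u ax; have [-> ->] := polar_at v ax.
  rewrite -hc; exact: (weight_exchange _ _ (max_min_sqr _ _) (max_min_sqr _ _)).
have mx (b b' : R) : 0 <= b -> 0 <= Num.max b b' ^+ 2 - b ^+ 2.
  by move=> b0; rewrite subr_ge0 ler_sqr ?nnegrE ?le_max ?b0 ?lexx.
have ds x : d (s x) = d x by rewrite /d sK [f (s x) + _]addrC [F (s x) + _]addrC.
have d0' x : 0 <= a x -> 0 <= d x.
  by move=> ax; rewrite dE//; apply: mulr_ge0; [rewrite mulr_ge0// ltW|apply: addr_ge0; exact: mx].
have d0 x : 0 <= d x.
  have [ax|ax] := leP 0 (a x); first exact: d0'.
  by rewrite -ds; apply: d0'; rewrite polarizer_neg oppr_ge0 ltW.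
have S : (weighted_mass u v + weighted_mass u v = weighted_mass (polar s a u) (polar s a v) + weighted_mass (polar s a u) (polar s a v) + nnint leb d)%E.
  rewrite /weighted_mass -/f -/F -{2}(mpres_nnint ms mf f0) -{2}(mpres_nnint ms mF F0).
  rewrite -(nnintD leb mf mfs f0 (fun x => f0 (s x))) -(nnintD leb mF mFs F0 (fun x => F0 (s x))).
  rewrite -(nnintD leb (mfD mF mFs) md (fun x => addr_ge0 (F0 x) (F0 (s x))) d0).
  by apply: eq_nnint => x; rewrite /d [RHS]addrC subrK.
have nd : nnint leb d = 0%E.
  have w0 : (0 <= weighted_mass u v)%E by apply: nnint_ge0.
  have d00 : (0 <= nnint leb d)%E by apply: nnint_ge0.
  move: S le fin w0 d00; case: (weighted_mass u v) => [w||] //; case: (weighted_mass _ _) => [w'||] //; case: (nnint leb d) => [t||] //.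
  rewrite -!EFinD !lee_fin => -[] h1 h2 _ _ h3; congr EFin; lra.
apply: filterS (nnint_eq0 md d0 nd) => x dx ax.
have := dE x (ltW ax); rewrite dx => /esym/eqP.
rewrite mulf_eq0 gt_eqF ?mulr_gt0//= paddr_eq0 ?mx// !subr_eq0 => /andP[/eqP h1 /eqP h2].
have fin_ (b b' : R) : 0 <= b -> Num.max b b' ^+ 2 = b ^+ 2 -> b' <= b.
  move=> b0 h; apply: (@le_trans _ _ (Num.max b b')); first by rewrite le_max lexx orbT.
  by rewrite -ler_sqr ?nnegrE ?le_max ?b0// h.
by split; apply: fin_.
Qed.

End fixed_polarizer.

Definition polarized u := forall s a, polarizer s a -> {ae leb, forall x, 0 < a x -> u (s x) <= u x}.

Lemma sqn_diff1 (k : 'I_N) x y : (forall i, i != k -> x ord0 i ^+ 2 = y ord0 i ^+ 2) ->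
  sqn x - sqn y = x ord0 k ^+ 2 - y ord0 k ^+ 2.
Proof.
move=> h; rewrite /sqn (bigD1 k)//= [in X in _ - X](bigD1 k)//= (eq_bigr _ h).
by rewrite opprD addrACA subrr addr0.
Qed.

Lemma sqn_diff2 (i j : 'I_N) x y : i != j -> (forall k, k != i -> k != j -> x ord0 k ^+ 2 = y ord0 k ^+ 2) ->
  sqn x - sqn y = (x ord0 i ^+ 2 - y ord0 i ^+ 2) + (x ord0 j ^+ 2 - y ord0 j ^+ 2).
Proof.
move=> ij h; have ji : j != i by rewrite eq_sym.
rewrite /sqn (bigD1 i)//= (bigD1 j)//= [in X in _ - X](bigD1 i)//= [in X in _ - X](bigD1 j)//=.
rewrite (eq_bigr (fun k => y ord0 k ^+ 2)) => [|k /andP[k1 k2]]; last exact: h.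
by move: (\sum_(_ | _) _) => S; ring.
Qed.

Definition refl (k : 'I_N) (t : R) x : E := \row_l (if l == k then 2 * t - x ord0 k else x ord0 l).

Lemma reflE k t x l : refl k t x ord0 l = if l == k then 2 * t - x ord0 k else x ord0 l.
Proof. by rewrite mxE. Qed.

Lemma mpres_refl k t : mpres (refl k t).
Proof.
rewrite (_ : refl k t = signed_perm 1%g (\row_l (if l == k then -1 else 1)) (\row_l (if l == k then 2 * t else 0))).
  by apply: mpres_signed_perm => i; rewrite mxE; case: ifP; rewrite ?sqrrN expr1n.
apply/funext => x; apply/rowP => l; rewrite !mxE perm1; case: eqP => [->|_].
  by rewrite mulN1r addrC.
by rewrite mul1r addr0.
Qed.

(** Reflection in x_k = t. The factor t makes the signed distance positive at the origin for either
    sign of t, and t = 0 is excluded because no side would then contain the origin. *)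
Lemma polarizer_refl k t : t != 0 -> polarizer (refl k t) (fun x => t * (t - x ord0 k)).
Proof.
move=> t0; have tt : 0 < t ^+ 2 by rewrite exprn_even_gt0.
split.
- exact: mpres_refl.
- by meas.
- move=> x; apply/rowP => l; rewrite !reflE eqxx; case: eqP => [->|//]; ring.
- move=> x y; apply/eqP; rewrite -subr_eq0 (@sqn_diff1 k) => [|i ik].
    by rewrite !mxE eqxx; apply/eqP; ring.
  by rewrite !mxE (negbTE ik).
split.
  exists (4 / t ^+ 2); first by rewrite divr_gt0.
  move=> x y; rewrite (@sqn_diff1 k) => [|i ik]; last by rewrite !mxE (negbTE ik).
  by rewrite !mxE eqxx; field.
exists 4 => // x; rewrite (@sqn_diff1 k) => [|i ik]; last by rewrite !mxE (negbTE ik).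
by rewrite !mxE eqxx; ring.
Qed.

Definition swap (i j : 'I_N) (t : R) x : E :=
  \row_l (if l == i then x ord0 j + t else if l == j then x ord0 i - t else x ord0 l).

Lemma mpres_swap i j t : i != j -> mpres (swap i j t).
Proof.
move=> ij; have ji : j != i by rewrite eq_sym.
rewrite (_ : swap i j t = signed_perm (tperm i j) (const_mx 1)
   (\row_l (if l == i then t else if l == j then - t else 0))).
  by apply: mpres_signed_perm => l; rewrite mxE expr1n.
apply/funext => x; apply/rowP => l; rewrite !mxE mul1r; case: eqP => [->|li]; first by rewrite tpermL.
case: eqP => [->|lj]; first by rewrite tpermR.
by rewrite addr0 tpermD//; apply/eqP => h; [exact: li|exact: lj].
Qed.

(** Reflection in x_i - x_j = t: a coordinate exchange followed by a translation. It transfers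
    length from one coordinate to another. *)
Lemma polarizer_swap i j t : i != j -> t != 0 ->
  polarizer (swap i j t) (fun x => t * (t - (x ord0 i - x ord0 j))).
Proof.
move=> ij t0; have tt : 0 < t ^+ 2 by rewrite exprn_even_gt0.
have ji : (j == i) = false by rewrite eq_sym (negbTE ij).
split.
- exact: mpres_swap.
- by meas.
- move=> x; apply/rowP => l; rewrite !mxE !eqxx ji; case: eqP => [->|_]; first by ring.
  by case: eqP => [->|//]; ring.
- move=> x y; apply/eqP; rewrite -subr_eq0 (@sqn_diff2 i j)//.
    by rewrite !mxE !eqxx ji; apply/eqP; ring.
  by move=> k ki kj; rewrite !mxE (negbTE ki) (negbTE kj).
split.
  exists (2 / t ^+ 2); first by rewrite divr_gt0.
  move=> x y; rewrite (@sqn_diff2 i j)//; last by move=> k ki kj; rewrite !mxE (negbTE ki) (negbTE kj).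
  by rewrite !mxE !eqxx ji; field.
exists 2 => // x; rewrite (@sqn_diff2 i j)//; last by move=> k ki kj; rewrite !mxE (negbTE ki) (negbTE kj).
by rewrite !mxE !eqxx ji; ring.
Qed.

End polarization.

(** * From local convergence and uniform tails to strong convergence *)

Section tight_convergence.
Context {R : realType} {N : nat}.
Hypothesis N0 : (0 < N)%N.
Local Notation E := 'rV[R]_N.
Local Notation leb := (@lebesgue_rV R N).
Implicit Types (u v w : E -> R) (x y z : E) (K M : R).

Definition ocube (M : R) x : bool := [forall i, `|x ord0 i| < M].

Lemma measurable_ocube M : measurable_fun setT (ocube M).
Proof.
rewrite (_ : ocube M = fun x => \big[andb/true]_i (`|x ord0 i| < M)); last first.
  by apply/funext => x; rewrite big_andE.
elim: (index_enum _) => [|i s IH]; first by under eq_fun do rewrite big_nil; exact: measurable_cst.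
by under eq_fun do rewrite big_cons; apply: mfand => //; meas.
Qed.

Lemma subcritical_room (r : R) : subcritical (N := N) r -> exists2 r' : R, r < r' & subcritical (N := N) r'.
Proof.
move=> [r2 rN]; have : all (fun c => c.1 * r < c.2) [:: (N%:R - 2, 2 * N%:R)] by rewrite /= mulrC rN.
move=> /lin_open[e e0 he]; exists (r + e / 2); first by rewrite ltrDl divr_gt0.
have h : `|e / 2| < e by rewrite gtr0_norm ?divr_gt0//; lra.
have /= := he _ h; rewrite andbT mulrC => h2; split => //.
by apply: (lt_trans r2); rewrite ltrDl divr_gt0.
Qed.

(** Below the threshold T with T^(r - r') = d the square dominates, above it the power r' with
    factor d. *)
Lemma interpolation (r r' d : R) : 2 < r -> r < r' -> 0 < d ->
  exists2 C : R, 0 <= C & forall t : R, 0 <= t -> t `^ r <= d * t `^ r' + C * t ^+ 2.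
Proof.
move=> r2 rr d0; have nz : r - r' != 0 by rewrite subr_eq0 lt_eqF.
pose T : R := d `^ (r - r')^-1.
have T0 : 0 < T by rewrite powR_gt0.
have Td : T `^ (r - r') = d by rewrite /T -powRrM mulVf// powRr1// ltW.
exists (T `^ (r - 2)); first exact: powR_ge0.
move=> t t0; have [->|tn] := eqVneq t 0.
  by rewrite powR0 ?addr_ge0// ?mulr_ge0 ?powR_ge0 ?sqr_ge0 ?(ltW d0)//; apply/eqP; lra.
have tp : 0 < t by rewrite lt_neqAle eq_sym tn.
have imp (a b : R) : (a + b == 0) ==> (t != 0) by rewrite tn implybT.
have [h|h] := leP t T.
  apply: (@le_trans _ _ (T `^ (r - 2) * t ^+ 2)); last first.
    by rewrite lerDr mulr_ge0 ?powR_ge0// ltW.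
  rewrite -powR_mulrn// (_ : t `^ r = t `^ (r - 2) * t `^ 2); last by rewrite -powRD// subrK.
  apply: ler_wpM2r; first exact: powR_ge0.
  by apply: ge0_ler_powR; rewrite ?nnegrE ?(ltW T0)//; lra.
apply: (@le_trans _ _ (d * t `^ r')); last by rewrite lerDl mulr_ge0 ?powR_ge0 ?sqr_ge0.
rewrite -Td (_ : t `^ r = t `^ (r - r') * t `^ r'); last by rewrite -powRD// subrK.
apply: ler_wpM2r; first exact: powR_ge0.
have h2 := anti_powR (_ : 0 <= r' - r) T0 (ltW h).
by rewrite opprB in h2; apply: h2; lra.
Qed.

Lemma sub_powR_le (r a b : R) : 0 <= r -> `|a - b| `^ r <= 2 `^ r * (`|a| `^ r + `|b| `^ r).
Proof.
move=> r0; have key (c d : R) : `|c| <= `|d| -> `|c - d| `^ r <= 2 `^ r * `|d| `^ r.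
  move=> cd; rewrite -powRM//; apply: ge0_ler_powR; rewrite ?nnegrE//.
  by have := ler_normB c d; lra.
have p0 (c : R) : 0 <= 2 `^ r * `|c| `^ r by rewrite mulr_ge0 ?powR_ge0.
rewrite mulrDr; case: (leP `|a| `|b|) => h.
  by apply: (le_trans (key _ _ h)); rewrite lerDr.
by rewrite distrC; apply: (le_trans (key _ _ (ltW h))); rewrite lerDl.
Qed.

Definition outer (r M : R) u : \bar R := nnint leb (fun x => (~~ ocube M x)%:R * `|u x| `^ r).

Lemma powR_cvg (r : R) (f : nat -> R) (l : R) : 0 < r -> (forall n, 0 <= f n) -> 0 <= l ->
  f n @[n --> \oo] --> l -> f n `^ r @[n --> \oo] --> l `^ r.
Proof.
move=> r0 f0 l0 hf; apply/cvgrPdist_le => e e0.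
have q0 : 0 <= (l + 1) `^ r by exact: powR_ge0.
have hf' := hf; move/cvgrPdist_le in hf'.
have c0 : 0 < 2 * (2 * (l + 1) `^ r + 1) by rewrite mulr_gt0// ltr_wpDl// mulr_ge0.
have d0 : 0 < e / (2 * (2 * (l + 1) `^ r + 1)) by rewrite divr_gt0.
have [C C0 hC] := powR_diff r0 ltr01 d0.
have t0 : 0 < (e / (2 * (C + 1))) `^ r^-1 by rewrite powR_gt0// divr_gt0// mulr_gt0// ltr_wpDl.
near=> n.
have h1 : `|l - f n| <= 1 by near: n; exact: (hf' 1 ltr01).
have h2 : `|l - f n| <= (e / (2 * (C + 1))) `^ r^-1 by near: n; exact: (hf' _ t0).
have := hC l (f n) l0 (f0 n); rewrite mulr1 powRr1//; move/le_trans; apply.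
have mono (a b : R) : 0 <= a -> a <= b -> a `^ r <= b `^ r.
  by move=> a0 ab; apply: ge0_ler_powR; rewrite ?nnegrE ?(ltW r0)//; exact: le_trans ab.
have h3 : l `^ r <= (l + 1) `^ r by apply: mono => //; lra.
have h4 : f n `^ r <= (l + 1) `^ r.
  by apply: mono => //; move: h1; rewrite ler_norml => /andP[]; lra.
have h5 : `|l - f n| `^ r <= e / (2 * (C + 1)).
  apply: (le_trans (mono _ _ (normr_ge0 _) h2)); rewrite -powRrM mulVf ?gt_eqF// powRr1//.
  by rewrite divr_ge0 ?(ltW e0)// mulr_ge0// addr_ge0.
have g1 : e / (2 * (2 * (l + 1) `^ r + 1)) * (l `^ r + f n `^ r) <= e / 2.
  rewrite mulrAC ler_pdivrMr//.
  have -> : e / 2 * (2 * (2 * (l + 1) `^ r + 1)) = e * (2 * (l + 1) `^ r + 1) by field.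
  by apply: ler_wpM2l; [exact: ltW|lra].
have g2 : C * `|l - f n| `^ r <= e / 2.
  apply: (le_trans (ler_wpM2l C0 h5)); rewrite mulrA ler_pdivrMr ?mulr_gt0 ?ltr_wpDl//.
  have -> : e / 2 * (2 * (C + 1)) = C * e + e by field.
  by rewrite lerDl ltW.
lra.
Unshelve. all: by end_near. Qed.

(** Inside a cube, local L^2 convergence is interpolated with a bound in a slightly higher
    subcritical norm; outside, the tails of the sequence and, by Fatou's lemma, of the limit are
    small. *)
Lemma Lr_convergence (r K : R) (un : nat -> E -> R) u : subcritical (N := N) r -> 0 <= K ->
  (forall n, in_ball (un n) K) -> in_ball u K ->
  {ae leb, forall x, un n x @[n --> \oo] --> u x} ->
  (forall n, (nnint leb (fun x => ((ocube n.+1%:R x)%:R * (un n x - u x) ^+ 2)%R) <= (16^-1 ^+ n)%:E)%E) ->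
  (forall e : R, 0 < e -> exists2 M : R, 0 < M & forall n, (outer r M (un n) <= e%:E)%E) ->
  forall e : R, 0 < e -> exists n0, forall n, (n0 <= n)%N -> (pint r (fun x => `|un n x - u x|)%R <= e%:E)%E.
Proof.
move=> hr K0 hun hu cv loc tails e e0; have [r2 _] := hr.
have r0 : 0 <= r by lra.
have mun n : measurable_fun setT (un n) by have [[]] := hun n.
have mu_ : measurable_fun setT u by have [[]] := hu.
pose c2 : R := 2 `^ r; have c20 : 0 < c2 by exact: powR_gt0.
have et0 : 0 < e / (8 * c2) by rewrite divr_gt0// mulr_gt0.
have [M M0 hM] := tails _ et0.
have mo (w : E -> R) : measurable_fun setT w -> measurable_fun setT (fun x => (~~ ocube M x)%:R * `|w x| `^ r).
  by move=> mw; apply: mfM; [apply: mfb; apply: mfneg; exact: measurable_ocube|meas].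
have o0 (w : E -> R) x : 0 <= (~~ ocube M x)%:R * `|w x| `^ r by rewrite mulr_ge0 ?powR_ge0.
have hMu : (outer r M u <= (e / (8 * c2))%:E)%E.
  apply: (@nnint_fatou _ _ _ leb (fun n x => (~~ ocube M x)%:R * `|un n x| `^ r) _ _ 0%N).
  - by move=> n; exact: mo.
  - exact: mo.
  - by move=> n x; exact: o0.
  - exact: o0.
  - apply: filterS cv => x hx; apply: cvgM; first exact: cvg_cst.
    by apply: powR_cvg => //; [lra|exact: cvg_norm].
  by move=> n _; exact: hM.
have [r' rr' hr'] := subcritical_room hr.
have K40 : 0 <= 4 * K by rewrite mulr_ge0.
have [G G0 hG] := sobolev N0 (ltW hr'.1) hr'.2 K40.
have d0 : 0 < e / (4 * (G + 1)) by rewrite divr_gt0// mulr_gt0// ltr_wpDl.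
have [C C0 hC] := interpolation r2 rr' d0.
have C1 : 0 < 4 * (C + 1) by rewrite mulr_gt0// ltr_wpDl.
have [n1 hn1] : exists n1, forall n, (n1 <= n)%N -> 16^-1 ^+ n <= e / (4 * (C + 1)).
  have c16 : 16^-1 ^+ n @[n --> \oo] --> (0 : R).
    by apply: cvg_expr; rewrite ger0_norm ?invr_ge0// invf_lt1// ltr1n.
  move/cvgrPdist_le: c16 => /(_ _ (divr_gt0 e0 C1))[n1 _ h]; exists n1 => n nn.
  by have := h n nn; rewrite /= sub0r normrN ger0_norm// exprn_ge0// invr_ge0.
pose n2 := Num.bound M; exists (maxn n1 n2) => n; rewrite geq_max => /andP[nn1 nn2].
pose w x := un n x - u x.
have mw : measurable_fun setT w by have := mun n => ?; rewrite /w; meas.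
have hw : in_ball w (4 * K) by exact: in_ball_sub.
have Mn : M <= n.+1%:R.
  by apply: (le_trans (ltW (archi_boundP (ltW M0)))); rewrite ler_nat; exact: leqW.
have mc : measurable_fun setT (fun x => (ocube n.+1%:R x)%:R * w x ^+ 2).
  by apply: mfM; [apply: mfb; exact: measurable_ocube|meas].
have mr' : measurable_fun setT (fun x => `|w x| `^ r') by meas.
pose h1 x := e / (4 * (G + 1)) * `|w x| `^ r'.
pose h2 x := C * ((ocube n.+1%:R x)%:R * w x ^+ 2).
pose h3 x := c2 * ((~~ ocube M x)%:R * `|un n x| `^ r).
pose h4 x := c2 * ((~~ ocube M x)%:R * `|u x| `^ r).
have m1 : measurable_fun setT h1 by rewrite /h1; meas.
have m2 : measurable_fun setT h2 by apply: mfM => //; exact: measurable_cst.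
have m3 : measurable_fun setT h3 by apply: mfM; [exact: measurable_cst|exact: mo].
have m4 : measurable_fun setT h4 by apply: mfM; [exact: measurable_cst|exact: mo].
have q0 x : 0 <= (ocube n.+1%:R x)%:R * w x ^+ 2 by rewrite mulr_ge0 ?sqr_ge0.
have p1 x : 0 <= h1 x by rewrite mulr_ge0 ?powR_ge0// ltW.
have p2 x : 0 <= h2 x by rewrite mulr_ge0.
have p3 x : 0 <= h3 x by rewrite mulr_ge0 ?o0// ltW.
have p4 x : 0 <= h4 x by rewrite mulr_ge0 ?o0// ltW.
apply: (@le_trans _ _ (nnint leb (fun x => (h1 x + h2 x + (h3 x + h4 x))%R))).
  apply: nnint_le; [by have := mw => ?; rewrite -/w; meas|exact: (mfD (mfD m1 m2) (mfD m3 m4))|by move=> x; exact: powR_ge0|].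
  move=> x; rewrite -/(w x); case: (boolP (ocube M x)) => hx.
    have hx' : ocube n.+1%:R x by apply/forallP => i; move/forallP: hx => /(_ i) h; exact: lt_le_trans Mn.
    apply: (@le_trans _ _ (h1 x + h2 x)); last by rewrite lerDl addr_ge0.
    by have := hC _ (normr_ge0 (w x)); rewrite real_normK ?num_real// /h1 /h2 hx' mul1r.
  apply: (@le_trans _ _ (h3 x + h4 x)); last by rewrite lerDr addr_ge0.
  by have := sub_powR_le (un n x) (u x) r0; rewrite /h3 /h4 hx !mul1r mulrDr.
rewrite (nnintD leb (mfD m1 m2) (mfD m3 m4) (fun x => addr_ge0 (p1 x) (p2 x)) (fun x => addr_ge0 (p3 x) (p4 x))).
rewrite (nnintD leb m1 m2 p1 p2) (nnintD leb m3 m4 p3 p4).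
rewrite (nnintZ leb mr' (fun x => powR_ge0 _ _) (ltW d0)) (nnintZ leb mc q0 C0).
rewrite (nnintZ leb (mo _ (mun n)) (o0 _) (ltW c20)) (nnintZ leb (mo _ mu_) (o0 _) (ltW c20)).
have E1 := lee_wpmul2l (_ : (0 <= (e / (4 * (G + 1)))%:E)%E) (hG w hw).
have E2 := lee_wpmul2l (_ : (0 <= C%:E)%E) (loc n).
have E3 := lee_wpmul2l (_ : (0 <= c2%:E)%E) (hM n).
have E4 := lee_wpmul2l (_ : (0 <= c2%:E)%E) hMu.
rewrite !lee_fin in E1 E2 E3 E4.
apply: (le_trans (leeD (leeD (E1 (ltW d0)) (E2 C0)) (leeD (E3 (ltW c20)) (E4 (ltW c20))))).
rewrite -!EFinM -!EFinD lee_fin.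
have f1 : e / (4 * (G + 1)) * G <= e / 4.
  rewrite mulrAC ler_pdivrMr ?mulr_gt0 ?ltr_wpDl//.
  have -> : e / 4 * (4 * (G + 1)) = e * G + e by field.
  by rewrite lerDl ltW.
have f2 : C * 16^-1 ^+ n <= e / 4.
  apply: (le_trans (ler_wpM2l C0 (hn1 n nn1))).
  rewrite mulrA ler_pdivrMr//; have -> : e / 4 * (4 * (C + 1)) = C * e + e by field.
  by rewrite lerDl ltW.
have f3 : c2 * (e / (8 * c2)) = e / 8 by field; rewrite gt_eqF.
rewrite f3; lra.
Qed.

End tight_convergence.

Lemma penalty_bound {R : realFieldType} (a b s x C : R) : s - x < a - b -> x <= 1 -> 0 <= s -> a <= C -> b <= C + 1.
Proof. lra. Qed.

Lemma penalty_limit {R : realFieldType} (a b s x d e : R) :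
  s - x < a - b -> a <= d + e / 2 -> x <= e / 2 -> b <= d + e - s.
Proof. lra. Qed.

(** * Maximisers on the energy ball *)

Section maximisers.
Context {R : realType} {N : nat} (alpha p q A B : R).
Hypotheses (N0 : (0 < N)%N) (al0 : 0 < alpha) (alN : alpha < N%:R).
Hypotheses (hp : (N%:R + alpha) / N%:R < p) (hp' : p * (N%:R - 2) < N%:R + alpha).
Hypotheses (hq : (N%:R + alpha) / N%:R < q) (hq' : q * (N%:R - 2) < N%:R + alpha).
Hypotheses (A0 : 0 < A) (B0 : 0 < B).
Local Notation E := 'rV[R]_N.
Local Notation leb := (@lebesgue_rV R N).
Local Notation DP := (@interaction R N alpha p q).
Local Notation ballP := (@ball R N A B N0).
Implicit Types (u v w : E -> R) (x y z : E).

Let K1 : R := ball_const A B 1.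
Let K10 : 0 <= K1. Proof. exact: ball_const_ge0. Qed.

Lemma ball_meas M u v : ballP M u v -> measurable_fun setT u /\ measurable_fun setT v.
Proof. by move=> [[mu_ _] [mv _] _]. Qed.

(** Extraction for the first component, then along it for the second. *)
Lemma pair_compact (un vn : nat -> E -> R) : (forall n, ballP 1 (un n) (vn n)) ->
  (forall n x, 0 <= un n x) -> (forall n x, 0 <= vn n x) ->
  exists (phi : nat -> nat) u v, [/\ [/\ forall n, (phi n < phi n.+1)%N, forall x, 0 <= u x & forall x, 0 <= v x],
   ballP 1 u v,
   {ae leb, forall x, un (phi n) x @[n --> \oo] --> u x} /\ {ae leb, forall x, vn (phi n) x @[n --> \oo] --> v x},
   forall n, (nnint leb (fun x => ((ocube n.+1%:R x)%:R * (un (phi n) x - u x) ^+ 2)%R) <= (16^-1 ^+ n)%:E)%E &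
   forall n, (nnint leb (fun x => ((ocube n.+1%:R x)%:R * (vn (phi n) x - v x) ^+ 2)%R) <= (16^-1 ^+ n)%:E)%E].
Proof.
move=> hb un0 vn0.
have hun n : in_ball (un n) K1 by have [] := ball_in_ball A0 B0 (hb n).
have hvn n : in_ball (vn n) K1 by have [] := ball_in_ball A0 B0 (hb n).
have [f1 [u [f1i mu_ cu lu]]] := compactness N0 K10 hun.
have [f2 [v [f2i mv cv lv]]] := compactness N0 K10 (fun n => hvn (f1 n)).
have f2n := ltn_phi_ge f2i.
have mono f n : (forall k, (f k < f k.+1)%N) -> forall m, (n <= m)%N -> (f n <= f m)%N.
  by move=> fi m; elim: m => [|m IH]; [rewrite leqn0 => /eqP->|rewrite leq_eqVlt => /orP[/eqP->//|/IH h]; exact: ltnW (leq_ltn_trans h (fi m))].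
have smono f n m : (forall k, (f k < f k.+1)%N) -> (n < m)%N -> (f n < f m)%N.
  by move=> fi nm; apply: leq_trans (fi n) _; exact: mono.
have cvsub (w : nat -> E -> R) (l : E -> R) : {ae leb, forall x, w n x @[n --> \oo] --> l x} ->
    {ae leb, forall x, w (f2 n) x @[n --> \oo] --> l x}.
  apply: filterS => x hx; apply: (cvg_comp f2 (fun n => w n x) _ hx).
  by move=> S [n _ hn]; exists n => // m /= nm; apply: hn => /=; exact: leq_trans (f2n m).
have cu' := cvsub _ _ cu.
(* Nonnegativity holds almost everywhere in the limit; truncation makes it hold at every point. *)
pose u' x := Num.max (u x) 0; pose v' x := Num.max (v x) 0.
have mu' : measurable_fun setT u' by rewrite /u'; meas.
have mv' : measurable_fun setT v' by rewrite /v'; meas.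
have pos (w : nat -> R) (l : R) : (forall n, 0 <= w n) -> w n @[n --> \oo] --> l -> Num.max l 0 = l.
  move=> w0 hw; apply/max_idPl; have <- : limn w = l by apply: cvg_lim.
  by apply: limr_ge; [apply/cvg_ex; exists l|exact: nearW].
have eu : {ae leb, forall x, u' x = u x} by apply: filterS cu => x; exact: pos.
have ev : {ae leb, forall x, v' x = v x} by apply: filterS cv => x; exact: pos.
have cu2 : {ae leb, forall x, un (f1 (f2 n)) x @[n --> \oo] --> u' x} by apply: filterS2 cu' eu => x h ->.
have cv2 : {ae leb, forall x, vn (f1 (f2 n)) x @[n --> \oo] --> v' x} by apply: filterS2 cv ev => x h ->.
have mun n : measurable_fun setT (un n) by have [[]] := hun n.
have mvn n : measurable_fun setT (vn n) by have [[]] := hvn n.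
have loc (w l l' : E -> R) (d : R) : measurable_fun setT w -> measurable_fun setT l -> measurable_fun setT l' ->
   {ae leb, forall x, l' x = l x} -> nnint leb (fun x => ((ocube d x)%:R * (w x - l' x) ^+ 2)) =
     nnint leb (fun x => ((ocube d x)%:R * (w x - l x) ^+ 2)).
  move=> mw ml ml' e; apply: nnint_ae_eq.
  - by apply: mfM; [apply: mfb; exact: measurable_ocube|meas].
  - by apply: mfM; [apply: mfb; exact: measurable_ocube|meas].
  by apply: filterS e => x ->.
exists (f1 \o f2), u', v'; split.
- split; last 2 first.
  + by move=> x; rewrite le_max lexx orbT.
  + by move=> x; rewrite le_max lexx orbT.
  by move=> n; exact: (smono f1 _ _ f1i (f2i n)).
- exact: (ball_limit A0 B0 mu' mv' cu2 cv2 (fun n => hb (f1 (f2 n)))).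
- by split.
- move=> n; rewrite (loc _ u u' _ (mun _) mu_ mu' eu).
  (* The index f2 n is at least n, so the estimate there, on a larger cube and with a smaller bound,
     contains the required one. *)
  apply: (@le_trans _ _ (16^-1 ^+ f2 n)%:E); last first.
    by rewrite lee_fin; apply: ler_wiXn2l => //; rewrite ?invr_ge0 ?invf_le1// ?ler1n.
  apply: le_trans (lu (f2 n)); apply: nnint_le.
  + by apply: mfM; [apply: mfb; exact: measurable_ocube|have := mun (f1 (f2 n)) => ?; meas].
  + by apply: mfM; [apply: mfb; exact: measurable_ocube|have := mun (f1 (f2 n)) => ?; meas].
  + by move=> x; rewrite mulr_ge0 ?sqr_ge0.
  move=> x; apply: ler_wpM2r; first exact: sqr_ge0.
  case: (boolP (ocube n.+1%:R x)) => // h; rewrite ler_nat lt0b; apply/forallP => i.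
  by move/forallP: h => /(_ i) h; apply: (lt_le_trans h); rewrite ler_nat ltnS.
- by move=> n; rewrite (loc _ v v' _ (mvn _) mv mv' ev); exact: lv.
Qed.

Lemma interaction_limsup (un vn : nat -> E -> R) u v : (forall n, ballP 1 (un n) (vn n)) -> ballP 1 u v ->
  (forall r, subcritical (N := N) r -> forall e : R, 0 < e -> exists n0, forall n, (n0 <= n)%N -> (pint r (fun x => `|un n x - u x|)%R <= e%:E)%E) ->
  (forall r, subcritical (N := N) r -> forall e : R, 0 < e -> exists n0, forall n, (n0 <= n)%N -> (pint r (fun x => `|vn n x - v x|)%R <= e%:E)%E) ->
  forall e : R, 0 < e -> exists n0, forall n, (n0 <= n)%N -> (DP (un n) (vn n) <= DP u v + e%:E)%E.
Proof.
move=> hn h cu cv e e0; have [d d0 [s hs hd]] := interaction_upper N0 al0 alN hp hp' hq hq' K10 e0.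
have fin (wn : nat -> E -> R) w : (forall r, subcritical (N := N) r -> forall e : R, 0 < e -> exists n0, forall n, (n0 <= n)%N -> (pint r (fun x => `|wn n x - w x|)%R <= e%:E)%E) ->
    exists n0, forall n, (n0 <= n)%N -> forall r, r \in s -> (pint r (fun x => `|wn n x - w x|)%R <= d%:E)%E.
  move=> cw; clear hd; elim: s hs => [|r s IH] hs; first by exists 0%N.
  have [n1 h1] := IH (fun t ht => hs t (mem_behead (s := r :: s) ht)).
  have [n2 h2] := cw r (hs r (mem_head _ _)) d d0.
  exists (maxn n1 n2) => n; rewrite geq_max => /andP[a1 a2] t; rewrite in_cons => /orP[/eqP->|ht]; [exact: h2|exact: h1].
have [n1 h1] := fin _ _ cu; have [n2 h2] := fin _ _ cv.
have [b1 b2] := ball_in_ball A0 B0 h.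
exists (maxn n1 n2) => n; rewrite geq_max => /andP[a1 a2].
by have [b3 b4] := ball_in_ball A0 B0 (hn n); apply: hd => // r hr; [exact: h1|exact: h2].
Qed.

Lemma ball_polar (s : E -> E) (a : E -> R) M u v : polarizer s a -> ballP M u v ->
  ballP M (polar s a u) (polar s a v).
Proof.
move=> hs [Lu Lv h]; have [Lpu npu] := n2_polar hs Lu; have [Lpv npv] := n2_polar hs Lv.
split => // e e0; apply: le_trans (h e e0); rewrite (pair_eps_energyE _ A0 B0 e Lpu Lpv) (pair_eps_energyE _ A0 B0 e Lu Lv) npu npv.
by apply: leeD => //; apply: leeD; apply: (eps_energy_polar hs); [exact: Lu.1|exact: Lv.1].
Qed.

Lemma interaction_polar (s : E -> E) (a : E -> R) u v : polarizer s a -> measurable_fun setT u -> measurable_fun setT v ->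
  (forall x, 0 <= u x) -> (forall x, 0 <= v x) -> (DP u v <= DP (polar s a u) (polar s a v))%E.
Proof.
move=> hs mu_ mv u0 v0; have p1 := exponent_gt1 N0 al0 hp; have q1 := exponent_gt1 N0 al0 hq.
have e (w : E -> R) (r : R) : 1 < r -> (forall x, 0 <= w x) ->
   (fun x => `|polar s a w x| `^ r) = polar s a (fun x => `|w x| `^ r).
  move=> r1 w0; apply/funext => x; rewrite ger0_norm ?polar_ge0// polar_powR//; last lra.
  by congr polar; apply/funext => y; rewrite ger0_norm.
rewrite /interaction (e u p p1 u0) (e v q q1 v0); apply: (riesz_form_polar N0 hs al0 alN); try by meas.
Qed.

Definition admissible u v := [/\ ballP 1 u v, forall x, 0 <= u x, forall x, 0 <= v x & (weighted_mass u v < +oo)%E].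

Lemma weighted_mass_ge0 u v : (0 <= weighted_mass u v)%E.
Proof. by apply: nnint_ge0 => x; rewrite mulr_ge0 ?sqn_ge0// addr_ge0 ?sqr_ge0. Qed.

(** Outside the cube of half-side M one has w^2 <= M^-2 (u^2 + v^2) |x|^2, so the second moment
    controls the square, and [interpolation] the power r. *)
Lemma weighted_mass_tail (r d : R) : subcritical (N := N) r -> 0 < d -> forall C : R, 0 <= C ->
  exists2 M : R, 0 < M & forall u v, ballP 1 u v -> (weighted_mass u v <= C%:E)%E ->
    (outer r M u <= d%:E)%E /\ (outer r M v <= d%:E)%E.
Proof.
move=> hr d0 C C0; have [r' rr' hr'] := subcritical_room hr.
have [G G0 hG] := sobolev N0 (ltW hr'.1) hr'.2 K10.
have t0 : 0 < d / (2 * (G + 1)) by rewrite divr_gt0// mulr_gt0// ltr_wpDl.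
have [c c0 hc] := interpolation hr.1 rr' t0.
(* Since M >= 1, dividing by M^2 instead of M only helps, and c C / M^2 is at most d/2. *)
pose M : R := 1 + 2 * c * C / d.
have M1 : 1 <= M by rewrite lerDl divr_ge0 ?(ltW d0)//; exact: mul3_ge0.
have M0 : 0 < M by exact: lt_le_trans M1.
have Md : c * C / M ^+ 2 <= d / 2.
  rewrite ler_pdivrMr ?exprn_gt0//; apply: (@le_trans _ _ (d / 2 * M)).
    rewrite /M; have -> : d / 2 * (1 + 2 * c * C / d) = c * C + d / 2 by field; rewrite gt_eqF.
    by rewrite lerDl divr_ge0// ltW.
  apply: ler_wpM2l; first by rewrite divr_ge0// ltW.
  by rewrite expr2 -{1}[M]mul1r ler_wpM2r// ltW.
exists M => //.
have key w (u v : E -> R) : in_ball w K1 -> measurable_fun setT u -> measurable_fun setT v ->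
    (forall x, w x ^+ 2 <= u x ^+ 2 + v x ^+ 2) -> (weighted_mass u v <= C%:E)%E -> (outer r M w <= d%:E)%E.
  move=> hw mu_ mv huv hW; have [[mw _] _ _] := hw; have mq := @measurable_sqn R N.
  pose h1 x := d / (2 * (G + 1)) * `|w x| `^ r'.
  pose h2 x := c / M ^+ 2 * ((u x ^+ 2 + v x ^+ 2) * sqn x).
  have mr' : measurable_fun setT (fun x => `|w x| `^ r') by meas.
  have mW : measurable_fun setT (fun x => (u x ^+ 2 + v x ^+ 2) * sqn x) by meas.
  have W0 x : 0 <= (u x ^+ 2 + v x ^+ 2) * sqn x by rewrite mulr_ge0 ?sqn_ge0// addr_ge0 ?sqr_ge0.
  have m1 : measurable_fun setT h1 by rewrite /h1; meas.
  have m2 : measurable_fun setT h2 by rewrite /h2; meas.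
  have cM : 0 <= c / M ^+ 2 by rewrite divr_ge0// exprn_ge0// ltW.
  have p1 x : 0 <= h1 x by rewrite mulr_ge0 ?powR_ge0// ltW.
  have p2 x : 0 <= h2 x by rewrite mulr_ge0.
  apply: (@le_trans _ _ (nnint leb (fun x => (h1 x + h2 x)%R))).
    apply: nnint_le.
    - by apply: mfM; [apply: mfb; apply: mfneg; exact: measurable_ocube|meas].
    - exact: mfD.
    - by move=> x; rewrite mulr_ge0 ?powR_ge0.
    move=> x; case: (boolP (ocube M x)) => hx; first by rewrite mul0r addr_ge0.
    rewrite mul1r; apply: (le_trans (hc _ (normr_ge0 _))); rewrite lerD2l /h2 -mulrA.
    apply: ler_wpM2l => //; rewrite real_normK ?num_real//.
    move: hx; rewrite negb_forall => /existsP[i]; rewrite -leNgt => hi.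
    have sx : M ^+ 2 <= sqn x.
      rewrite -enorm_sqr ler_sqr ?nnegrE ?enorm_ge0 ?(ltW M0)//; exact: le_trans (coord_le_enorm x i).
    rewrite -ler_pdivrMl ?invr_gt0 ?exprn_gt0// invrK mulrC; apply: ler_pM => //; [exact: sqr_ge0|exact: exprn_ge0 (ltW M0)].
  rewrite (nnintD leb m1 m2 p1 p2) (nnintZ leb mr' (fun x => powR_ge0 _ _) (ltW t0)) (nnintZ leb mW W0 cM).
  have E1 := lee_wpmul2l (_ : (0 <= (d / (2 * (G + 1)))%:E)%E) (hG w hw).
  have E2 := lee_wpmul2l (_ : (0 <= (c / M ^+ 2)%:E)%E) hW.
  rewrite !lee_fin in E1 E2; apply: (le_trans (leeD (E1 (ltW t0)) (E2 cM))).
  rewrite -!EFinM -!EFinD lee_fin.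
  have f1 : d / (2 * (G + 1)) * G <= d / 2.
    rewrite mulrAC ler_pdivrMr ?mulr_gt0 ?ltr_wpDl//.
    have -> : d / 2 * (2 * (G + 1)) = d * G + d by field.
    by rewrite lerDl ltW.
  by rewrite mulrAC; lra.
move=> u v h hW; have [b1 b2] := ball_in_ball A0 B0 h; have [mu_ mv] := ball_meas h.
split; [apply: (key u u v)|apply: (key v u v)] => // x.
- by rewrite lerDl sqr_ge0.
- by rewrite lerDr sqr_ge0.
Qed.

(** A bounded second moment keeps the maximising sequence tight, so D converges from above, while
    the second moment is lower semicontinuous. A polarization that lowered the second moment would
    raise the objective, hence invariance. The final inequality drops the negative term, which is of
    no use as l tends to 0. *)
Lemma penalised_maximiser (l : R) : 0 < l -> exists u v, [/\ admissible u v, polarized u, polarized v &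
  forall u' v', admissible u' v' -> (DP u' v' <= DP u v + l%:E * weighted_mass u' v')%E].
Proof.
move=> l0; have [C C0 hC] := interaction_bound N0 al0 alN hp hp' hq hq' K10.
have Dfin u v : ballP 1 u v -> exists2 r : R, 0 <= r <= C & DP u v = r%:E.
  move=> h; have [b1 b2] := ball_in_ball A0 B0 h; have h1 := hC _ _ b1 b2.
  have [r r0 e] := ge0_finite (interaction_ge0 p q al0 alN u v) (fine_le_lty h1).
  by exists r => //; rewrite r0 -lee_fin -e.
(* Both quantities are extended reals; finite witnesses are carried along so that the supremum is
   real. *)
pose S : set R := [set t | exists u v, admissible u v /\ exists2 a : R, DP u v = a%:E & exists2 b : R, weighted_mass u v = b%:E & t = a - l * b].
have SC t : S t -> t <= C.
  move=> [u [v [[hb _ _ _] [a ea [b eb ->]]]]].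
  have [r /andP[_ rC] er] := Dfin _ _ hb; have := weighted_mass_ge0 u v; rewrite eb lee_fin => b0.
  have -> : a = r by apply: EFin_inj; rewrite -ea.
  have := mulr_ge0 (ltW l0) b0; lra.
have L0 := L20 leb.
have b00 : ballP 1 (cst 0) (cst 0).
  split => // e e0; rewrite /pair_eps_energy /dint (eq_nnint _ (g := fun=> 0)) => [|w].
    by rewrite /nnint integral0 lee_fin mulr_ge0// ltW// moment_gt0.
  by rewrite /pair_eps_density /potential /cst; ring.
have D00 : exists2 a : R, DP (cst 0) (cst 0) = a%:E & 0 <= a.
  by have [r /andP[r0 _] e] := Dfin _ _ b00; exists r.
have W00 : weighted_mass (cst 0 : E -> R) (cst 0) = 0%:E.
  rewrite /weighted_mass (eq_nnint _ (g := fun=> 0)) => [|w]; first by rewrite /nnint integral0.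
  by rewrite /cst; ring.
have [a00 ea00 a000] := D00.
have S0 : S a00.
  exists (cst 0), (cst 0); split; last by exists a00 => //; exists 0 => //; ring.
  by split => //; rewrite W00 ltry.
have hS : has_sup S by split; [exists a00|exists C => t /SC].
have s0 : 0 <= sup S by apply: (le_trans a000); exact: sup_upper_bound.
have ex n : exists uv : (E -> R) * (E -> R), admissible uv.1 uv.2 /\ exists2 a : R, DP uv.1 uv.2 = a%:E &
    exists2 b : R, weighted_mass uv.1 uv.2 = b%:E & sup S - n.+1%:R^-1 < a - l * b.
  have i0 : 0 < n.+1%:R^-1 :> R by rewrite invr_gt0 ltr0n.
  have [t [u [v [h1 [a h2 [b h3 ->]]]]] ht] := sup_adherent i0 hS.
  by exists (u, v); split => //; exists a => //; exists b.
have [w hw] := choice ex.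
have hb n : ballP 1 (w n).1 (w n).2 by have [[]] := hw n.
have w1 n x : 0 <= (w n).1 x by have [[_ h _ _] _] := hw n.
have w2 n x : 0 <= (w n).2 x by have [[_ _ h _] _] := hw n.
have hW n : (weighted_mass (w n).1 (w n).2 <= ((C + 1) / l)%:E)%E.
  have [_ [a ea [b eb h]]] := hw n; have [r /andP[_ rC] er] := Dfin _ _ (hb n).
  have ar : a = r by apply: EFin_inj; rewrite -ea.
  rewrite eb lee_fin ler_pdivlMr// mulrC.
  have x1 : n.+1%:R^-1 <= 1 :> R by rewrite invf_le1 ?ltr0n// ler1n.
  by rewrite ar in h; exact: (penalty_bound h x1 s0 rC).
have Cl : 0 <= (C + 1) / l by rewrite divr_ge0 ?addr_ge0// ltW.
have [phi [u [v [[phii u0 v0] hbuv [cu cv] lu lv]]]] := pair_compact hb w1 w2.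
have phin := ltn_phi_ge phii.
have tails (r : R) : subcritical (N := N) r -> forall e : R, 0 < e -> exists2 M : R, 0 < M & forall n,
    (outer r M (w (phi n)).1 <= e%:E)%E /\ (outer r M (w (phi n)).2 <= e%:E)%E.
  by move=> hr e e0; have [M M0 hM] := weighted_mass_tail hr e0 Cl; exists M => // n; exact: hM.
have [b1 b2] := ball_in_ball A0 B0 hbuv.
have hb1 n : in_ball (w (phi n)).1 K1 by have [] := ball_in_ball A0 B0 (hb (phi n)).
have hb2 n : in_ball (w (phi n)).2 K1 by have [] := ball_in_ball A0 B0 (hb (phi n)).
have lim := @interaction_limsup (fun n => (w (phi n)).1) (fun n => (w (phi n)).2) u v (fun n => hb (phi n)) hbuv.
have {}lim : forall e : R, 0 < e -> exists n0, forall n, (n0 <= n)%N -> (DP (w (phi n)).1 (w (phi n)).2 <= DP u v + e%:E)%E.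
  apply: lim => r hr.
    apply: (@Lr_convergence _ _ N0 r K1 (fun n => (w (phi n)).1) u hr K10 hb1 b1 cu lu) => e e0.
    by have [M M0 hM] := tails r hr e e0; exists M => // n; have [] := hM n.
  apply: (@Lr_convergence _ _ N0 r K1 (fun n => (w (phi n)).2) v hr K10 hb2 b2 cv lv) => e e0.
  by have [M M0 hM] := tails r hr e e0; exists M => // n; have [] := hM n.
have [d /andP[d0 dC] ed] := Dfin _ _ hbuv; have [mu_ mv] := ball_meas hbuv.
have mq := @measurable_sqn R N.
(* Fatou's lemma along the tail where D is within e/2 of its limit value and the sequence within e/2
   of the supremum. *)
have Wle (e : R) : 0 < e -> (weighted_mass u v <= ((d + e - sup S) / l)%:E)%E.
  move=> e0; have e2 : 0 < e / 2 by rewrite divr_gt0.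
  have [n0 hn0] := lim _ e2.
  pose n1 := maxn n0 (Num.bound (2 / e)).
  have sqc (f : nat -> R) (t : R) : f n @[n --> \oo] --> t -> f n ^+ 2 @[n --> \oo] --> t ^+ 2.
    by move=> hf; under eq_fun do rewrite expr2; exact: cvgM.
  apply: (@nnint_fatou _ _ _ leb (fun n x => ((w (phi n)).1 x ^+ 2 + (w (phi n)).2 x ^+ 2) * sqn x) _ _ n1).
  - by move=> n; have [m1 m2] := ball_meas (hb (phi n)); meas.
  - by meas.
  - by move=> n x; rewrite mulr_ge0 ?sqn_ge0// addr_ge0 ?sqr_ge0.
  - by move=> x; rewrite mulr_ge0 ?sqn_ge0// addr_ge0 ?sqr_ge0.
  - apply: filterS2 cu cv => x h1 h2; apply: cvgM; last exact: cvg_cst.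
    by apply: cvgD; exact: sqc.
  move=> n; rewrite geq_max => /andP[nn0 nn1].
  have [_ [a ea [b eb h]]] := hw (phi n); rewrite -/(weighted_mass _ _) eb lee_fin ler_pdivlMr// mulrC.
  have := hn0 n nn0; rewrite ea ed -EFinD lee_fin => h1.
  have h2 : (phi n).+1%:R^-1 <= e / 2 :> R.
    rewrite -[e / 2]invrK lef_pV2 ?posrE ?invr_gt0 ?ltr0n// invf_div.
    apply: (le_trans (ltW (archi_boundP (_ : 0 <= 2 / e)))); first by rewrite divr_ge0// ltW.
    by rewrite ler_nat; apply: leq_trans nn1 _; exact: leq_trans (phin n) _.
  exact: (penalty_limit h h1 h2).
have Wfin : exists2 b : R, 0 <= b & weighted_mass u v = b%:E.
  by apply: ge0_finite; [exact: weighted_mass_ge0|exact: (fine_le_lty (Wle 1 ltr01))].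
have [b b0 eb] := Wfin.
have hadm : admissible u v by split => //; rewrite eb ltry.
have best : sup S <= d - l * b.
  apply/ler_addgt0Pr => e e0; have := Wle e e0; rewrite eb lee_fin ler_pdivlMr// mulrC; lra.
have opt u' v' : admissible u' v' -> (DP u' v' <= DP u v + l%:E * weighted_mass u' v' - l%:E * weighted_mass u v)%E.
  move=> h; have [hb' u'0 v'0 W'] := h; have [d' _ ed'] := Dfin _ _ hb'.
  have [b' b'0 eb'] := ge0_finite (weighted_mass_ge0 u' v') W'.
  rewrite ed' ed eb' eb -!EFinM -EFinD lee_fin.
  have : S (d' - l * b') by exists u', v'; split => //; exists d' => //; exists b'.
  move=> /(sup_upper_bound hS); lra.
(* If the second moment dropped strictly, the polarized pair would be admissible with D at least as
   large, contradicting maximality. *)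
have KK s a : polarizer s a -> {ae leb, forall x, 0 < a x -> u (s x) <= u x /\ v (s x) <= v x}.
  move=> hs; apply: (weighted_mass_polar hs mu_ mv u0 v0); first by rewrite eb ltry.
  rewrite leNgt; apply/negP => lt; have bp := ball_polar hs hbuv.
  have Wp := lt_trans lt (_ : (weighted_mass u v < +oo)%E); rewrite eb ltry in Wp.
  have hp_ : admissible (polar s a u) (polar s a v).
    by split => //; [exact: polar_ge0|exact: polar_ge0|exact: Wp].
  have := opt _ _ hp_; have := interaction_polar hs mu_ mv u0 v0; have [d' _ ed'] := Dfin _ _ bp.
  have [b' b'0 eb'] := ge0_finite (weighted_mass_ge0 (polar s a u) (polar s a v)) (Wp isT).
  move: lt; rewrite ed' ed eb' eb -!EFinM -EFinD !lee_fin lte_fin => h1 h2 h3.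
  have : l * b' < l * b by rewrite ltr_pM2l.
  lra.
exists u, v; split => //.
- by move=> s a /KK; apply: filterS => x h ax; have [] := h ax.
- by move=> s a /KK; apply: filterS => x h ax; have [] := h ax.
move=> u' v' h; apply: (le_trans (opt _ _ h)); rewrite ed eb; have [_ _ _ W'] := h.
have [b' b'0 eb'] := ge0_finite (weighted_mass_ge0 u' v') W'.
rewrite eb' -!EFinM -EFinD lee_fin; have := mulr_ge0 (ltW l0) b0; lra.
Qed.

End maximisers.

(** * Monotonicity and decay of polarization-invariant functions *)

Section monotonicity_from_polarization.
Context {R : realType} {N : nat}.
Hypothesis N0 : (0 < N)%N.
Local Notation E := 'rV[R]_N.
Local Notation leb := (@lebesgue_rV R N).
Implicit Types (u v w : E -> R) (x y z t : E).

Lemma measurable_notin (A : set E) : measurable A -> measurable_fun setT (fun x => x \notin A).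
Proof.
move=> mA; apply: mfneg; apply: (measurable_fun_bool true) => //.
by rewrite (_ : _ `&` _ = A)//; apply/seteqP; split => x /=; [by move=> [_ /set_mem]|by move=> /mem_set].
Qed.

(** Off the null set of bad x the predicate is weakened to a true one, which reduces the claim to
    [ae_swap]. *)
Lemma ae_ae_swap (b : E -> E -> bool) : measurable_fun setT (fun z : E * E => b z.1 z.2) ->
  {ae leb, forall x, {ae leb, forall y, b x y}} -> {ae leb, forall y, {ae leb, forall x, b x y}}.
Proof.
move=> mb [A [mA A0 sA]].
pose c x y := ~~ ((x \notin A) && ~~ b x y).
have mc : measurable_fun setT (fun z : E * E => c z.1 z.2).
  apply: mfneg; apply: mfand; last exact: mfneg.
  by apply: (@measurableT_comp _ _ _ _ _ _ (fun x => x \notin A)); [exact: measurable_notin|exact: measurable_fst].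
have hc x : {ae leb, forall y, c x y}.
  case: (boolP (x \in A)) => [xA|xA]; first by apply: nearW => y; rewrite /c xA.
  have h : {ae leb, forall y, b x y}.
    by apply: contrapT => h; move: xA => /negP; apply; apply: mem_set; exact: sA.
  by apply: filterS h => y by_; rewrite /c by_ andbF.
have nA : {ae leb, forall x, x \notin A}.
  by exists A; split => // x /= /negP; rewrite negbK => /set_mem.
apply: filterS (ae_swap mc hc) => y hy.
by apply: filterS2 hy nA => x; rewrite /c => + xA; rewrite xA/= negbK.
Qed.

(** The first k coordinates are reflected in x_l = t_l / 2; after all of them x becomes t - x. *)
Definition mix (k : nat) t x : E := \row_(l < N) (if (l < k)%N then t ord0 l - x ord0 l else x ord0 l).

Lemma mpres_mix k t : mpres (mix k t).
Proof.
rewrite (_ : mix k t = signed_perm 1%g (\row_(l < N) (if (l < k)%N then -1 else 1))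
   (\row_(l < N) (if (l < k)%N then t ord0 l else 0))).
  by apply: mpres_signed_perm => i; rewrite mxE; case: ifP; rewrite ?sqrrN expr1n.
apply/funext => x; apply/rowP => l; rewrite !mxE perm1; case: ifP => _.
  by rewrite mulN1r addrC.
by rewrite mul1r addr0.
Qed.

Lemma mixS (k : 'I_N) t x : mix k.+1 t x = refl k (t ord0 k / 2) (mix k t x).
Proof.
apply/rowP => l; rewrite !mxE ltnn ltnS leq_eqVlt; case: (eqVneq l k) => [->|lk].
  by rewrite eqxx /= mulrC divfK.
by rewrite (_ : (l == k :> nat) = false) //; apply/negbTE.
Qed.

Lemma closer_sqr (s r : R) : `|s| < `|r - s| -> r != 0 /\ 0 < r / 2 * (r / 2 - s).
Proof.
move=> h; have h2 : s ^+ 2 < (r - s) ^+ 2.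
  by rewrite -[s ^+ 2]real_normK ?num_real// -[(r - s) ^+ 2]real_normK ?num_real// ltr_sqr ?nnegrE.
split; last by nra.
by apply: contraTneq h => ->; rewrite sub0r normrN ltxx.
Qed.

Lemma polarized_mix u t : polarized u -> forall k, (k <= N)%N -> {ae leb, forall x,
  (forall l : 'I_N, (l < k)%N -> `|x ord0 l| < `|t ord0 l - x ord0 l|) -> u (mix k t x) <= u x}.
Proof.
move=> hu; elim=> [|k IH] kN.
  apply: nearW => x _; rewrite (_ : mix 0 t x = x)//; apply/rowP => l; by rewrite mxE.
have IHk := IH (ltnW kN); pose o := Ordinal kN.
have [t0|t0] := eqVneq (t ord0 o / 2) 0.
  apply: nearW => x /(_ o (ltnSn k)) /closer_sqr[t1 _]; exfalso.
  by move/eqP: t0; rewrite mulf_eq0 (negbTE t1) invr_eq0 pnatr_eq0.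
have h := mpres_ae (mpres_mix k t) (hu _ _ (polarizer_refl o t0)).
apply: filterS2 IHk h => x h1 h2 hx.
apply: le_trans (h1 (fun l lk => hx l (ltnW lk))).
rewrite -[mix k.+1 t x]/(mix o.+1 t x) mixS; apply: h2; rewrite mxE ltnn.
by have [] := closer_sqr (hx o (ltnSn k)).
Qed.

Definition inner_pt x z : bool := [forall l : 'I_N, `|x ord0 l| < `|z ord0 l|].

Lemma measurable2_inner_pt (F G : E * E -> E) : measurable_fun setT F -> measurable_fun setT G ->
  measurable_fun setT (fun w : E * E => inner_pt (F w) (G w)).
Proof.
move=> mF mG; rewrite (_ : (fun w : E * E => _) = fun w : E * E => \big[andb/true]_i (`|(F w) ord0 i| < `|(G w) ord0 i|)); last first.
  by apply/funext => w; rewrite /inner_pt big_andE.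
elim: (index_enum _) => [|i s IH]; first by under eq_fun do rewrite big_nil; exact: measurable_cst.
have c (H : E * E -> E) : measurable_fun setT H -> measurable_fun setT (fun w : E * E => (H w) ord0 i).
  by move=> mH; apply: (@measurableT_comp _ _ _ _ _ _ (fun z : E => z ord0 i)) => //; exact: measurable_coord.
have cF := c F mF; have cG := c G mG.
by under eq_fun do rewrite big_cons; apply: mfand => //; meas.
Qed.

(** The composed reflections give u(t - x) <= u(x) when each coordinate of x is smaller in modulus.
    The exceptional set depends on t; two exchanges of almost-everywhere quantifiers and the
    substitution z = t - x make the statement one about almost every pair. *)
Lemma polarized_outer_le u : measurable_fun setT u -> polarized u ->
  {ae leb, forall z, {ae leb, forall x, inner_pt x z -> u z <= u x}}.
Proof.
move=> mu_ hu.
pose b t x := ~~ (inner_pt x (t - x) && ~~ (u (t - x) <= u x)).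
have hb t : {ae leb, forall x, b t x}.
  apply: filterS (polarized_mix t hu (leqnn N)) => x hx; rewrite /b negb_and negbK -implybE.
  apply/implyP => /forallP h; have -> : t - x = mix N t x.
    by apply/rowP => l; rewrite !mxE ltn_ord.
  by apply: hx => l _; have := h l; rewrite !mxE.
have md : measurable_fun setT (fun w : E * E => w.1 - w.2) by meas.
have mux : measurable_fun setT (fun w : E * E => u w.2).
  by apply: (@measurableT_comp _ _ _ _ _ _ u) => //; exact: measurable_snd.
have mud : measurable_fun setT (fun w : E * E => u (w.1 - w.2)) by exact: (measurableT_comp mu_ md).
have mb : measurable_fun setT (fun w : E * E => b w.1 w.2).
  apply: mfneg; apply: mfand.
    by apply: (measurable2_inner_pt (F := fun w : E * E => w.2) (G := fun w : E * E => w.1 - w.2)) => //; exact: measurable_snd.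
  by apply: mfneg; meas.
pose c x z := ~~ (inner_pt x z && ~~ (u z <= u x)).
have hc : {ae leb, forall x, {ae leb, forall z, c x z}}.
  apply: filterS (ae_swap mb hb) => x hx.
  by apply: filterS (mpres_ae (mpres_add x) hx) => z; rewrite /b addrK.
have muz : measurable_fun setT (fun w : E * E => u w.1).
  by apply: (@measurableT_comp _ _ _ _ _ _ u) => //; exact: measurable_fst.
have mc : measurable_fun setT (fun w : E * E => c w.1 w.2).
  apply: mfneg; apply: mfand.
    by apply: (measurable2_inner_pt (F := fun w : E * E => w.1) (G := fun w : E * E => w.2)); [exact: measurable_fst|exact: measurable_snd].
  by apply: mfneg; meas.
apply: filterS (ae_ae_swap mc hc) => z hz.
by apply: filterS hz => x; rewrite /c negb_and negbK => /orP[/negP|].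
Qed.

(** The induction measure: coordinates that still prevent comparison with the whole cube. *)
Definition nsmall (n : nat) y : nat := (\sum_(j < N) nat_of_bool (`|y ord0 j| <= n%:R :> R)%R)%N.

Lemma ae_countable (I : countType) (P : I -> E -> Prop) : (forall i, {ae leb, forall x, P i x}) ->
  {ae leb, forall x, forall i, P i x}.
Proof.
move=> h; have h2 : {ae leb, forall x, forall n, (if unpickle n is Some i then P i x else True)}.
  apply: ae_foralln => n; case: (unpickle n) => [i|]; [exact: h|exact: nearW].
by apply: filterS h2 => x hx i; have := hx (pickle i); rewrite pickleK.
Qed.

(** If one coordinate of y is huge, about half of it can be transferred to a small coordinate by a
    reflection that does not decrease u. Repeating this makes all coordinates exceed n, where
    [polarized_outer_le] compares y with every point of the cube. Each transfer shrinks the large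
    coordinate by less than a factor 4, whence the threshold. *)
Lemma polarized_small (u : E -> R) (n : nat) : measurable_fun setT u -> polarized u -> (0 < n)%N ->
  forall m, {ae leb, forall y, (nsmall n y <= m)%N -> (exists i, (4 ^+ m * n%:R : R) < `|y ord0 i|) ->
    {ae leb, forall x, ocube n%:R x -> u y <= u x}}.
Proof.
move=> mu_ hu n0; elim=> [|m IH].
  apply: filterS (polarized_outer_le mu_ hu) => y hy; rewrite leqn0 => hs _.
  apply: filterS hy => x hx /forallP hxn; apply: hx; apply/forallP => l; apply: (lt_trans (hxn l)).
  rewrite ltNge; apply/negP => h; move: hs; rewrite /nsmall (bigD1 l)//= h.
  by rewrite addn_eq0.
(* The transferred length depends on y, so the exceptional sets are unioned over countably many
   reflections, with rational parameter. *)
have step (c : 'I_N * 'I_N * rat) : {ae leb, forall y, c.1.1 != c.1.2 -> ratr c.2 != 0 :> R ->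
   let s := swap c.1.1 c.1.2 (ratr c.2) in
   (0 < ratr c.2 * (ratr c.2 - ((s y) ord0 c.1.1 - (s y) ord0 c.1.2)) -> u y <= u (s y)) /\
   ((nsmall n (s y) <= m)%N -> (exists i, (4 ^+ m * n%:R : R) < `|(s y) ord0 i|) ->
    {ae leb, forall x, ocube n%:R x -> u (s y) <= u x})}.
  case: c => [[i j] r] /=.
  have [->|ij] := eqVneq i j; first exact: nearW.
  have [r0|r0] := eqVneq (ratr r : R) 0; first exact: nearW.
  have hs := polarizer_swap ij r0; have [ms _ sK _ _] := hs.
  apply: filterS2 (mpres_ae ms (hu _ _ hs)) (mpres_ae ms IH) => y h1 h2 _ _; split.
    by move=> a0; have := h1 a0; rewrite sK.
  exact: h2.
apply: filterS2 IH (ae_countable step) => y hIH hstep hs [i hi].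
have N4 : (1 : R) <= 4 ^+ m by rewrite exprn_ege1// ler1n.
have nR : (1 : R) <= n%:R by rewrite ler1n.
have p4 : n%:R <= 4 ^+ m * n%:R :> R by rewrite ler_peMl// ler0n.
have e4 : 4 ^+ m.+1 * n%:R = 4 * (4 ^+ m * n%:R) :> R by rewrite exprS mulrA.
rewrite e4 in hi; move: p4 hi; set P := 4 ^+ m * n%:R => p4 hi.
have [sm|sm] := leqP (nsmall n y) m.
  by apply: hIH => //; exists i; rewrite -/P; lra.
have [j hj] : exists j : 'I_N, `|y ord0 j| <= n%:R.
  apply: contrapT => no; move: sm; rewrite /nsmall big1 // => j _.
  by case: (boolP (`|y ord0 j| <= n%:R)) => // h; case: no; exists j.
have ij : i != j by apply: contraTneq hj => <-; rewrite -ltNge; lra.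
have ji : (j == i) = false by rewrite eq_sym (negbTE ij).
(* Between 1/2 and 5/8 of y_i: at least 3/8 of the large coordinate remains, the small one ends
   above n in modulus, and the image lies on the side of the origin. *)
have [r hr] : exists r : rat, (if 0 < y ord0 i then y ord0 i / 2 < ratr r < 5 * y ord0 i / 8
    else 5 * y ord0 i / 8 < ratr r < y ord0 i / 2).
  case: ltP => hy.
    have /rat_in_itvoo[r] : y ord0 i / 2 < 5 * y ord0 i / 8 by lra.
    by rewrite in_itv/=; exists r.
  have yn : y ord0 i < 0 by rewrite lt_neqAle hy andbT; apply/eqP => h; move: hi; rewrite h normr0; lra.
  have /rat_in_itvoo[r] : 5 * y ord0 i / 8 < y ord0 i / 2 by lra.
  by rewrite in_itv/=; exists r.
pose t : R := ratr r; rewrite -/t in hr.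
have hj2 : - n%:R <= y ord0 j /\ y ord0 j <= n%:R by move: hj; rewrite ler_norml => /andP.
have [j1 j2] := hj2.
have facts : [/\ t != 0, 0 < t * (y ord0 i - y ord0 j - t), n%:R < `|y ord0 j + t| & P < `|y ord0 i - t|].
  move: hr; case: ltP => hy /andP[r1 r2].
    rewrite gtr0_norm// in hi; split.
    - by apply/eqP => h; lra.
    - by apply: mulr_gt0; lra.
    - by apply: lt_le_trans (ler_norm _); lra.
    - by apply: lt_le_trans (ler_norm _); lra.
  rewrite ler0_norm// in hi; split.
  - by apply/eqP => h; lra.
  - by rewrite -mulrNN; apply: mulr_gt0; lra.
  - by rewrite -normrN; apply: lt_le_trans (ler_norm _); lra.
  - by rewrite -normrN; apply: lt_le_trans (ler_norm _); lra.
have [t0 a0 zi zj] := facts.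
have [h1 h2] := hstep (i, j, r) ij t0; rewrite /= -/t in h1 h2.
have si : swap i j t y ord0 i = y ord0 j + t by rewrite mxE eqxx.
have sj : swap i j t y ord0 j = y ord0 i - t by rewrite mxE ji eqxx.
have uy : u y <= u (swap i j t y).
  by apply: h1; rewrite si sj (_ : t - _ = y ord0 i - y ord0 j - t)//; ring.
have ns : (nsmall n (swap i j t y) <= m)%N.
  have L z : nsmall n z = ((`|z ord0 i| <= n%:R)%R + ((`|z ord0 j| <= n%:R)%R +
      \sum_(k < N | (k != i) && (k != j)) nat_of_bool (`|z ord0 k| <= n%:R :> R)%R))%N.
    by rewrite /nsmall (bigD1 i)//= (bigD1 j)//= eq_sym.
  rewrite -ltnS; apply: leq_trans hs; rewrite !L si sj hj.
  rewrite (_ : (`|y ord0 j + t| <= n%:R) = false); last by apply/negbTE; rewrite -ltNge.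
  rewrite (_ : (`|y ord0 i - t| <= n%:R) = false); last by apply/negbTE; rewrite -ltNge; lra.
  rewrite !add0n (eq_bigr (fun k => nat_of_bool (`|y ord0 k| <= n%:R :> R))) => [|k /andP[k1 k2]].
    by rewrite add1n addnS ltnS leq_addl.
  by rewrite mxE (negbTE k1) (negbTE k2).
have ex : exists k, P < `|swap i j t y ord0 k| by exists j; rewrite sj.
by apply: filterS (h2 ns ex) => x hx /hx; exact: le_trans.
Qed.

(** On a cube of side n the function is at least u(y), so u(y)^2 times the volume of the cube is at
    most the squared norm. *)
Lemma polarized_decay (u : E -> R) : L2 leb u -> polarized u -> (forall x, 0 <= u x) ->
  {ae leb, forall y, forall n, (0 < n)%N -> (exists i, (4 ^+ N * n%:R : R) < `|y ord0 i|) ->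
    u y ^+ 2 * n%:R <= n2 leb u}.
Proof.
move=> Lu hu u0; have mu_ := Lu.1; apply: ae_foralln => n.
case: n => [|n]; first exact: nearW.
apply: filterS (polarized_small mu_ hu (ltn0Sn n) N) => y hy _ ex.
have hs : (nsmall n.+1 y <= N)%N.
  rewrite /nsmall; apply: leq_trans (_ : \sum_(j < N) 1 <= N)%N; last by rewrite sum1_card card_ord.
  by apply: leq_sum => j _; exact: leq_b1.
have {}hy := hy hs ex.
have n1 : (0 : R) < n.+1%:R by rewrite ltr0n.
have n20 : 0 <= n.+1%:R / 2 :> R by rewrite divr_ge0.
have mi : measurable_fun setT (fun x => (incube (n.+1%:R / 2) x)%:R : R) by apply: mfb; exact: measurable_incube.
rewrite -lee_fin -(n2E Lu); apply: (@le_trans _ _ ((u y ^+ 2)%:E * nnint leb (fun x => ((incube (n.+1%:R / 2) x)%:R)%R))%E).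
  rewrite nnint_incube// EFinM; apply: lee_wpmul2l; first by rewrite lee_fin sqr_ge0.
  (* The volume is a power with exponent N >= 1 of a number at least 1; the first power is
     enough. *)
  rewrite lee_fin mulrC divfK//; apply: (@le_trans _ _ (n.+1%:R ^+ 1)); first by rewrite expr1.
  by apply: ler_weXn2l => //; rewrite ler1n.
rewrite -(nnintZ leb mi (fun x => ler0n _ _) (sqr_ge0 _)).
apply: nnint_ae_le.
- by apply: mfM => //; exact: measurable_cst.
- by meas.
- by move=> x; rewrite mulr_ge0 ?sqr_ge0.
- by move=> x; exact: sqr_ge0.
apply: filterS hy => x hx; case: incubeP => hc; last by rewrite mulr0 sqr_ge0.
rewrite mulr1 ler_sqr ?nnegrE//; apply: hx; apply/forallP => i; apply: (le_lt_trans (hc i)); lra.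
Qed.

Lemma polarized_tail (r d C : R) : subcritical (N := N) r -> 0 < d -> 0 <= C ->
  exists2 M : R, 0 < M & forall u, L2 leb u -> polarized u -> (forall x, 0 <= u x) -> n2 leb u <= C ->
    (outer r M u <= d%:E)%E.
Proof.
(* Where u^2 <= c one has u^r <= c^((r-2)/2) u^2, and this c makes the factor d/(C + 1). *)
move=> [r2 _] d0 C0; pose c : R := (d / (C + 1)) `^ (2 / (r - 2)).
have C1 : 0 < C + 1 by rewrite ltr_wpDl.
have r20 : 0 < r - 2 by lra.
have c0 : 0 < c by rewrite powR_gt0// divr_gt0.
pose n := (Num.bound (C / c)).+1.
have nC : C / n%:R <= c.
  rewrite ler_pdivrMr ?ltr0n// mulrC -ler_pdivrMr//.
  have h : 0 <= C / c by rewrite divr_ge0// ltW.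
  by apply: (le_trans (ltW (archi_boundP h))); rewrite ler_nat.
pose M : R := 4 ^+ N * n%:R + 1.
have M0 : 0 < M by rewrite ltr_wpDl// mulr_ge0// exprn_ge0.
exists M => // u Lu hu u0 nu; have mu_ := Lu.1.
have dC : 0 <= d / (C + 1) by rewrite divr_ge0 ?ltW.
apply: (@le_trans _ _ (nnint leb (fun x => (d / (C + 1) * u x ^+ 2)%R))).
  apply: nnint_ae_le.
  - by apply: mfM; [apply: mfb; apply: mfneg; exact: measurable_ocube|meas].
  - by meas.
  - by move=> x; rewrite mulr_ge0 ?powR_ge0.
  - by move=> x; rewrite mulr_ge0 ?sqr_ge0.
  apply: filterS (polarized_decay Lu hu u0) => x hx.
  case: (boolP (ocube M x)) => ho; first by rewrite mul0r mulr_ge0 ?sqr_ge0.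
  rewrite mul1r ger0_norm//.
  have hx2 : u x ^+ 2 <= c.
    apply: le_trans nC; rewrite ler_pdivlMr ?ltr0n//; apply: le_trans nu; apply: hx => //.
    by move: ho; rewrite negb_forall => /existsP[i]; rewrite -leNgt => hi; exists i; apply: lt_le_trans hi; rewrite ltrDl.
  have [ux|ux] := eqVneq (u x) 0.
    have rn : r != 0 by apply/eqP; lra.
    by rewrite ux powR0// mulr_ge0 ?sqr_ge0.
  rewrite (_ : u x `^ r = (u x ^+ 2) `^ ((r - 2) / 2) * u x ^+ 2).
    apply: ler_wpM2r; first exact: sqr_ge0.
    apply: (@le_trans _ _ (c `^ ((r - 2) / 2))).
      by apply: ge0_ler_powR; rewrite ?nnegrE ?sqr_ge0 ?(ltW c0)// divr_ge0// ltW.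
    rewrite /c -powRrM (_ : 2 / (r - 2) * ((r - 2) / 2) = 1) ?powRr1//; field; exact: lt0r_neq0.
  rewrite -powR_mulrn// -powRrM -powRD; last by rewrite ux implybT.
  by congr (_ `^ _); field.
have m2 : measurable_fun setT (fun x => u x ^+ 2) by meas.
rewrite (nnintZ leb m2 (fun x => sqr_ge0 _) dC) (n2E Lu) -EFinM lee_fin.
rewrite mulrAC ler_pdivrMr// ler_wpM2l ?(ltW d0)//; lra.
Qed.

Lemma polarized_limit (un : nat -> E -> R) u : {ae leb, forall x, un n x @[n --> \oo] --> u x} ->
  (forall n, polarized (un n)) -> polarized u.
Proof.
move=> cu hun s a hs; have [ms _ _ _ _] := hs.
have h : {ae leb, forall x, forall n, 0 < a x -> un n (s x) <= un n x} by apply: ae_foralln => n; exact: hun.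
have cs := mpres_ae ms cu.
apply: filterS (filterI h (filterI cu cs)) => x [h1 [h2 h3]] ax.
by apply: ler_cvg_to h3 h2 _; apply: nearW => n; exact: h1.
Qed.

End monotonicity_from_polarization.

(** * Integration by parts for test functions *)

Section test_functions_H1.
Context {R : realType} {N : nat}.
Local Notation E := 'rV[R]_N.
Local Notation leb := (@lebesgue_rV R N).
Implicit Types (phi psi u : E -> R) (x z : E).

(** A difference quotient passes from one factor to the other by translation invariance. Expanding
    both sides to first order in a step 1/(n+1) leaves the two pairings with an error of the same
    order. *)
Lemma test_by_parts phi psi (i : 'I_N) : test_function phi -> test_function psi ->
  ip leb phi (partial i psi) = - ip leb (partial i phi) psi.
Proof.
move=> tp tq; have Lp := test_L2 tp; have Lq := test_L2 tq.
have Lpi := test_L2 (test_partial i tp); have Lqi := test_L2 (test_partial i tq).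
have [C1 C10 h1] := test_expansion tp; have [C2 C20 h2] := test_expansion tq.
apply/eqP; rewrite -subr_eq0 opprK -normr_le0; apply/eqP; apply/eqP.
have sumz (t : R) (f : 'I_N -> R) : \sum_j (t *: unit_vec i : E) ord0 j * f j = t * f i.
  rewrite (bigD1 i)//= big1 ?addr0 => [|j ji]; first by rewrite !mxE !eqxx mulr1.
  by rewrite !mxE (negbTE ji) andbF mulr0 mul0r.
have l1u (t : R) : l1norm (t *: unit_vec i : E) = `|t|.
  rewrite l1normZ /l1norm (bigD1 i)//= big1 ?addr0 => [|j ji]; first by rewrite !mxE !eqxx normr1 mulr1.
  by rewrite !mxE (negbTE ji) andbF normr0.
pose C := C2 * (n2 leb phi + 1) + C1 * (n2 leb psi + 1).
apply: (@le_of_inv_bound _ _ C 0%N) => n _; pose t : R := n.+1%:R^-1.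
have t0 : 0 < t by rewrite invr_gt0 ltr0n.
have t1 : t <= 1 by rewrite invf_le1 ?ltr0n// ler1n.
pose z : E := t *: unit_vec i.
have lz : l1norm z = t by rewrite l1u gtr0_norm.
have lNz : l1norm (- z) = t by rewrite l1normN.
have e2 := h2 phi z Lp; rewrite lz t0 t1 in e2.
have e1 := h1 psi (- z) Lq; rewrite lNz t0 t1 in e1.
have s2 : \sum_j z ord0 j * ip leb phi (partial j psi) = t * ip leb phi (partial i psi).
  exact: (sumz t (fun j => ip leb phi (partial j psi))).
have s1 : \sum_j (- z) ord0 j * ip leb psi (partial j phi) = - (t * ip leb psi (partial i phi)).
  rewrite -(sumz t (fun j => ip leb psi (partial j phi))) -sumrN.
  by apply: eq_bigr => j _; rewrite [X in X * _]mxE mulNr.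
rewrite s2 in e2; rewrite s1 in e1; move: (e1 isT) (e2 isT) => {s1 s2 e1 e2}.
have -> : ip leb phi (fun x => psi (x + z) - psi x) = ip leb psi (fun x => phi (x + - z) - phi x).
  rewrite ipC (ipBl (L2_shift z Lq) Lq Lp) (ip_shift z Lq Lp) [ip leb psi (fun x => _ - _)]ipC.
  by rewrite (ipBl (L2_shift (- z) Lp) Lp Lq) [X in X - _]ipC [ip leb phi psi]ipC.
rewrite opprK [ip leb psi (partial i phi)]ipC; move: (ip leb psi _) => X.
set a := ip leb phi _; set b := ip leb _ psi => k1 k2.
have : t * `|a + b| <= C * t ^+ 2.
  rewrite -{1}(gtr0_norm t0) -normrM (_ : t * (a + b) = (X + t * b) - (X - t * a)); last by ring.
  apply: (le_trans (ler_normB _ _)); apply: (le_trans (lerD k1 k2)).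
  by rewrite /C addrC -mulrDl.
rewrite expr2 mulrCA; rewrite ler_pM2l//.
Qed.

Lemma wgrad_test phi : test_function phi -> wgrad phi (fun i => partial i phi).
Proof.
move=> tp i; split; first by apply: test_L2; exact: test_partial.
by apply/weak_partial_ip => psi tq; exact: test_by_parts.
Qed.

Lemma H1_test phi : test_function phi -> H1 phi.
Proof. by move=> tp; apply/H1P; split; [exact: test_L2|exists (fun i => partial i phi); exact: wgrad_test]. Qed.

End test_functions_H1.

(** * Cutoff functions *)

Section cutoffs.
Context {R : realType} {N : nat}.
Local Notation E := 'rV[R]_N.
Local Notation leb := (@lebesgue_rV R N).
Local Notation moment := (@moment R N).
Implicit Types (u v : E -> R) (x z : E) (r e : R).

Definition cutoff r x : R := Num.max 0 (1 - l1norm x / r).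

Lemma cutoff_ge0 r x : 0 <= cutoff r x.
Proof. by rewrite le_max lexx. Qed.

Lemma cutoff_le1 r x : 0 < r -> cutoff r x <= 1.
Proof. by move=> r0; rewrite ge_max ler01/= lerBlDr lerDl divr_ge0 ?l1norm_ge0// ltW. Qed.

Lemma l1norm_triangle x z : l1norm (x + z) <= l1norm x + l1norm z.
Proof. by rewrite /l1norm -big_split/=; apply: ler_sum => i _; rewrite mxE; exact: ler_normD. Qed.

Lemma cutoff_lip r x z : 0 < r -> `|cutoff r (x + z) - cutoff r x| <= l1norm z / r.
Proof.
move=> r0; have h1 := l1norm_triangle x z.
have h2 : l1norm x <= l1norm (x + z) + l1norm z.
  by have := l1norm_triangle (x + z) (- z); rewrite addrK l1normN.
have maxlip (a b c : R) : `|a - b| <= c -> `|Num.max 0 a - Num.max 0 b| <= c.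
  by rewrite !ler_norml => /andP[? ?]; case: (leP 0 a); case: (leP 0 b); move=> *; apply/andP; split; lra.
apply: maxlip; rewrite (_ : _ - _ = (l1norm x - l1norm (x + z)) / r); last by rewrite mulrBl; ring.
rewrite normrM [`|r^-1|]gtr0_norm ?invr_gt0// ler_pM2r ?invr_gt0//.
by rewrite ler_norml; apply/andP; split; lra.
Qed.

Lemma measurable_cutoff r : measurable_fun setT (cutoff r).
Proof. by rewrite /cutoff /l1norm; meas. Qed.

Lemma cutoff_supp r x : 0 < r -> cutoff r x != 0 -> sqn x <= r ^+ 2.
Proof.
move=> r0; rewrite /cutoff; case: (leP 0 (1 - l1norm x / r)) => h; rewrite ?eqxx// => _.
rewrite -enorm_sqr ler_sqr ?nnegrE ?enorm_ge0 ?(ltW r0)//; apply: (le_trans (enorm_le_sum x)).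
by move: h; rewrite subr_ge0 ler_pdivrMr// mul1r.
Qed.

Lemma nnint_bz_sqn e : nnint leb (fun z => ball_ind e z * sqn z) = (N%:R * moment e)%:E.
Proof.
rewrite (eq_nnint _ (g := fun z => \sum_i ball_ind e z * (z ord0 i * z ord0 i))) => [|z]; last first.
  by rewrite /sqn mulr_sumr; apply: eq_bigr => i _; rewrite expr2.
have hb := @measurable_ball_ind R N e.
rewrite nnint_sum => [|i|i z]; last 2 first.
- by meas.
- by apply: mulr_ge0; [exact: ball_ind_ge0|exact: sqr_ge0].
rewrite (eq_bigr (fun=> (moment e)%:E)) => [|i _]; last first.
  rewrite nnint_Rint; [by rewrite -(ball_momentE e i)|exact: intb_ball_moment|].
  by move=> z; apply: mulr_ge0; [exact: ball_ind_ge0|exact: sqr_ge0].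
by rewrite sumEFin sumr_const card_ord -[moment e *+ N]mulr_natl.
Qed.

(** The discrete product rule is X a - Y b = X (a - b) + (X - Y) b. Splitting the square with
    weights 1 + 1/r and 1 + r, and using slope 1/r of the cutoff, makes both error terms O(1/r). *)
Lemma eps_energy_cutoff r e u : 1 <= r -> L2 leb u ->
  (eps_energy e (fun x => (cutoff r x * u x)%R) <= (1 + r^-1)%:E * eps_energy e u +
    (moment e * (2 * N%:R ^+ 2 / r * n2 leb u))%:E)%E.
Proof.
move=> r1 Lu; have mu_ := Lu.1; have r0 : 0 < r by lra.
have mc := measurable_cutoff r.
have mcu : measurable_fun setT (fun x => cutoff r x * u x) by meas.
have m1 := measurable2_eps_energy e mu_; have m0 := measurable2_eps_energy e mcu.
have ir : 0 <= 1 + r^-1 by rewrite addr_ge0// invr_ge0 ltW.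
pose c : R := (1 + r) * (N%:R / r ^+ 2).
have c0 : 0 <= c by rewrite mulr_ge0 ?addr_ge0 ?divr_ge0 ?exprn_ge0 ?(ltW r0).
pose F z x := ball_ind e z * sqn z * u x ^+ 2.
have hb := @measurable_ball_ind R N e; have hs := @measurable_sqn R N.
have mF : measurable2 F.
  have mb1 : measurable_fun setT (fun w : E * E => ball_ind e w.1).
    by apply: (@measurableT_comp _ _ _ _ _ _ (ball_ind e)) => //; exact: measurable_fst.
  have ms1 : measurable_fun setT (fun w : E * E => sqn w.1).
    by apply: (@measurableT_comp _ _ _ _ _ _ (@sqn R N)) => //; exact: measurable_fst.
  have mu1 : measurable_fun setT (fun w : E * E => u w.2).
    by apply: (@measurableT_comp _ _ _ _ _ _ u) => //; exact: measurable_snd.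
  by rewrite /measurable2 /F; meas.
have F0 z x : 0 <= F z x by rewrite mulr_ge0 ?sqr_ge0// mulr_ge0 ?ball_ind_ge0 ?sqn_ge0.
have mbs : measurable_fun setT (fun z => ball_ind e z * sqn z) by meas.
have bs0 z : 0 <= ball_ind e z * sqn z by rewrite mulr_ge0 ?ball_ind_ge0 ?sqn_ge0.
have m2 : measurable_fun setT (fun x => u x ^+ 2) by meas.
have FE : dint F = (N%:R * moment e * n2 leb u)%:E.
  rewrite (dint_factor mF F0 mbs bs0 (nnint_ge0 leb (fun x => sqr_ge0 (u x)))); last first.
    by move=> z; rewrite -(nnintZ leb m2 (fun x => sqr_ge0 _) (bs0 z)).
  by rewrite nnint_bz_sqn (n2E Lu).
have m1' := mfM (@measurable_cst _ _ (E * E)%type R setT (1 + r^-1)) m1.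
have mF' := mfM (@measurable_cst _ _ (E * E)%type R setT c) mF.
have n1 (w : E * E) := eps_energy_fun_ge0 e u w.1 w.2.
have step : (eps_energy e (fun x => (cutoff r x * u x)%R) <= (1 + r^-1)%:E * eps_energy e u + c%:E * dint F)%E.
  rewrite /eps_energy /dint -(nnintZ _ m1 n1 ir) -(nnintZ _ mF (fun w => F0 w.1 w.2) c0).
  rewrite -(nnintD _ m1' mF' (fun w => mulr_ge0 ir (n1 w)) (fun w => mulr_ge0 c0 (F0 w.1 w.2))).
  apply: (nnint_le _ m0 (mfD m1' mF') (fun w => eps_energy_fun_ge0 e (fun x => cutoff r x * u x) w.1 w.2)) => w; rewrite /cst /F.
  have k1 := cutoff_le1 (w.2 + w.1) r0; have k0 := cutoff_ge0 r (w.2 + w.1).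
  have k2 := cutoff_lip w.2 w.1 r0; have b0 := ball_ind_ge0 e w.1.
  have k3 : (cutoff r (w.2 + w.1) - cutoff r w.2) ^+ 2 <= N%:R / r ^+ 2 * sqn w.1.
    rewrite -[leLHS]real_normK ?num_real//; apply: (@le_trans _ _ ((l1norm w.1 / r) ^+ 2)).
      by rewrite ler_sqr ?nnegrE ?divr_ge0 ?l1norm_ge0 ?(ltW r0).
    by rewrite expr_div_n [leRHS]mulrAC ler_pM2r ?invr_gt0 ?exprn_gt0//; exact: l1norm_sqr_le.
  move: k1 k0 k3; move: (u (w.2 + w.1)) (u w.2) (cutoff r (w.2 + w.1)) (cutoff r w.2) => a b X Y k1 k0 k3.
  have id : X * a - Y * b = X * (a - b) + (X - Y) * b by ring.
  have ri : r * r^-1 = 1 by rewrite divff// gt_eqF.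
  have ir0 : 0 < r^-1 by rewrite invr_gt0.
  have y2 (P Q : R) : (P + Q) ^+ 2 <= (1 + r^-1) * P ^+ 2 + (1 + r) * Q ^+ 2.
    rewrite -subr_ge0 (_ : _ - _ = r^-1 * (P - r * Q) ^+ 2); first by rewrite mulr_ge0 ?sqr_ge0// ltW.
    have -> : r^-1 * (P - r * Q) ^+ 2 = r^-1 * P ^+ 2 - 2 * (r * r^-1) * (P * Q) + r * (r * r^-1) * Q ^+ 2 by ring.
    by rewrite ri; ring.
  have X2 : X ^+ 2 * (a - b) ^+ 2 <= (a - b) ^+ 2.
    by rewrite -[leRHS]mul1r ler_wpM2r ?sqr_ge0// expr_le1.
  have Y2 : (X - Y) ^+ 2 * b ^+ 2 <= N%:R / r ^+ 2 * sqn w.1 * b ^+ 2 by rewrite ler_wpM2r ?sqr_ge0.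
  have h := y2 (X * (a - b)) ((X - Y) * b); rewrite !exprMn in h.
  have h3 : (X * a - Y * b) ^+ 2 <= (1 + r^-1) * (a - b) ^+ 2 + (1 + r) * (N%:R / r ^+ 2 * sqn w.1 * b ^+ 2).
    rewrite id; apply: (le_trans h); apply: lerD; apply: ler_wpM2l => //; lra.
  apply: (le_trans (ler_wpM2l b0 h3)); rewrite le_eqVlt; apply/orP; left; apply/eqP.
  by rewrite /c; move: (N%:R / r ^+ 2) => k; ring.
apply: (le_trans step); apply: leeD => //; rewrite FE -EFinM lee_fin.
have me0 : 0 <= moment e * (N%:R * n2 leb u).
  have h : (0 <= (N%:R * moment e)%:E)%E.
    by rewrite -nnint_bz_sqn; apply: nnint_ge0 => z; apply: mulr_ge0; [exact: ball_ind_ge0|exact: sqn_ge0].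
  by rewrite mulrA [_ * N%:R]mulrC; apply: mulr_ge0; [rewrite -lee_fin|exact: n2_ge0].
have cle : c <= 2 * N%:R / r.
  rewrite /c (_ : 2 * N%:R / r = (2 * r) * (N%:R / r ^+ 2)); last by field; rewrite gt_eqF.
  by apply: ler_wpM2r; [rewrite divr_ge0// exprn_ge0// ltW|lra].
have := ler_wpM2r me0 cle; rewrite (_ : c * (moment e * _) = c * (N%:R * moment e * n2 leb u)); last by ring.
by move/le_trans; apply; rewrite le_eqVlt; apply/orP; left; apply/eqP; ring.
Qed.

End cutoffs.

(** * Removing the penalty *)

Section global_maximiser.
Context {R : realType} {N : nat} (alpha p q A B : R).
Hypotheses (N0 : (0 < N)%N) (al0 : 0 < alpha) (alN : alpha < N%:R).
Hypotheses (hp : (N%:R + alpha) / N%:R < p) (hp' : p * (N%:R - 2) < N%:R + alpha).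
Hypotheses (hq : (N%:R + alpha) / N%:R < q) (hq' : q * (N%:R - 2) < N%:R + alpha).
Hypotheses (A0 : 0 < A) (B0 : 0 < B).
Local Notation E := 'rV[R]_N.
Local Notation leb := (@lebesgue_rV R N).
Local Notation DP := (@interaction R N alpha p q).
Local Notation ballP := (@ball R N A B N0).
Local Notation moment := (@moment R N).
Implicit Types (u v w : E -> R) (x y z : E).

Let K1 : R := ball_const A B 1.
Let K10 : 0 <= K1. Proof. exact: ball_const_ge0. Qed.

Let half_le (b e n : R) : 2 * b <= n * e -> b <= e / 2 * n.
Proof. lra. Qed.

Let halves (r y e t : R) : r <= y + e / 2 + t -> t <= e / 2 -> r <= y + e.
Proof. lra. Qed.

Lemma ereal_le_limit (x : \bar R) (y b : R) : (0 <= x)%E ->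
  (forall e : R, 0 < e -> exists n0, forall n, (n0 <= n)%N -> (x <= y%:E + e%:E + (n.+1%:R^-1 * b)%:E)%E) ->
  (x <= y%:E)%E.
Proof.
move=> x0 h; case: x x0 h => [r||] //; last by move=> _ /(_ 1 ltr01)[n0 /(_ n0 (leqnn _))]; rewrite -!EFinD.
rewrite lee_fin => r0 h; rewrite lee_fin; apply/ler_addgt0Pr => e e0.
have e2 : 0 < e / 2 by rewrite divr_gt0.
have [n0 hn] := h _ e2.
pose n1 := maxn n0 (Num.bound (2 * `|b| / e)).
have := hn n1 (leq_maxl _ _); rewrite -!EFinD lee_fin => h1.
have b1 : n1.+1%:R^-1 * b <= e / 2.
  rewrite mulrC ler_pdivrMr ?ltr0n//; apply: (le_trans (ler_norm b)).
  have h2 : 0 <= 2 * `|b| / e by rewrite divr_ge0 ?mulr_ge0// ltW.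
  have h3 : 2 * `|b| / e <= n1.+1%:R.
    by apply: (le_trans (ltW (archi_boundP h2))); rewrite ler_nat; apply: leqW; exact: leq_maxr.
  by move: h3; rewrite ler_pdivrMr// => /half_le.
exact: halves h1 b1.
Qed.

(** As the penalty 1/(n+1) tends to 0 the second moments may blow up; the tails are controlled
    instead by [polarized_tail], which depends only on the L^2 norm. *)
Lemma symmetric_maximiser : exists u v, [/\ ballP 1 u v, (forall x, 0 <= u x) /\ (forall x, 0 <= v x), polarized u, polarized v &
  forall u' v', admissible A B N0 u' v' -> (DP u' v' <= DP u v)%E].
Proof.
have ex n : exists uv : (E -> R) * (E -> R), [/\ admissible A B N0 uv.1 uv.2, polarized uv.1, polarized uv.2 &
    forall u' v', admissible A B N0 u' v' -> (DP u' v' <= DP uv.1 uv.2 + (n.+1%:R^-1)%:E * weighted_mass u' v')%E].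
  have i0 : 0 < n.+1%:R^-1 :> R by rewrite invr_gt0 ltr0n.
  have [u [v h]] := penalised_maximiser N0 al0 alN hp hp' hq hq' A0 B0 i0.
  by exists (u, v).
have [w hw] := choice ex.
have hb n : ballP 1 (w n).1 (w n).2 by have [[]] := hw n.
have w1 n x : 0 <= (w n).1 x by have [[_ h _ _] _] := hw n.
have w2 n x : 0 <= (w n).2 x by have [[_ _ h _] _] := hw n.
have k1 n : polarized (w n).1 by have [] := hw n.
have k2 n : polarized (w n).2 by have [] := hw n.
have [phi [u [v [[phii u0 v0] hbuv [cu cv] lu lv]]]] := pair_compact A0 B0 hb w1 w2.
have phin := ltn_phi_ge phii.
have [b1 b2] := ball_in_ball A0 B0 hbuv.
have hb1 n : in_ball (w (phi n)).1 K1 by have [] := ball_in_ball A0 B0 (hb (phi n)).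
have hb2 n : in_ball (w (phi n)).2 K1 by have [] := ball_in_ball A0 B0 (hb (phi n)).
have conv (wn : nat -> E -> R) u' r : subcritical (N := N) r -> (forall n, in_ball (wn n) K1) -> in_ball u' K1 ->
    (forall n x, 0 <= wn n x) -> (forall n, polarized (wn n)) ->
    {ae leb, forall x, wn n x @[n --> \oo] --> u' x} ->
    (forall n, (nnint leb (fun x => ((ocube n.+1%:R x)%:R * (wn n x - u' x) ^+ 2)%R) <= (16^-1 ^+ n)%:E)%E) ->
    forall e : R, 0 < e -> exists n0, forall n, (n0 <= n)%N -> (pint r (fun x => `|wn n x - u' x|)%R <= e%:E)%E.
  move=> hr bn b wn0 kn c l; apply: (@Lr_convergence _ _ N0 r K1 wn u' hr K10 bn b c l) => e e0.
  have [M M0 hM] := polarized_tail N0 hr e0 K10; exists M => // n.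
  by have [Ln nn _] := bn n; exact: hM.
have lim : forall e : R, 0 < e -> exists n0, forall n, (n0 <= n)%N -> (DP (w (phi n)).1 (w (phi n)).2 <= DP u v + e%:E)%E.
  apply: (interaction_limsup al0 alN hp hp' hq hq' A0 B0 (fun n => hb (phi n)) hbuv) => r hr.
    exact: (conv (fun n => (w (phi n)).1)).
  exact: (conv (fun n => (w (phi n)).2)).
exists u, v; split; [exact: hbuv|by []|exact: (polarized_limit cu)|exact: (polarized_limit cv)|].
move=> u' v' h; have [C C0 hC] := interaction_bound N0 al0 alN hp hp' hq hq' K10.
have [d d0 ed] := ge0_finite (interaction_ge0 p q al0 alN u v) (fine_le_lty (hC _ _ b1 b2)).
have [_ _ _ W'] := h; have [b b0 eb] := ge0_finite (weighted_mass_ge0 u' v') W'.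
rewrite ed; apply: (@ereal_le_limit _ _ b (interaction_ge0 p q al0 alN u' v')) => e e0.
have [n0 hn0] := lim e e0; exists n0 => n nn.
have [_ _ _ opt] := hw (phi n); apply: (le_trans (opt _ _ h)); rewrite eb -EFinM.
apply: leeD; first by rewrite -ed; exact: hn0.
by rewrite lee_fin ler_wpM2r// lef_pV2 ?posrE ?ltr0n// ler_nat ltnS.
Qed.

Lemma interaction_fatou (un vn : nat -> E -> R) u v (C : \bar R) :
  (forall n, measurable_fun setT (un n)) -> (forall n, measurable_fun setT (vn n)) ->
  measurable_fun setT u -> measurable_fun setT v ->
  (forall x, un n x @[n --> \oo] --> u x) -> (forall x, vn n x @[n --> \oo] --> v x) ->
  (forall n, (DP (un n) (vn n) <= C)%E) -> (DP u v <= C)%E.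
Proof.
move=> mun mvn mu_ mv cu cv h.
have p1 := exponent_gt1 N0 al0 hp; have q1 := exponent_gt1 N0 al0 hq.
have mk := @measurable_riesz R N alpha; have k0 := @riesz_ge0 R N alpha al0 alN.
have mF (a b : E -> R) : measurable_fun setT a -> measurable_fun setT b ->
    measurable2 (fun x y => riesz alpha (x - y) * `|a y| `^ p * `|b x| `^ q).
  by move=> ma mb; apply: (measurable_riesz_form (f := fun y => `|a y| `^ p) (g := fun y => `|b y| `^ q)) => //; meas.
have F0 (a b : E -> R) x y : 0 <= riesz alpha (x - y) * `|a y| `^ p * `|b x| `^ q.
  by apply: mul3_ge0 => //; exact: powR_ge0.
rewrite /interaction /riesz_form /dint; apply: (@nnint_fatou _ _ _ (leb \x leb)%E (fun n (w : E * E) => riesz alpha (w.1 - w.2) * `|un n w.2| `^ p * `|vn n w.1| `^ q) _ _ 0%N).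
- by move=> n; exact: mF.
- exact: mF.
- by move=> n w; exact: F0.
- by move=> w; exact: F0.
- apply: nearW => w; apply: cvgM; first apply: cvgM; first exact: cvg_cst.
    by apply: powR_cvg => //; [lra|exact: cvg_norm].
  by apply: powR_cvg => //; [lra|exact: cvg_norm].
by move=> n _; exact: h.
Qed.

Lemma cutoff_cvg x : cutoff n.+1%:R x @[n --> \oo] --> (1 : R).
Proof.
have h : 1 - l1norm x * (n.+1%:R^-1) @[n --> \oo] --> (1 : R).
  rewrite -[X in _ --> X]subr0 -[X in _ - X](mulr0 (l1norm x)).
  by apply: cvgB; [exact: cvg_cst|apply: cvgM; [exact: cvg_cst|exact: cvg_harmonic]].
apply: (@squeeze_cvgr _ _ _ _ (fun n => 1 - l1norm x * (n.+1%:R^-1)) (cst 1)) => //; last exact: cvg_cst.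
apply: nearW => n; rewrite cutoff_le1 ?ltr0n// andbT.
by rewrite /cutoff le_max lexx orbT.
Qed.

(** An arbitrary competitor is replaced by its absolute values, cut off to have finite second
    moment, and rescaled to stay in the unit ball; Fatou's lemma recovers its interaction. *)
Theorem maximiser : exists u v, [/\ ballP 1 u v, (forall x, 0 <= u x) /\ (forall x, 0 <= v x), polarized u, polarized v &
  forall u' v', ballP 1 u' v' -> (DP u' v' <= DP u v)%E].
Proof.
have [u [v [hb uv0 ku kv opt]]] := symmetric_maximiser; exists u, v; split; [exact: hb|exact: uv0|exact: ku|exact: kv|] => u' v' hb'.
have habs := ball_abs A0 B0 hb'; have [mu' mv'] := ball_meas hb'.
pose a x := `|u' x|; pose b x := `|v' x|.
have ma : measurable_fun setT a by rewrite /a; meas.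
have mb : measurable_fun setT b by rewrite /b; meas.
have [La Lb hE] := habs; rewrite -/a -/b in La Lb hE.
have -> : DP u' v' = DP a b.
  by apply: eq_nnint => w; rewrite /a /b !normr_id.
have [i1 i2] := ball_in_ball A0 B0 habs.
have na : n2 leb a <= K1 by have [] := i1. have nb : n2 leb b <= K1 by have [] := i2.
(* The excess energy over 1 at radius n + 1 is at most c/(n+1): 1 from the factor 1 + 1/r on the
   differences and 2 N^2 K1 from each component. *)
pose c : R := 1 + 4 * N%:R ^+ 2 * K1.
have c0 : 0 <= c by apply: addr_ge0 => //; apply: mulr_ge0 => //; apply: mulr_ge0 => //; exact: exprn_ge0.
(* The square of this factor times 1 + c/(n+1) is at most 1, and the factor tends to 1. *)
pose s n : R := (1 + c * n.+1%:R^-1)^-1.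
have d0 n : 0 < 1 + c * n.+1%:R^-1 :> R by rewrite ltr_wpDr// mulr_ge0// invr_ge0.
have d1 n : 1 <= 1 + c * n.+1%:R^-1 :> R by rewrite lerDl mulr_ge0// invr_ge0.
have s0 n : 0 < s n by rewrite invr_gt0.
have s1 n : s n <= 1 by rewrite invf_le1.
have sc : s n @[n --> \oo] --> (1 : R).
  rewrite -[X in _ --> X]invr1; apply: cvgV => //.
  rewrite -[X in _ --> X]addr0 -[X in _ + X](mulr0 c).
  by apply: cvgD; [exact: cvg_cst|apply: cvgM; [exact: cvg_cst|exact: cvg_harmonic]].
pose un n x := s n * (cutoff n.+1%:R x * a x); pose vn n x := s n * (cutoff n.+1%:R x * b x).
have mc n := @measurable_cutoff R N n.+1%:R.
have r1 n : 1 <= n.+1%:R :> R by rewrite ler1n.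
have r0 n : 0 < n.+1%:R :> R by rewrite ltr0n.
have cle (f : E -> R) n x : `|cutoff n.+1%:R x * f x| <= `|f x|.
  by rewrite normrM ger0_norm ?cutoff_ge0// ler_piMl// cutoff_le1.
have Lc n f : L2 leb f -> L2 leb (fun x => cutoff n.+1%:R x * f x).
  move=> Lf; have mf := Lf.1; have mcn := mc n; apply: (L2_le _ Lf) => [|x]; [by meas|exact: cle].
have bc n : ballP (1 + c * n.+1%:R^-1) (fun x => cutoff n.+1%:R x * a x) (fun x => cutoff n.+1%:R x * b x).
  split; [exact: Lc|exact: Lc|] => e e0; rewrite (pair_eps_energyE _ A0 B0 e (Lc n _ La) (Lc n _ Lb)).
  have h := hE e e0; rewrite (pair_eps_energyE _ A0 B0 e La Lb) in h.
  have m0 := moment_gt0 N0 e0; set t : R := n.+1%:R^-1.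
  have t0 : 0 <= t by rewrite invr_ge0.
  have n2c (f : E -> R) : L2 leb f -> n2 leb (fun x => cutoff n.+1%:R x * f x) <= n2 leb f.
    by move=> Lf; apply: n2_le => //; exact: Lc.
  have e1 := eps_energy_cutoff e (r1 n) La; have e2 := eps_energy_cutoff e (r1 n) Lb; rewrite -/t in e1 e2.
  apply: (le_trans (leeD (leeD e1 e2) (lexx _))).
  have := eps_energy_ge0 e a; have := eps_energy_ge0 e b; move: h.
  case: (eps_energy e a) => [x1||] //; case: (eps_energy e b) => [x2||] //.
  rewrite -!EFinM -!EFinD !lee_fin => h y1 y2.
  have k1 : A * n2 leb (fun x => cutoff n.+1%:R x * a x) + B * n2 leb (fun x => cutoff n.+1%:R x * b x) <= A * n2 leb a + B * n2 leb b.
    by apply: lerD; apply: ler_wpM2l; rewrite ?(ltW A0) ?(ltW B0)//; exact: n2c.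
  have k2 := ler_wpM2l (ltW m0) k1.
  have k3 : moment e * (2 * N%:R ^+ 2 * t * n2 leb a) + moment e * (2 * N%:R ^+ 2 * t * n2 leb b) <= moment e * (4 * N%:R ^+ 2 * K1 * t).
    rewrite -mulrDr; apply: ler_wpM2l; first exact: ltW.
    have z0 : 0 <= 2 * N%:R ^+ 2 * t by rewrite !mulr_ge0// exprn_ge0.
    have := ler_wpM2l z0 na; have := ler_wpM2l z0 nb; rewrite (_ : 4 * N%:R ^+ 2 * K1 * t = 2 * N%:R ^+ 2 * t * K1 + 2 * N%:R ^+ 2 * t * K1); last by ring.
    lra.
  have P0 : 0 <= A * n2 leb a + B * n2 leb b by rewrite addr_ge0// mulr_ge0 ?n2_ge0// ltW.
  have k4 : t * (x1 + x2) <= t * (moment e).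
    apply: ler_wpM2l => //; move: h (mulr_ge0 (ltW m0) P0); rewrite mulr1; lra.
  rewrite (_ : moment e * (1 + c * t) = moment e + t * moment e + moment e * (4 * N%:R ^+ 2 * K1 * t)); last by rewrite /c; ring.
  move: h k2 k3 k4; rewrite mulr1; move: (moment e * _) (moment e * _) (moment e * _) (moment e * _) (t * moment e) => y3 y4 y5 y6 y7.
  rewrite mulrDr; lra.
have adm n : admissible A B N0 (un n) (vn n).
  have sM : (s n) ^+ 2 * (1 + c * n.+1%:R^-1) <= 1.
    by rewrite expr2 -mulrA mulVf ?gt_eqF// mulr1.
  split.
  - exact: (ball_le sM (ball_scale A0 B0 (s n) (bc n))).
  - by move=> x; apply: mulr_ge0; [exact: ltW|apply: mulr_ge0; [exact: cutoff_ge0|exact: normr_ge0]].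
  - by move=> x; apply: mulr_ge0; [exact: ltW|apply: mulr_ge0; [exact: cutoff_ge0|exact: normr_ge0]].
  have bd (f : E -> R) x : (s n * (cutoff n.+1%:R x * f x)) ^+ 2 * sqn x <= n.+1%:R ^+ 2 * f x ^+ 2.
    have [z|nz] := eqVneq (cutoff n.+1%:R x) 0.
      by rewrite z mul0r mulr0 expr0n mul0r mulr_ge0 ?sqr_ge0// exprn_ge0.
    have sx := cutoff_supp (r0 n) nz.
    rewrite mulrC; apply: ler_pM; rewrite ?sqn_ge0 ?sqr_ge0//.
    rewrite -[leLHS]real_normK ?num_real// -[leRHS]real_normK ?num_real// ler_sqr ?nnegrE//.
    by rewrite normrM ger0_norm ?(ltW (s0 n))//; apply: le_trans (cle f n x); rewrite ler_piMl.
  have mcn := mc n; have mq := @measurable_sqn R N.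
  have ma2 : measurable_fun setT (fun x => a x ^+ 2) by meas.
  have mb2 : measurable_fun setT (fun x => b x ^+ 2) by meas.
  have rr0 : 0 <= n.+1%:R ^+ 2 :> R by rewrite exprn_ge0.
  apply: (@le_lt_trans _ _ (nnint leb (fun x => (n.+1%:R ^+ 2 * a x ^+ 2 + n.+1%:R ^+ 2 * b x ^+ 2)%R))).
    apply: nnint_le; [by rewrite /un /vn; meas|by meas| |].
    - by move=> x; rewrite mulr_ge0 ?sqn_ge0// addr_ge0 ?sqr_ge0.
    by move=> x; rewrite mulrDl; apply: lerD; exact: bd.
  rewrite nnintD; [|by meas|by meas|by move=> x; rewrite mulr_ge0 ?sqr_ge0|by move=> x; rewrite mulr_ge0 ?sqr_ge0].
  rewrite (nnintZ leb ma2 (fun x => sqr_ge0 _) rr0) (nnintZ leb mb2 (fun x => sqr_ge0 _) rr0) (n2E La) (n2E Lb).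
  by rewrite -!EFinM -EFinD ltry.
apply: (interaction_fatou (un := un) (vn := vn) _ _ ma mb).
- by move=> n; have mcn := mc n; rewrite /un; meas.
- by move=> n; have mcn := mc n; rewrite /vn; meas.
- move=> x; rewrite -[X in _ --> X]mul1r; apply: cvgM => //.
  by rewrite -[X in _ --> X]mul1r; apply: cvgM; [exact: cutoff_cvg|exact: cvg_cst].
- move=> x; rewrite -[X in _ --> X]mul1r; apply: cvgM => //.
  by rewrite -[X in _ --> X]mul1r; apply: cvgM; [exact: cutoff_cvg|exact: cvg_cst].
by move=> n; exact: opt.
Qed.

End global_maximiser.

(** * Positivity *)

Section barrier.
Context {R : realType} {N : nat}.
Local Notation E := 'rV[R]_N.
Local Notation leb := (@lebesgue_rV R N).
Implicit Types (u phi f : E -> R) (x z c : E).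

Definition radial (k : nat) (a b : R) x : R := bump k (b - a * sqn x).

Lemma is_derive_sqn x i : is_derive x (unit_vec i) (@sqn R N) (2 * x ord0 i).
Proof.
apply: is_derive_of_line.
have e (s : R) : sqn (x + s *: unit_vec i) = s * (s + 2 * x ord0 i) + sqn x.
  rewrite /sqn (bigD1 i)//= [in RHS](bigD1 i)//= !mxE !eqxx mulr1.
  rewrite (eq_bigr (fun j => x ord0 j ^+ 2)) => [|j ji]; first by ring.
  by rewrite !mxE (negbTE ji) andbF mulr0 addr0.
rewrite (_ : (fun s : R => _) = (fun s : R => s * (s + 2 * x ord0 i) + sqn x)); last exact/funext.
have h1 := is_deriveD (is_derive_id (0 : R) (1 : R)) (is_derive_cst (2 * x ord0 i) (0 : R) 1).
have h2 := is_deriveM (is_derive_id (0 : R) (1 : R)) h1.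
have := is_deriveD h2 (is_derive_cst (sqn x) (0 : R) 1).
have ev : (id + cst (2 * x ord0 i) : R -> R) 0 = 2 * x ord0 i by exact: add0r.
by move=> h; apply: (is_derive_eq h); rewrite ev /GRing.scale/= !addr0; ring.
Qed.

Lemma esm_sqn : esm (@sqn R N).
Proof.
rewrite /sqn; elim: (index_enum _) => [|i s IH].
  by under eq_fun do rewrite big_nil; exact: esm_cst.
under eq_fun do rewrite big_cons expr2.
by apply: esm_add => //; apply: esm_mul; exact: esm_coord.
Qed.

Lemma esm_radial k a b : esm (radial k a b).
Proof.
apply: esm_bump; apply: esm_sub; first exact: esm_cst.
by apply: esm_mul; [exact: esm_cst|exact: esm_sqn].
Qed.

Lemma is_derive_radial k (a b : R) x i : is_derive x (unit_vec i) (radial k a b)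
  ((radial k.+2 a b x - k%:R * radial k.+1 a b x) * (- (2 * a) * x ord0 i)).
Proof.
apply: is_derive_comp_dir; last exact: is_derive_bump.
have h1 := is_deriveZ a (is_derive_sqn x i).
have := is_deriveB (is_derive_cst b x (unit_vec i)) h1.
by move=> h; apply: (is_derive_eq h); rewrite /GRing.scale/= sub0r; ring.
Qed.

Lemma partial_radial (a b : R) i x :
  partial i (radial 0 a b) x = - (2 * a) * x ord0 i * radial 2 a b x.
Proof. by have [_ h] := is_derive_radial 0 a b x i; apply: etrans h _; rewrite mul0r subr0 mulrC. Qed.

Lemma partial2_radial (a b : R) i x :
  partial i (partial i (radial 0 a b)) x =
  - (2 * a) * radial 2 a b x + 4 * a ^+ 2 * x ord0 i ^+ 2 * (radial 4 a b x - 2 * radial 3 a b x).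
Proof.
rewrite (_ : partial i (radial 0 a b) = (fun x => - (2 * a) * x ord0 i * radial 2 a b x)); last first.
  by apply/funext => y; exact: partial_radial.
have h1 := is_deriveZ (- (2 * a)) (is_derive_coord i i x).
have := is_deriveM h1 (is_derive_radial 2 a b x i).
have ev : (- (2 * a) \*: (fun x : E => x ord0 i)) x = - (2 * a) * x ord0 i by [].
by move=> [_ h]; apply: etrans h _; rewrite ev eqxx /GRing.scale/=; ring.
Qed.

Definition laplacian phi x : R := \sum_i partial i (partial i phi) x.

Lemma laplacian_radial (a b : R) x : laplacian (radial 0 a b) x =
  - (2 * a * N%:R) * radial 2 a b x + 4 * a ^+ 2 * sqn x * (radial 4 a b x - 2 * radial 3 a b x).
Proof.
rewrite /laplacian (eq_bigr _ (fun i _ => partial2_radial a b i x)) big_split/=.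
rewrite sumr_const card_ord -mulr_suml -mulr_sumr /sqn -mulr_natl; ring.
Qed.

(* The bracket left after factoring exp(-1/s) s^(-4) out of the operator. *)
Lemma barrier_bracket (n A r X a t : R) : 0 <= n -> 0 <= A -> 0 < a -> a <= 1 -> 0 < t -> 0 <= X ->
  t <= a * r ^+ 2 -> a * r ^+ 2 <= 4^-1 -> a * (2 * n * r ^+ 4 + A * r ^+ 8) < 2 * X ->
  0 < - (2 * a * n) * t ^+ 2 + 4 * a ^+ 2 * X * (1 - 2 * t) - A * t ^+ 4.
Proof.
move=> n0 A0 a0 a1 t0 X0 tr r4 hX.
have h2 : t ^+ 2 <= (a * r ^+ 2) ^+ 2 by rewrite ler_sqr ?nnegrE ?(ltW t0)// (le_trans (ltW t0)).
have h4 : t ^+ 4 <= (a * r ^+ 2) ^+ 4 by rewrite lerXn2r ?nnegrE ?(ltW t0)// (le_trans (ltW t0)).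
have k2 : 2 * a * n * t ^+ 2 <= 2 * a * n * (a * r ^+ 2) ^+ 2.
  by apply: ler_wpM2l => //; rewrite mulr_ge0// mulr_ge0// ltW.
have k4 := ler_wpM2l A0 h4.
have k1 : 2 * a ^+ 2 * X <= 4 * a ^+ 2 * X * (1 - 2 * t).
  rewrite (_ : 4 * a ^+ 2 * X * _ = 2 * a ^+ 2 * X * (2 * (1 - 2 * t))); last by ring.
  by rewrite ler_peMr ?mulr_ge0 ?sqr_ge0//; lra.
have k5 : A * (a * r ^+ 2) ^+ 4 <= a ^+ 3 * (A * r ^+ 8).
  rewrite exprMn -exprM mulrCA; apply: ler_wpM2r; first by rewrite mulr_ge0// exprn_even_ge0.
  by rewrite [leLHS]exprS ler_piMl ?exprn_ge0 ?(ltW a0).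
have k6 : a ^+ 2 * (a * (2 * n * r ^+ 4 + A * r ^+ 8)) < a ^+ 2 * (2 * X) by rewrite ltr_pM2l ?exprn_gt0.
have e1 : 2 * a * n * (a * r ^+ 2) ^+ 2 = a ^+ 3 * (2 * n * r ^+ 4) by rewrite exprMn -exprM; ring.
have e2 : a ^+ 2 * (a * (2 * n * r ^+ 4 + A * r ^+ 8)) = a ^+ 3 * (2 * n * r ^+ 4) + a ^+ 3 * (A * r ^+ 8) by ring.
rewrite e1 in k2; rewrite e2 in k6.
rewrite (_ : a ^+ 2 * (2 * X) = 2 * a ^+ 2 * X) in k6; last by ring.
rewrite mulNr; move: k2 k4 k1 k5 k6; lra.
Qed.

(** Since t <= a r^2, the favourable term of [barrier_bracket] is of order a^2 and the others of
    order a^3 or smaller, so a small [a] wins away from the centre. *)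
Lemma barrier_param (n A r d : R) : 0 <= n -> 0 <= A -> 0 < d ->
  exists a : R, [/\ 0 < a, a <= 1, a * r ^+ 2 <= 4^-1 & a * (2 * n * r ^+ 4 + A * r ^+ 8) < 2 * d].
Proof.
move=> n0 A0 d0; pose D := 1 + 4 * r ^+ 2 + (2 * n * r ^+ 4 + A * r ^+ 8).
have p4 : 0 <= 2 * n * r ^+ 4 + A * r ^+ 8 by apply: addr_ge0; apply: mulr_ge0 => //; [exact: mulr_ge0|exact: exprn_even_ge0|exact: exprn_even_ge0].
have p2 : 0 <= 4 * r ^+ 2 by rewrite mulr_ge0 ?sqr_ge0.
have D1 : 1 <= D by rewrite /D; lra.
have D0 : 0 < D by lra.
pose m := Num.min 1 d; have m0 : 0 < m by rewrite lt_min ltr01.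
have m1 : m <= 1 by rewrite ge_min lexx.
have md : m <= d by rewrite ge_min lexx orbT.
exists (m / D); split; first exact: divr_gt0.
- by rewrite ler_pdivrMr// mul1r; lra.
- have : m / D * (4 * r ^+ 2) <= 1.
    rewrite mulrAC ler_pdivrMr// mul1r; apply: (@le_trans _ _ (1 * (4 * r ^+ 2))); first exact: ler_wpM2r.
    by rewrite /D; lra.
  by rewrite mulrCA; lra.
apply: (@le_lt_trans _ _ d); last lra.
rewrite mulrAC ler_pdivrMr//; apply: (@le_trans _ _ (m * D)); first by apply: ler_wpM2l; [exact: ltW|rewrite /D; lra].
by apply: ler_wpM2r => //; exact: ltW.
Qed.

(** The function is exp(-1/(a (r^2 - |x|^2))) inside the ball of radius r. Near the centre its
    Laplacian has the wrong sign, so positivity is claimed only for |x|^2 >= d. *)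
Lemma radial_barrier (A r d : R) : 0 <= A -> 0 < d -> exists a : R,
  [/\ test_function (radial 0 a (a * r ^+ 2)),
      (forall x, r ^+ 2 <= sqn x -> laplacian (radial 0 a (a * r ^+ 2)) x - A * radial 0 a (a * r ^+ 2) x = 0)
    & forall x, d <= sqn x -> sqn x < r ^+ 2 ->
      0 < laplacian (radial 0 a (a * r ^+ 2)) x - A * radial 0 a (a * r ^+ 2) x].
Proof.
move=> A0 d0; have [a [a0 a1 h4 hX]] := barrier_param r (ler0n R N) A0 d0; exists a.
have out k x : r ^+ 2 <= sqn x -> radial k a (a * r ^+ 2) x = 0.
  by move=> h; rewrite /radial /bump ltNge subr_le0 ler_pM2l// h.
split.
- apply: (@esm_test _ _ _ `|r|); first exact: esm_radial.
  move=> x hx i; have h : sqn x <= r ^+ 2.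
    by case: (leP (sqn x) (r ^+ 2)) => // /ltW/(out 0%N) h; rewrite h eqxx in hx.
  apply: (le_trans (coord_le_enorm x i)); rewrite -ler_sqr ?nnegrE ?enorm_ge0//.
  by rewrite enorm_sqr real_normK ?num_real.
- by move=> x h; rewrite laplacian_radial !out// !mulr0 subrr mulr0 addr0 subr0.
move=> x h1 h2; rewrite laplacian_radial /radial -mulrBr /bump.
set t := a * (r ^+ 2 - sqn x).
have t0 : 0 < t by rewrite mulr_gt0// subr_gt0.
have tr : t <= a * r ^+ 2 by rewrite ler_pM2l// lerBlDr lerDl sqn_ge0.
rewrite t0; have := barrier_bracket (ler0n R N) A0 a0 a1 t0 (sqn_ge0 x) tr h4 (lt_le_trans hX _).
move=> /(_ _)/wrap[]; first by rewrite ler_pM2l.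
have e0 := expR_gt0 (- t^-1); have i0 : 0 < t^-1 ^+ 4 by rewrite exprn_gt0// invr_gt0.
have it : t * t^-1 = 1 by rewrite divff// gt_eqF.
move: e0 i0; move: (expR _) (sqn x) => e X e0 i0 hb.
have := mulr_gt0 (mulr_gt0 e0 i0) hb; move: it; move: (t^-1) => w it.
set P := (X in 0 < X -> _); set Q := (X in _ -> 0 < X); suff -> : P = Q by [].
rewrite /P /Q.
have -> : e * w ^+ 4 * (- (2 * a * N%:R) * t ^+ 2 + 4 * a ^+ 2 * X * (1 - 2 * t) - A * t ^+ 4) =
  - (2 * a * N%:R) * (w ^+ 2 * (t * w) ^+ 2 * e) +
  4 * a ^+ 2 * X * (w ^+ 4 * e - 2 * (w ^+ 3 * (t * w) * e)) - A * ((t * w) ^+ 4 * e) by ring.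
by rewrite it; ring.
Qed.

Definition supersolution (A : R) u := forall phi, test_function phi -> (forall x, 0 <= phi x) ->
  0 <= \sum_i ip leb (gradc u i) (partial i phi) + A * ip leb u phi.

Lemma test_laplacian phi : test_function phi -> L2 leb (laplacian phi).
Proof. by move=> tp; apply: L2_sum => i; apply: test_L2; do 2 apply: test_partial. Qed.

Lemma supersolution_ip A u phi : H1 u -> supersolution A u -> test_function phi -> (forall x, 0 <= phi x) ->
  ip leb u (fun x => laplacian phi x - A * phi x) <= 0.
Proof.
move=> hu hs tp p0; have Lu : L2 leb u by have [] := (H1P u).1 hu.
have Lp := test_L2 tp; have hl := test_laplacian tp.
have gu := gradP hu; have := hs _ tp p0.
have e : ip leb (fun x => laplacian phi x - A * phi x) u =
    ip leb (laplacian phi) u - ip leb (fun x => A * phi x) u := ipBl hl (L2Z A Lp) Lu.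
rewrite [ip leb u (fun x => _ - _)]ipC e (ipZl A Lp Lu) [ip _ phi u]ipC.
have -> : ip leb (laplacian phi) u = - \sum_i ip leb (gradc u i) (partial i phi).
  rewrite ip_suml => [|i|//]; last by apply: test_L2; do 2 apply: test_partial.
  rewrite -sumrN; apply: eq_bigr => i _; have [Lg /weak_partial_ip w] := gu i.
  by rewrite ipC (w _ (test_partial i tp)).
lra.
Qed.

Lemma ip_le0_eq0 u f : L2 leb u -> L2 leb f -> {ae leb, forall x, 0 <= u x * f x} -> ip leb u f <= 0 ->
  {ae leb, forall x, u x * f x = 0}.
Proof.
move=> Lu Lf h h0; have i := intbM Lu Lf; have mm := intb_measurable i.
have ma : measurable_fun setT (fun x => `|u x * f x|) by meas.
have e : nnint leb (fun x => `|u x * f x|) = (ip leb u f)%:E.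
  rewrite nnint_Rint; last by move=> x; exact: normr_ge0.
    rewrite /ip; congr (_%:E); apply: Rint_ae_eq => //; apply: filterS h => x h; exact: ger0_norm.
  by apply: intb_nn => //; exact: intb_abs_lty.
have : nnint leb (fun x => `|u x * f x|) = 0%E.
  by apply/eqP; rewrite eq_le nnint_ge0 ?andbT => [|x]; rewrite ?e ?lee_fin// normr_ge0.
by move/(nnint_eq0 ma (fun x => normr_ge0 _)); apply: filterS => x /eqP; rewrite normr_eq0 => /eqP.
Qed.

(** Strong maximum principle. The centre of the barrier is put in the ball where [u] vanishes, so
    its bad region does not count; elsewhere the integrand is nonnegative while its integral is at
    most 0, and [u] vanishes on the annulus. The outer radius is arbitrary. *)
Lemma supersolution_vanish (A : R) u c (d : R) : 0 <= A -> H1 u -> (forall x, 0 <= u x) ->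
  supersolution A u -> 0 < d -> {ae leb, forall x, sqn (x - c) < d -> u x = 0} ->
  {ae leb, forall x, u x = 0}.
Proof.
move=> A0 hu u0 hs d0 hz; have Lu : L2 leb u by have [] := (H1P u).1 hu.
have key n : {ae leb, forall x, sqn (x - c) < n%:R ^+ 2 -> u x = 0}.
  have [a [tp out pos]] := radial_barrier n%:R A0 d0.
  set phi := radial _ _ _ in tp out pos; have ts := test_shift (- c) tp.
  have Ls := test_L2 ts; have hl := test_laplacian ts.
  have lE x : laplacian (fun x => phi (x - c)) x = laplacian phi (x - c).
    by apply: eq_bigr => i _; rewrite (partial_shift i phi) (partial_shift i (partial i phi)).
  have L := L2B hl (L2Z A Ls).
  have := ip_le0_eq0 Lu L _ (supersolution_ip hu hs ts (fun x => bump_ge0 _ _)).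
  move=> /(_ _)/wrap[].
    apply: filterS hz => x hx; rewrite lE.
    have [h|h] := ltP (sqn (x - c)) d; first by rewrite hx// mul0r.
    have [h'|h'] := leP (n%:R ^+ 2) (sqn (x - c)); first by rewrite out// mulr0.
    by apply: mulr_ge0 => //; apply/ltW/pos.
  apply: filterS2 hz => x hx; rewrite lE => e h'.
  have [h|h] := ltP (sqn (x - c)) d; first exact: hx.
  have := pos _ h h'; move/eqP: e; rewrite mulf_eq0 => /orP[/eqP//|/eqP ->].
  by rewrite ltxx.
have := ae_countable key; apply: filterS => x h.
apply: (h (Num.bound (sqn (x - c))).+1).
have h1 := archi_boundP (sqn_ge0 (x - c)); apply: (lt_le_trans h1).
by rewrite expr2 -natrM ler_nat (leq_trans (leqnSn _) (leq_pmulr _ (ltn0Sn _))).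
Qed.

(** Either [u] vanishes at typical points beyond some n in all coordinates, hence on a ball and
    everywhere, or beyond every n there is a typical point with positive value, which bounds [u]
    below on the cube of half-side n. *)
Lemma polarized_positive (A : R) u : 0 <= A -> H1 u -> (forall x, 0 <= u x) ->
  polarized u -> supersolution A u -> {ae leb, forall x, u x = 0} \/ {ae leb, forall x, 0 < u x}.
Proof.
move=> A0 hu u0 ku hs; have mu_ : measurable_fun setT u by have [[]] := (H1P u).1 hu.
have ho := polarized_outer_le mu_ ku.
have [[n hn]|h] := pselect (exists n : nat, forall z, (forall k, n%:R < `|z ord0 k|) ->
    {ae leb, forall x, inner_pt x z -> u z <= u x} -> u z = 0).
  left; apply: (@supersolution_vanish A u (const_mx (n%:R + 1)) 1) => //.
  apply: filterS ho => z hz hb; apply: hn => // k.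
  have : `|(z - const_mx (n%:R + 1)) ord0 k| < 1.
    apply: (le_lt_trans (coord_le_enorm _ _)); rewrite -ltr_sqr ?nnegrE ?enorm_ge0//.
    by rewrite enorm_sqr expr1n.
  rewrite !mxE ltr_norml => /andP[h1 h2]; apply: (lt_le_trans _ (ler_norm _)); lra.
right; have key n : {ae leb, forall x, (forall k, `|x ord0 k| <= n%:R) -> 0 < u x}.
  apply: contrapT => hn; apply: h; exists n => z hz hx; apply/eqP; rewrite eq_le u0 andbT leNgt.
  apply/negP => uz; apply: hn; apply: filterS hx => x hx hk; apply: (lt_le_trans uz); apply: hx; apply/forallP => l.
  exact: (le_lt_trans (hk l) (hz l)).
have := ae_countable key; apply: filterS => x hx.
apply: (hx (Num.bound (enorm x))) => k; apply: (le_trans (coord_le_enorm x k)).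
exact/ltW/archi_boundP/enorm_ge0.
Qed.

End barrier.

(** * Criticality and the ground level *)

Section quadratic_form.
Context {R : realType} {N : nat}.
Local Notation E := 'rV[R]_N.
Local Notation leb := (@lebesgue_rV R N).
Implicit Types (u v h k f phi : E -> R) (x z : E) (t a b : R) (g : 'I_N -> E -> R).

Lemma H1L2 u : H1 u -> L2 leb u.
Proof. by move/H1P => []. Qed.

Lemma wgrad_lin u h g g' t : L2 leb u -> L2 leb h -> wgrad u g -> wgrad h g' ->
  wgrad (fun x => u x + t * h x) (fun i x => g i x + t * g' i x).
Proof.
move=> Lu Lh wu wh i; have [Lg /weak_partial_ip w1] := wu i; have [Lg' /weak_partial_ip w2] := wh i.
split; first exact: (L2D Lg (L2Z t Lg')).
apply/weak_partial_ip => phi tp; have Lp := test_L2 tp; have Lpi := test_L2 (test_partial i tp).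
rewrite (ipDl Lu (L2Z t Lh) Lpi) (ipDl Lg (L2Z t Lg') Lp) (ipZl t Lh Lpi) (ipZl t Lg' Lp).
by rewrite w1// w2// mulrN opprD.
Qed.

Lemma H1_lin u h t : H1 u -> H1 h -> H1 (fun x => u x + t * h x).
Proof.
move=> hu hh; have Lu := H1L2 hu; have Lh := H1L2 hh; apply/H1P; split.
  exact: (L2D Lu (L2Z t Lh)).
by eexists; exact: (wgrad_lin t Lu Lh (gradP hu) (gradP hh)).
Qed.

Definition dirichlet_form u h : R := \sum_i ip leb (gradc u i) (gradc h i).

Lemma n2_lin u h t : L2 leb u -> L2 leb h ->
  n2 leb (fun x => u x + t * h x) = n2 leb u + 2 * t * ip leb u h + t ^+ 2 * n2 leb h.
Proof.
move=> Lu Lh; rewrite (n2D Lu (L2Z t Lh)) (n2Z t Lh) [ip leb u _]ipC (ipZl t Lh Lu) [ip leb h u]ipC; ring.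
Qed.

Lemma dirichlet_lin u h t : H1 u -> H1 h ->
  dirichlet (fun x => u x + t * h x) = dirichlet u + 2 * t * dirichlet_form u h + t ^+ 2 * dirichlet h.
Proof.
move=> hu hh; rewrite (dirichletE (H1_lin t hu hh) (wgrad_lin t (H1L2 hu) (H1L2 hh) (gradP hu) (gradP hh))).
rewrite /dirichlet /dirichlet_form !mulr_sumr -!big_split/=; apply: eq_bigr => i _.
by apply: n2_lin; [have [] := gradP hu i|have [] := gradP hh i].
Qed.

Definition energy_form a b u v h k : R := dirichlet_form u h + a * ip leb u h + (dirichlet_form v k + b * ip leb v k).

Let quadratic_sum (a b t x1 x2 x3 y1 y2 y3 z1 z2 z3 w1 w2 w3 : R) :
  x1 + 2 * t * x2 + t ^+ 2 * x3 + a * (y1 + 2 * t * y2 + t ^+ 2 * y3) +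
  (z1 + 2 * t * z2 + t ^+ 2 * z3 + b * (w1 + 2 * t * w2 + t ^+ 2 * w3)) =
  x1 + a * y1 + (z1 + b * w1) + 2 * t * (x2 + a * y2 + (z2 + b * w2)) + t ^+ 2 * (x3 + a * y3 + (z3 + b * w3)).
Proof. ring. Qed.

Lemma energy_lin a b u v h k t : H1 u -> H1 v -> H1 h -> H1 k ->
  energy a b (fun x => u x + t * h x) (fun x => v x + t * k x) =
  energy a b u v + 2 * t * energy_form a b u v h k + t ^+ 2 * energy a b h k.
Proof.
move=> hu hv hh hk; rewrite /energy /energy_form (dirichlet_lin t hu hh) (dirichlet_lin t hv hk).
rewrite (n2_lin t (H1L2 hu) (H1L2 hh)) (n2_lin t (H1L2 hv) (H1L2 hk)).
exact: quadratic_sum.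
Qed.

(** Scaling is a perturbation of [u] along itself, so scaling laws follow from the formulas for
    perturbations. *)
Lemma lin_scale u c : (fun x => c * u x) = (fun x => u x + (c - 1) * u x).
Proof. by apply/funext => x; ring. Qed.

Lemma H1_scale u c : H1 u -> H1 (fun x => c * u x).
Proof. by move=> hu; rewrite lin_scale; exact: H1_lin. Qed.

Lemma energy_scale a b u v c : H1 u -> H1 v ->
  energy a b (fun x => c * u x) (fun x => c * v x) = c ^+ 2 * energy a b u v.
Proof.
move=> hu hv; rewrite (lin_scale u) (lin_scale v) (energy_lin a b (c - 1) hu hv hu hv).
have e : energy_form a b u v u v = energy a b u v by [].
by rewrite e; move: (energy a b u v) => X; ring.
Qed.

Lemma ip_ae u f h : measurable_fun setT u -> measurable_fun setT f -> measurable_fun setT h ->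
  {ae leb, forall x, f x = h x} -> ip leb u f = ip leb u h.
Proof.
move=> mu_ mf mh e; apply: Rint_ae_eq; [by meas|by meas|].
by apply: filterS e => x ->.
Qed.

Lemma dirichlet_form_test u phi : H1 u -> test_function phi ->
  dirichlet_form u phi = \sum_i ip leb (gradc u i) (partial i phi).
Proof.
move=> hu tp; apply: eq_bigr => i _; have [[mg _] _] := gradP hu i.
have hp := H1_test tp; have [[mp _] _] := gradP hp i; have mpi := measurable_test (test_partial i tp).
by apply: ip_ae => //; exact: (wgrad_gradc hp (wgrad_test tp)).
Qed.

Lemma dirichlet_form0 u : H1 u -> dirichlet_form u (cst 0 : E -> R) = 0.
Proof.
move=> hu; rewrite (dirichlet_form_test hu (@test0 R N)) big1// => i _.
have -> : partial i (cst 0 : E -> R) = (fun x => 0 * 0) by apply/funext => x; rewrite mul0r; exact: derive_cst.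
have [Lg _] := gradP hu i; rewrite ipC (ipZl 0 (L20 _) Lg); exact: mul0r.
Qed.

Lemma H1_ae u v : H1 u -> measurable_fun setT v -> {ae leb, forall x, u x = v x} ->
  [/\ H1 v, dirichlet v = dirichlet u & n2 leb v = n2 leb u].
Proof.
move=> hu mv e; have Lu := H1L2 hu; have Lv := L2_ae mv Lu e.
have wv : wgrad v (gradc u).
  move=> i; have [Lg /weak_partial_ip w] := gradP hu i; split => //.
  apply/weak_partial_ip => phi tp; have mp := measurable_test (test_partial i tp).
  rewrite -w// ![ip leb _ (partial i phi)]ipC; apply: ip_ae => //; first exact: Lu.1.
  by apply: filterS e => x ->.
have hv : H1 v by apply/H1P; split => //; exists (gradc u).
split; [exact: hv|exact: (dirichletE hv wv)|].
by apply: n2_ae => //; [exact: Lu.1|apply: filterS e => x ->].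
Qed.

Lemma energy_integral a b u v : H1 u -> H1 v ->
  \int[leb]_x (enorm (grad u x) ^+ 2 + a * `|u x| ^+ 2 + enorm (grad v x) ^+ 2 + b * `|v x| ^+ 2) = energy a b u v.
Proof.
move=> hu hv.
have i2 f : L2 leb f -> intb leb (fun x => f x * f x) by move=> Lf; exact: intbM.
have iG f : H1 f -> intb leb (fun x => \sum_i gradc f i x * gradc f i x).
  by move=> hf; apply: intb_sum => i; apply: i2; have [] := gradP hf i.
have RG f : H1 f -> \int[leb]_x (\sum_i gradc f i x * gradc f i x) = dirichlet f.
  by move=> hf; rewrite Rint_sum => [|i]//; apply: i2; have [] := gradP hf i.
have iu := i2 _ (H1L2 hu); have iv := i2 _ (H1L2 hv).
rewrite (_ : (fun x => _) = (fun x => \sum_i gradc u i x * gradc u i x + a * (u x * u x) +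
   (\sum_i gradc v i x * gradc v i x + b * (v x * v x)))); last first.
  apply/funext => x; rewrite !enorm_sqr !real_normK ?num_real// !expr2 addrA.
  by congr (_ + _ + _ + _); apply: eq_bigr => i _; rewrite expr2.
have j1 := intbD (iG _ hu) (intbZ a iu); have j2 := intbD (iG _ hv) (intbZ b iv).
rewrite (RintD j1 j2) (RintD (iG _ hu) (intbZ a iu)) (RintD (iG _ hv) (intbZ b iv)).
by rewrite (RintZ a iu) (RintZ b iv) !RG.
Qed.

Lemma HnormE u v : H1 u -> H1 v -> Hnorm (u, v) = Num.sqrt (energy 1 1 u v).
Proof.
move=> hu hv; rewrite -(energy_integral 1 1 hu hv) /Hnorm; congr (Num.sqrt _).
by congr (Rintegral _ _ _); apply/funext => x; rewrite /= !mul1r.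
Qed.

Let weighted_le (a b x y z w : R) : 0 <= a -> 0 <= b -> 0 <= x -> 0 <= y -> 0 <= z -> 0 <= w ->
  x + a * y + (z + b * w) <= (1 + a + b) * (x + 1 * y + (z + 1 * w)).
Proof.
move=> a0 b0 x0 y0 z0 w0; have := mulr_ge0 a0 x0; have := mulr_ge0 a0 z0; have := mulr_ge0 a0 w0.
have := mulr_ge0 b0 x0; have := mulr_ge0 b0 y0; have := mulr_ge0 b0 z0; rewrite !mul1r; lra.
Qed.

Lemma energy_le_Hnorm a b u v t : 0 < a -> 0 < b -> H1 u -> H1 v -> 0 <= t -> Hnorm (u, v) <= t ->
  energy a b u v <= (1 + a + b) * t ^+ 2.
Proof.
move=> a0 b0 hu hv t0 h.
have c0 : 0 <= 1 + a + b by lra.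
have N0 : 0 <= energy 1 1 u v by exact: energy_ge0.
have h2 : energy 1 1 u v <= t ^+ 2.
  by move: h; rewrite (HnormE hu hv) -ler_sqr ?nnegrE ?sqrtr_ge0// sqr_sqrtr.
apply: le_trans (ler_wpM2l c0 h2).
exact: (weighted_le (ltW a0) (ltW b0) (dirichlet_ge0 u) (n2_ge0 leb u) (dirichlet_ge0 v) (n2_ge0 leb v)).
Qed.

Lemma Hnorm_scale u v c : H1 u -> H1 v -> Hnorm ((fun x => c * u x), (fun x => c * v x)) = `|c| * Hnorm (u, v).
Proof.
move=> hu hv; rewrite (HnormE (H1_scale c hu) (H1_scale c hv)) (HnormE hu hv) (energy_scale 1 1 c hu hv).
by rewrite sqrtrM ?sqr_ge0// sqrtr_sqr.
Qed.

End quadratic_form.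

(** * Convexity of powers *)

Section power_convexity.
Context {R : realType}.
Implicit Types (x y r s t : R).

(** Young's inequality for x and y^(r-1) with conjugate exponents is the tangent inequality,
    including x = 0. *)
Lemma powR_tangent x y r : 1 < r -> 0 <= x -> 0 < y -> y `^ r + r * y `^ (r - 1) * (x - y) <= x `^ r.
Proof.
move=> r1 x0 y0; have r0 : 0 < r by lra.
have q0 : 0 < r / (r - 1) by rewrite divr_gt0//; lra.
have rn : r != 0 by rewrite gt_eqF. have rn1 : r - 1 != 0 by rewrite gt_eqF//; lra.
have h := @conjugate_powR R x (y `^ (r - 1)) r (r / (r - 1)) x0 (powR_ge0 _ _) r0 q0.
have := h _; rewrite -powRrM (_ : (r - 1) * (r / (r - 1)) = r); last by field.
move=> /(_ _)/wrap[]; first by field; rewrite rn rn1.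
rewrite -(mulr_powRB1 (ltW y0) r0).
set b := y `^ (r - 1) => {}h.
have := ler_wpM2l (ltW r0) h; rewrite mulrDr (_ : r * (x `^ r / r) = x `^ r); last by field.
rewrite (_ : r * (y * b / (r / (r - 1))) = (r - 1) * (y * b)); last by field; rewrite rn rn1.
lra.
Qed.

Lemma powR_midpoint x y r : 1 < r -> 0 <= x -> 0 <= y -> ((x + y) / 2) `^ r <= (x `^ r + y `^ r) / 2.
Proof.
move=> r1 x0 y0; have [s0|] := ltP 0 ((x + y) / 2); last first.
  move=> h; have -> : x = 0 by lra. have -> : y = 0 by lra.
  by rewrite addr0 mul0r !powR0 ?addr0 ?mul0r//; rewrite gt_eqF//; lra.
have := powR_tangent r1 x0 s0; have := powR_tangent r1 y0 s0.
move: (_ `^ r) (_ `^ r) (_ `^ r) => X Y Z; move: (r * _) => c h1 h2.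
have : c * (x - (x + y) / 2) + c * (y - (x + y) / 2) = 0 by field.
lra.
Qed.

(** The tangent at the larger of the two moduli bounds the difference of powers; both moduli are at
    most |a| + |k| and differ by at most 2 t |k|. *)
Lemma powR_perturb (a k t r : R) : 1 < r -> 0 <= t -> t <= 1 ->
  `| `|a + t * k| `^ r - `|a - t * k| `^ r | <= 2 * r * t * (`|a| + `|k|) `^ r.
Proof.
move=> r1 t0 t1; set M := `|a| + `|k|.
have M0 : 0 <= M by rewrite addr_ge0.
have key (x y : R) : 0 <= y -> y <= x -> x <= M -> x - y <= 2 * t * `|k| -> x `^ r - y `^ r <= 2 * r * t * M `^ r.
  move=> y0 yx xM d; have [x0|] := ltP 0 x; last first.
    move=> x0; have -> : x = y by lra. rewrite subrr; apply: mulr_ge0; last exact: powR_ge0.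
    by apply: mulr_ge0 => //; lra.
  have h := powR_tangent r1 y0 x0.
  have r0' : 0 < r by lra.
  have e := mulr_powRB1 M0 r0'; symmetry in e.
  have m : x `^ (r - 1) <= M `^ (r - 1) by apply: ge0_ler_powR => //; rewrite ?nnegrE//; lra.
  have kM : `|k| <= M by rewrite /M lerDr.
  have d' : x - y <= 2 * t * M by apply: (le_trans d); apply: ler_wpM2l => //; rewrite mulr_ge0.
  have : x `^ (r - 1) * (x - y) <= M `^ (r - 1) * (2 * t * M).
    by apply: ler_pM => //; [exact: powR_ge0|lra].
  move=> h3; have := ler_wpM2l (_ : 0 <= r) h3; move=> /(_ _)/wrap[]; first lra.
  rewrite e; move: h; set p1 := x `^ (r - 1); set p2 := M `^ (r - 1); move: (x `^ r) (y `^ r) => X Y.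
  rewrite (_ : r * p1 * (y - x) = - (r * (p1 * (x - y)))); last by ring.
  rewrite (_ : 2 * r * t * (M * p2) = r * (p2 * (2 * t * M))); last by ring.
  lra.
have tk : `|t * k| <= `|k| by rewrite normrM ger0_norm// ler_piMl.
have p1 : `|a + t * k| <= M by apply: (le_trans (ler_normD _ _)); rewrite lerD2l.
have p2 : `|a - t * k| <= M by apply: (le_trans (ler_normB _ _)); rewrite lerD2l.
have q1 : `|a + t * k| - `|a - t * k| <= 2 * t * `|k|.
  apply: (le_trans (lerB_dist _ _)); rewrite (_ : _ - _ = 2 * t * k); last by ring.
  by rewrite !normrM (ger0_norm t0) ger0_norm.
have q2 : `|a - t * k| - `|a + t * k| <= 2 * t * `|k|.
  apply: (le_trans (lerB_dist _ _)); rewrite (_ : _ - _ = - (2 * t * k)); last by ring.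
  by rewrite normrN !normrM (ger0_norm t0) ger0_norm.
rewrite ler_norml; have n1 := normr_ge0 (a + t * k); have n2 := normr_ge0 (a - t * k).
have r0 : 0 <= r by lra.
have [le|/ltW le] := leP `|a + t * k| `|a - t * k|.
  have := key _ _ n1 le p2 q2.
  have : `|a + t * k| `^ r <= `|a - t * k| `^ r by apply: ge0_ler_powR.
  by move=> *; apply/andP; split; lra.
have := key _ _ n2 le p1 q1.
have : `|a - t * k| `^ r <= `|a + t * k| `^ r by apply: ge0_ler_powR.
by move=> *; apply/andP; split; lra.
Qed.

End power_convexity.

(** * Variations of the action at an extremal pair *)

Section variational.
Context {R : realType} {N : nat} (alpha p q A B : R).
Hypotheses (N0 : (0 < N)%N) (al0 : 0 < alpha) (alN : alpha < N%:R).
Hypotheses (hp : (N%:R + alpha) / N%:R < p) (hp' : p * (N%:R - 2) < N%:R + alpha).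
Hypotheses (hq : (N%:R + alpha) / N%:R < q) (hq' : q * (N%:R - 2) < N%:R + alpha).
Hypotheses (A0 : 0 < A) (B0 : 0 < B).
Local Notation E := 'rV[R]_N.
Local Notation leb := (@lebesgue_rV R N).
Local Notation DP := (@interaction R N alpha p q).
Local Notation energy := (@energy R N A B).
Local Notation energy_form := (@energy_form R N A B).
Local Notation J := (@action R N alpha p q (cst A) (cst B)).
Implicit Types (u v h k f g phi : E -> R) (x y z : E) (K e t c m : R).

Let p1 : 1 < p. Proof. exact: (exponent_gt1 N0 al0 hp). Qed.
Let q1 : 1 < q. Proof. exact: (exponent_gt1 N0 al0 hq). Qed.
Let p0 : 0 <= p. Proof. by apply: ltW; apply: lt_trans p1. Qed.
Let q0 : 0 <= q. Proof. by apply: ltW; apply: lt_trans q1. Qed.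
Let pq2 : 2 < p + q. Proof. by move: p1 q1; lra. Qed.

Definition coupling u v : R := fine (DP u v).

Lemma interaction_bounded K : exists2 C : R, 0 <= C & forall u v, H1 u -> H1 v -> energy u v <= K -> (DP u v <= C%:E)%E.
Proof.
have [C C0 h] := interaction_bound N0 al0 alN hp hp' hq hq' (ball_const_ge0 A0 B0 (normr_ge0 K)).
exists C => // u v hu hv hK.
have hb := ball_le (le_trans hK (ler_norm K)) (energy_ball N0 A0 B0 hu hv).
by have [b1 b2] := ball_in_ball A0 B0 hb; exact: h.
Qed.

Lemma interaction_coupling u v : H1 u -> H1 v -> DP u v = (coupling u v)%:E.
Proof.
move=> hu hv; have [C C0 h] := interaction_bounded (energy u v).
have [r r0 e] := ge0_finite (interaction_ge0 p q al0 alN u v) (fine_le_lty (h _ _ hu hv (lexx _))).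
by rewrite /coupling e.
Qed.

Lemma coupling_ge0 u v : 0 <= coupling u v.
Proof. by apply: fine_ge0; exact: interaction_ge0. Qed.

Lemma actionE u v : H1 u -> H1 v -> J (u, v) = 2^-1 * energy u v - 2 / (p + q) * coupling u v.
Proof.
move=> hu hv; rewrite /action (interaction_convolution p q al0 alN (H1L2 hu).1 (H1L2 hv).1).
by rewrite -(energy_integral A B hu hv).
Qed.

Lemma coupling_scale u v c : H1 u -> H1 v -> 0 <= c ->
  coupling (fun x => c * u x) (fun x => c * v x) = c `^ (p + q) * coupling u v.
Proof.
move=> hu hv c0; apply/EFin_inj; rewrite -interaction_coupling; [|exact: H1_scale|exact: H1_scale].
by rewrite (interaction_scale N0 al0 alN hp hq (H1L2 hu).1 (H1L2 hv).1 c0) EFinM -interaction_coupling.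
Qed.

Lemma H1_abs u v : H1 u -> H1 v ->
  [/\ H1 (fun x => `|u x|), H1 (fun x => `|v x|) & energy (fun x => `|u x|) (fun x => `|v x|) <= energy u v].
Proof. by move=> hu hv; exact: (ball_energy_le A0 B0 (ball_abs A0 B0 (energy_ball N0 A0 B0 hu hv))). Qed.

Let parallelogram (x y z w : R) : 0 <= w -> x = y + 2 * 1 * z + 1 ^+ 2 * w -> forall n : R, n = y + 2 * (- 1) * z + (- 1) ^+ 2 * w ->
  0 <= n -> x <= 2 * (y + w).
Proof. by move=> w0 -> n ->; rewrite sqrrN expr1n; lra. Qed.

Lemma energy_add_le u v h k : H1 u -> H1 v -> H1 h -> H1 k ->
  energy (fun x => u x + 1 * h x) (fun x => v x + 1 * k x) <= 2 * (energy u v + energy h k).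
Proof.
move=> hu hv hh hk.
have e1 := energy_lin A B 1 hu hv hh hk; have e2 := energy_lin A B (- 1) hu hv hh hk.
exact: (parallelogram (energy_ge0 A0 B0 h k) e1 e2 (energy_ge0 A0 B0 _ _)).
Qed.

(** Uses 4 ((a+b)/2) ((c+d)/2) = 2 (a c + b d) - (a - b)(c - d): convexity handles the first part,
    and the cross term is a product of two differences of order t. *)
Let mixed_le (a b c d F G a1 b1 cp cq t : R) : 0 <= F -> 0 <= G -> a1 <= (a + b) / 2 -> b1 <= (c + d) / 2 ->
  0 <= a1 -> 0 <= b1 -> 0 <= cp -> 0 <= cq -> `|a - b| <= cp * t * F -> `|c - d| <= cq * t * G ->
  2 * (a1 * b1) <= a * c + b * d + cp * cq / 2 * t ^+ 2 * (F * G).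
Proof.
move=> F0 G0 h1 h2 a0 b0 cp0 cq0 h3 h4.
have k1 : a1 * b1 <= (a + b) / 2 * ((c + d) / 2) by apply: ler_pM.
have k2 : `|a - b| * `|c - d| <= cp * t * F * (cq * t * G) by apply: ler_pM.
have k3 := ler_norm (- ((a - b) * (c - d))); rewrite normrN normrM in k3.
have e1 : 4 * ((a + b) / 2 * ((c + d) / 2)) = 2 * (a * c + b * d) + - ((a - b) * (c - d)) by field.
have e2 : cp * t * F * (cq * t * G) = cp * cq * t ^+ 2 * (F * G) by ring.
have e3 : cp * cq / 2 * t ^+ 2 * (F * G) = (cp * cq * t ^+ 2 * (F * G)) / 2 by field.
rewrite e3; lra.
Qed.

Lemma midpoint_abs (a b : R) s : 1 < s -> `|a| `^ s <= (`|a + b| `^ s + `|a - b| `^ s) / 2.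
Proof.
move=> s1; apply: le_trans (powR_midpoint s1 (normr_ge0 _) (normr_ge0 _)).
apply: ge0_ler_powR; rewrite ?nnegrE ?normr_ge0 ?divr_ge0 ?addr_ge0//; first by apply: ltW; apply: lt_trans s1.
rewrite ler_pdivlMr// (_ : `|a| * 2 = `|(a + b) + (a - b)|); first exact: ler_normD.
by rewrite (_ : a + b + (a - b) = a * 2) ?normrM ?(ger0_norm (ler0n R 2))//; ring.
Qed.

Let eq_le_impl (a b : \bar R) : a = b -> (a <= b)%E. Proof. by move->. Qed.

(** The interaction is not jointly convex, but its failure under a symmetric perturbation is the
    cross term of [mixed_le], dominated by t^2 times the interaction of |u| + |h| and |v| + |k|. *)
Lemma coupling_second_difference K : exists2 C : R, 0 <= C & forall u v h k t, H1 u -> H1 v -> H1 h -> H1 k ->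
  energy u v <= K -> energy h k <= K -> 0 <= t -> t <= 1 ->
  2 * coupling u v <= coupling (fun x => u x + t * h x) (fun x => v x + t * k x) +
    coupling (fun x => u x + - t * h x) (fun x => v x + - t * k x) + C * t ^+ 2.
Proof.
have [C C0 hC] := interaction_bounded (2 * (K + K)).
have cc0 : 0 <= (2 * p) * (2 * q) / 2 by rewrite divr_ge0// mulr_ge0// mulr_ge0.
exists ((2 * p) * (2 * q) / 2 * C); first exact: mulr_ge0.
move=> u v h k t hu hv hh hk Ku Kh t0 t1.
have [au av an] := H1_abs hu hv; have [ah ak an'] := H1_abs hh hk.
pose F x := `|u x| + 1 * `|h x|; pose G x := `|v x| + 1 * `|k x|.
have hF : H1 F by exact: H1_lin. have hG : H1 G by exact: H1_lin.
have DFG : (DP F G <= C%:E)%E.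
  apply: hC => //; apply: (le_trans (energy_add_le au av ah ak)); apply: ler_wpM2l => //.
  by apply: lerD; [exact: (le_trans an)|exact: (le_trans an')].
have hu1 := H1_lin t hu hh; have hv1 := H1_lin t hv hk.
have hu2 := H1_lin (- t) hu hh; have hv2 := H1_lin (- t) hv hk.
have mk := @measurable_riesz R N alpha; have k0 := @riesz_ge0 R N alpha al0 alN.
have mP (a b : E -> R) : H1 a -> H1 b -> measurable_fun setT (fun w : E * E => riesz alpha (w.1 - w.2) * `|a w.2| `^ p * `|b w.1| `^ q).
  move=> /H1L2[ma _] /H1L2[mb _].
  by apply: (measurable_riesz_form (f := fun y => `|a y| `^ p) (g := fun y => `|b y| `^ q) mk); meas.
have P0 (a b : E -> R) (w : E * E) : 0 <= riesz alpha (w.1 - w.2) * `|a w.2| `^ p * `|b w.1| `^ q.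
  by apply: mul3_ge0 => //; exact: powR_ge0.
have m0 := mP _ _ hu hv; have m1 := mP _ _ hu1 hv1; have m2 := mP _ _ hu2 hv2; have m3 := mP _ _ hF hG.
have c0 : 0 <= (2 * p) * (2 * q) / 2 * t ^+ 2 by rewrite mulr_ge0// sqr_ge0.
set c := (2 * p) * (2 * q) / 2 * t ^+ 2 in c0.
have m3' := mfM (@measurable_cst _ _ (E * E)%type R setT c) m3.
have m0' := mfM (@measurable_cst _ _ (E * E)%type R setT 2) m0.
have key : (2%:E * DP u v <= DP (fun x => (u x + t * h x)%R) (fun x => (v x + t * k x)%R) +
    DP (fun x => (u x + - t * h x)%R) (fun x => (v x + - t * k x)%R) + c%:E * DP F G)%E.
  rewrite /interaction /riesz_form /dint.
  have e1 := nnintZ (leb \x leb)%E m0 (P0 _ _) (ler0n R 2).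
  have Pa := P0 (fun x => u x + t * h x) (fun x => v x + t * k x).
  have Pb := P0 (fun x => u x + - t * h x) (fun x => v x + - t * k x).
  have e2 := nnintD (leb \x leb)%E (mfD m1 m2) m3' (fun w => addr_ge0 (Pa w) (Pb w)) (fun w => mulr_ge0 c0 (P0 F G w)).
  rewrite (nnintD (leb \x leb)%E m1 m2 Pa Pb) (nnintZ (leb \x leb)%E m3 (P0 F G) c0) in e2.
  apply: (le_trans _ (eq_le_impl e2)); apply: (le_trans (eq_le_impl (esym e1))).
  apply: (nnint_le _ m0' (mfD (mfD m1 m2) m3') (fun w => mulr_ge0 (ler0n R 2) (P0 _ _ w))) => w; rewrite /cst.
  have i1 := midpoint_abs (u w.2) (t * h w.2) p1; have i2 := midpoint_abs (v w.1) (t * k w.1) q1.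
  have i3 := powR_perturb (u w.2) (h w.2) p1 t0 t1; have i4 := powR_perturb (v w.1) (k w.1) q1 t0 t1.
  rewrite -!mulNr in i1 i2 i3 i4.
  have eF : `|F w.2| = `|u w.2| + `|h w.2| by rewrite ger0_norm /F ?mul1r// addr_ge0.
  have eG : `|G w.1| = `|v w.1| + `|k w.1| by rewrite ger0_norm /G ?mul1r// addr_ge0.
  rewrite eF eG.
  have := mixed_le (powR_ge0 _ _) (powR_ge0 _ _) i1 i2 (powR_ge0 _ _) (powR_ge0 _ _)
    (mulr_ge0 (ler0n R 2) p0) (mulr_ge0 (ler0n R 2) q0) i3 i4.
  rewrite -/c; move: (_ `^ p) (_ `^ p) (_ `^ p) (_ `^ p) (_ `^ q) (_ `^ q) (_ `^ q) (_ `^ q) => X1 X2 X3 X4 Y1 Y2 Y3 Y4.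
  move/(ler_wpM2l (k0 (w.1 - w.2))); move: (riesz _ _) => r.
  set L := (X in X <= _ -> _); set L' := (X in _ -> X <= _); have -> : L = L' by rewrite /L /L'; ring.
  move/le_trans; apply; rewrite le_eqVlt; apply/orP; left; apply/eqP; ring.
move: key DFG; rewrite !interaction_coupling// -!EFinM -!EFinD !lee_fin => key DFG.
apply: (le_trans key); apply: lerD => //; rewrite /c mulrAC; apply: ler_wpM2r; first exact: sqr_ge0.
exact: ler_wpM2l.
Qed.

(* [S] is the best constant in [coupling <= S energy ^ ((p + q) / 2)] and [m0] the
   energy at which the action restricted to the ray of a maximiser is maximal. *)
Context (S m0 : R).
Hypotheses (S0 : 0 < S) (m00 : 0 < m0).
Let r : R := (p + q) / 2.
Let r1 : 1 < r. Proof. by rewrite /r; move: pq2; lra. Qed.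
Hypothesis hS : forall u v m, H1 u -> H1 v -> 0 < m -> energy u v <= m -> coupling u v <= S * m `^ r.
Hypothesis hm0 : S * m0 `^ (r - 1) = 2^-1.

Definition extremal u v := [/\ H1 u, H1 v, energy u v = m0 & coupling u v = S * m0 `^ r].

Let pqr : 2 / (p + q) = r^-1.
Proof. by rewrite /r invf_div. Qed.

Let lower_algebra (m P P1 Q Q1 d : R) : 0 < m -> S * Q1 = 2^-1 -> d <= S * P -> P + r * P1 * (m0 - m) <= Q ->
  (2^-1 * m - r^-1 * d) - (2^-1 * m0 - r^-1 * (S * Q)) >= - (S * ((P1 - Q1) * (m - m0))).
Proof.
move=> m_0 e1 h1 h2; have rr : r^-1 * r = 1 by rewrite mulVf// gt_eqF//; move: r1; lra.
have ri : 0 <= r^-1 by rewrite invr_ge0; move: r1; lra.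
have k1 := ler_wpM2l ri h1; have k2 := ler_wpM2l ri (ler_wpM2l (ltW S0) h2).
have e2 : r^-1 * (S * (P + r * P1 * (m0 - m))) = r^-1 * (S * P) - (r^-1 * r) * (S * P1 * (m - m0)) by ring.
rewrite e2 rr mul1r in k2.
have -> : S * ((P1 - Q1) * (m - m0)) = S * P1 * (m - m0) - S * Q1 * (m - m0) by ring.
rewrite e1; lra.
Qed.

Let powR_near e : 0 < e -> exists2 d : R, 0 < d & forall m, `|m - m0| < d ->
  0 < m /\ `|m `^ (r - 1) - m0 `^ (r - 1)| < e.
Proof.
move=> e0; have : {for m0, continuous (fun m : R => m `^ (r - 1))}.
  have h : {for m0, continuous (fun m : R => expR ((r - 1) * ln m))}.
    apply: (@continuous_comp _ _ _ (fun m : R => (r - 1) * ln m) expR); last exact: continuous_expR.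
    by apply: cvgM; [exact: cvg_cst|exact: continuous_ln].
  have e1 m : 0 < m -> m `^ (r - 1) = expR ((r - 1) * ln m) by move=> m1; rewrite /powR gt_eqF.
  move: h; rewrite /prop_for /continuous_at (e1 _ m00) => h.
  apply: cvg_trans h; apply: near_eq_cvg; near=> m; rewrite e1//; near: m; exact: lt_nbhsr.
move=> /cvgrPdist_lt/(_ e e0) [d /= d0 hd]; exists (Num.min d m0); first by rewrite lt_min d0.
move=> m; rewrite lt_min => /andP[h1 h2]; split; first by move: h2; rewrite ltr_norml => /andP[]; lra.
by rewrite distrC; apply: hd; rewrite /= distrC.
Unshelve. all: by end_near. Qed.

(** A weak Cauchy-Schwarz inequality for the energy form, read off from the nonnegativity of the
    energy at t = 1 and t = -1. *)
Let increment_bound (t b K n : R) : 0 <= n -> n <= K -> `|t| <= 1 -> 0 <= m0 + 2 * 1 * b + 1 ^+ 2 * n ->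
  0 <= m0 + 2 * (- 1) * b + (- 1) ^+ 2 * n -> `|2 * t * b + t ^+ 2 * n| <= `|t| * (m0 + 2 * K).
Proof.
rewrite expr1n sqrrN expr1n => n0 nK t1 h1 h2.
have -> : 2 * t * b + t ^+ 2 * n = t * (2 * b + t * n) by ring.
rewrite normrM; apply: ler_wpM2l => //; apply: (le_trans (ler_normD _ _)).
have b1 : `|2 * b| <= m0 + n by rewrite ler_norml; apply/andP; split; lra.
have b2 : `|t * n| <= n by rewrite normrM (ger0_norm n0) ler_piMl.
lra.
Qed.

Let sub_of_sum (a b c d : R) : d = a + b + c -> d - a = b + c.
Proof. by move=> ->; ring. Qed.

(** A pair of energy m has action at least m/2 - S m^r / r, with equality at the extremal pair. By
    the equation for [m0] this function of m is stationary there, and m - m0 is O(t). *)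
Lemma action_lower u v K e : extremal u v -> 0 <= K -> 0 < e -> exists2 d : R, 0 < d &
  forall h k t, H1 h -> H1 k -> energy h k <= K -> `|t| < d ->
  - (e * `|t|) <= J ((fun x => u x + t * h x), (fun x => v x + t * k x)) - J (u, v).
Proof.
move=> [hu hv nw dw] K0 e0; pose c := m0 + 2 * K; have c0 : 0 < c by rewrite /c; move: m00 K0; lra.
have [d d0 hd] := powR_near (divr_gt0 e0 (mulr_gt0 S0 c0)).
exists (Num.min 1 (d / c)); first by rewrite lt_min ltr01 divr_gt0.
move=> h k t hh hk hK; rewrite lt_min => /andP[/ltW t1 td].
have hu1 := H1_lin t hu hh; have hv1 := H1_lin t hv hk.
have em := energy_lin A B t hu hv hh hk; rewrite nw in em.
have b1 := energy_lin A B 1 hu hv hh hk; have b2 := energy_lin A B (- 1) hu hv hh hk; rewrite nw in b1 b2.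
have g1 := energy_ge0 A0 B0 (fun x => u x + 1 * h x) (fun x => v x + 1 * k x); rewrite b1 in g1.
have g2 := energy_ge0 A0 B0 (fun x => u x + - 1 * h x) (fun x => v x + - 1 * k x); rewrite b2 in g2.
have ib := increment_bound (energy_ge0 A0 B0 h k) hK t1 g1 g2.
rewrite (actionE hu1 hv1) (actionE hu hv) nw dw pqr.
set m := energy (fun x => _ + _) _ in em *.
have mm : `|m - m0| <= `|t| * c by rewrite (sub_of_sum em).
have [m_0 hm] : 0 < m /\ `|m `^ (r - 1) - m0 `^ (r - 1)| < e / (S * c).
  by apply: hd; apply: (le_lt_trans mm); rewrite -ltr_pdivlMr.
apply: le_trans (lower_algebra m_0 hm0 (hS hu1 hv1 m_0 (lexx _)) (powR_tangent r1 (ltW m00) m_0)).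
rewrite lerN2; apply: (le_trans (ler_norm _)); rewrite normrM (gtr0_norm S0) normrM.
apply: (@le_trans _ _ (S * (e / (S * c) * (`|t| * c)))).
  by apply: ler_wpM2l; [exact: ltW|apply: ler_pM => //; exact: ltW].
rewrite le_eqVlt; apply/orP; left; apply/eqP; field; by rewrite !gt_eqF.
Qed.

Let upper_algebra (n n1 n2' N1 b t d d1 d2 C K e : R) : 0 <= N1 -> N1 <= K -> 0 < t ->
  n1 = n + 2 * t * b + t ^+ 2 * N1 -> n2' = n + 2 * (- t) * b + (- t) ^+ 2 * N1 ->
  2 * d <= d1 + d2 + C * t ^+ 2 -> t * (K + r^-1 * C) <= e / 2 ->
  - (e / 2 * t) <= (2^-1 * n2' - r^-1 * d2) - (2^-1 * n - r^-1 * d) ->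
  (2^-1 * n1 - r^-1 * d1) - (2^-1 * n - r^-1 * d) <= e * t.
Proof.
move=> N10 NK t0 e1 e2 h1 h2 h3; have ri : 0 <= r^-1 by rewrite invr_ge0; move: r1; lra.
have k1 := ler_wpM2l ri h1; have k2 := ler_wpM2l (ltW t0) h2.
have k3 := ler_wpM2l (sqr_ge0 t) NK.
have e3 : t * (t * (K + r^-1 * C)) = t ^+ 2 * K + r^-1 * (C * t ^+ 2) by ring.
rewrite e3 in k2; rewrite sqrrN in e2; rewrite !mulrDr in k1.
have : r^-1 * (2 * d) = 2 * (r^-1 * d) by ring.
move: h3; rewrite e1 e2; move: (t ^+ 2 * N1) (t ^+ 2 * K) k2 k3 => X Y k2 k3.
rewrite (_ : e * t = t * (e / 2) + e / 2 * t); last by field.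
rewrite (_ : e / 2 * t = t * (e / 2)) in k2 *; last by ring.
move: k1 k2; move: (t * (e / 2)) (r^-1 * _) (r^-1 * _) (r^-1 * _) (r^-1 * _) (r^-1 * _) => Z W1 W2 W3 W4 W5; lra.
Qed.

Let half_le (a : R) : 0 <= a -> a / 2 <= a.
Proof. lra. Qed.

(** The second difference turns the lower bound at -t into an upper bound at t, with an error of
    order t^2. *)
Lemma action_variation u v K e : extremal u v -> 0 <= K -> 0 < e -> exists2 d : R, 0 < d &
  forall h k t, H1 h -> H1 k -> energy h k <= K -> 0 < t -> t < d ->
  `|J ((fun x => u x + t * h x), (fun x => v x + t * k x)) - J (u, v)| <= e * t.
Proof.
move=> ex K0 e0; have [hu hv nw dw] := ex; have e2 : 0 < e / 2 by rewrite divr_gt0.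
have [d1 d10 h1] := action_lower ex K0 e2.
have K'0 : 0 <= Num.max m0 K by rewrite le_max K0 orbT.
have [C C0 hC] := coupling_second_difference (Num.max m0 K).
have ri : 0 <= r^-1 by rewrite invr_ge0; move: r1; lra.
have kc : 0 < K + r^-1 * C + 1 by rewrite ltr_wpDl// addr_ge0// mulr_ge0.
exists (Num.min 1 (Num.min d1 (e / 2 / (K + r^-1 * C + 1)))).
  by rewrite !lt_min ltr01 d10 divr_gt0.
move=> h k t hh hk hK t0; rewrite !lt_min => /andP[/ltW t1 /andP[td1 td2]].
have l1 : - (e / 2 * t) <= J ((fun x => u x + t * h x), (fun x => v x + t * k x)) - J (u, v).
  by have := h1 h k t hh hk hK; rewrite (gtr0_norm t0); apply; exact: td1.
have l2 : - (e / 2 * t) <= J ((fun x => u x + - t * h x), (fun x => v x + - t * k x)) - J (u, v).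
  by have := h1 h k (- t) hh hk hK; rewrite normrN (gtr0_norm t0); apply; exact: td1.
have et : 0 <= e * t by rewrite mulr_ge0 ?ltW.
rewrite ler_norml; apply/andP; split.
  by apply: le_trans l1; rewrite lerN2; apply: ler_wpM2r; [exact: ltW|exact: half_le (ltW e0)].
have nu : energy u v <= Num.max m0 K by rewrite nw le_max lexx.
have nh : energy h k <= Num.max m0 K by rewrite le_max hK orbT.
have sd := hC u v h k t hu hv hh hk nu nh (ltW t0) t1.
move: l2; rewrite (actionE (H1_lin (- t) hu hh) (H1_lin (- t) hv hk)) (actionE hu hv) (actionE (H1_lin t hu hh) (H1_lin t hv hk)) pqr.
apply: (upper_algebra (energy_ge0 A0 B0 h k) hK t0 (energy_lin A B t hu hv hh hk) (energy_lin A B (- t) hu hv hh hk) sd).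
apply: (@le_trans _ _ (t * (K + r^-1 * C + 1))); first by apply: ler_wpM2l; [exact: ltW|rewrite lerDl].
by rewrite -ler_pdivlMr//; exact: ltW.
Qed.

Lemma extremal_critical u v : extremal u v -> is_frechet_derivative J (u, v) (cst 0).
Proof.
move=> ex; split; first by move=> a h k _ _; rewrite /cst mulr0 addr0.
  by exists 0 => h _; rewrite normr0 mul0r.
move=> e e0; have K0 : 0 <= 1 + A + B by move: A0 B0; lra.
have [d d0 hd] := action_variation ex K0 e0; exists d => // -[h k] [hh hk] hn.
change (H1 h) in hh; change (H1 k) in hk.
rewrite subr0; have -> : (u, v) + (h, k) = ((fun x => u x + h x), (fun x => v x + k x)) by [].
set X := `|_|; have key t : 0 < t -> Hnorm (h, k) <= t -> t < d -> X <= e * t.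
  move=> t0 ht td.
  have hh' := H1_scale t^-1 hh; have hk' := H1_scale t^-1 hk.
  have nK : energy (fun x => t^-1 * h x) (fun x => t^-1 * k x) <= 1 + A + B.
    rewrite (energy_scale A B t^-1 hh hk).
    have := ler_wpM2l (sqr_ge0 t^-1) (energy_le_Hnorm A0 B0 hh hk (ltW t0) ht).
    by rewrite mulrCA -exprMn mulVf ?gt_eqF// expr1n mulr1.
  have := hd _ _ t hh' hk' nK t0 td.
  have e1 (a b : E -> R) : (fun x => a x + t * (t^-1 * b x)) = (fun x => a x + b x).
    by apply/funext => x; rewrite mulrA mulfV ?gt_eqF// mul1r.
  by rewrite (e1 u h) (e1 v k).
rewrite leNgt; apply/negP => lt.
have H0 : 0 <= Hnorm (h, k) by exact: sqrtr_ge0.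
(* The direction is normalised by a number strictly above its norm, which may be 0, and still below
   both d and X/e. *)
pose b := Num.min d (X / e); pose t := (Hnorm (h, k) + b) / 2.
have hb : Hnorm (h, k) < b by rewrite lt_min hn ltr_pdivlMr// mulrC.
have bd : b <= d by rewrite ge_min lexx.
have bX : b <= X / e by rewrite ge_min lexx orbT.
have [t1 t2 t3] : [/\ 0 < t, Hnorm (h, k) <= t & t < b] by rewrite /t; split; lra.
have := key t t1 t2 (lt_le_trans t3 bd).
by apply/negP; rewrite -ltNge mulrC -ltr_pdivlMr//; exact: lt_le_trans bX.
Qed.

Let variation_algebra (e t b n d d1 K : R) : 0 < t -> 0 < e -> n <= K -> t * K <= e -> d <= d1 ->
  - (e * t) <= (2^-1 * (m0 + 2 * t * b + t ^+ 2 * n) - r^-1 * d1) - (2^-1 * m0 - r^-1 * d) -> 0 <= b + 2 * e.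
Proof.
move=> t0 e0 nK tK dd h; have ri : 0 <= r^-1 by rewrite invr_ge0; move: r1; lra.
have k1 := ler_wpM2l ri dd; have k2 := ler_wpM2l (sqr_ge0 t) nK; have k3 := ler_wpM2l (ltW t0) tK.
have te := mulr_ge0 (ltW t0) (ltW e0).
have -> : 0 <= b + 2 * e = (0 <= t * (b + 2 * e)) by rewrite pmulr_rge0.
rewrite (_ : t * (t * K) = t ^+ 2 * K) in k3; last by ring.
rewrite (_ : t * (b + 2 * e) = t * b + 2 * (t * e)); last by ring.
move: h; rewrite (_ : e * t = t * e); last by ring.
rewrite (_ : 2 * t * b = 2 * (t * b)); last by ring.
move: k1 k2 k3 te; move: (t * b) (t * e) (t ^+ 2 * n) (t ^+ 2 * K) (r^-1 * d) (r^-1 * d1) => X1 X2 X3 X4 X5 X6; lra.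
Qed.

(** Nonnegative variations increase the coupling, so in the lower bound for the action only the
    energy can compensate; dividing by t leaves its first-order term. *)
Lemma extremal_variation u v h k : extremal u v -> (forall x, 0 <= u x) -> (forall x, 0 <= v x) ->
  H1 h -> H1 k -> (forall x, 0 <= h x) -> (forall x, 0 <= k x) -> 0 <= energy_form u v h k.
Proof.
move=> ex u0 v0 hh hk h0 k0; have [hu hv nw dw] := ex.
apply/ler_addgt0Pr => e' e'0; have e0 : 0 < e' / 2 by rewrite divr_gt0.
set K := energy h k; have K0 : 0 <= K by exact: energy_ge0.
have [d d0 hd] := action_lower ex K0 e0.
have K1 : 0 < K + 1 by rewrite ltr_wpDl.
pose t := Num.min (d / 2) (e' / 2 / (K + 1)).
have t0 : 0 < t by rewrite lt_min !divr_gt0.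
have td : t < d by apply: (@le_lt_trans _ _ (d / 2)); [rewrite ge_min lexx|move: d0; lra].
have tK : t * K <= e' / 2.
  apply: (@le_trans _ _ (t * (K + 1))); first by apply: ler_wpM2l; [exact: ltW|rewrite lerDl].
  by rewrite -ler_pdivlMr// ge_min lexx orbT.
have hu1 := H1_lin t hu hh; have hv1 := H1_lin t hv hk.
have mono : coupling u v <= coupling (fun x => u x + t * h x) (fun x => v x + t * k x).
  have le1 x : `|u x| <= `|u x + t * h x|.
    by rewrite !ger0_norm ?lerDl ?addr_ge0 ?mulr_ge0 ?(ltW t0).
  have le2 x : `|v x| <= `|v x + t * k x|.
    by rewrite !ger0_norm ?lerDl ?addr_ge0 ?mulr_ge0 ?(ltW t0).
  have := interaction_mono N0 al0 alN hp hq (H1L2 hu).1 (H1L2 hv).1 (H1L2 hu1).1 (H1L2 hv1).1 le1 le2.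
  by rewrite (interaction_coupling hu hv) (interaction_coupling hu1 hv1) lee_fin.
have := hd h k t hh hk (lexx _); rewrite (gtr0_norm t0) => /(_ td).
rewrite (actionE hu1 hv1) (actionE hu hv) (energy_lin A B t hu hv hh hk) nw pqr => low.
have := variation_algebra t0 e0 (lexx K) tK mono low.
by rewrite mulrCA mulfV// mulr1.
Qed.

Lemma ip0r u : L2 leb u -> ip leb u (cst 0) = 0.
Proof. by move=> Lu; have := ipZl 0 (L20 leb) Lu; rewrite mul0r -[ip leb u _]ipC; apply: etrans; congr (ip leb _ _); apply/funext => x; rewrite mul0r. Qed.

Lemma extremal_supersolution u v : extremal u v -> (forall x, 0 <= u x) -> (forall x, 0 <= v x) ->
  supersolution A u /\ supersolution B v.
Proof.
move=> ex u0 v0; have [hu hv _ _] := ex; have h0 := H1_test (@test0 R N).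
split=> phi tp phi0; have hphi := H1_test tp.
  have := extremal_variation ex u0 v0 hphi h0 phi0 (fun _ => lexx 0).
  by rewrite /energy_form (dirichlet_form_test hu tp) (dirichlet_form0 hv) (ip0r (H1L2 hv)) mulr0 !addr0.
have := extremal_variation ex u0 v0 h0 hphi (fun _ => lexx 0) phi0.
by rewrite /energy_form (dirichlet_form_test hv tp) (dirichlet_form0 hu) (ip0r (H1L2 hu)) mulr0 !add0r.
Qed.

Let ray_algebra (s n d P e H : R) : 0 <= n -> 1 + (p + q) * s <= P -> 0 <= d ->
  `|(2^-1 * ((1 + s) ^+ 2 * n) - r^-1 * (P * d)) - (2^-1 * n - r^-1 * d)| <= e * (`|s| * H) ->
  - (e * (`|s| * H)) <= s * (n - 2 * d) + s ^+ 2 * n.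
Proof.
move=> n0 hP d0; rewrite ler_norml => /andP[h _]; apply: (le_trans h).
have ri : 0 <= r^-1 by rewrite invr_ge0; move: r1; lra.
have k := ler_wpM2l ri (ler_wpM2r d0 hP).
have e1 : r^-1 * ((1 + (p + q) * s) * d) = r^-1 * d + s * (2 * d).
  by rewrite mulrDl mul1r mulrDr; congr (_ + _); rewrite /r; field; move: pq2 => h2; rewrite gt_eqF//; lra.
rewrite e1 in k; have := mulr_ge0 (sqr_ge0 s) n0.
rewrite (_ : (1 + s) ^+ 2 * n = n + 2 * (s * n) + s ^+ 2 * n); last by ring.
rewrite mulrBr; move: k; move: (s * n) (s ^+ 2 * n) (s * (2 * d)) (r^-1 * d) (r^-1 * _) => X1 X2 X3 X4 X5; lra.
Qed.

Let slope_le (e H c n s : R) : 0 < s -> s <= e -> 0 <= n -> - (e * (s * H)) <= s * c + s ^+ 2 * n -> - (e * (H + n)) <= c.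
Proof.
move=> s0 se n0 h; have k := ler_wpM2l (ltW s0) (ler_wpM2r n0 se).
rewrite -subr_ge0 -(pmulr_rge0 _ s0) (_ : s * (c - _) = s * c + e * (s * H) + s * (e * n)); last by ring.
rewrite (_ : s * (s * n) = s ^+ 2 * n) in k; last by ring.
move: h k; move: (s * c) (e * _) (s ^+ 2 * n) (s * _) => X1 X2 X3 X4; lra.
Qed.

(** The derivative along the ray through the pair vanishes. On the ray the action is explicit, and
    Bernoulli's inequality for (1 + t)^(p+q) with t = s and t = -s gives both inequalities in the
    limit. *)
Lemma nehari_identity u v : nehari alpha p q (cst A) (cst B) (u, v) -> energy u v = 2 * coupling u v.
Proof.
move=> [[/= hu hv] _ [L [Llin _ Lder] Lw]]; set n := energy u v; set d := coupling u v.
have n0 : 0 <= n by exact: energy_ge0.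
have H0 : 0 <= Hnorm (u, v) by exact: sqrtr_ge0.
set H := Hnorm (u, v) in H0.
have hz := H1_test (@test0 R N).
have Lz : L (cst 0, cst 0) = 0.
  have := Llin 1 (cst 0, cst 0) (cst 0, cst 0) (conj hz hz) (conj hz hz).
  rewrite scale1r mul1r (_ : (cst 0, cst 0) + (cst 0, cst 0) = (cst 0, cst 0) :> (E -> R) * (E -> R)); last exact: addr0.
  by move=> h; apply/eqP; rewrite -[eqbLHS](addrK (L (cst 0, cst 0))) -h subrr.
have Ls s : L ((fun x => s * u x), (fun x => s * v x)) = 0.
  have := Llin s (u, v) (cst 0, cst 0) (conj hu hv) (conj hz hz).
  rewrite Lw Lz mulr0 => e0; apply: etrans (etrans e0 (addr0 0)); congr L; exact: (esym (addr0 _)).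
have small e : 0 < e -> `|n - 2 * d| <= e * (H + n).
  move=> e0; have [dl dl0 hd] := Lder e e0.
  have H1p : 0 < H + 1 by rewrite ltr_wpDl.
  (* At most 1/2 so that 1 - s >= 0, at most e to absorb the term s^2 n, and small enough for the
     derivative estimate. *)
  pose s := Num.min 2^-1 (Num.min e (dl / 2 / (H + 1))).
  have s0 : 0 < s by rewrite !lt_min e0 !divr_gt0// invr_gt0 ltr0n.
  have s2 : s <= 2^-1 by rewrite ge_min lexx.
  have se : s <= e by rewrite !ge_min lexx orbT.
  have sd : s * H < dl.
    apply: (@le_lt_trans _ _ (dl / 2)); last by move: dl0; lra.
    apply: (@le_trans _ _ (s * (H + 1))); first by apply: ler_wpM2l; [exact: ltW|rewrite lerDl].
    by rewrite -ler_pdivlMr// !ge_min lexx !orbT.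
  have ray t : `|t| = s -> 0 <= 1 + t -> - (e * (s * H)) <= t * (n - 2 * d) + t ^+ 2 * n.
    move=> ts t1; rewrite -ts; have hs : Hnorm ((fun x => t * u x), (fun x => t * v x)) = `|t| * H by exact: Hnorm_scale.
    have := hd ((fun x => t * u x), (fun x => t * v x)) (conj (H1_scale t hu) (H1_scale t hv)).
    rewrite hs {1}ts => /(_ sd); rewrite Ls subr0.
    have -> : (u, v) + ((fun x => t * u x), (fun x => t * v x)) = ((fun x => (1 + t) * u x), (fun x => (1 + t) * v x)).
      by congr (_, _); apply/funext => x; rewrite mulrDl mul1r.
    rewrite (actionE (H1_scale (1 + t) hu) (H1_scale (1 + t) hv)) (actionE hu hv) (energy_scale A B (1 + t) hu hv).
    rewrite (coupling_scale hu hv t1) pqr; apply: ray_algebra => //; last exact: coupling_ge0.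
    have := powR_tangent (lt_trans (ltr1n R 2) pq2) t1 ltr01.
    by rewrite !powR1 mulr1 [1 + t - 1]addrC addKr.
  have sn : `|s| = s by rewrite gtr0_norm.
  have r1' := ray s sn (_ : 0 <= 1 + s); have r2' := ray (- s) (etrans (normrN s) sn) (_ : 0 <= 1 + - s).
  have k1 := slope_le s0 se n0 (r1' (addr_ge0 ler01 (ltW s0))).
  have s1 : 0 <= 1 + - s by move: s2; lra.
  have := r2' s1; rewrite sqrrN mulNr -mulrN => h2.
  have k2 := slope_le s0 se n0 h2.
  by rewrite ler_norml k1 /= -lerN2; exact: k2.
apply/eqP; rewrite -subr_eq0 -normr_le0; apply/ler_addgt0Pr => e e0; rewrite add0r.
have Hn : 0 < H + n + 1 by rewrite ltr_wpDl// addr_ge0.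
apply: (le_trans (small _ (divr_gt0 e0 Hn))); rewrite mulrAC ler_pdivrMr//.
by apply: ler_wpM2l; [exact: ltW|rewrite lerDl].
Qed.

Let sum_eq0 (a b x y z w : R) : 0 < a -> 0 < b -> 0 <= x -> 0 <= y -> 0 <= z -> 0 <= w ->
  x + a * y + (z + b * w) = 0 -> y = 0 /\ w = 0.
Proof.
move=> a0 b0 x0 y0 z0 w0 h; have h1 := mulr_ge0 (ltW a0) y0; have h2 := mulr_ge0 (ltW b0) w0.
have k1 : a * y = 0 by lra.
have k2 : b * w = 0 by lra.
move/eqP: k1; move/eqP: k2; by rewrite !mulf_eq0 (gt_eqF a0) (gt_eqF b0) => /eqP -> /eqP ->.
Qed.

Lemma energy_eq0 u v : H1 u -> H1 v -> energy u v = 0 -> Hzero (u, v).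
Proof.
move=> hu hv h; have [h1 h2] := sum_eq0 A0 B0 (dirichlet_ge0 u) (n2_ge0 leb u) (dirichlet_ge0 v) (n2_ge0 leb v) h.
by split; [exact: (n2_eq0 (H1L2 hu) h1)|exact: (n2_eq0 (H1L2 hv) h2)].
Qed.

Lemma extremal_nonzero u v : extremal u v -> ~ Hzero (u, v).
Proof.
move=> [hu hv nw _] [/= zu zv].
have z f : H1 f -> {ae leb, forall x, f x = 0} -> dirichlet (fun x => 0 * f x) = dirichlet f /\ n2 leb (fun x => 0 * f x) = n2 leb f.
  move=> hf zf; have e0 : {ae leb, forall x, f x = 0 * f x} by apply: filterS zf => x ->; rewrite mulr0.
  by have [_ d1 d2] := H1_ae hf (H1L2 (H1_scale 0 hf)).1 e0; split.
have [d1 n1] := z _ hu zu; have [d2 n2'] := z _ hv zv.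
have := energy_scale A B 0 hu hv; rewrite /energy d1 d2 n1 n2' -/(energy u v) nw expr0n mul0r => h.
by move: m00; rewrite h ltxx.
Qed.

Let level_algebra (n x y : R) : 0 < n -> S * y = 2^-1 -> n <= 2 * (S * (n * x)) -> y <= x.
Proof.
move=> n0 e h; have : S * y <= S * x.
  rewrite e -(ler_pM2l n0); move: h; rewrite (_ : S * (n * x) = n * (S * x)); last by ring.
  by move: (n * (S * x)) => X; lra.
by rewrite ler_pM2l.
Qed.

Let value_algebra (n d : R) : m0 <= n -> n = 2 * d -> 2^-1 * m0 - r^-1 * (2^-1 * m0) <= 2^-1 * n - r^-1 * d.
Proof.
move=> mn e; have -> : d = 2^-1 * n by rewrite e mulKf.
have ri : r^-1 <= 1 by rewrite invf_le1; move: r1; lra.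
rewrite -subr_ge0 (_ : _ - _ = 2^-1 * ((1 - r^-1) * (n - m0))); last by ring.
by apply: mulr_ge0 => //; apply: mulr_ge0; rewrite subr_ge0.
Qed.

(** On N_0 the energy n equals 2 D <= 2 S n^r, so n >= m0, and the action is (1/2 - 1/(2r)) n,
    increasing in n; the extremal pair attains n = m0. *)
Lemma extremal_level u v : extremal u v -> (J (u, v))%:E = @ground_level R N alpha p q (cst A) (cst B).
Proof.
move=> ex; have [hu hv nw dw] := ex; apply/eqP; rewrite eq_le; apply/andP; split; last first.
  apply: ereal_inf_lbound; exists (u, v) => //; split; [by []|exact: (extremal_nonzero ex)|].
  by exists (cst 0) => //; exact: extremal_critical.
apply: le_ereal_inf_tmp => _ [[a b] nab <-].
suff le : J (u, v) <= J (a, b) by rewrite lee_fin.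
have e1 := nehari_identity nab; have [[ha hb] nz _] := nab; rewrite [_.1]/= in ha; rewrite [_.2]/= in hb.
have n0 : 0 < energy a b.
  by rewrite lt_neqAle energy_ge0// andbT; apply/eqP => /esym/(energy_eq0 ha hb).
have r0 : 0 < r by apply: lt_trans r1.
have m0r : S * m0 `^ r = 2^-1 * m0 by rewrite -(mulr_powRB1 (ltW m00) r0) mulrCA hm0 mulrC.
have k1 := hS ha hb n0 (lexx _); rewrite -(mulr_powRB1 (ltW n0) r0) in k1.
have k2 : energy a b <= 2 * (S * (energy a b * energy a b `^ (r - 1))) by rewrite {1}e1 ler_pM2l.
have k3 := level_algebra n0 hm0 k2.
have k4 : m0 <= energy a b.
  rewrite leNgt; apply/negP => lt; move: k3; rewrite leNgt => /negP; apply.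
  by apply: gt0_ltr_powR => //; rewrite ?subr_gt0 ?nnegrE ?(ltW n0) ?(ltW m00).
rewrite (actionE hu hv) (actionE ha hb) nw dw pqr m0r.
exact: (value_algebra k4 e1).
Qed.

End variational.

(** * Existence of a positive ground state *)

Section existence.
Context {R : realType} {N : nat} (alpha p q A B : R).
Hypotheses (N0 : (0 < N)%N) (al0 : 0 < alpha) (alN : alpha < N%:R).
Hypotheses (hp : (N%:R + alpha) / N%:R < p) (hp' : p * (N%:R - 2) < N%:R + alpha).
Hypotheses (hq : (N%:R + alpha) / N%:R < q) (hq' : q * (N%:R - 2) < N%:R + alpha).
Hypotheses (A0 : 0 < A) (B0 : 0 < B).
Local Notation E := 'rV[R]_N.
Local Notation leb := (@lebesgue_rV R N).
Local Notation DP := (@interaction R N alpha p q).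
Local Notation energy := (@energy R N A B).
Local Notation cpl := (@coupling R N alpha p q).
Implicit Types (u v h k f g phi : E -> R) (x y z : E) (K e t c m : R).

Let p1 : 1 < p. Proof. exact: (exponent_gt1 N0 al0 hp). Qed.
Let q1 : 1 < q. Proof. exact: (exponent_gt1 N0 al0 hq). Qed.
Let r : R := (p + q) / 2.
Let r1 : 1 < r. Proof. by rewrite /r; move: p1 q1; lra. Qed.
Let r0 : 0 < r. Proof. by move: r1; lra. Qed.

Lemma exists_test_nonzero : exists2 phi : E -> R, test_function phi & ~ {ae leb, forall x, phi x = 0}.
Proof.
exists (plateau 1 (fun=> - 2) (fun=> 2)); first exact: test_plateau.
move=> h; have : nnint leb (fun x => (incube 1 x)%:R) = nnint leb (fun=> 0).
  apply: nnint_ae_eq; [exact: (@L2_incube R N 1).1|exact: measurable_cst|].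
  apply: filterS h => x hx; have [/incubeP c|//] := boolP (incube 1 x).
  move: hx; rewrite plateau_eq1 => [/eqP|i]; first by rewrite oner_eq0.
  by have := c i; rewrite ler_norml !mul1r => /andP[h1 h2]; split; lra.
rewrite nnint_incube// /nnint integral0 => /(congr1 fine)/= /eqP; rewrite mulr1 expf_eq0 (_ : (2 : R) == 0 = false) ?andbF//.
exact: (@pnatr_eq0 R 2).
Qed.

Lemma coupling_pos phi : test_function phi -> ~ {ae leb, forall x, phi x = 0} -> 0 < cpl phi phi.
Proof.
move=> tp nz; have hphi := H1_test tp; have mp := (H1L2 hphi).1.
rewrite lt_neqAle coupling_ge0// andbT; apply/eqP => e; apply: nz.
have : DP phi phi = 0%E by rewrite (interaction_coupling N0 al0 alN hp hp' hq hq' A0 B0 hphi hphi) -e.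
have m (s : R) : measurable_fun setT (fun x => `|phi x| `^ s) by meas.
have z (s : R) : {ae leb, forall x, `|phi x| `^ s = 0} -> {ae leb, forall x, phi x = 0}.
  by apply: filterS => x /eqP; rewrite powR_eq0 normr_eq0 => /andP[/eqP].
move=> e0; have [] := riesz_form_eq0 N0 al0 alN (m p) (m q) (fun x => powR_ge0 `|phi x| p) (fun x => powR_ge0 `|phi x| q) e0; exact: z.
Qed.

(** The maximal value on the unit ball is the constant [S], by homogeneity of degree p + q, and the
    maximiser is rescaled to energy [m0]. *)
Lemma exists_extremal : exists S m0 u v, [/\ [/\ 0 < S, 0 < m0 & S * m0 `^ (r - 1) = 2^-1],
  (forall u v m, H1 u -> H1 v -> 0 < m -> energy u v <= m -> cpl u v <= S * m `^ r),
  extremal alpha p q A B S m0 u v, (forall x, 0 <= u x) /\ (forall x, 0 <= v x) & polarized u /\ polarized v].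
Proof.
have [u [v [hb [u0 v0] ku kv opt]]] := maximiser N0 al0 alN hp hp' hq hq' A0 B0.
have [hu hv nuv] := ball_energy_le A0 B0 hb; pose S := cpl u v.
have Dc a b (ha : H1 a) (hb' : H1 b) := interaction_coupling N0 al0 alN hp hp' hq hq' A0 B0 ha hb'.
have hS a b m : H1 a -> H1 b -> 0 < m -> energy a b <= m -> cpl a b <= S * m `^ r.
  (* Scaling by m^(-1/2) brings the pair into the unit ball and multiplies the coupling by m^-r. *)
  move=> ha hb' m0 nm; pose s := m `^ (- 2^-1).
  have s0 : 0 <= s by exact: powR_ge0.
  have s2 : s ^+ 2 = m^-1 by rewrite /s -powR_mulrn// -powRrM mulNr mulVf// powR_inv1// ltW.
  have sr : s `^ (p + q) = (m `^ r)^-1 by rewrite /s -powRrM -powRN /r; congr (_ `^ _); ring.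
  have bs : ball A B N0 1 (fun x => s * a x) (fun x => s * b x).
    apply: ball_le (energy_ball N0 A0 B0 (H1_scale s ha) (H1_scale s hb')).
    by rewrite (energy_scale A B s ha hb') s2 mulrC ler_pdivrMr// mul1r.
  have := opt _ _ bs; rewrite (Dc _ _ (H1_scale s ha) (H1_scale s hb')) (Dc _ _ hu hv) lee_fin.
  by rewrite (coupling_scale N0 al0 alN hp hp' hq hq' A0 B0 ha hb' s0) sr mulrC ler_pdivrMr// powR_gt0.
have S0 : 0 < S.
  have [phi tp nz] := exists_test_nonzero; have hphi := H1_test tp.
  have n0 := energy_ge0 A0 B0 phi phi; have n1 : 0 < energy phi phi + 1 by rewrite ltr_wpDl.
  have := lt_le_trans (coupling_pos tp nz) (hS _ _ _ hphi hphi n1 (_ : _ <= _)).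
  by rewrite lerDl ler01 => /(_ isT); rewrite pmulr_lgt0// powR_gt0.
(* Energy below some m < 1 would give S <= S m^r < S. *)
have n1 : energy u v = 1.
  apply/eqP; rewrite eq_le nuv/= leNgt; apply/negP => lt.
  have n0 := energy_ge0 A0 B0 u v; set n := energy u v in lt n0.
  pose m := (n + 1) / 2; have m0 : 0 < m by rewrite divr_gt0// ltr_wpDl.
  have m1 : m < 1 by rewrite /m; lra.
  have := hS u v m hu hv m0 (_ : _ <= _); move=> /(_ _)/wrap[]; first by rewrite -/n /m; lra.
  rewrite -/S ler_pMr// leNgt => /negP; apply.
  by have := gt0_ltr_powR r0 (_ : m \in Num.nneg) (_ : 1 \in Num.nneg) m1; rewrite !nnegrE powR1; apply => //; exact: ltW.
(* Solves the stationarity equation S m0^(r-1) = 1/2. *)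
pose m0 := ((2 * S)^-1) `^ (r - 1)^-1.
have S2 : 0 < (2 * S)^-1 by rewrite invr_gt0 mulr_gt0.
have m00 : 0 < m0 by rewrite powR_gt0.
have hm0 : S * m0 `^ (r - 1) = 2^-1.
  rewrite /m0 -powRrM mulVf ?powRr1 ?(ltW S2)//; last by rewrite gt_eqF// subr_gt0.
  by field; rewrite gt_eqF.
pose t := m0 `^ 2^-1; have t0 : 0 <= t by exact: powR_ge0.
exists S, m0, (fun x => t * u x), (fun x => t * v x); split => //.
- split; [exact: H1_scale|exact: H1_scale| |].
    by rewrite (energy_scale A B t hu hv) n1 mulr1 /t -powR_mulrn// -powRrM mulVf// powRr1// ltW.
  rewrite (coupling_scale N0 al0 alN hp hp' hq hq' A0 B0 hu hv t0) mulrC /t -powRrM.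
  by congr (_ * _ `^ _); rewrite mulrC.
- by split=> x; exact: mulr_ge0.
by split=> s a ha; [have := ku s a ha|have := kv s a ha]; apply: filterS => x h ax; apply: ler_wpM2l => //; exact: h.
Qed.

(** Positivity and the decay estimate hold off a null set; on that set the value 1/(1 + |x|) is
    used, which is positive and tends to 0. *)
Lemma decaying_representative u : L2 leb u -> polarized u -> (forall x, 0 <= u x) -> {ae leb, forall x, 0 < u x} ->
  exists u', [/\ measurable_fun setT u', {ae leb, forall x, u x = u' x}, forall x, 0 < u' x & vanishes_at_infinity u'].
Proof.
move=> Lu ku u0 pu; have mu_ := Lu.1; have hd := polarized_decay N0 Lu ku u0.
have [X [mX X0 sX]] := filterI pu hd.
have good x : x \notin X -> 0 < u x /\ forall n, (0 < n)%N -> (exists i : 'I_N, (4 ^+ N * n%:R : R) < `|x ord0 i|) -> u x ^+ 2 * n%:R <= n2 leb u.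
  by move=> xX; apply: contrapT => h; move/negP: xX; apply; rewrite inE; exact: sX.
have d0 x : 0 < 1 + enorm x by rewrite ltr_wpDr// enorm_ge0.
pose u' x := (x \notin X)%:R * u x + (1 - (x \notin X)%:R) * (1 + enorm x) `^ (- 1).
have u'E x : u' x = if x \notin X then u x else (1 + enorm x)^-1.
  by rewrite /u' powR_inv1 ?(ltW (d0 x))//; case: (x \notin X); rewrite ?subrr ?mul0r ?mul1r ?addr0// subr0 add0r mul1r.
exists u'; split.
- have mn := measurable_notin mX; have moment := @measurable_enorm R N; rewrite /u'; meas.
- exists X; split => // x /= h; rewrite -in_setE; apply: contrapT => /negP xX; apply: h.
  by rewrite u'E xX.
- by move=> x; rewrite u'E; case: ifP => [/good[]//|_]; rewrite invr_gt0.
move=> e e0; pose n := (Num.bound (n2 leb u / e ^+ 2)).+1.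
have hn : n2 leb u < e ^+ 2 * n%:R.
  rewrite mulrC -ltr_pdivrMr ?exprn_gt0//; apply: (lt_le_trans (archi_boundP _)); first by rewrite divr_ge0 ?n2_ge0 ?exprn_ge0 ?(ltW e0).
  by rewrite ler_nat.
exists (Num.max e^-1 (N%:R * (4 ^+ N * n%:R))) => x; rewrite gt_max => /andP[h1 h2].
rewrite u'E; case: ifP => [/good[ux dx]|_].
  rewrite gtr0_norm// -ltr_sqr ?nnegrE ?(ltW ux) ?(ltW e0)//.
  have [i hi] : exists i : 'I_N, (4 ^+ N * n%:R : R) < `|x ord0 i|.
    apply: contrapT => hno; move: h2; rewrite ltNge => /negP; apply.
    apply: (le_trans (enorm_le_sum x)).
    apply: (@le_trans _ _ (\sum_(i < N) (4 ^+ N * n%:R : R))); last by rewrite sumr_const card_ord -[leLHS]mulr_natl.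
    by apply: ler_sum => i _; rewrite leNgt; apply/negP => hi; apply: hno; exists i.
  rewrite -(@ltr_pM2r _ n%:R) ?ltr0n//; apply: le_lt_trans hn.
  by apply: dx => //; exists i.
rewrite gtr0_norm ?invr_gt0// -[e]invrK ltf_pV2 ?posrE ?invr_gt0//.
by apply: (lt_le_trans h1); rewrite lerDr.
Qed.

(** The dichotomy for supersolutions leaves only the zero function as an alternative, and that would
    annihilate the positive coupling. *)
Lemma extremal_positive S m0 u v : 0 < S -> 0 < m0 -> S * m0 `^ (r - 1) = 2^-1 ->
  (forall u v m, H1 u -> H1 v -> 0 < m -> energy u v <= m -> cpl u v <= S * m `^ r) ->
  extremal alpha p q A B S m0 u v -> (forall x, 0 <= u x) -> (forall x, 0 <= v x) -> polarized u -> polarized v ->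
  {ae leb, forall x, 0 < u x} /\ {ae leb, forall x, 0 < v x}.
Proof.
move=> S0 m00 hm0 hS ex u0 v0 ku kv; have [hu hv _ dw] := ex.
have [su sv] := extremal_supersolution N0 al0 alN hp hp' hq hq' A0 B0 S0 m00 hS hm0 ex u0 v0.
have cp : 0 < cpl u v by rewrite dw mulr_gt0// powR_gt0.
have mk := @measurable_riesz R N alpha.
have zero f g : (forall y x, `|f y| `^ p * `|g x| `^ q = 0) -> cpl f g = 0.
  move=> h; rewrite /coupling /interaction /riesz_form /dint (@eq_nnint _ _ _ _ _ (fun=> 0)) => [|w]; last by rewrite -mulrA h mulr0.
  by rewrite /nnint integral0.
have mu_ := (H1L2 hu).1; have mv := (H1L2 hv).1.
have mc := @measurable_cst _ _ E R setT 0.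
have z0 (s : R) : 1 < s -> `|0 : R| `^ s = 0 by move=> s1; rewrite normr0 powR0// gt_eqF//; lra.
split.
  have [z|//] := polarized_positive (ltW A0) hu u0 ku su; move: cp.
  rewrite /coupling (interaction_ae_eq p q al0 alN mu_ mv mc mv z (aeW leb (fun x => erefl (v x)))) -/(cpl _ _) zero ?ltxx// => y x.
  by rewrite /cst z0// mul0r.
have [z|//] := polarized_positive (ltW B0) hv v0 kv sv; move: cp.
rewrite /coupling (interaction_ae_eq p q al0 alN mu_ mv mu_ mc (aeW leb (fun x => erefl (u x))) z) -/(cpl _ _) zero ?ltxx// => y x.
by rewrite /cst z0// mulr0.
Qed.

Lemma exists_positive_ground_state : exists u v,
  [/\ ground_state alpha p q (cst A) (cst B) (u, v), forall x, 0 < u x & forall x, 0 < v x].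
Proof.
have [S [m0 [u [v [[S0 m00 hm0] hS ex [u0 v0] [ku kv]]]]]] := exists_extremal.
have [pu pv] := extremal_positive S0 m00 hm0 hS ex u0 v0 ku kv; have [hu hv nw dw] := ex.
have [u' [mu' eu pu' du']] := decaying_representative (H1L2 hu) ku u0 pu.
have [v' [mv' ev pv' dv']] := decaying_representative (H1L2 hv) kv v0 pv.
have [hu' d1 n1] := H1_ae hu mu' eu; have [hv' d2 n2'] := H1_ae hv mv' ev.
have ex' : extremal alpha p q A B S m0 u' v'.
  split; [exact: hu'|exact: hv'|by rewrite -nw /energy d1 n1 d2 n2'|].
  by rewrite -dw /coupling (interaction_ae_eq p q al0 alN (H1L2 hu).1 (H1L2 hv).1 mu' mv' eu ev).
exists u', v'; split; [split|exact: pu'|exact: pv'].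
- by split; [split; [exact: hu'|exact: hv']|exact: (extremal_critical N0 al0 alN hp hp' hq hq' A0 B0 S0 m00 hS hm0 ex')|exact: du'|exact: dv'].
- exact: (extremal_nonzero m00 ex').
exact: (extremal_level N0 al0 alN hp hp' hq hq' A0 B0 S0 m00 hS hm0 ex').
Qed.

End existence.

(** Multiplying out the denominator gives one condition for all dimensions: for N <= 2 its left side
    is at most 0. *)
Lemma critical_exponent_lt (R : realType) (N : nat) (alpha p : R) : 0 < alpha -> 0 < p ->
  (p%:E < critical_exponent N alpha)%E -> p * (N%:R - 2) < N%:R + alpha.
Proof.
move=> a0 p0; rewrite /critical_exponent; case: leqP => [n2 _|n2].
  apply: (@le_lt_trans _ _ 0); last by rewrite ltr_wpDl.
  by rewrite pmulr_rle0// subr_le0 (ler_nat R N 2).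
by rewrite lte_fin ltr_pdivlMr// subr_gt0 (ltr_nat R 2 N).
Qed.

Theorem corollary1p3 (R : realType) (N : nat) (hN : (1 <= N)%N)
    (alpha : R) (halpha0 : 0 < alpha) (halphaN : alpha < N%:R)
    (p q : R)
    (hp : (N%:R + alpha) / N%:R < p) (hp' : (p%:E < critical_exponent N alpha)%E)
    (hq : (N%:R + alpha) / N%:R < q) (hq' : (q%:E < critical_exponent N alpha)%E)
    (hpq : p != q)
    (A B : R) (hA : 0 < A) (hB : 0 < B) :
  exists u v : 'rV[R]_N -> R,
    [/\ ground_state alpha p q (cst A) (cst B) (u, v),
        forall x, 0 < u x & forall x, 0 < v x].
Proof.
have p0 : 0 < p by apply: lt_trans (exponent_gt1 hN halpha0 hp).
have q0 : 0 < q by apply: lt_trans (exponent_gt1 hN halpha0 hq).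
exact: (exists_positive_ground_state hN halpha0 halphaN hp (critical_exponent_lt halpha0 p0 hp')
  hq (critical_exponent_lt halpha0 q0 hq') hA hB).
Qed.
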